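(* Let $n=2$. Assume that there are a.s. positive stopping times $\sigma^\varepsilon,\sigma$ such that $\gamma_t^{\alpha\dot w^\varepsilon}$ exists uniquely on $[0,\sigma^\varepsilon]$ and the solution $\gamma_t$ of $V=\kappa-\frac1{|\gamma_t|}\int_{\gamma_t}\kappa\,d\bar s+\frac{\alpha|D|}{2|\gamma_t|}\circ\dot w(t)$ (Stratonovich) started at $\gamma_0$ exists uniquely on $[0,\sigma]$; and that for every $T'>0$, $m'\in\mathbb N$, $(\sigma^\varepsilon,d^\varepsilon(t\wedge\sigma^\varepsilon))\to(\sigma,d^0(t\wedge\sigma))$ a.s. in $\mathbb R_+\times C([0,T'],C^{m'}(\mathcal O))$ as $\varepsilon\downarrow 0$, where $d^\varepsilon,d^0$ are the signed distances (negative inside) to $\gamma_t^{\alpha\dot w^\varepsilon},\gamma_t$ respectively and $\mathcal O$ is an open neighbourhood of $\gamma_0$. Then for every $L\in\mathbb N$ there exist $N=N(K)\in\mathbb N$, a stopping time $T=\tau(\omega)>0$ and $C=C(C_{\mathcal V,T},K,T,L)>0$ such that $$\sup_{1\le i\le2}\ \sup_{\theta\in S}\ |\partial_t^k\partial_\theta^mX_0^i(\cdot,\theta)|_{0,T}\le C(1+|v|_{N,T})^N,$$ $$\sup_{t\in[0,T]}\ \sup_{x\in V^t_{3\delta}}|\partial_t^k\partial^{\mathbf m}\theta(t,x)|\le C(1+|v|_{N,T})^N,$$ for every $v\in\mathcal V=\{\alpha\dot w^\varepsilon;0<\varepsilon\le\varepsilon_0^*\}$, $k=0,1,\dots,K$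 and $m,|\mathbf m|\le M$.
   Context: $D\subset\mathbb R^2$ is a bounded domain with smooth boundary, $\alpha>0$, $c=|D|/2$, $K>6$ is a fixed integer and $M=M(K)$ a fixed positive integer. $w^\varepsilon(t)$, $0<\varepsilon\le1$, are adapted processes, smooth in $t$, converging a.s. in $C^\theta([0,T])$ (some $\theta\in(0,1/2)$, all $T$) to a Brownian motion $w$; $\varepsilon_0^*\in(0,1]$ is sufficiently small. For $v\in C^\infty(\mathbb R_+)$, $\gamma_t^v\subset D$ is the closed strictly convex curve, started at a given smooth strictly convex $\gamma_0$, with inward normal velocity $V^v=\kappa-\frac1{|\gamma_t^v|}\int_{\gamma_t^v}\kappa\,d\bar s+\frac{|D|}{2|\gamma_t^v|}v(t)$ ($\kappa$ = curvature). It is parametrized by the Gauss map: $X_0(t,\theta)$, $\theta\in S=[0,2\pi)$, is the point whose outward normal makes angle $\theta$ with $(1,0)$; then $\kappa=\kappa(t,\theta)>0$ satisfies $\partial_t\kappa=\kappa^2\partial_\theta^2\kappa+\kappa^3-\kappa^2\bar\kappa+\frac{c\kappa^2}{|\gamma^v|}v$ with $|\gamma^v|=\int_S d\theta/\kappa$, $\bar\kappa=2\pi/|\gamma^v|$. $d(t,x)=d^v(t,x)$ is the signed distance to $\gamma_t^v$ (negative inside), $V^t_{3\delta}=\{x\in D:|d(t,x)|<3\delta\}$, with $\delta>0$ so small that $d$ is smooth there and $\mathrm{dist}(\gamma^v_t,\partial D)>3\delta$; $\theta(t,x)\in S$ is determined by $x=X_0(t,\theta)+r\,\nabla d(t,X_0(t,\theta))$,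 $r=d(t,x)$. $|g|_{k,T}=\sum_{i=0}^k\sup_{[0,T]}|d^ig/dt^i|$. $C_{\mathcal V,T}$ is the maximum of (1) the supremum over $v\in\mathcal V$, $\theta\in S$, $|r|<3\delta$, $t\in[0,T]$ and $|\mathbf m|\le M$ of the spatial derivatives $|\partial^{\mathbf m}d(t,X_0(t,\theta))|$, $|\partial^{\mathbf m}\theta(t,X_0(t,\theta)+r\nabla d(t,X_0(t,\theta)))|$, $|\partial^{\mathbf m}X_0(t,\theta)|$; and (2) the supremum over $v\in\mathcal V$, $\theta$, $t\in[0,T]$ of $|\nabla\theta(t,X_0(t,\theta))|^{-2}$ and $|\gamma_t^v|^{-1}$.
   Formalization: The smallness threshold for ε_0^* is allowed to depend on ω, since the assumed convergences as ε↓0 are only almost sure and a single deterministic ε_0^* need not leave a common positive existence time T for all v in V. *)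

(* Defs.v *)
From HB Require Import structures.
From mathcomp Require Import all_boot all_order all_algebra.
From mathcomp Require Import all_classical all_reals all_analysis.

Set Implicit Arguments.
Unset Strict Implicit.
Unset Printing Implicit Defensive.

Import Order.TTheory GRing.Theory Num.Theory.
Import numFieldNormedType.Exports.

Local Open Scope classical_set_scope.
Local Open Scope ring_scope.

Section Plane.
Context {R : realType}.
Implicit Types (p q : R * R) (D : set (R * R)).

Definition coord (i : 'I_2) p : R := if i == ord0 then p.1 else p.2.

Definition dotp p q : R := p.1 * q.1 + p.2 * q.2.

(* The norm provided by the library on [R * R] is the sup norm. *)
Definition enorm p : R := Num.sqrt (dotp p p).

Definition partial1 (f : R * R -> R) p : R := 'D_((1, 0) : R * R) f p.
Definition partial2 (f : R * R -> R) p : R := 'D_((0, 1) : R * R) f p.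

Definition pd (m1 m2 : nat) (f : R * R -> R) : R * R -> R :=
  iter m1 partial1 (iter m2 partial2 f).

Definition grad (f : R * R -> R) p : R * R := (partial1 f p, partial2 f p).

Definition smooth_on (U : set (R * R)) (f : R * R -> R) : Prop :=
  forall m1 m2 p, U p -> differentiable (pd m1 m2 f) p.

Definition bdry D : set (R * R) := closure D `\` D°.

Definition smooth_boundary D : Prop :=
  forall p, bdry D p -> exists (U : set (R * R)) (g : R * R -> R),
    [/\ open U, U p, smooth_on U g,
        (forall q, U q -> grad g q != 0) &
        D `&` U = [set q | U q /\ g q < 0]].

Definition smooth_bounded_domain D : Prop :=
  [/\ open D, connected D, D !=set0, bounded_set D & smooth_boundary D].

Definition area D : R :=
  fine (((@lebesgue_measure R) \x (@lebesgue_measure R))%E D).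

Definition Cm_on (m : nat) (O : set (R * R)) (f : R * R -> R) : Prop :=
  forall m1 m2 x, O x ->
    ((m1 + m2 <= m)%N -> {for x, continuous (pd m1 m2 f)}) /\
    ((m1 + m2 < m)%N -> differentiable (pd m1 m2 f) x).

Definition Cm_norm (m : nat) (O : set (R * R)) (f : R * R -> R) : \bar R :=
  ereal_sup [set y | exists m1 m2 x,
    [/\ (m1 + m2 <= m)%N, O x & y = `|pd m1 m2 f x|%:E]].

(* [u] belongs to C([0,T], C^m(O)). *)
Definition in_C_Cm (T : R) (m : nat) (O : set (R * R)) (u : R -> R * R -> R)
    : Prop :=
  (forall t, `[0, T]%classic t ->
     Cm_on m O (u t) /\ (Cm_norm m O (u t) < +oo)%E) /\
  (forall t, `[0, T]%classic t ->
     Cm_norm m O (fun x => u s x - u t x) @[s --> within `[0, T] (nbhs t)]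
       --> 0%E).

Definition C_Cm_norm (T : R) (m : nat) (O : set (R * R))
    (u : R -> R * R -> R) : \bar R :=
  ereal_sup [set Cm_norm m O (u t) | t in `[0, T]].

End Plane.

(* Derivatives relative to a set of times, one-sided at the endpoints of an
   interval. *)
Section TimeDerivative.
Context {R : realType}.
Implicit Types (A : set R) (f : R -> R).

Definition derivable_w A f (t : R) : Prop :=
  cvg ((s - t)^-1 * (f s - f t) @[s --> within A t^']).

Definition derw A f (t : R) : R :=
  lim ((s - t)^-1 * (f s - f t) @[s --> within A t^']).

Definition derwn A (n : nat) f : R -> R := iter n (derw A) f.

Definition smooth_w A f : Prop :=
  forall n t, A t -> derivable_w A (derwn A n f) t.

(* |g|_{k,T} *)
Definition cknorm (k : nat) (T : R) f : \bar R :=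
  (\sum_(i < k.+1)
     ereal_sup [set `|derwn `[0%R, T] i f t|%:E | t in `[0%R, T]])%E.

Definition holder_norm (h T : R) f : \bar R :=
  (ereal_sup [set `|f t|%:E | t in `[0%R, T]] +
   ereal_sup [set y | exists s t, [/\ `[0%R, T]%classic s, `[0%R, T]%classic t,
     s != t & y = (`|f t - f s| / (`|t - s| `^ h))%:E]])%E.

End TimeDerivative.

(* A curve is a function [R -> R * R] of period 2 pi, the parameter being the
   angle of the outward normal. *)
Section Curve.
Context {R : realType}.
Implicit Types (X : R -> R * R) (D : set (R * R)).

Definition normal (th : R) : R * R := (cos th, sin th).
Definition tangent (th : R) : R * R := (- sin th, cos th).

(* [X] is derived coordinatewise. *)
Definition dth (m : nat) X (th : R) : R * R :=
  (derive1n m (fun a => (X a).1) th, derive1n m (fun a => (X a).2) th).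

Definition smooth_curve X : Prop :=
  forall (i : 'I_2) m th, derivable (fun a => coord i (dth m X a)) th 1.

Definition speed X (th : R) : R := enorm (dth 1 X th).

Definition curv X (th : R) : R :=
  ((dth 1 X th).1 * (dth 2 X th).2 - (dth 1 X th).2 * (dth 2 X th).1)
    / speed X th ^+ 3.

(* Closed strictly convex curve with positive curvature, parametrized by its
   Gauss map: the last clause says that the curve lies strictly on the inner
   side of its tangent line at [X th], so [normal th] is the outward normal. *)
Definition gauss_curve X : Prop :=
  [/\ smooth_curve X,
      (forall th, X (th + 2 * pi) = X th),
      (forall th, exists2 rho : R, 0 < rho & dth 1 X th = rho *: tangent th),
      (forall th, 0 < curv X th) &
      (forall th th', X th' != X th -> dotp (X th' - X th) (normal th) < 0)].

Definition clen X : R :=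
  \int[@lebesgue_measure R]_(th in `[0, 2 * pi]) speed X th.

Definition avg_curv X : R :=
  (\int[@lebesgue_measure R]_(th in `[0, 2 * pi]) (curv X th * speed X th))
    / clen X.

Definition inner_region X : set (R * R) :=
  [set x | forall th, dotp (x - X th) (normal th) < 0].

Definition sdist X (x : R * R) : R :=
  let r := inf (range (fun th => enorm (x - X th))) in
  if `[< inner_region X x >] then - r else r.

Definition tube D (delta : R) X : set (R * R) :=
  [set x | D x /\ `|sdist X x| < 3 * delta].

Definition curve_point X (r th : R) : R * R :=
  X th + r *: grad (sdist X) (X th).

Definition is_angle X (x : R * R) (th : R) : Prop :=
  x = curve_point X (sdist X x) th.

(* Branch with values in [b, b + 2 pi). *)
Definition angle_from (b : R) X (x : R * R) : R :=
  xget b [set th | [/\ b <= th, th < b + 2 * pi & is_angle X x th]].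

Definition angle X (x : R * R) : R := angle_from 0 X x.

(* The angle is circle-valued, and its representative in [0, 2 pi) jumps on the
   normal line at angle 0. Its derivatives at a point are those of the branch
   around that point. *)
Definition local_angle X (x : R * R) (X' : R -> R * R) : R * R -> R :=
  angle_from (angle X x - pi) X'.

Definition pd_angle (m1 m2 : nat) X (x : R * R) : R :=
  pd m1 m2 (local_angle X x X) x.

Definition grad_angle X (x : R * R) : R * R := grad (local_angle X x X) x.

End Curve.

(* An evolving curve is a function of time and of the normal angle. *)
Section Flow.
Context {R : realType}.
Implicit Types (X : R -> R -> R * R) (D : set (R * R)) (T : R).

Definition dt_dth T (k m : nat) (i : 'I_2) X (t th : R) : R :=
  derwn `[0, T] k (fun s => coord i (dth m (X s) th)) t.

Definition smooth_evolution T X : Prop :=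
  forall (i : 'I_2) (k m : nat) t th, `[0, T]%classic t ->
    [/\ derivable (fun a => coord i (dth m (X t) a)) th 1,
        derivable_w `[0, T] (fun s => dt_dth T k m i X s th) t &
        dt_dth T k m i X q.1 q.2
          @[q --> within (`[0, T] `*` setT) (nbhs (t, th))]
          --> dt_dth T k m i X t th].

Definition velocity T X (t th : R) : R :=
  - dotp (dt_dth T 1 0 ord0 X t th, dt_dth T 1 0 ord_max X t th) (normal th).

Definition is_flow D (g0 : R -> R * R) (v : R -> R) T X : Prop :=
  [/\ smooth_evolution T X,
      X 0 = g0,
      (forall t, `[0, T]%classic t ->
         gauss_curve (X t) /\ (forall th, D (X t th))) &
      (forall t th, `[0, T]%classic t ->
         velocity T X t th =
           curv (X t) th - avg_curv (X t) + area D / (2 * clen (X t)) * v t)].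

(* existence of the flow on [0,T], with uniqueness up to every time *)
Definition is_unique_flow D (g0 : R -> R * R) (v : R -> R) T X : Prop :=
  is_flow D g0 v T X /\
  (forall s X', 0 < s -> s <= T -> is_flow D g0 v s X' ->
     forall t th, `[0, s]%classic t -> X' t th = X t th).

Definition tubes D delta T X : set (R * (R * R)) :=
  [set q | `[0, T]%classic q.1 /\ tube D delta (X q.1) q.2].

Definition dt_pd T (k m1 m2 : nat) (u : R -> R * R -> R) (t : R) (x : R * R)
    : R :=
  derwn `[0, T] k (fun s => pd m1 m2 (u s) x) t.

Definition smooth_tx_at T (U : set (R * (R * R))) (u : R -> R * R -> R)
    (t : R) (x : R * R) : Prop :=
  forall k m1 m2,
    [/\ differentiable (pd m1 m2 (u t)) x,
        derivable_w `[0, T] (fun s => dt_pd T k m1 m2 u s x) t &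
        dt_pd T k m1 m2 u q.1 q.2 @[q --> within U (nbhs (t, x))]
          --> dt_pd T k m1 m2 u t x].

Definition dt_pd_angle T (k m1 m2 : nat) X (t : R) (x : R * R) : R :=
  dt_pd T k m1 m2 (fun s => local_angle (X t) x (X s)) t x.

(* The requirements on [delta]: the distance to the boundary of [D] exceeds
   [3 * delta], the signed distance is smooth in the tubes, and the angle is
   well defined and smooth there. *)
Definition good_tubes D delta T X : Prop :=
  [/\ (forall t, `[0, T]%classic t ->
         3 * delta <
           inf [set r | exists th y, bdry D y /\ r = enorm (X t th - y)]),
      (forall t x, tubes D delta T X (t, x) ->
         smooth_tx_at T (tubes D delta T X) (fun s => sdist (X s)) t x),
      (forall t x, tubes D delta T X (t, x) ->
         exists! th, [/\ 0 <= th, th < 2 * pi & is_angle (X t) x th]) &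
      (forall t x, tubes D delta T X (t, x) ->
         smooth_tx_at T (tubes D delta T X)
           (fun s => local_angle (X t) x (X s)) t x)].

(* C_{V,T}, possibly infinite *)
Definition C_VT D (g0 : R -> R * R) (delta : R) (M : nat) (V : set (R -> R)) T
    : \bar R :=
  ereal_sup [set y : \bar R | exists v X t th,
    [/\ V v, is_flow D g0 v T X, `[0, T]%classic t,
        (0 <= th) && (th < 2 * pi) &
     [\/ exists m1 m2, (m1 + m2 <= M)%N /\
           y = `|pd m1 m2 (sdist (X t)) (X t th)|%:E,
         exists m1 m2 r, [/\ (m1 + m2 <= M)%N, `|r| < 3 * delta &
           y = `|pd_angle m1 m2 (X t) (curve_point (X t) r th)|%:E],
         exists m, (m <= M)%N /\ y = (enorm (dth m (X t) th))%:E |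
         y = (enorm (grad_angle (X t) (X t th)) ^- 2)%:E \/
         y = ((clen (X t))^-1)%:E]]].

End Flow.

Section Stochastic.
Context {R : realType} {dd : measure_display} {Omega : measurableType dd}.
Variable P : probability Omega R.
Implicit Types (F : R -> set (set Omega)).

(* filtration indexed by the nonnegative times, under the usual conditions *)
Definition is_filtration F : Prop :=
  [/\ (forall t, 0 <= t -> sigma_algebra setT (F t)),
      (forall t A, 0 <= t -> F t A -> measurable A),
      (forall s t, 0 <= s -> s <= t -> F s `<=` F t),
      (forall t A, 0 <= t -> (forall s, t < s -> F s A) -> F t A) &
      (forall A, measurable A -> P A = 0%E -> F 0 A)].

Definition adapted F (Y : Omega -> R -> R) : Prop :=
  forall t (B : set R), 0 <= t -> measurable B -> F t [set om | B (Y om t)].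

Definition stopping_time F (tau : Omega -> R) : Prop :=
  forall t, 0 <= t -> F t [set om | tau om <= t].

Definition is_brownian F (w : Omega -> R -> R) : Prop :=
  [/\ adapted F w,
      {ae P, forall om, w om 0 = 0},
      {ae P, forall om, {within `[0, +oo[, continuous (w om)}} &
      forall (s t : R) (A : set Omega) (B : set R),
        0 <= s -> s < t -> F s A -> measurable B ->
        P (A `&` [set om | B (w om t - w om s)]) =
          (P A * normal_prob 0 (Num.sqrt (t - s)) B)%E].

(* [I] is the Stratonovich integral of [Y] against [Z] over [0,t]: limit in
   probability of the trapezoidal sums as the mesh tends to 0. *)
Definition stratonovich (Y Z : Omega -> R -> R) (t : R) (I : Omega -> R)
    : Prop :=
  forall e : R, 0 < e -> exists2 eta : R, 0 < eta &
    forall (n : nat) (p : nat -> R), p 0%N = 0 -> p n = t ->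
      (forall j, (j < n)%N -> 0 <= p j.+1 - p j < eta) ->
      exists A : set Omega,
        [/\ measurable A, (P A <= e%:E)%E &
            forall om, ~ A om ->
              `|\sum_(j < n) (Y om (p j) + Y om (p j.+1)) / 2
                     * (Z om (p j.+1) - Z om (p j)) - I om| <= e].

(* V = kappa - avg + alpha |D| / (2 |gamma_t|) o dw/dt on [0, sigma]. As the
   parameter is the normal angle, the normal velocity of the curve is minus the
   time derivative of X . n at fixed angle. *)
Definition is_strat_flow F (w : Omega -> R -> R) (alpha : R)
    (D : set (R * R)) (g0 : R -> R * R) (sigma : Omega -> R)
    (X : Omega -> R -> R -> R * R) : Prop :=
  [/\ (forall (i : 'I_2) th,
         adapted F (fun om t => coord i (X om (Num.min t (sigma om)) th))),
      {ae P, forall om, X om 0 = g0},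
      {ae P, forall om t, 0 <= t -> t <= sigma om ->
         gauss_curve (X om t) /\ (forall th, D (X om t th))},
      {ae P, forall om (i : 'I_2) m t th, 0 <= t -> t <= sigma om ->
         coord i (dth m (X om q.1) q.2)
           @[q --> within (`[0, sigma om] `*` setT) (nbhs (t, th))]
           --> coord i (dth m (X om t) th)} &
      forall t, 0 <= t -> exists I : Omega -> R,
        stratonovich
          (fun om s =>
             alpha * area D / (2 * clen (X om (Num.min s (sigma om)))))
          (fun om s => w om (Num.min s (sigma om))) t I /\
        {ae P, forall om th,
           dotp (X om (Num.min t (sigma om)) th) (normal th) =
             dotp (g0 th) (normal th)
             - (\int[@lebesgue_measure R]_(s in `[0, Num.min t (sigma om)])
                   (curv (X om s) th - avg_curv (X om s)))
             - I om}].

Definition is_unique_strat_flow F (w : Omega -> R -> R) (alpha : R)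
    (D : set (R * R)) (g0 : R -> R * R) (sigma : Omega -> R)
    (X : Omega -> R -> R -> R * R) : Prop :=
  is_strat_flow F w alpha D g0 sigma X /\
  (forall sigma' X', stopping_time F sigma' ->
     {ae P, forall om, 0 <= sigma' om <= sigma om} ->
     is_strat_flow F w alpha D g0 sigma' X' ->
     {ae P, forall om t th, 0 <= t -> t <= sigma' om ->
        X' om t th = X om t th}).

Definition is_approximation F (w : Omega -> R -> R)
    (we : R -> Omega -> R -> R) : Prop :=
  [/\ (forall eps, 0 < eps <= 1 -> adapted F (we eps)),
      {ae P, forall om eps, 0 < eps <= 1 -> smooth_w `[0, +oo[ (we eps om)} &
      exists h : R, 0 < h < 2^-1 /\
        {ae P, forall om T, 0 < T ->
           holder_norm h T (fun t => we eps om t - w om t)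
             @[eps --> 0^'+] --> 0%E}].

End Stochastic.

Section Forcing.
Context {R : realType} {Omega : Type}.

Definition forcing (alpha : R) (we : R -> Omega -> R -> R) (eps : R)
    (om : Omega) : R -> R :=
  fun t => alpha * derw `[0, +oo[ (we eps om) t.

Definition forcings (alpha : R) (we : R -> Omega -> R -> R) (eps0 : R)
    (om : Omega) : set (R -> R) :=
  [set forcing alpha we eps om | eps in [set eps | 0 < eps <= eps0]].

End Forcing.

(* Main.v *)
(* The support function of the curve is that of [g0] plus xi(t, theta) + beta(t)
   with xi_t = - kappa. The forcing then acts on beta alone and, after an
   integration in time, only through its primitive w. If w is uniformly small on
   [0, T0], Picard iteration gives the flow on [0, T0] with all spatial
   derivatives bounded independently of the forcing. The iterates are nested sums
   of terms a(t) cos (n y + phi) in the normalized arclength y of [g0], for which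
   bounded weighted norms imply convergence, so no contraction is needed. A time
   derivative is read off the equation at the price of at most one factor
   1 + |v|_{K,T}; hence N = K. The angle inherits these bounds from the implicit
   equation of the foot point, and uniqueness is the maximum principle for the
   difference of two support functions.

   For the random forcing, tau is the minimum of T0 and of the exit time of w from
   a small interval, and uniform convergence on [0, T0] makes the primitives of
   all the forcings small on [0, tau] for small eps. *)

Require Import Defs.
From HB Require Import structures.
From mathcomp Require Import all_boot all_order all_algebra.
From mathcomp Require Import all_classical all_reals all_analysis.
From mathcomp Require Import ring lra.

Set Implicit Arguments.
Unset Strict Implicit.
Unset Printing Implicit Defensive.

Import Order.TTheory GRing.Theory Num.Theory.
Import numFieldNormedType.Exports.

Local Open Scope classical_set_scope.
Local Open Scope ring_scope.

(** * Derivatives relative to a set *)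

Section WDeriv.
Context {R : realType}.
Implicit Types (A : set R) (f g : R -> R) (t l : R).

(** The forcings have no bound uniform in eps, so [v] must stay out of every estimate until time
    derivatives are counted. If [len = L0 + nu int xi k + 2 pi be] is the length, then
    [len * be' = 2 pi - c v]; integrating in time, and by parts in the product with [int xi k] by
    means of [xi_t = - a], removes [be'] and leaves an equation for [be] that contains only the
    primitive. The equation for xi is fully nonlinear: xi_yy has to be bounded by the source with no
    loss. This endpoint estimate holds in the Wiener algebra with coefficients bounded in time,
    where the gain of the heat semigroup is computed mode by mode. It wants a constant principal
    coefficient, whence the normalized arclength. It carries no small factor; smallness comes from
    the second order part of the source being quadratic in zeta, while the fixed term - k is smooth
    and gains a factor T. Constants independent of the forcing are obtained by treating all
    admissible forcings as one family, indexed by a type, whose regularity classes share their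
    constants. *)

Definition wderiv A f t l : Prop :=
  (s - t)^-1 * (f s - f t) @[s --> within A t^'] --> l.

(** Cleared of the division, the estimate also covers s = t; compositions and limits can then be
    estimated without excluding that point. *)
Lemma wderivP A f t l : wderiv A f t l <->
  (forall e : R, 0 < e -> exists2 d : R, 0 < d & forall s, A s -> `|s - t| < d ->
     `|f s - f t - l * (s - t)| <= e * `|s - t|).
Proof.
split=> [/cvgrPdist_le h e e0|h].
  have := h e e0; rewrite near_withinE /dnbhs /within /=.
  move=> /nbhs_ballP[d /= d0 hd]; exists d => // s As sd.
  have [->|st] := eqVneq s t; first by rewrite !subrr mulr0 subr0 normr0 mulr0.
  have st0 : s - t != 0 by rewrite subr_eq0.
  have he := hd s; rewrite /ball /= distrC in he; have {}he := he sd st As.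
  rewrite -[f s - f t](mulVKf st0) [l * _]mulrC -mulrBr normrM distrC.
  by rewrite mulrC ler_wpM2r// distrC.
apply/cvgrPdist_le => e e0; have [d d0 hd] := h e e0.
rewrite near_withinE /dnbhs /within /=.
apply/nbhs_ballP; exists d => //= s; rewrite /ball /= distrC => sd st As.
have st0 : s - t != 0 by rewrite subr_eq0.
have := hd s As sd; rewrite -[f s - f t](mulVKf st0) [l * _]mulrC -mulrBr normrM.
by rewrite mulrC ler_pM2r ?normr_gt0// distrC mulVKf.
Qed.

Lemma wderiv_sub A B f t l : B `<=` A -> wderiv A f t l -> wderiv B f t l.
Proof.
move=> BA /wderivP h; apply/wderivP => e /h[d d0 hd].
by exists d => // s /BA; exact: hd.
Qed.

Lemma wderiv_near A f g t l (d : R) : 0 < d ->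
  (forall s, A s -> `|s - t| < d -> f s = g s) -> f t = g t ->
  wderiv A f t l -> wderiv A g t l.
Proof.
move=> d0 fg fgt /wderivP h; apply/wderivP => e /h[d' d'0 hd].
exists (Num.min d d'); first by rewrite lt_min d0.
move=> s As; rewrite lt_min => /andP[sd sd'].
by rewrite -fg// -fgt; exact: hd.
Qed.

Lemma wderiv_ext A f g t l : f =1 g -> wderiv A f t l -> wderiv A g t l.
Proof. by move=> /funext ->. Qed.

Lemma wderiv_eqon A f g t l : {in A, f =1 g} -> A t ->
  wderiv A f t l -> wderiv A g t l.
Proof.
move=> fg At; apply: (@wderiv_near _ _ _ _ _ 1) => //.
  by move=> s As _; rewrite fg// inE.
by rewrite fg// inE.
Qed.

Lemma wderiv_cvg A f t l : wderiv A f t l -> f s @[s --> within A (nbhs t)] --> f t.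
Proof.
move=> /wderivP h; apply/cvgrPdist_le => e e0.
have [d d0 hd] := h 1 ltr01.
rewrite near_withinE; apply/nbhs_ballP.
pose K := 1 + `|l|; have K0 : 0 < K by rewrite ltr_pwDl.
exists (Num.min d (e / K)); first by rewrite /= lt_min d0 divr_gt0.
move=> s; rewrite /ball /= distrC lt_min => /andP[sd se] As.
have {}hd := hd s As sd; rewrite distrC.
have -> : f s - f t = (f s - f t - l * (s - t)) + l * (s - t) by rewrite subrK.
apply: le_trans (ler_normD _ _) _; rewrite normrM.
apply: (@le_trans _ _ (K * `|s - t|)); first by rewrite mulrDl lerD2r.
by rewrite mulrC -ler_pdivlMr// ltW.
Qed.

Lemma wderiv_cst A (c : R) t : wderiv A (fun=> c) t 0.
Proof.
by apply/wderivP => e e0; exists 1 => // s _ _; rewrite subrr mul0r subr0 normr0 mulr_ge0// ltW.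
Qed.

Lemma wderiv_id A t : wderiv A id t 1.
Proof.
by apply/wderivP => e e0; exists 1 => // s _ _; rewrite mul1r subrr normr0 mulr_ge0// ltW.
Qed.

Lemma wderivD A f g t l m : wderiv A f t l -> wderiv A g t m ->
  wderiv A (fun s => f s + g s) t (l + m).
Proof.
move=> hf hg; rewrite /wderiv.
under eq_fun do rewrite opprD addrACA mulrDr.
exact: cvgD.
Qed.

Lemma wderivN A f t l : wderiv A f t l -> wderiv A (fun s => - f s) t (- l).
Proof.
move=> hf; rewrite /wderiv.
under eq_fun do rewrite -opprD mulrN.
exact: cvgN.
Qed.

Lemma wderivB A f g t l m : wderiv A f t l -> wderiv A g t m ->
  wderiv A (fun s => f s - g s) t (l - m).
Proof. by move=> hf /wderivN; exact: wderivD. Qed.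

Lemma within_dnbhs A t : within A t^' `=>` within A (nbhs t).
Proof. by move=> P; rewrite /within /dnbhs/= => h; apply: filterS h => s h _; exact: h. Qed.

Lemma wderivM A f g t l m : wderiv A f t l -> wderiv A g t m ->
  wderiv A (fun s => f s * g s) t (l * g t + f t * m).
Proof.
move=> hf hg; rewrite /wderiv.
have -> : (fun s => (s - t)^-1 * (f s * g s - f t * g t)) =
  (fun s => ((s - t)^-1 * (f s - f t)) * g s + f t * ((s - t)^-1 * (g s - g t))).
  by apply/funext => s; ring.
apply: cvgD; first apply: cvgM => //.
  apply: cvg_trans (wderiv_cvg hg); apply: cvg_app; exact: within_dnbhs.
by apply: cvgMr.
Qed.

Lemma wderivZ A (c : R) f t l : wderiv A f t l -> wderiv A (fun s => c * f s) t (c * l).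
Proof.
move=> hf; have := wderivM (wderiv_cst A c t) hf.
by rewrite mul0r add0r.
Qed.

Lemma wderivV A f t l : wderiv A f t l -> f t != 0 ->
  wderiv A (fun s => (f s)^-1) t (- l / f t ^+ 2).
Proof.
move=> hf ft0; rewrite /wderiv.
have h2 : (f s)^-1 @[s --> within A t^'] --> (f t)^-1.
  apply: cvgV => //; apply: cvg_trans (wderiv_cvg hf); apply: cvg_app; exact: within_dnbhs.
have h3 : \forall s \near within A t^', f s != 0.
  have h : f s @[s --> within A t^'] --> f t.
    apply: cvg_trans (wderiv_cvg hf); apply: cvg_app; exact: within_dnbhs.
  exact: (cvgr_neq0 _ h).
have -> : - l / f t ^+ 2 = - (l * (f t)^-1 * (f t)^-1).
  by rewrite -mulrA -invfM -expr2 mulNr.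
apply: (@cvg_trans _ (- ((s - t)^-1 * (f s - f t) * (f s)^-1 * (f t)^-1) @[s --> within A t^'])).
  apply: near_eq_cvg; near=> s.
  have fs0 : f s != 0 by near: s.
  have -> : (f s)^-1 - (f t)^-1 = - (f s - f t) * (f s)^-1 * (f t)^-1.
    by field; rewrite fs0 ft0.
  by rewrite !mulrA !mulrN !mulNr.
apply: cvgN; apply: cvgMl; apply: cvgM => //.
Unshelve. all: by end_near. Qed.

Lemma wderiv_comp A (B : set R) f g t l m : (forall s, A s -> B (f s)) ->
  wderiv A f t l -> wderiv B g (f t) m -> wderiv A (fun s => g (f s)) t (m * l).
Proof.
move=> AB hf /wderivP hg; apply/wderivP => e e0.
have hc := wderiv_cvg hf.
pose e1 := Num.min 1 (e / (2 * (1 + `|l| + `|m|))).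
have K0 : 0 < 2 * (1 + `|l| + `|m|) by rewrite mulr_gt0// -addrA ltr_pwDl// addr_ge0.
have e10 : 0 < e1 by rewrite lt_min ltr01 divr_gt0.
have [d d0 hd] := hg e1 e10.
have /cvgrPdist_lt/(_ d d0) := hc.
rewrite near_withinE => /nbhs_ballP[d1 /= d10 hd1].
have [d2 d20 hd2] := (wderivP A f t l).1 hf e1 e10.
exists (Num.min d1 d2); first by rewrite lt_min d10.
move=> s As; rewrite lt_min => /andP[s1 s2].
have hfs := hd2 s As s2.
have /hd/(_ _) := AB s As => /(_ _)hgs.
have {}hgs : `|g (f s) - g (f t) - m * (f s - f t)| <= e1 * `|f s - f t|.
  by apply: hgs; rewrite distrC; apply: hd1 => //; rewrite /ball /= distrC.
have -> : g (f s) - g (f t) - m * l * (s - t) =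
  (g (f s) - g (f t) - m * (f s - f t)) + m * (f s - f t - l * (s - t)) by ring.
apply: le_trans (ler_normD _ _) _; rewrite normrM.
have h1 : `|f s - f t| <= (1 + `|l|) * `|s - t|.
  have -> : f s - f t = (f s - f t - l * (s - t)) + l * (s - t) by rewrite subrK.
  apply: le_trans (ler_normD _ _) _; rewrite normrM mulrDl lerD2r.
  by apply: le_trans hfs _; rewrite ler_wpM2r// ge_min lexx.
have h2 : e1 * (1 + `|l| + `|m|) <= e.
  have : e1 <= e / (2 * (1 + `|l| + `|m|)) by rewrite ge_min lexx orbT.
  rewrite ler_pdivlMr// => h; apply: le_trans h.
  rewrite mulrCA ler_peMl//; last by rewrite ler1n.
  by rewrite mulr_ge0 ?(ltW e10)// !addr_ge0.
apply: le_trans (lerD hgs (ler_wpM2l (normr_ge0 m) hfs)) _.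
apply: (@le_trans _ _ (e1 * ((1 + `|l|) * `|s - t|) + `|m| * (e1 * `|s - t|))).
  by rewrite lerD2r ler_wpM2l// ltW.
have -> : e1 * ((1 + `|l|) * `|s - t|) + `|m| * (e1 * `|s - t|) = e1 * (1 + `|l| + `|m|) * `|s - t| by ring.
by rewrite ler_wpM2r.
Qed.

Lemma is_derive_wderiv A f t l : is_derive t 1 f l -> wderiv A f t l.
Proof.
move=> [hd <-]; apply: (@wderiv_sub setT) => //.
suff : (s - t)^-1 * (f s - f t) @[s --> t^'] --> 'D_1 f t.
  apply: cvg_trans; apply: cvg_app => P; rewrite /within /= => hP.
  by apply: filterS hP => x hx _.
have h : h^-1 *: (f (h *: 1 + t) - f t) @[h --> 0^'] --> 'D_1 f t by exact: hd.
apply/cvgrPdist_le => e e0; move/cvgrPdist_le : h => /(_ e e0).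
rewrite /dnbhs !near_withinE => /nbhs_ballP[d /= d0 hd'].
apply/nbhs_ballP; exists d => //= s; rewrite /ball /= => ts st.
have := hd' (s - t); rewrite /ball /= sub0r opprB => /(_ ts).
by rewrite subr_eq0 => /(_ st); rewrite /GRing.scale/= mulr1 subrK.
Qed.

Lemma wderiv_is_derive f t l (d : R) A : 0 < d -> (forall s, `|s - t| < d -> A s) ->
  wderiv A f t l -> is_derive t 1 f l.
Proof.
move=> d0 dA /wderivP h.
have h1 : h^-1 *: (f (h *: 1 + t) - f t) @[h --> 0^'] --> l.
  apply/cvgrPdist_le => e e0; have [d' d'0 hd] := h e e0.
  rewrite /dnbhs near_withinE; apply/nbhs_ballP.
  exists (Num.min d d'); first by rewrite /= lt_min d0.
  move=> x; rewrite /ball /= sub0r normrN lt_min => /andP[xd xd'] x0.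
  have := hd (x + t); rewrite addrK => /(_ (dA _ _) xd').
  rewrite addrK => /(_ xd) h2.
  rewrite /GRing.scale/= mulr1 distrC.
  have alg (u v c : R) : u != 0 -> u^-1 * v - c = u^-1 * (v - c * u) by move=> u0; field.
  rewrite (alg _ _ _ x0).
  rewrite normrM normfV mulrC ler_pdivrMr ?normr_gt0//.
split; first by apply/cvg_ex; exists l.
exact: cvg_lim h1.
Qed.

Lemma wderiv_unique A f t l m : A t -> (exists d : R, 0 < d /\
    ((forall s, t <= s < t + d -> A s) \/ (forall s, t - d < s <= t -> A s))) ->
  wderiv A f t l -> wderiv A f t m -> l = m.
Proof.
move=> At [d [d0 hd]] /wderivP hl /wderivP hm.
apply/eqP; rewrite -subr_eq0 -normr_le0; apply/ler_addgt0Pl => e e0; rewrite addr0.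
have e20 : 0 < e / 2 by rewrite divr_gt0.
have [d1 d10 h1] := hl _ e20; have [d2 d20 h2] := hm _ e20.
pose r := Num.min d (Num.min d1 d2) / 2.
have m0 : 0 < Num.min d (Num.min d1 d2) by rewrite !lt_min d0 d10.
have r0 : 0 < r by rewrite divr_gt0.
have rm : r < Num.min d (Num.min d1 d2) by rewrite ltr_pdivrMr// ltr_pMr// ltr1n.
move: rm; rewrite !lt_min => /and3P[rd r1 r2].
have key s : A s -> `|s - t| = r -> `|l - m| <= e.
  move=> As sr; have st : s - t != 0 by rewrite -normr_eq0 sr gt_eqF.
  have := h1 s As; rewrite sr => /(_ r1) k1; have := h2 s As; rewrite sr => /(_ r2) k2.
  rewrite -(ler_pM2r r0) -{1}sr -normrM.
  have -> : (l - m) * (s - t) = (f s - f t - m * (s - t)) - (f s - f t - l * (s - t)) by ring.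
  by apply: le_trans (ler_normB _ _) _; rewrite [e]splitr mulrDl lerD.
case: hd => hd.
  apply: (key (t + r)); first by apply: hd; rewrite lerDl ltW//= ltrD2l.
  by rewrite addrAC subrr add0r gtr0_norm.
apply: (key (t - r)); first by apply: hd; rewrite ltrD2l ltrN2 rd gerBl ltW.
by rewrite addrAC subrr add0r normrN gtr0_norm.
Qed.

Lemma wderiv_unique_cc a b f t l m : a < b -> a <= t <= b ->
  wderiv `[a, b] f t l -> wderiv `[a, b] f t m -> l = m.
Proof.
move=> ab /andP[at_ tb]; apply: wderiv_unique; first by rewrite /= in_itv/= at_ tb.
have [tb'|bt] := ltP t b.
  exists (b - t); split; first by rewrite subr_gt0.
  left => s /andP[ts]; rewrite addrC subrK => sb.
  by rewrite /= in_itv/= (le_trans at_ ts) ltW.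
exists (b - a); split; first by rewrite subr_gt0.
right => s; have -> : t = b by apply/eqP; rewrite eq_le tb.
by rewrite opprB addrC subrK => /andP[/ltW as_ sb]; rewrite /= in_itv/= as_.
Qed.

Lemma wderiv_MVT A f df a b : a < b -> (forall s, a <= s <= b -> A s) ->
  (forall s, a <= s <= b -> wderiv A f s (df s)) ->
  exists2 c, a < c < b & f b - f a = df c * (b - a).
Proof.
move=> ab hA hd.
have h1 : forall x, x \in `]a, b[ -> is_derive x 1 f (df x).
  move=> x; rewrite in_itv/= => /andP[ax xb].
  have r0 : 0 < Num.min (x - a) (b - x) by rewrite lt_min !subr_gt0 ax.
  apply: (wderiv_is_derive r0) (hd _ _); last by rewrite !ltW.
  move=> s; rewrite lt_min !ltr_norml => /andP[/andP[h1 _] /andP[_ h2]].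
  by apply: hA; apply/andP; split; lra.
have h2 : {within `[a, b], continuous f}.
  apply/continuous_within_itvP => //; split.
  + move=> x; rewrite in_itv/= => /andP[ax xb].
    have r0 : 0 < Num.min (x - a) (b - x) by rewrite lt_min !subr_gt0 ax.
    apply: differentiable_continuous; apply/derivable1_diffP.
    have [] // := @wderiv_is_derive f x (df x) _ A r0 _ (hd _ _); last by rewrite !ltW.
    move=> s; rewrite lt_min !ltr_norml => /andP[/andP[k1 _] /andP[_ k2]].
    by apply: hA; apply/andP; split; lra.
  + have := wderiv_cvg (hd a _); rewrite lexx ltW// => /(_ erefl).
    apply: cvg_trans; apply: cvg_app => P; rewrite /within /at_right /=.
    move=> /nbhs_ballP[e /= e0 he]; apply/nbhs_ballP.
    exists (Num.min e (b - a)); first by rewrite /= lt_min e0 subr_gt0.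
    move=> s; rewrite /ball /= lt_min => /andP[s1 s2] as_.
    apply: he => //; apply: hA; rewrite ltW//=.
    by move: s2; rewrite distrC gtr0_norm ?subr_gt0// => s2; lra.
  + have := wderiv_cvg (hd b _); rewrite lexx ltW// => /(_ erefl).
    apply: cvg_trans; apply: cvg_app => P; rewrite /within /at_left /=.
    move=> /nbhs_ballP[e /= e0 he]; apply/nbhs_ballP.
    exists (Num.min e (b - a)); first by rewrite /= lt_min e0 subr_gt0.
    move=> s; rewrite /ball /= lt_min => /andP[s1 s2] as_.
    apply: he => //; apply: hA; rewrite [s <= b]ltW// andbT.
    by move: s2; rewrite gtr0_norm ?subr_gt0// => s2; lra.
have [c cab ->] := MVT ab h1 h2.
by exists c => //; move: cab; rewrite in_itv.
Qed.

Lemma wderiv_le_norm A f df a b (C : R) : (forall s, Num.min a b <= s <= Num.max a b -> A s) ->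
  (forall s, Num.min a b <= s <= Num.max a b -> wderiv A f s (df s)) ->
  (forall s, Num.min a b <= s <= Num.max a b -> `|df s| <= C) ->
  `|f b - f a| <= C * `|b - a|.
Proof.
move=> hA hd hC; have [ab|ba|->] := ltgtP a b; last by rewrite !subrr normr0 mulr0.
- rewrite min_l ?max_r ?(ltW ab)// in hA hd hC.
  have [c /andP[ac cb] ->] := wderiv_MVT ab hA hd.
  by rewrite normrM ler_wpM2r// hC// !ltW.
- rewrite min_r ?max_l ?(ltW ba)// in hA hd hC.
  have [c /andP[ac cb]] := wderiv_MVT ba hA hd.
  rewrite distrC => ->; rewrite normrM [X in _ <= _ * X]distrC.
  by rewrite ler_wpM2r// hC// !ltW.
Qed.

Lemma wderiv_ge0_le A f df a b : a <= b -> (forall s, a <= s <= b -> A s) ->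
  (forall s, a <= s <= b -> wderiv A f s (df s)) ->
  (forall s, a <= s <= b -> 0 <= df s) -> f a <= f b.
Proof.
rewrite le_eqVlt => /predU1P[->//|ab] hA hd h0.
have [c /andP[ac cb] h] := wderiv_MVT ab hA hd.
by rewrite -subr_ge0 h mulr_ge0 ?h0 ?subr_ge0 ?(ltW ab) ?(ltW ac) ?(ltW cb).
Qed.

(** The mean value inequality for g n - g N bounds its increments by e / 4 * |s - t| for all n >= N;
    letting n tend to infinity gives the same for g0 - g N, and g N alone is differentiated at t.
    The first hypothesis is the convexity of A that the mean value inequality requires. *)
Lemma wderiv_lim A (g dg : nat -> R -> R) (g0 d0 : R -> R) (B : nat -> R) :
  (forall a b s, A a -> A b -> Num.min a b <= s <= Num.max a b -> A s) ->
  (forall n s, A s -> wderiv A (g n) s (dg n s)) ->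
  (forall n s, A s -> `|g n s - g0 s| <= B n) ->
  (forall n s, A s -> `|dg n s - d0 s| <= B n) ->
  (forall e : R, 0 < e -> exists N, forall n, (N <= n)%N -> B n <= e) ->
  forall t, A t -> wderiv A g0 t (d0 t).
Proof.
move=> cA hg hg0 hd0 B0 t At; apply/wderivP => e e0.
have e8 : 0 < e / 8 by rewrite divr_gt0.
have [N hN] := B0 _ e8.
have [d dp hd] := (wderivP _ _ _ _).1 (hg N t At) _ e8.
exists d => // s As sd.
have key n : (N <= n)%N -> `|(g n s - g N s) - (g n t - g N t)| <= (e / 4) * `|s - t|.
  move=> Nn; apply: (@wderiv_le_norm A (fun s => g n s - g N s) (fun s => dg n s - dg N s)).
  - by move=> u; exact: cA.
  - by move=> u hu; apply: wderivB; apply: hg; exact: cA hu.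
  - move=> u hu; have Au : A u by exact: cA hu.
    have -> : dg n u - dg N u = (dg n u - d0 u) - (dg N u - d0 u) by ring.
    apply: le_trans (ler_normB _ _) _.
    have := lerD (le_trans (hd0 n u Au) (hN n Nn)) (le_trans (hd0 N u Au) (hN N (leqnn N))).
    by move=> h; apply: le_trans h _; lra.
have lim : `|(g0 s - g N s) - (g0 t - g N t)| <= (e / 4) * `|s - t|.
  apply/ler_addgt0Pr => c c0.
  have c2 : 0 < c / 2 by rewrite divr_gt0.
  have [N' hN'] := B0 _ c2.
  pose n := maxn N N'; have /key k := leq_maxl N N'.
  have -> : (g0 s - g N s) - (g0 t - g N t) = ((g n s - g N s) - (g n t - g N t)) - (g n s - g0 s) + (g n t - g0 t) by ring.
  apply: le_trans (ler_normD _ _) _; rewrite [c]splitr addrA; apply: lerD.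
    apply: le_trans (ler_normB _ _) _; apply: lerD => //.
    by apply: le_trans (hg0 n s As) _; apply: hN'; rewrite leq_maxr.
  by apply: le_trans (hg0 n t At) _; apply: hN'; rewrite leq_maxr.
have -> : g0 s - g0 t - d0 t * (s - t) = ((g0 s - g N s) - (g0 t - g N t)) +
  (g N s - g N t - dg N t * (s - t)) + (dg N t - d0 t) * (s - t) by ring.
have h1 := hd s As sd; have h2 := le_trans (hd0 N t At) (hN N (leqnn N)).
have h3 : `|(dg N t - d0 t) * (s - t)| <= e / 8 * `|s - t| by rewrite normrM ler_wpM2r.
apply: le_trans (ler_normD _ _) _; apply: le_trans (lerD (ler_normD _ _) (lexx _)) _.
apply: le_trans (lerD (lerD lim h1) h3) _.
by rewrite -!mulrDl ler_wpM2r//; lra.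
Qed.

Lemma prim_above f (a : R) : continuous f -> a < 0 ->
  exists F : R -> R, F 0 = 0 /\ forall t, a < t -> is_derive t 1 F (f t).
Proof.
move=> cf a0.
pose F x := \int[@lebesgue_measure R]_(t in `[a, x]) (f t).
exists (fun x => F x - F 0); split; first by rewrite subrr.
move=> t at_; have [] := @continuous_FTC1_closed R f a t (t + 1).
- by rewrite ltrDl.
- apply: continuous_compact_integrable; first exact: segment_compact.
  exact: continuous_subspaceT.
- exact: at_.
- exact: cf.
- rewrite -/F => h1 h2; rewrite -[f t]subr0; apply: is_deriveB.
  by split; [exact: h1|rewrite -derive1E].
Qed.

(** The primitives started from - (n + 1), normalized at 0, agree on their common domain, and are
    glued by letting n grow with |t|. *)
Lemma prim_exists f : continuous f ->
  exists F : R -> R, F 0 = 0 /\ forall t, is_derive t 1 F (f t).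
Proof.
move=> cf.
have /choice[G hG] n : exists F : R -> R, F 0 = 0 /\
    forall t, - n.+1%:R < t -> is_derive t 1 F (f t).
  by apply: prim_above => //; rewrite oppr_lt0.
have GE m n t : - m.+1%:R < t -> (m <= n)%N -> G n t = G m t.
  move=> mt mn; have m0 : - m.+1%:R < 0 :> R by rewrite oppr_lt0.
  have ht u : Num.min 0 t <= u <= Num.max 0 t -> - m.+1%:R < u.
    by move=> /andP[+ _]; apply: lt_le_trans; rewrite lt_min m0 mt.
  have h : `|(G n t - G m t) - (G n 0 - G m 0)| <= 0 * `|t - 0|.
    apply: (@wderiv_le_norm setT (fun u => G n u - G m u) (fun=> 0)) => //.
      move=> u /ht mu; rewrite -(subrr (f u)); apply: wderivB; apply: is_derive_wderiv.
        by apply: (hG n).2; apply: le_lt_trans mu; rewrite lerN2 ler_nat.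
      exact: (hG m).2.
    by move=> u _; rewrite normr0.
  move: h; rewrite mul0r normr_le0 (hG n).1 (hG m).1 subrr subr0 subr_eq0.
  exact: eqP.
pose F t := G (Num.truncn `|t|) t.
exists F; split; first by rewrite /F (hG _).1.
move=> t; pose n := (Num.truncn `|t|).+1.
have FG s : `|s| < n.+1%:R -> F s = G n s.
  move=> sn; rewrite /F; apply/esym/GE.
    have /andP[_] := truncn_itv (normr_ge0 s).
    by rewrite -normrN => /ltr_normlW; rewrite -ltrNl.
  by rewrite -ltnS -(ltr_nat R); apply: le_lt_trans sn; rewrite truncn_le.
have tn : `|t| < n%:R by have /andP[] := truncn_itv (normr_ge0 t).
have tn' : - n.+1%:R < t.
  rewrite ltrNl; apply: (@le_lt_trans _ _ `|t|); first by rewrite -normrN ler_norm.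
  by apply: lt_le_trans tn _; rewrite ler_nat.
apply: (@wderiv_is_derive F t _ 1 setT) => //.
apply: (@wderiv_near _ (G n) _ _ _ 1) => //; last exact/is_derive_wderiv/(hG n).2.
  move=> s _ st; apply/esym/FG.
  have -> : s = (s - t) + t by rewrite subrK.
  by apply: le_lt_trans (ler_normD _ _) _; rewrite -addn1 natrD addrC ltrD.
by apply/esym/FG; apply: lt_le_trans tn _; rewrite ler_nat.
Qed.

(** The primitive vanishing at 0, made a total function of the integrand: it is 0 when no primitive
    exists. Integrals in time and over a period are values of it. *)
Definition prim f : R -> R :=
  if pselect (exists F : R -> R, F 0 = 0 /\ forall t, is_derive t 1 F (f t))
  is left h then projT1 (cid h) else (fun=> 0).

Lemma primP f : continuous f -> prim f 0 = 0 /\ forall t, is_derive t 1 (prim f) (f t).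
Proof.
move=> /prim_exists hf; rewrite /prim; case: pselect => // h.
exact: (projT2 (cid h)).
Qed.

Lemma prim0 f : continuous f -> prim f 0 = 0.
Proof. by move=> /primP[]. Qed.

Lemma prim_derive f t : continuous f -> is_derive t 1 (prim f) (f t).
Proof. by move=> /primP[]. Qed.

Lemma prim_continuous f : continuous f -> continuous (prim f).
Proof.
move=> cf t; apply: differentiable_continuous; apply/derivable1_diffP.
by have [] := prim_derive t cf.
Qed.

End WDeriv.
Arguments wderivZ {R} A c {f t l}.

(** * Differentiability from continuous partial derivatives *)

Section DifferentiableLittleo.
Context {K : realFieldType} {V W : normedModType K}.

(** The differential is a map selected by [get]; one continuous linear map with the expansion is
    enough for the selected one to have it. *)
Lemma differentiable_littleo (f : V -> W) (df : {linear V -> W}) x :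
  continuous df -> f \o shift x = cst (f x) + df +o_ 0 id -> differentiable f x.
Proof.
move=> dfc dxf.
have hdf h : (f \o shift x = cst (f x) + h +o_ 0 id) ->
    h = f \o shift x - cst (f x) +o_ 0 id.
  move=> hdf; apply: eqaddoE.
  rewrite hdf addrAC -!addrA addrC !addrA subrK.
  rewrite -[LHS]addr0 -addrA; congr (_ + _).
  by apply/eqP; rewrite eq_sym addrC addr_eq0 oppo.
apply/diffP => /=.
apply: (@getPex _ (fun (df : {linear V -> W}) => continuous df /\
  forall y, f y = f (lim (nbhs x)) + df (y - lim (nbhs x))
                  +o_(y \near x) (y - lim (nbhs x)))).
exists df; split=> //; apply: eqaddoEx => z.
rewrite (hdf _ dxf) !addrA lim_id // /(_ \o _) /= subrK [f _ + _]addrC addrK.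
rewrite -addrA -[LHS]addr0; congr (_ + _).
apply/eqP; rewrite eq_sym addrC addr_eq0 oppox; apply/eqP.
rewrite [in LHS]littleo_center0 (comp_centerK x id).
by rewrite -[- _ in RHS](comp_centerK x).
Qed.

Lemma differentiable_bound (f : V -> W) (df : {linear V -> W}) x :
  continuous df ->
  (forall e : K, 0 < e -> exists2 d : K, 0 < d & forall h, `|h| < d ->
    `|f (h + x) - f x - df h| <= e * `|h|) -> differentiable f x.
Proof.
move=> dfc hf; apply: (differentiable_littleo dfc); apply/eqaddoP => e e0.
have [d d0 hd] := hf e e0.
apply/nbhs_ballP; exists d => //= h; rewrite -ball_normE /= sub0r normrN => hd'.
by have := hd h hd'; rewrite !fctE /= opprD addrA.
Qed.

End DifferentiableLittleo.

Section TwoVariables.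
Context {R : realType}.

Definition lin2 (l1 l2 : R) (h : R * R) : R := l1 * h.1 + l2 * h.2.

Lemma lin2_is_linear l1 l2 : linear (lin2 l1 l2).
Proof. by move=> a x y; rewrite /lin2 /= /GRing.scale /=; ring. Qed.

HB.instance Definition _ l1 l2 :=
  GRing.isLinear.Build R (R * R)%type R _ (lin2 l1 l2) (lin2_is_linear l1 l2).

(** The increment is split into a horizontal one at the height of the endpoint and a vertical one
    through p. The mean value inequality is applied to f minus its linear part, whose partial
    derivatives are small near p. *)
Lemma differentiable_partials (f f1 f2 : R * R -> R) (p : R * R) :
  (\forall q \near p, wderiv setT (fun s => f (s, q.2)) q.1 (f1 q)) ->
  (\forall q \near p, wderiv setT (fun s => f (q.1, s)) q.2 (f2 q)) ->
  {for p, continuous f1} -> {for p, continuous f2} -> differentiable f p.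
Proof.
move=> h1 h2 c1 c2.
pose df := lin2 (f1 p) (f2 p).
have dfc : continuous df.
  move=> q; apply: cvgD; apply: cvgMr; [exact: cvg_fst|exact: cvg_snd].
apply: (@differentiable_bound R (R * R)%type R f df p dfc) => e e0.
  have e20 : 0 < e / 2 by rewrite divr_gt0.
  have /cvgrPdist_le/(_ _ e20) d1 := c1.
  have /cvgrPdist_le/(_ _ e20) d2 := c2.
  have : nbhs p [set q | ((wderiv setT (fun s => f (s, q.2)) q.1 (f1 q) /\
      wderiv setT (fun s => f (q.1, s)) q.2 (f2 q)) /\
      (`|f1 p - f1 q| <= e / 2 /\ `|f2 p - f2 q| <= e / 2))].
    exact: (filterI (filterI h1 h2) (filterI d1 d2)).
  move=> /nbhs_ballP[r /= r0 hr].
  exists r => // h hr'.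
  have h1r : `|h.1| < r by apply: le_lt_trans hr'; rewrite prod_normE le_max lexx.
  have h2r : `|h.2| < r by apply: le_lt_trans hr'; rewrite prod_normE le_max lexx orbT.
  have inb q : `|q.1 - p.1| < r -> `|q.2 - p.2| < r -> ball p r q.
    by move=> q1 q2; split; rewrite /ball /= distrC.
  have mm (x y s : R) : Num.min x (y + x) <= s <= Num.max x (y + x) -> `|s - x| <= `|y|.
    have [y0|y0] := leP 0 y.
      rewrite min_l ?max_r ?lerDr// => /andP[a b].
      by rewrite !ger0_norm// ?subr_ge0// lerBlDr.
    have yx : y + x <= x by lra.
    rewrite min_r// max_l// => /andP[a b].
    by rewrite (ltr0_norm y0) ler_norml; apply/andP; split; lra.
  have b2 : `|h.2 + p.2 - p.2| < r by rewrite addrK.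
  have b1 : `|p.1 - p.1| < r by rewrite subrr normr0.
  have k1 : `|(f (h.1 + p.1, h.2 + p.2) - f1 p * (h.1 + p.1)) - (f (p.1, h.2 + p.2) - f1 p * p.1)| <= (e / 2) * `|h.1 + p.1 - p.1|.
    apply: (@wderiv_le_norm _ setT (fun s => f (s, h.2 + p.2) - f1 p * s) (fun s => f1 (s, h.2 + p.2) - f1 p)) => //.
      move=> s /mm hs; have [[g1 _] _] := hr _ (inb (s, h.2 + p.2) (le_lt_trans hs h1r) b2).
      apply: wderivB; first exact: g1.
      by have := wderivZ setT (f1 p) (wderiv_id setT s); rewrite mulr1.
    move=> s /mm hs; have [_ [g1 _]] := hr _ (inb (s, h.2 + p.2) (le_lt_trans hs h1r) b2).
    by rewrite distrC.
  have k2 : `|(f (p.1, h.2 + p.2) - f2 p * (h.2 + p.2)) - (f (p.1, p.2) - f2 p * p.2)| <= (e / 2) * `|h.2 + p.2 - p.2|.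
    apply: (@wderiv_le_norm _ setT (fun s => f (p.1, s) - f2 p * s) (fun s => f2 (p.1, s) - f2 p)) => //.
      move=> s /mm hs; have [[_ g1] _] := hr _ (inb (p.1, s) b1 (le_lt_trans hs h2r)).
      apply: wderivB; first exact: g1.
      by have := wderivZ setT (f2 p) (wderiv_id setT s); rewrite mulr1.
    move=> s /mm hs; have [_ [_ g1]] := hr _ (inb (p.1, s) b1 (le_lt_trans hs h2r)).
    by rewrite distrC.
  rewrite !addrK in k1 k2.
  have -> : f (h + p) - f p - df h =
    ((f (h.1 + p.1, h.2 + p.2) - f1 p * (h.1 + p.1)) - (f (p.1, h.2 + p.2) - f1 p * p.1)) +
    ((f (p.1, h.2 + p.2) - f2 p * (h.2 + p.2)) - (f (p.1, p.2) - f2 p * p.2)).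
    rewrite /df /= /lin2 -surjective_pairing.
    by have -> : h + p = (h.1 + p.1, h.2 + p.2) by []; ring.
  apply: le_trans (ler_normD _ _) _; apply: le_trans (lerD k1 k2) _.
  have n1 : `|h.1| <= `|h| by rewrite prod_normE le_max lexx.
  have n2 : `|h.2| <= `|h| by rewrite prod_normE le_max lexx orbT.
  rewrite [X in _ <= X * _]splitr mulrDl.
  by apply: lerD; rewrite ler_pM2l.
Qed.

End TwoVariables.

(** * Trigonometric series with time-dependent coefficients *)

(* The term [acoef t * cos (afreq * y + aphase)] of a trigonometric series in
   [y], with a bound [abound] of its coefficient on the time interval. *)
Record atom {R : realType} := Atom {
  acoef : R -> R; afreq : nat; aphase : R; abound : R }.
HB.instance Definition _ {R : realType} := gen_eqMixin (@atom R).

Section Atoms.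
Context {R : realType}.
Variables (T mu : R).
Hypotheses (T0 : 0 < T) (mu0 : 0 < mu).
Implicit Types (x : @atom R) (l : seq (@atom R)) (w : nat -> R) (t y c : R).

Definition wfa x := [/\ continuous (acoef x), 0 <= abound x &
  forall t, 0 <= t <= T -> `|acoef x t| <= abound x].
Definition wfl l := forall x, x \in l -> wfa x.

Definition aev x t y := acoef x t * cos ((afreq x)%:R * y + aphase x).
Definition ev l t y := \sum_(x <- l) aev x t y.
(** A weighted Wiener norm of the formal list: it sees the bounds [abound] instead of the
    coefficients and does not merge equal frequencies, so it is exactly additive under
    concatenation. *)
Definition nrm w l := \sum_(x <- l) w (afreq x) * abound x.

Definition amulp x x' := Atom (fun t => acoef x t * acoef x' t / 2)
  (afreq x + afreq x') (aphase x + aphase x') (abound x * abound x' / 2).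
(** The difference frequency is taken in the order that makes it a natural number; as cos is even,
    the phase changes sign with it. *)
Definition amulm x x' := Atom (fun t => acoef x t * acoef x' t / 2)
  (if (afreq x' <= afreq x)%N then (afreq x - afreq x')%N else (afreq x' - afreq x)%N)
  (if (afreq x' <= afreq x)%N then aphase x - aphase x' else aphase x' - aphase x)
  (abound x * abound x' / 2).
(** Locked, so that simplification leaves the nested products of the iteration folded. *)
Definition lmul l l' := locked ([seq amulp x x' | x <- l, x' <- l'] ++
  [seq amulm x x' | x <- l, x' <- l']).
Definition ascale c x := Atom (fun t => c * acoef x t) (afreq x) (aphase x) (`|c| * abound x).
Definition lscale c := map (ascale c).
(* Adding [pi / 2] to the phase turns cos into - sin. *)
Definition adyn j x := Atom (fun t => (afreq x)%:R ^+ j * acoef x t) (afreq x)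
  (aphase x + j%:R * (pi / 2)) ((afreq x)%:R ^+ j * abound x).
Definition ldyn j := map (adyn j).
(* [lheat] solves [u_t = mu u_yy + f], [u 0 = 0], by Duhamel's formula; [hb]
   bounds its effect on the frequency [n]. *)
Definition rate n := mu * n%:R ^+ 2.
Definition hb n := if n == 0%N then T else Num.min T (rate n)^-1.
Definition hcoef n (a : R -> R) t :=
  expR (- (rate n * t)) * prim (fun s => expR (rate n * s) * a s) t.
Definition aheat x := Atom (hcoef (afreq x) (acoef x)) (afreq x) (aphase x)
  (hb (afreq x) * abound x).
Definition lheat := map aheat.
(** The integral over a period, not an average, and only for frequency 0; [lmean] drops the other
    frequencies, whose integral is 0. *)
Definition amean x := Atom (fun t => 2 * pi * cos (aphase x) * acoef x t) 0 0 (2 * pi * abound x).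
Definition lmean l := map amean [seq x <- l | afreq x == 0%N].
Definition aanti x := Atom (fun t => (afreq x)%:R^-1 * acoef x t) (afreq x)
  (aphase x - pi / 2) ((afreq x)%:R^-1 * abound x).
Definition lanti l := map aanti [seq x <- l | afreq x != 0%N].
Definition aprim x := Atom (prim (acoef x)) (afreq x) (aphase x) (T * abound x).
Definition lprim := map aprim.

Lemma ev_nil t y : ev [::] t y = 0. Proof. exact: big_nil. Qed.
Lemma ev_cons x l t y : ev (x :: l) t y = aev x t y + ev l t y.
Proof. exact: big_cons. Qed.
Lemma nrm_nil w : nrm w [::] = 0. Proof. exact: big_nil. Qed.
Lemma nrm_cons w x l : nrm w (x :: l) = w (afreq x) * abound x + nrm w l.
Proof. exact: big_cons. Qed.

Lemma ev_cat l l' t y : ev (l ++ l') t y = ev l t y + ev l' t y.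
Proof. exact: big_cat. Qed.
Lemma nrm_cat w l l' : nrm w (l ++ l') = nrm w l + nrm w l'.
Proof. exact: big_cat. Qed.

Lemma aev_mul x x' t y :
  aev (amulp x x') t y + aev (amulm x x') t y = aev x t y * aev x' t y.
Proof.
rewrite /aev /=; set a := acoef x t; set b := acoef x' t.
set A := (afreq x)%:R * y + aphase x; set B := (afreq x')%:R * y + aphase x'.
have -> : (afreq x + afreq x')%:R * y + (aphase x + aphase x') = A + B.
  by rewrite natrD /A /B; ring.
have -> : cos ((if (afreq x' <= afreq x)%N then (afreq x - afreq x')%N else (afreq x' - afreq x)%N)%:R * y +
  (if (afreq x' <= afreq x)%N then aphase x - aphase x' else aphase x' - aphase x)) = cos (A - B).
  case: leqP => h; first by rewrite natrB// /A /B; congr cos; ring.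
  by rewrite natrB 1?ltnW// -[RHS]cosN /A /B; congr cos; ring.
by rewrite cosD cosB; field.
Qed.

Lemma ev_mul l l' t y : ev (lmul l l') t y = ev l t y * ev l' t y.
Proof.
rewrite /lmul -lock ev_cat /ev !big_allpairs_dep -big_split/= mulr_suml.
apply: eq_bigr => x _; rewrite -big_split/= mulr_sumr.
by apply: eq_bigr => x' _; exact: aev_mul.
Qed.

Lemma ev_scale c l t y : ev (lscale c l) t y = c * ev l t y.
Proof.
rewrite /ev big_map mulr_sumr; apply: eq_bigr => x _.
by rewrite /aev /= mulrA.
Qed.

Lemma wfl_nil : wfl [::]. Proof. by []. Qed.
Lemma wfl_cat l l' : wfl l -> wfl l' -> wfl (l ++ l').
Proof. by move=> h h' x; rewrite mem_cat => /orP[/h|/h']. Qed.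
Lemma wfl_catr l l' : wfl (l ++ l') -> wfl l'.
Proof. by move=> h x xl; apply: h; rewrite mem_cat xl orbT. Qed.
Lemma wfl_cons x l : wfl (x :: l) -> wfa x /\ wfl l.
Proof.
move=> h; split=> [|z zl]; first by apply: h; rewrite mem_head.
by apply: h; rewrite inE zl orbT.
Qed.
Lemma wfl_map (f : @atom R -> @atom R) l : (forall x, wfa x -> wfa (f x)) -> wfl l -> wfl (map f l).
Proof. by move=> hf h x /mapP[z /h zl ->]; exact: hf. Qed.
Lemma wfl_filter (p : pred (@atom R)) l : wfl l -> wfl (seq.filter p l).
Proof. by move=> h x; rewrite mem_filter => /andP[_ /h]. Qed.

Lemma wfl_mul l l' : wfl l -> wfl l' -> wfl (lmul l l').
Proof.
move=> h h'.
have key x x' : x \in l -> x' \in l' -> continuous (fun t => acoef x t * acoef x' t / 2) /\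
  (0 <= abound x * abound x' / 2 /\ forall t, 0 <= t <= T ->
     `|acoef x t * acoef x' t / 2| <= abound x * abound x' / 2).
  move=> /h[c1 b1 h1] /h'[c2 b2 h2]; split.
    by move=> t; apply: cvgM; [apply: cvgM; [exact: c1|exact: c2]|exact: cvg_cst].
  split; first by rewrite divr_ge0// mulr_ge0.
  move=> t ht; rewrite !normrM [`|2^-1|]ger0_norm// ler_pM2r//.
  by rewrite ler_pM// ?h1 ?h2.
rewrite /lmul -lock; apply: wfl_cat => z /allpairsP[[x x'] /= [xl xl' ->]];
  by have [k1 [k2 k3]] := key _ _ xl xl'.
Qed.

Lemma wfl_scale c l : wfl l -> wfl (lscale c l).
Proof.
apply: wfl_map => x [h1 h2 h3]; split => /=.
- by move=> t; apply: cvgM; [exact: cvg_cst|exact: h1].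
- by rewrite mulr_ge0.
- by move=> t ht; rewrite normrM ler_wpM2l// h3.
Qed.

Lemma wfl_dyn j l : wfl l -> wfl (ldyn j l).
Proof.
apply: wfl_map => x [h1 h2 h3]; split => /=.
- by move=> t; apply: cvgM; [exact: cvg_cst|exact: h1].
- by rewrite mulr_ge0// exprn_ge0.
- move=> t ht; rewrite normrM ger0_norm ?exprn_ge0//.
  by rewrite ler_wpM2l ?exprn_ge0// h3.
Qed.

Lemma wfl_mean l : wfl l -> wfl (lmean l).
Proof.
move=> /(@wfl_filter (fun x => afreq x == 0%N)); apply: wfl_map => x [h1 h2 h3]; split => /=.
- by move=> t; apply: cvgM; [exact: cvg_cst|exact: h1].
- by rewrite !mulr_ge0 ?pi_ge0.
- move=> t ht; rewrite !normrM ger0_norm// ger0_norm ?pi_ge0//.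
  rewrite -!mulrA ler_pM2l// ler_pM2l ?pi_gt0//.
  rewrite -[leRHS]mul1r ler_pM// ?h3//.
  by rewrite ler_norml cos_geN1 cos_le1.
Qed.

(** Up to sign, P is compared with s c exp (r s), and r P with c (exp (r s) - 1): both differences
    have a nonnegative derivative. The two conclusions are the two bounds whose minimum is [hb]. *)
Lemma ode_bound (a P : R -> R) (r c t : R) : 0 <= r -> 0 <= c -> 0 <= t ->
  P 0 = 0 -> (forall s : R, is_derive s 1 P (expR (r * s) * a s)) ->
  (forall s, 0 <= s <= t -> `|a s| <= c) ->
  `|expR (- (r * t)) * P t| <= t * c /\ `|expR (- (r * t)) * P t| * r <= c.
Proof.
move=> r0 c0 t0 P0 dP ha.
have dE (s : R) : wderiv setT (fun s => expR (r * s)) s (r * expR (r * s)).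
  rewrite mulrC; apply: (@wderiv_comp _ setT setT (fun s => r * s) expR) => //.
    by have := wderivZ setT r (wderiv_id setT s); rewrite mulr1.
  by apply: is_derive_wderiv; exact: is_derive_expR.
have dPw s : wderiv setT P s (expR (r * s) * a s) by apply: is_derive_wderiv; exact: dP.
have key (b : bool) : let sg := (-1) ^+ b : R in
   sg * P t <= expR (r * t) * (t * c) /\ (sg * P t) * r <= expR (r * t) * c.
  move=> sg; have sgh s : 0 <= s <= t -> sg * a s <= c.
    move=> /ha; apply: le_trans; apply: le_trans (ler_norm _) _.
    by rewrite normrM normr_sign mul1r.
  split.
    have := @wderiv_ge0_le _ setT (fun s => expR (r * s) * (s * c) - sg * P s)
      (fun s => (r * expR (r * s)) * (s * c) + expR (r * s) * c - sg * (expR (r * s) * a s)) 0 t t0.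
    rewrite P0 mul0r !mulr0 subrr subr_ge0; apply => // s hs.
      apply: wderivB; last exact: wderivZ.
      apply: wderivM => //.
      have := wderivM (wderiv_id setT s) (wderiv_cst setT c s).
      by rewrite mul1r mulr0 addr0.
    have -> : r * expR (r * s) * (s * c) + expR (r * s) * c - sg * (expR (r * s) * a s) =
      expR (r * s) * (r * (s * c) + (c - sg * a s)) by ring.
    rewrite mulr_ge0 ?expR_ge0// addr_ge0//; last by rewrite subr_ge0 sgh.
    by rewrite !mulr_ge0//; case/andP: hs.
  have := @wderiv_ge0_le _ setT (fun s => c * expR (r * s) - r * (sg * P s))
    (fun s => c * (r * expR (r * s)) - r * (sg * (expR (r * s) * a s))) 0 t t0.
  rewrite P0 !mulr0 expR0 mulr1 subr0 => h.
  have {}h : c <= c * expR (r * t) - r * (sg * P t).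
    apply: h => // s hs; first by apply: wderivB; [exact: wderivZ|do 2 apply: wderivZ].
    have -> : c * (r * expR (r * s)) - r * (sg * (expR (r * s) * a s)) =
      r * (expR (r * s) * (c - sg * a s)) by ring.
    by rewrite !mulr_ge0 ?expR_ge0// subr_ge0 sgh.
  by move: h; lra.
have ep : 0 < expR (r * t) by exact: expR_gt0.
have eN : expR (- (r * t)) = (expR (r * t))^-1 by rewrite expRN.
have [p1 p2] := key false; have [n1 n2] := key true.
rewrite /= expr0 !mul1r in p1 p2; rewrite /= expr1 !mulN1r in n1 n2.
rewrite normrM ger0_norm ?expR_ge0// eN; split.
  by rewrite mulrC ler_pdivrMr// [X in _ <= X]mulrC ler_norml lerNl n1.
rewrite -mulrA mulrC ler_pdivrMr// [X in _ <= X]mulrC -[X in _ * X](ger0_norm r0) -normrM.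
by rewrite ler_norml lerNl -mulNr n2.
Qed.

Lemma hcoef_cont n a : continuous a -> continuous (hcoef n a).
Proof.
move=> ca t.
have c1 r : continuous (fun s : R => expR (r * s)).
  move=> s; apply: (@continuous_comp _ _ _ (fun s => r * s) expR); last exact: continuous_expR.
  by apply: cvgM; [exact: cvg_cst|exact: cvg_id].
apply: cvgM.
  have := c1 (- rate n) t; by under eq_fun do rewrite mulNr.
apply: prim_continuous => s; apply: cvgM; [exact: c1|exact: ca].
Qed.

Lemma hb_ge0 n : 0 <= hb n.
Proof.
rewrite /hb; case: ifPn => n0; first exact: ltW.
by rewrite le_min ltW//= invr_ge0 mulr_ge0 ?(ltW mu0)// exprn_ge0.
Qed.

Lemma rate_ge0 n : 0 <= rate n.
Proof. by rewrite mulr_ge0 ?(ltW mu0)// exprn_ge0. Qed.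

Lemma expR_lin_cont (r : R) : continuous (fun s : R => expR (r * s)).
Proof.
move=> s; apply: (@continuous_comp _ _ _ (fun s => r * s) expR); last exact: continuous_expR.
by apply: cvgM; [exact: cvg_cst|exact: cvg_id].
Qed.

Lemma wfl_heat l : wfl l -> wfl (lheat l).
Proof.
apply: wfl_map => x [h1 h2 h3]; split => /=.
- exact: hcoef_cont.
- by rewrite mulr_ge0// hb_ge0.
- move=> t /andP[t0 tT].
  have cc : continuous (fun s => expR (rate (afreq x) * s) * acoef x s).
    by move=> s; apply: cvgM; [exact: expR_lin_cont|exact: h1].
  have [] := @ode_bound (acoef x) (prim (fun s => expR (rate (afreq x) * s) * acoef x s))
    (rate (afreq x)) (abound x) t (rate_ge0 _) h2 t0.
  + exact: prim0.
  + by move=> s; exact: prim_derive.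
  + by move=> s /andP[s0 st]; apply: h3; rewrite s0 (le_trans st).
  rewrite -/(hcoef _ _ _) => k1 k2.
  have k1' : `|hcoef (afreq x) (acoef x) t| <= T * abound x.
    by apply: le_trans k1 _; rewrite ler_wpM2r.
  rewrite /hb; case: ifPn => n0 //.
  have rp : 0 < rate (afreq x) by rewrite mulr_gt0// exprn_gt0// ltr0n lt0n.
  have [|] := leP T (rate (afreq x))^-1 => // _.
  by rewrite mulrC ler_pdivlMr.
Qed.

Lemma wfl_prim l : wfl l -> wfl (lprim l).
Proof.
apply: wfl_map => x [h1 h2 h3]; split => /=.
- exact: prim_continuous.
- by rewrite mulr_ge0// ltW.
- move=> t /andP[t0 tT].
  have h : `|prim (acoef x) t - prim (acoef x) 0| <= abound x * `|t - 0|.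
    apply: (@wderiv_le_norm _ setT (prim (acoef x)) (acoef x)) => //.
      by move=> s _; apply: is_derive_wderiv; exact: prim_derive.
    by rewrite min_l// max_r// => s /andP[s0 st]; apply: h3; rewrite s0 (le_trans st).
  rewrite prim0// !subr0 [`|t|]ger0_norm// in h.
  by apply: le_trans h _; rewrite mulrC ler_wpM2r.
Qed.

Lemma ev_dyn_deriv j l t y :
  wderiv setT (ev (ldyn j l) t) y (ev (ldyn j.+1 l) t y).
Proof.
elim: l => [|x l IH].
  by rewrite ev_nil; apply: (@wderiv_ext _ _ (fun=> 0)); [move=> s; rewrite ev_nil|exact: wderiv_cst].
rewrite /= ev_cons; apply: (@wderiv_ext _ _ (fun s => aev (adyn j x) t s + ev (ldyn j l) t s)).
  by move=> s; rewrite ev_cons.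
apply: wderivD => //; rewrite /aev /=.
set n := (afreq x)%:R : R; set a := acoef x t; set b := aphase x.
have -> : n ^+ j.+1 * a * cos (n * y + (b + j.+1%:R * (pi / 2))) =
   (n ^+ j * a) * (- sin (n * y + (b + j%:R * (pi / 2))) * n).
  have -> : n * y + (b + j.+1%:R * (pi / 2)) = (n * y + (b + j%:R * (pi / 2))) + pi / 2.
    by rewrite -natr1; ring.
  by rewrite cosDpihalf exprS; ring.
apply: wderivZ.
apply: (@wderiv_comp _ setT setT (fun s => n * s + (b + j%:R * (pi / 2))) cos) => //.
  have := wderivD (wderivZ setT n (wderiv_id setT y)) (wderiv_cst setT (b + j%:R * (pi / 2)) y).
  by rewrite mulr1 addr0.
by apply: is_derive_wderiv; exact: is_derive_cos.
Qed.

Lemma ev_dyn0 l t y : ev (ldyn 0 l) t y = ev l t y.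
Proof.
rewrite /ev big_map; apply: eq_bigr => x _.
by rewrite /aev /= expr0 mul1r mul0r addr0.
Qed.

Lemma hcoef_deriv n (a : R -> R) t : continuous a ->
  wderiv setT (hcoef n a) t (- rate n * hcoef n a t + a t).
Proof.
move=> ca.
have cc : continuous (fun s => expR (rate n * s) * a s).
  by move=> s; apply: cvgM; [exact: expR_lin_cont|exact: ca].
have h1 : wderiv setT (fun s => expR (- (rate n * s))) t (expR (- (rate n * t)) * - rate n).
  apply: (@wderiv_comp _ setT setT (fun s => - (rate n * s)) expR) => //.
    by apply: wderivN; have := wderivZ setT (rate n) (wderiv_id setT t); rewrite mulr1.
  by apply: is_derive_wderiv; exact: is_derive_expR.
have h2 := is_derive_wderiv setT (prim_derive t cc).
have -> : - rate n * hcoef n a t + a t =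
  (expR (- (rate n * t)) * - rate n) * prim (fun s => expR (rate n * s) * a s) t +
  expR (- (rate n * t)) * (expR (rate n * t) * a t).
  by rewrite mulrA -expRD addNr expR0 mul1r /hcoef; ring.
exact: wderivM.
Qed.

Lemma hcoef0 n (a : R -> R) : continuous a -> hcoef n a 0 = 0.
Proof.
move=> ca; rewrite /hcoef prim0 ?mulr0// => s.
by apply: cvgM; [exact: expR_lin_cont|exact: ca].
Qed.

Lemma ev_heat_deriv j l t y : wfl l ->
  wderiv setT (fun s => ev (ldyn j (lheat l)) s y) t
    (mu * ev (ldyn j.+2 (lheat l)) t y + ev (ldyn j l) t y).
Proof.
elim: l => [|x l IH] h.
  rewrite /= !ev_nil mulr0 addr0.
  by apply: (@wderiv_ext _ _ (fun=> 0)); [move=> s; rewrite ev_nil|exact: wderiv_cst].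
have [hx hl] := wfl_cons h.
rewrite /= !ev_cons mulrDr addrACA; apply: (@wderiv_ext _ _ (fun s => aev (adyn j (aheat x)) s y + ev (ldyn j (lheat l)) s y)).
  by move=> s; rewrite ev_cons.
apply: wderivD; last exact: IH.
rewrite /aev /=.
set n := (afreq x)%:R : R; set b := aphase x.
set C := cos (n * y + (b + j%:R * (pi / 2))).
have -> : cos (n * y + (b + j.+2%:R * (pi / 2))) = - C.
  have -> : n * y + (b + j.+2%:R * (pi / 2)) = (n * y + (b + j%:R * (pi / 2))) + pi.
    by rewrite -(natr1 j.+1) -natr1; lra.
  by rewrite cosDpi.
have [ca _ _] := hx.
have := wderivM (wderivZ setT (n ^+ j) (@hcoef_deriv (afreq x) (acoef x) t ca)) (wderiv_cst setT C t).
rewrite mulr0 addr0; congr (wderiv _ _ _ _).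
by rewrite /rate -/n !exprS; ring.
Qed.

Lemma ev_heat0 j l y : wfl l -> ev (ldyn j (lheat l)) 0 y = 0.
Proof.
elim: l => [|x l IH] h; first by rewrite ev_nil.
have [[ca _ _] hl] := wfl_cons h.
by rewrite /= ev_cons IH// addr0 /aev /= hcoef0// mulr0 mul0r.
Qed.

Lemma ev_prim_deriv l t y : wfl l ->
  wderiv setT (fun s => ev (lprim l) s y) t (ev l t y).
Proof.
elim: l => [|x l IH] h.
  by rewrite ev_nil; apply: (@wderiv_ext _ _ (fun=> 0)); [move=> s; rewrite ev_nil|exact: wderiv_cst].
have [[ca _ _] hl] := wfl_cons h.
rewrite /= !ev_cons; apply: (@wderiv_ext _ _ (fun s => aev (aprim x) s y + ev (lprim l) s y)).
  by move=> s; rewrite ev_cons.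
apply: wderivD; last exact: IH.
rewrite /aev /=; set C := cos _.
have := wderivM (is_derive_wderiv setT (prim_derive t ca)) (wderiv_cst setT C t).
by rewrite mulr0 addr0.
Qed.

Lemma ev_prim0 l y : wfl l -> ev (lprim l) 0 y = 0.
Proof.
elim: l => [|x l IH] h; first by rewrite ev_nil.
have [[ca _ _] hl] := wfl_cons h.
by rewrite /= ev_cons IH// addr0 /aev /= prim0// mul0r.
Qed.

(** Away from frequency 0 the list is the derivative of a periodic one, so the integral over a
    period can be read off this splitting. *)
Lemma ev_mean l t y :
  ev l t y = ev (lmean l) t 0 / (2 * pi) + ev (ldyn 1 (lanti l)) t y.
Proof.
have pi0 : pi != 0 :> R by rewrite gt_eqF// pi_gt0.
elim: l => [|x l IH]; first by rewrite /= !ev_nil mul0r addr0.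
rewrite ev_cons IH /lmean /lanti /=; case: ifPn => n0 /=; rewrite ev_cons.
  rewrite [in RHS]mulrDl -addrA; congr (_ + _).
  rewrite /aev /= (eqP n0) !mul0r !add0r cos0 mulr1.
  have -> : 2 * pi * cos (aphase x) * acoef x t = acoef x t * cos (aphase x) * (2 * pi) by ring.
  by rewrite mulfK// mulf_neq0.
rewrite addrCA; congr (_ + _); congr (_ + _).
rewrite /aev /= expr1; set n := (afreq x)%:R : R.
have nz : n != 0 by rewrite pnatr_eq0.
by rewrite mulVKf// mul1r subrK.
Qed.

Lemma aev_periodic x t y : aev x t (y + 2 * pi) = aev x t y.
Proof.
rewrite /aev; have -> : (afreq x)%:R * (y + 2 * pi) + aphase x = ((afreq x)%:R * y + aphase x) + (2 * pi) *+ afreq x.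
  by rewrite -mulr_natl; ring.
congr (_ * _); move: ((afreq x)%:R * y + aphase x) => u.
elim: (afreq x) => [|m IH]; first by rewrite mulr0n addr0.
by rewrite mulrSr addrA [2 * pi]mulrC mulr_natr cosD2pi -mulr_natr mulrC.
Qed.

Lemma ev_periodic l t y : ev l t (y + 2 * pi) = ev l t y.
Proof. by rewrite /ev; apply: eq_bigr => x _; exact: aev_periodic. Qed.

Lemma nrm_map (f : @atom R -> @atom R) w w' c l :
  (forall x, wfa x -> w (afreq (f x)) * abound (f x) <= c * (w' (afreq x) * abound x)) ->
  wfl l -> nrm w (map f l) <= c * nrm w' l.
Proof.
move=> h hl; rewrite /nrm big_map mulr_sumr big_seq [leRHS]big_seq.
by apply: ler_sum => x /hl; exact: h.
Qed.

Lemma nrm_ge0 w l : (forall n, 0 <= w n) -> wfl l -> 0 <= nrm w l.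
Proof.
move=> w0 hl; rewrite /nrm big_seq; apply: sumr_ge0 => x /hl[_ b _].
by rewrite mulr_ge0.
Qed.

Lemma nrm_le w w' c l : (forall n, w n <= c * w' n) -> wfl l -> nrm w l <= c * nrm w' l.
Proof.
move=> h hl; rewrite -[in leLHS](map_id l); apply: nrm_map => // x [_ b _].
by rewrite mulrA ler_wpM2r.
Qed.

Lemma nrm_filter w (p : pred (@atom R)) l : (forall n, 0 <= w n) -> wfl l ->
  nrm w (seq.filter p l) <= nrm w l.
Proof.
move=> w0 hl; rewrite /nrm big_filter [leRHS](bigID p)/= lerDl.
rewrite big_seq_cond; apply: sumr_ge0 => x /andP[/hl[_ b _] _].
by rewrite mulr_ge0.
Qed.

Lemma nrm_scale w c l : nrm w (lscale c l) = `|c| * nrm w l.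
Proof. by rewrite /nrm big_map mulr_sumr; apply: eq_bigr => x _ /=; rewrite mulrCA. Qed.

Lemma nrm_dyn w j l : nrm w (ldyn j l) = nrm (fun n => w n * n%:R ^+ j) l.
Proof. by rewrite /nrm big_map; apply: eq_bigr => x _ /=; rewrite mulrA. Qed.

Lemma nrm_prim w l : nrm w (lprim l) = T * nrm w l.
Proof. by rewrite /nrm big_map mulr_sumr; apply: eq_bigr => x _ /=; rewrite mulrCA. Qed.

Lemma nrm_mean w l : (forall n, 0 <= w n) -> wfl l -> nrm w (lmean l) <= 2 * pi * nrm w l.
Proof.
move=> w0 hl; apply: le_trans (_ : 2 * pi * nrm w [seq x <- l | afreq x == 0%N] <= _); last first.
  by rewrite ler_wpM2l ?mulr_ge0 ?pi_ge0// nrm_filter.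
rewrite /lmean /nrm big_map mulr_sumr !big_filter.
by rewrite le_eqVlt; apply/orP; left; apply/eqP; apply: eq_bigr => x /eqP -> /=; ring.
Qed.

(** The Wiener algebra property. Sum and difference frequencies each carry half of the product of
    the bounds; a difference frequency is at most the sum, which is where the monotonicity of the
    weight enters. *)
Lemma nrm_mul w l l' : (forall n, 0 <= w n) -> {homo w : m n / (m <= n)%N >-> m <= n} ->
  (forall m n, w (m + n)%N <= w m * w n) -> wfl l -> wfl l' ->
  nrm w (lmul l l') <= nrm w l * nrm w l'.
Proof.
move=> w0 wm wD hl hl'; rewrite /lmul -lock nrm_cat.
have key (f : @atom R -> @atom R -> @atom R) :
    (forall x x', w (afreq (f x x')) <= w (afreq x) * w (afreq x')) ->
    (forall x x', abound (f x x') = abound x * abound x' / 2) ->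
    nrm w [seq f x x' | x <- l, x' <- l'] <= nrm w l * nrm w l' / 2.
  move=> h1 h2; rewrite /nrm big_allpairs_dep !mulr_suml big_seq [leRHS]big_seq.
  apply: ler_sum => x /hl[_ b _]; rewrite mulr_sumr mulr_suml big_seq [leRHS]big_seq.
  apply: ler_sum => x' /hl'[_ b' _]; rewrite h2.
  have -> : w (afreq x) * abound x * (w (afreq x') * abound x') / 2 =
    (w (afreq x) * w (afreq x')) * (abound x * abound x' / 2) by ring.
  by rewrite ler_wpM2r// divr_ge0// mulr_ge0.
rewrite [leRHS]splitr; apply: lerD; apply: key => // x x' /=; first exact: wD.
apply: (@le_trans _ _ (w (afreq x + afreq x')%N)); last exact: wD.
apply: wm.
by case: ifP => _; apply: leq_trans (leq_subr _ _) _; [exact: leq_addr|exact: leq_addl].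
Qed.

Lemma nrm_heat w l : (forall n, 0 <= w n) -> wfl l -> nrm w (lheat l) <= T * nrm w l.
Proof.
move=> w0; apply: nrm_map => x [_ b _] /=; rewrite mulrCA ler_wpM2r ?mulr_ge0//.
by rewrite /hb; case: ifP => // _; rewrite ge_min lexx.
Qed.

(** The minimum of T and 1 / (mu n^2) is at most their geometric mean, and n times the latter is
    sqrt (T / mu): one derivative is gained together with a small factor. *)
Lemma nrm_heat1 w l (s1 : R) : 0 <= s1 -> T <= s1 ^+ 2 * mu -> (forall n, 0 <= w n) ->
  wfl l -> nrm w (ldyn 1 (lheat l)) <= s1 * nrm w l.
Proof.
move=> s0 hs w0 hl; rewrite nrm_dyn; apply: nrm_map => // x [_ b _] /=.
have -> : w (afreq x) * (afreq x)%:R ^+ 1 * (hb (afreq x) * abound x) =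
  ((afreq x)%:R * hb (afreq x)) * (w (afreq x) * abound x) by rewrite expr1; ring.
apply: ler_wpM2r; first by rewrite mulr_ge0.
have [->|n0] := eqVneq (afreq x) 0%N; first by rewrite mul0r.
set n := (afreq x)%:R : R; have np : 0 < n by rewrite ltr0n lt0n.
rewrite -(@ler_pXn2r _ 2)// ?nnegrE ?mulr_ge0 ?hb_ge0 ?(ltW np)//.
have rp : 0 < mu * n ^+ 2 by rewrite mulr_gt0// exprn_gt0.
have : hb (afreq x) * hb (afreq x) <= T * (mu * n ^+ 2)^-1.
  by rewrite ler_pM ?hb_ge0// /hb (negbTE n0) ge_min /rate -/n lexx ?orbT.
rewrite ler_pdivlMr// => h.
rewrite -(ler_pM2r mu0); apply: le_trans hs; apply: le_trans h.
by rewrite le_eqVlt; apply/orP; left; apply/eqP; ring.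
Qed.

(** The full gain of two derivatives, from the second bound in [hb]; no small factor is left. *)
Lemma nrm_heat2 w l : (forall n, 0 <= w n) ->
  wfl l -> nrm w (ldyn 2 (lheat l)) <= mu^-1 * nrm w l.
Proof.
move=> w0 hl; rewrite nrm_dyn; apply: nrm_map => // x [_ b _] /=.
have -> : w (afreq x) * (afreq x)%:R ^+ 2 * (hb (afreq x) * abound x) =
  ((afreq x)%:R ^+ 2 * hb (afreq x)) * (w (afreq x) * abound x) by ring.
apply: ler_wpM2r; first by rewrite mulr_ge0.
have [->|n0] := eqVneq (afreq x) 0%N; first by rewrite expr0n mul0r invr_ge0 ltW.
set n := (afreq x)%:R : R; have np : 0 < n by rewrite ltr0n lt0n.
rewrite /hb (negbTE n0) /rate -/n.
apply: (@le_trans _ _ (n ^+ 2 * (mu * n ^+ 2)^-1)).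
  by rewrite ler_wpM2l ?exprn_ge0// ge_min lexx orbT.
by rewrite invfM mulrCA mulfV ?mulr1// expf_neq0// gt_eqF.
Qed.

(** Here both derivatives fall on the source, and the factor T is kept. This is the estimate for a
    source that is smooth but not small. *)
Lemma nrm_heat2' w l : (forall n, 0 <= w n) ->
  wfl l -> nrm w (ldyn 2 (lheat l)) <= T * nrm w (ldyn 2 l).
Proof.
move=> w0 hl; rewrite !nrm_dyn; apply: nrm_map => // x [_ b _] /=.
rewrite [leLHS]mulrCA ler_wpM2r ?mulr_ge0 ?exprn_ge0//.
by rewrite /hb; case: ifP => // _; rewrite ge_min lexx.
Qed.

Lemma ev_le_nrm l t y : 0 <= t <= T -> wfl l -> `|ev l t y| <= nrm (fun=> 1) l.
Proof.
move=> ht hl; apply: le_trans (ler_norm_sum _ _ _) _.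
rewrite /nrm big_seq [leRHS]big_seq; apply: ler_sum => x /hl[_ b h].
rewrite mul1r normrM -[leRHS]mulr1 ler_pM ?h//.
by rewrite ler_norml cos_geN1 cos_le1.
Qed.

(* The iterates below are nested multisets of atoms. For these, boundedness of
   the norms is enough for convergence: [|ev l' - ev l| <= nrm l' - nrm l]. *)
Definition sublist l l' := exists r, perm_eq l' (l ++ r).

Lemma sublist_refl l : sublist l l.
Proof. by exists [::]; rewrite cats0. Qed.

Lemma sublist_trans l1 l2 l3 : sublist l1 l2 -> sublist l2 l3 -> sublist l1 l3.
Proof.
move=> [r h] [r' h']; exists (r ++ r'); apply: perm_trans h' _.
by rewrite catA perm_cat2r.
Qed.

Lemma sublist0 l : sublist [::] l.
Proof. by exists l. Qed.

Lemma sublist_cat l1 l2 l1' l2' : sublist l1 l1' -> sublist l2 l2' ->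
  sublist (l1 ++ l2) (l1' ++ l2').
Proof.
move=> [r h] [r' h']; exists (r ++ r').
by apply: perm_trans (perm_cat h h') _; rewrite perm_catACA.
Qed.

Lemma sublist_map f l l' : sublist l l' -> sublist (map f l) (map f l').
Proof. by move=> [r h]; exists (map f r); rewrite -map_cat; exact: perm_map. Qed.

Lemma sublist_filter (p : pred (@atom R)) l l' : sublist l l' ->
  sublist (seq.filter p l) (seq.filter p l').
Proof. by move=> [r h]; exists (seq.filter p r); rewrite -filter_cat; exact: perm_filter. Qed.

Lemma sublist_allpairs (f : @atom R -> @atom R -> @atom R) l1 l2 l1' l2' :
  sublist l1 l1' -> sublist l2 l2' ->
  sublist [seq f x z | x <- l1, z <- l2] [seq f x z | x <- l1', z <- l2'].
Proof.
move=> [r h] [r' h'].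
exists ([seq f x z | x <- l1, z <- r'] ++ [seq f x z | x <- r, z <- l2 ++ r']).
apply: perm_trans (perm_allpairs f h h') _.
rewrite allpairs_cat catA perm_cat2r; apply/permPl.
exact: (perm_allpairs_catr (fun x z => f x z) l1 (fun=> l2) (fun=> r')).
Qed.

Lemma sublist_mul l1 l2 l1' l2' : sublist l1 l1' -> sublist l2 l2' ->
  sublist (lmul l1 l2) (lmul l1' l2').
Proof. by move=> h h'; rewrite /lmul -!lock; apply: sublist_cat; exact: sublist_allpairs. Qed.

Lemma sublist_mean l l' : sublist l l' -> sublist (lmean l) (lmean l').
Proof. by move=> h; apply: sublist_map; exact: sublist_filter. Qed.

Lemma sublist_ev l l' t y : 0 <= t <= T -> wfl l' -> sublist l l' ->
  `|ev l' t y - ev l t y| <= nrm (fun=> 1) l' - nrm (fun=> 1) l.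
Proof.
move=> ht hl' [r h].
have hr : wfl r by move=> x xr; apply: hl'; rewrite (perm_mem h) mem_cat xr orbT.
have -> : ev l' t y = ev (l ++ r) t y by rewrite /ev (perm_big _ h).
have -> : nrm (fun=> 1) l' = nrm (fun=> 1) (l ++ r) by rewrite /nrm (perm_big _ h).
have alg (u v : R) : u + v - u = v by ring.
by rewrite ev_cat nrm_cat !alg ev_le_nrm.
Qed.

End Atoms.

(** * Relative continuity, integrals over a period, limits of nested lists *)

Section ContOn.
Context {R : realType} {P : topologicalType}.
Implicit Types (A : set P) (f g : P -> R).

Definition cont_on A f := forall p, A p -> f q @[q --> within A (nbhs p)] --> f p.

Lemma cont_on_sub A B f : B `<=` A -> cont_on A f -> cont_on B f.
Proof.
move=> BA h p Bp; apply: cvg_trans (h p (BA p Bp)); apply: cvg_app => U.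
rewrite !nbhs_simpl /within /= => hU.
by apply: filterS hU => q hq Bq; apply: hq; exact: BA.
Qed.

Lemma cont_onT A f : continuous f -> cont_on A f.
Proof. by move=> cf p _; apply: cvg_within_filter; exact: cf. Qed.

Lemma cont_on_eq A f g : (forall p, A p -> f p = g p) -> cont_on A f -> cont_on A g.
Proof.
move=> fg h p Ap; rewrite -fg//; apply: cvg_trans (h p Ap).
apply: near_eq_cvg; rewrite near_withinE; near=> q => Aq; exact: fg.
Unshelve. all: by end_near. Qed.

Lemma cont_on_cst A (c : R) : cont_on A (fun=> c).
Proof. by move=> p _; exact: cvg_cst. Qed.

Lemma cont_onD A f g : cont_on A f -> cont_on A g -> cont_on A (fun p => f p + g p).
Proof. by move=> hf hg p Ap; apply: cvgD; [exact: hf|exact: hg]. Qed.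

Lemma cont_onN A f : cont_on A f -> cont_on A (fun p => - f p).
Proof. by move=> hf p Ap; apply: cvgN; exact: hf. Qed.

Lemma cont_onM A f g : cont_on A f -> cont_on A g -> cont_on A (fun p => f p * g p).
Proof. by move=> hf hg p Ap; apply: cvgM; [exact: hf|exact: hg]. Qed.

Lemma cont_onV A f : (forall p, A p -> f p != 0) -> cont_on A f -> cont_on A (fun p => (f p)^-1).
Proof. by move=> f0 hf p Ap; apply: cvgV; [exact: f0|exact: hf]. Qed.

Lemma cont_on_lim A (f : nat -> P -> R) g (B : nat -> R) :
  (forall m, cont_on A (f m)) -> (forall m p, A p -> `|f m p - g p| <= B m) ->
  B @ \oo --> 0 -> cont_on A g.
Proof.
move=> hf hB B0 p Ap; apply/cvgrPdist_le => e e0.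
have e3 : 0 < e / 3 by rewrite divr_gt0.
have /cvgrPdist_le/(_ _ e3)[N _ hN] := B0.
have BN : B N <= e / 3.
  by have := hN N (leqnn N); rewrite sub0r normrN; apply: le_trans; rewrite ler_norm.
have /cvgrPdist_le/(_ _ e3) := hf N p Ap.
rewrite !near_withinE; apply: filterS => q h Aq.
have -> : g p - g q = - (f N p - g p) + (f N p - f N q) + (f N q - g q) by ring.
apply: le_trans (ler_normD _ _) _; apply: le_trans (lerD (ler_normD _ _) (lexx _)) _.
rewrite normrN.
have h1 := le_trans (hB N p Ap) BN; have h2 := le_trans (hB N q Aq) BN; have h3 := h Aq.
by lra.
Qed.

Lemma cont_on_setT f : cont_on setT f -> continuous f.
Proof.
move=> h p; have := h p I; apply: cvg_trans; apply: cvg_app => U; rewrite nbhs_simpl /within /= => hU.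
by apply: filterS hU => q hq; exact: hq.
Qed.

End ContOn.

Lemma cont_on_comp {R : realType} {P Q : topologicalType} (A : set P) (E : set Q) (f : P -> R) (g : Q -> P) :
  (forall q, E q -> A (g q)) -> (forall q, E q -> g r @[r --> within E (nbhs q)] --> g q) ->
  cont_on A f -> cont_on E (fun q => f (g q)).
Proof.
move=> BA cg cf q Eq; apply: cvg_trans (cf _ (BA q Eq)) => U hU.
have : \forall r \near within E (nbhs q), A (g r) -> U (f (g r)) by exact: (cg q Eq _ hU).
change ((\forall r \near within E (nbhs q), A (g r) -> U (f (g r))) ->
  \forall r \near within E (nbhs q), U (f (g r))).
by rewrite !near_withinE; apply: filterS => r + Er; apply => //; exact: BA.
Qed.

Lemma line_continuous {R : realType} (y : R) : continuous (fun t : R => (t, y)).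
Proof.
move=> t; apply/cvgrPdist_le => e e0; apply/nbhs_ballP; exists e => //= s.
rewrite /ball /= => ts; rewrite prod_normE /= subrr normr0 ge_max (ltW e0) andbT.
exact: ltW.
Qed.

Lemma wderiv_continuous {R : realType} (f df : R -> R) :
  (forall y, wderiv setT f y (df y)) -> continuous f.
Proof. by move=> h; apply: cont_on_setT => y _; exact: wderiv_cvg (h y). Qed.

Section Mean.
Context {R : realType}.
Implicit Types (f g F : R -> R).

Definition int2pi f : R := prim f (2 * pi).

Lemma int2pi_anti f F : continuous f -> (forall y, wderiv setT F y (f y)) ->
  int2pi f = F (2 * pi) - F 0.
Proof.
move=> cf hF.
have h : `|(prim f (2 * pi) - F (2 * pi)) - (prim f 0 - F 0)| <= 0 * `|2 * pi - 0|.
  apply: (@wderiv_le_norm _ setT (fun y => prim f y - F y) (fun=> 0)) => //.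
    move=> s _; rewrite -(subrr (f s)); apply: wderivB => //.
    by apply: is_derive_wderiv; exact: prim_derive.
  by move=> s _; rewrite normr0.
move: h; rewrite mul0r normr_le0 (prim0 cf) sub0r opprK /int2pi => /eqP h.
by lra.
Qed.

Lemma int2pi_le f g (e : R) : continuous f -> continuous g ->
  (forall y, 0 <= y <= 2 * pi -> `|f y - g y| <= e) ->
  `|int2pi f - int2pi g| <= e * (2 * pi).
Proof.
move=> cf cg h; have p0 : 0 <= 2 * pi :> R by rewrite mulr_ge0 ?pi_ge0.
have := @wderiv_le_norm _ setT (fun y => prim f y - prim g y) (fun y => f y - g y) 0 (2 * pi) e.
rewrite (prim0 cf) (prim0 cg) !subr0 (ger0_norm p0) min_l// max_r//; apply => //.
by move=> s _; apply: wderivB; apply: is_derive_wderiv; exact: prim_derive.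
Qed.
End Mean.

Section Majorant.
Context {R : realType}.

(** V and u + V are both nondecreasing and bounded above, so u converges as a difference of monotone
    sequences; the error is bounded by the tail of V. *)
Lemma majorant_cvg (u V : nat -> R) (C : R) :
  (forall m n, (m <= n)%N -> `|u n - u m| <= V n - V m) -> (forall n, V n <= C) ->
  exists l lV, [/\ u @ \oo --> l, V @ \oo --> lV & forall m, `|u m - l| <= lV - V m].
Proof.
move=> h hC.
have Vm m n : (m <= n)%N -> V m <= V n.
  by move=> /h; rewrite -[V m <= _]subr_ge0; apply: le_trans.
have cV : V @ \oo --> sup (range V).
  apply: nondecreasing_cvgn; last by exists C => _ [n _ <-].
  by move=> m n mn; exact: Vm.
have uV : (fun n => u n + V n) @ \oo --> sup (range (fun n => u n + V n)).
  apply: nondecreasing_cvgn.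
    move=> m n mn; have := h m n mn; rewrite ler_norml => /andP[+ _]; lra.
  exists (u 0%N - V 0%N + 2 * C) => _ [n _ <-].
  have := h 0%N n (leq0n _); rewrite ler_norml => /andP[_]; have := hC n; lra.
exists (sup (range (fun n => u n + V n)) - sup (range V)), (sup (range V)).
have ul : u @ \oo --> sup (range (fun n => u n + V n)) - sup (range V).
  have uE : u = (fun n => u n + V n - V n) by apply/funext => n; rewrite addrK.
  by rewrite [X in X @ _ --> _]uE; exact: cvgB.
split => // m.
have c1 : (fun n => `|u m - u n|) @ \oo --> `|u m - (sup (range (fun n => u n + V n)) - sup (range V))|.
  by apply: cvg_norm; apply: cvgB => //; exact: cvg_cst.
have c2 : (fun n => V n - V m) @ \oo --> sup (range V) - V m.
  by apply: cvgB => //; exact: cvg_cst.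
apply: (ler_cvg_to c1 c2); near=> n; rewrite distrC; apply: h.
by near: n; exact: nbhs_infty_ge.
Unshelve. all: by end_near. Qed.

Lemma cvg0_eventually (B : nat -> R) : B @ \oo --> 0 ->
  forall e : R, 0 < e -> exists N, forall n, (N <= n)%N -> B n <= e.
Proof.
move=> /cvgrPdist_le h e e0; have [N _ hN] := h e e0; exists N => n Nn.
have := hN n Nn; rewrite sub0r normrN; apply: le_trans; exact: ler_norm.
Qed.

Lemma bound_cvg (u B : nat -> R) l : (forall m, `|u m - l| <= B m) -> B @ \oo --> 0 ->
  u @ \oo --> l.
Proof.
move=> h B0; apply/cvgrPdist_le => e e0.
have [N hN] := cvg0_eventually B0 e0; exists N => // n Nn.
by rewrite distrC; apply: le_trans (h n) _; exact: hN.
Qed.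
End Majorant.

Section ListLimit.
Context {R : realType}.
Variables (T : R).
Hypothesis T0 : 0 < T.

Definition slab (T : R) : set (R * R) := [set q | 0 <= q.1 <= T].

Lemma ev_cont (l : seq (@atom R)) : wfl T l -> continuous (fun q : R * R => ev l q.1 q.2).
Proof.
elim: l => [|x l IH] h.
  have -> : (fun q : R * R => ev [::] q.1 q.2) = (fun=> 0) :> (_ -> R).
    by apply/funext => q; rewrite ev_nil.
  by move=> q; exact: cvg_cst.
have [[ca _ _] hl] := wfl_cons h.
have -> : (fun q : R * R => ev (x :: l) q.1 q.2) = (fun q => aev x q.1 q.2 + ev l q.1 q.2).
  by apply/funext => q; rewrite ev_cons.
move=> q; apply: cvgD; last exact: IH.
apply: cvgM.
  by apply: (@continuous_comp _ _ _ fst (acoef x)); [exact: cvg_fst|exact: ca].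
apply: (@continuous_comp _ _ _ (fun q : R * R => (afreq x)%:R * q.2 + aphase x) cos); last exact: continuous_cos.
apply: cvgD; last exact: cvg_cst.
by apply: cvgM; [exact: cvg_cst|exact: cvg_snd].
Qed.

Lemma ev_cont2 (l : seq (@atom R)) t : wfl T l -> continuous (ev l t).
Proof.
move=> h y; apply: differentiable_continuous; apply/derivable1_diffP.
have [] := @wderiv_is_derive _ (ev l t) y (ev (ldyn 1 l) t y) 1 setT ltr01 _ _ => //.
have := @ev_dyn_deriv R 0 l t y; apply: wderiv_ext => z; exact: ev_dyn0.
Qed.

Lemma int2pi_ev (l : seq (@atom R)) t : wfl T l -> int2pi (ev l t) = ev (lmean l) t 0.
Proof.
move=> h; set c := ev (lmean l) t 0.
rewrite (@int2pi_anti _ _ (fun y => c / (2 * pi) * y + ev (lanti l) t y)).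
- rewrite mulr0 add0r.
  have -> : ev (lanti l) t (2 * pi) = ev (lanti l) t 0 by rewrite -{1}[2 * pi]add0r ev_periodic.
  by rewrite addrK mulfVK// mulf_neq0// gt_eqF// pi_gt0.
- exact: ev_cont2.
- move=> y; rewrite (ev_mean l t y); apply: wderivD.
    by have := wderivZ setT (c / (2 * pi)) (wderiv_id setT y); rewrite mulr1.
  have := @ev_dyn_deriv R 0 (lanti l) t y; apply: wderiv_ext => z; exact: ev_dyn0.
Qed.

Lemma ldyn_sublist j (l l' : seq (@atom R)) : sublist l l' -> sublist (ldyn j l) (ldyn j l').
Proof. exact: sublist_map. Qed.

(** Boundedness of the norms of every order replaces a Cauchy estimate: for each j the norms of
    [ldyn j (L m)] increase to a limit, and their tails [B j] bound the error uniformly in t and y.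
    [F j] is the j-th derivative in y of the sum. *)
Lemma list_limit (L : nat -> seq (@atom R)) (C : nat -> R) :
  (forall m, wfl T (L m)) -> (forall m, sublist (L m) (L m.+1)) ->
  (forall j m, nrm (fun n => n%:R ^+ j) (L m) <= C j) ->
  exists (F : nat -> R -> R -> R) (B : nat -> nat -> R),
  [/\ forall j, B j @ \oo --> 0,
      forall j m t y, 0 <= t <= T -> `|ev (ldyn j (L m)) t y - F j t y| <= B j m,
      forall j t y, 0 <= t <= T -> `|F j t y| <= C j,
      forall j t y, 0 <= t <= T -> wderiv setT (F j t) y (F j.+1 t y) &
      (forall j t y, F j t (y + 2 * pi) = F j t y) /\
      (forall j, cont_on (slab T) (fun q => F j q.1 q.2))].
Proof.
move=> wL sL hC.
have sub m n : (m <= n)%N -> sublist (L m) (L n).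
  elim: n => [|n IH]; first by rewrite leqn0 => /eqP ->; exact: sublist_refl.
  rewrite leq_eqVlt => /predU1P[->|mn]; first exact: sublist_refl.
  by apply: sublist_trans (IH mn) _; exact: sL.
pose V j m := nrm (fun=> 1) (ldyn j (L m)).
have VC j m : V j m <= C j.
  apply: le_trans (hC j m); rewrite /V nrm_dyn.
  by rewrite le_eqVlt; apply/orP; left; apply/eqP; congr nrm; apply/funext => n; rewrite mul1r.
have dV j t y : 0 <= t <= T -> forall m n, (m <= n)%N ->
    `|ev (ldyn j (L n)) t y - ev (ldyn j (L m)) t y| <= V j n - V j m.
  move=> ht m n mn; apply: (@sublist_ev _ T) => //; first exact: wfl_dyn.
  exact/ldyn_sublist/sub.
pose F j t y := lim (ev (ldyn j (L m)) t y @[m --> \oo]).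
pose B j m := lim (V j @ \oo) - V j m.
have Vcv j : V j @ \oo --> lim (V j @ \oo).
  have [l [lV [_ h _]]] := majorant_cvg (dV j 0 0 (introT andP (conj (lexx 0) (ltW T0)))) (VC j).
  by rewrite (cvg_lim _ h).
have key j m t y : 0 <= t <= T -> `|ev (ldyn j (L m)) t y - F j t y| <= B j m.
  move=> ht; have [l [lV [h1 h2 h3]]] := majorant_cvg (dV j t y ht) (VC j).
  by rewrite /F (cvg_lim _ h1)// /B (cvg_lim _ h2).
have B0 j : B j @ \oo --> 0.
  rewrite -(subrr (lim (V j @ \oo))); apply: cvgB => //; exact: cvg_cst.
exists F, B; split => //.
- move=> j t y ht; have c := bound_cvg (fun m => key j m t y ht) (B0 j).
  apply: (ler_cvg_to (cvg_norm c) (cvg_cst (C j))); near=> n => /=.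
  apply: le_trans (VC j n); apply: ev_le_nrm ht _; exact: wfl_dyn.
- move=> j t y ht.
  apply: (@wderiv_lim _ setT (fun m => ev (ldyn j (L m)) t) (fun m => ev (ldyn j.+1 (L m)) t)
    (F j t) (F j.+1 t) (fun m => `|B j m| + `|B j.+1 m|)) => //.
  + by move=> m s _; exact: ev_dyn_deriv.
  + move=> m s _; apply: le_trans (key j m t s ht) _.
    by apply: le_trans (ler_norm _) _; rewrite lerDl.
  + move=> m s _; apply: le_trans (key j.+1 m t s ht) _.
    by apply: le_trans (ler_norm _) _; rewrite lerDr.
  + apply: cvg0_eventually; rewrite -[X in _ --> X]addr0 -{1 2}(@normr0 _ R).
    by apply: cvgD; apply: cvg_norm.
split.
- move=> j t y; rewrite /F; congr (lim (_ @ \oo)); apply/funext => m.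
  exact: ev_periodic.
- move=> j; apply: (@cont_on_lim _ _ _ (fun m q => ev (ldyn j (L m)) q.1 q.2) _ (B j)) => //.
    by move=> m; apply: cont_onT; apply: ev_cont; exact: wfl_dyn.
  by move=> m [t y] ht; exact: key.
Unshelve. all: by end_near. Qed.
End ListLimit.

(** * Existence on a short time interval *)

Section Iteration.
Context {R : realType}.
Variables (T mu nu L0 b0 : R) (W : R -> R) (kd pd qd : nat -> seq (@atom R)).
Hypotheses (T0 : 0 < T) (mu0 : 0 < mu) (nu0 : 0 < nu) (L00 : 0 < L0).
Hypotheses (cW : continuous W) (b00 : 0 <= b0)
  (W_le : forall t, 0 <= t <= T -> `|W t| <= b0).
Hypotheses (wk : forall m, wfl T (kd m)) (wp : forall m, wfl T (pd m))
  (wq : forall m, wfl T (qd m)).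
Hypotheses (sk : forall m, sublist (kd m) (kd m.+1))
  (sp : forall m, sublist (pd m) (pd m.+1))
  (sq : forall m, sublist (qd m) (qd m.+1)).

Local Notation lst := (seq (@atom R)).

(* Picard iteration for
     xi_t = mu xi_yy + f,   zeta = xi + q (xi_yy - p xi_y) + be,
     f = - mu p xi_y + k^2 (xi + be) - k - k^2 zeta^2 a,   a = k - k zeta a,
     be = W - (pi / L0) be^2 - (nu / L0) (int xi k) be
            - (nu / L0) int_0^t (int a k) be,
   where [a] is the curvature, so that [f] is the equation [xi_t = - a] made
   parabolic by means of [k^2 q = mu]. The forcing is present only through its
   primitive [W]. *)
Definition fxi (f : lst) : lst := lheat T mu f.
Definition fzeta (p q f b : lst) : lst :=
  fxi f ++ (lmul q (ldyn 2 (fxi f) ++ lscale (-1) (lmul p (ldyn 1 (fxi f)))) ++ b).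
Definition fg (k p q f a b : lst) : lst :=
  lscale (- mu) (lmul p (ldyn 1 (fxi f))) ++ (lmul (lmul k k) (fxi f ++ b) ++
  lscale (-1) (lmul (lmul (lmul k k) (lmul (fzeta p q f b) (fzeta p q f b))) a)).
Definition fF (k p q f a b : lst) : lst := lscale (-1) k ++ fg k p q f a b.
Definition fK (k p q f a b : lst) : lst :=
  k ++ lscale (-1) (lmul (lmul k (fzeta p q f b)) a).
Definition fD (k a b : lst) : lst := lmul (lmean (lmul a k)) b.
Definition fB (k f a b : lst) : lst :=
  [:: Atom W 0 0 b0] ++ (lscale (- (pi / L0)) (lmul b b) ++
  (lscale (- (nu / L0)) (lmul (lmean (lmul (fxi f) k)) b) ++
   lscale (- (nu / L0)) (lprim T (fD k a b)))).

(** The data enter truncated at the index of the iterate, which keeps every list finite; iterating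
    and refining the truncation both only add atoms. *)
Fixpoint st (m : nat) : lst * lst * lst :=
  if m is n.+1 then
    let: (f, a, b) := st n in
    (fF (kd n) (pd n) (qd n) f a b, fK (kd n) (pd n) (qd n) f a b, fB (kd n) f a b)
  else ([::], [::], [::]).
Definition stf m := (st m).1.1.
Definition sta m := (st m).1.2.
Definition stb m := (st m).2.

Lemma stfS m : stf m.+1 = fF (kd m) (pd m) (qd m) (stf m) (sta m) (stb m).
Proof. by rewrite /stf /sta /stb /=; case: (st m) => [[f a] b]. Qed.
Lemma staS m : sta m.+1 = fK (kd m) (pd m) (qd m) (stf m) (sta m) (stb m).
Proof. by rewrite /stf /sta /stb /=; case: (st m) => [[f a] b]. Qed.
Lemma stbS m : stb m.+1 = fB (kd m) (stf m) (sta m) (stb m).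
Proof. by rewrite /stf /sta /stb /=; case: (st m) => [[f a] b]. Qed.

Lemma sublist_heat (l l' : lst) : sublist l l' -> sublist (fxi l) (fxi l').
Proof. exact: sublist_map. Qed.
Lemma sublist_scale c (l l' : lst) : sublist l l' -> sublist (lscale c l) (lscale c l').
Proof. exact: sublist_map. Qed.
Lemma sublist_prim (l l' : lst) : sublist l l' -> sublist (lprim T l) (lprim T l').
Proof. exact: sublist_map. Qed.

Lemma sublist_D (k a b k' a' b' : lst) : sublist k k' -> sublist a a' -> sublist b b' ->
  sublist (fD k a b) (fD k' a' b').
Proof. by move=> *; apply: sublist_mul => //; apply: sublist_mean; exact: sublist_mul. Qed.

(** Every operation of the iteration is monotone for [sublist], because signs are carried by the
    coefficients and nothing is ever cancelled, and the first iterate is empty. *)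
Lemma st_sub m : [/\ sublist (stf m) (stf m.+1), sublist (sta m) (sta m.+1) &
  sublist (stb m) (stb m.+1)].
Proof.
elim: m => [|m [hf ha hb]]; first by split; exact: sublist0.
rewrite !(stfS m.+1) !(staS m.+1) !(stbS m.+1).
have hz : sublist (fzeta (pd m) (qd m) (stf m) (stb m)) (fzeta (pd m.+1) (qd m.+1) (stf m.+1) (stb m.+1)).
  apply: sublist_cat; first exact: sublist_heat.
  apply: sublist_cat => //; apply: sublist_mul => //.
  apply: sublist_cat; first by apply: ldyn_sublist; exact: sublist_heat.
  by apply: sublist_scale; apply: sublist_mul => //; apply: ldyn_sublist; exact: sublist_heat.
split; rewrite ?(stfS m) ?(staS m) ?(stbS m) in hf ha hb hz *.
- apply: sublist_cat; first exact: sublist_scale.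
  apply: sublist_cat.
    by apply: sublist_scale; apply: sublist_mul => //; apply: ldyn_sublist; exact: sublist_heat.
  apply: sublist_cat.
    apply: sublist_mul; first exact: sublist_mul.
    by apply: sublist_cat => //; exact: sublist_heat.
  apply: sublist_scale; apply: sublist_mul => //.
  by apply: sublist_mul; exact: sublist_mul.
- apply: sublist_cat => //; apply: sublist_scale; apply: sublist_mul => //.
  exact: sublist_mul.
- apply: sublist_cat; first exact: sublist_refl.
  apply: sublist_cat; first by apply: sublist_scale; exact: sublist_mul.
  apply: sublist_cat.
    apply: sublist_scale; apply: sublist_mul => //; apply: sublist_mean.
    by apply: sublist_mul => //; exact: sublist_heat.
  by apply: sublist_scale; apply: sublist_prim; exact: sublist_D.
Qed.

Lemma wfl_xi f : wfl T f -> wfl T (fxi f). Proof. exact: wfl_heat. Qed.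

Lemma wfl_zeta p q f b : wfl T p -> wfl T q -> wfl T f -> wfl T b -> wfl T (fzeta p q f b).
Proof.
move=> hp hq hf hb; apply: wfl_cat; first exact: wfl_xi.
apply: wfl_cat => //; apply: wfl_mul => //; apply: wfl_cat.
  by apply: wfl_dyn; exact: wfl_xi.
by apply: wfl_scale; apply: wfl_mul => //; apply: wfl_dyn; exact: wfl_xi.
Qed.

Lemma wfl_g k p q f a b : wfl T k -> wfl T p -> wfl T q -> wfl T f -> wfl T a -> wfl T b ->
  wfl T (fg k p q f a b).
Proof.
move=> hk hp hq hf ha hb; have hz := wfl_zeta hp hq hf hb.
apply: wfl_cat; first by apply: wfl_scale; apply: wfl_mul => //; apply: wfl_dyn; exact: wfl_xi.
apply: wfl_cat.
  by apply: wfl_mul; [exact: wfl_mul|apply: wfl_cat => //; exact: wfl_xi].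
by apply: wfl_scale; apply: wfl_mul => //; apply: wfl_mul; exact: wfl_mul.
Qed.

Lemma wfl_D k a b : wfl T k -> wfl T a -> wfl T b -> wfl T (fD k a b).
Proof. by move=> *; apply: wfl_mul => //; apply: wfl_mean; exact: wfl_mul. Qed.

Lemma st_wf m : [/\ wfl T (stf m), wfl T (sta m) & wfl T (stb m)].
Proof.
elim: m => [|m [hf ha hb]]; first by split; exact: wfl_nil.
rewrite stfS staS stbS; split.
- by apply: wfl_cat; [exact: wfl_scale|exact: wfl_g].
- apply: wfl_cat => //; apply: wfl_scale; apply: wfl_mul => //; apply: wfl_mul => //.
  exact: wfl_zeta.
- apply: wfl_cat; first by move=> x; rewrite inE => /eqP ->; split.
  apply: wfl_cat; first by apply: wfl_scale; exact: wfl_mul.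
  apply: wfl_cat.
    apply: wfl_scale; apply: wfl_mul => //; apply: wfl_mean; apply: wfl_mul => //.
    exact: wfl_xi.
  by apply: wfl_scale; apply: wfl_prim => //; exact: wfl_D.
Qed.

Definition freq0 (l : lst) := all (fun x => afreq x == 0%N) l.

Lemma freq0_mul l l' : freq0 l -> freq0 l' -> freq0 (lmul l l').
Proof.
move=> /allP h /allP h'; apply/allP => z; rewrite /lmul -lock mem_cat => /orP[] /allpairsP[[x x'] /= [/h/eqP xl /h'/eqP xl' ->]] /=;
  by rewrite xl xl'.
Qed.

Lemma freq0_map (f : @atom R -> @atom R) l : (forall x, afreq (f x) = afreq x) ->
  freq0 l -> freq0 (map f l).
Proof. by move=> h /allP hl; apply/allP => x /mapP[z /hl hz ->]; rewrite h. Qed.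

Lemma freq0_mean l : freq0 (lmean l).
Proof. by apply/allP => x /mapP[z _ ->]. Qed.

(** This is what makes the limit of these lists a function of time alone. *)
Lemma st_freq0 m : freq0 (stb m).
Proof.
elim: m => // m IH; rewrite stbS /freq0 !all_cat -!/(freq0 _) /=.
rewrite !freq0_map//; apply: freq0_mul => //; exact: freq0_mean.
Qed.

Lemma ev_freq0 l t y : freq0 l -> ev l t y = ev l t 0.
Proof.
move=> /allP h; rewrite /ev big_seq [RHS]big_seq; apply: eq_bigr => x /h /eqP xl.
by rewrite /aev xl !mul0r.
Qed.

Lemma ev_zeta p q f b t y : ev (fzeta p q f b) t y = ev (fxi f) t y +
  ev q t y * (ev (ldyn 2 (fxi f)) t y - ev p t y * ev (ldyn 1 (fxi f)) t y) + ev b t y.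
Proof. by rewrite /fzeta !ev_cat ev_mul ev_cat ev_scale ev_mul mulN1r addrA. Qed.

Section Bounds.
Variables (e1 e2 b kb pb qb k2b s1 : R) (w : nat -> R).
Hypotheses (w0 : forall n, 0 <= w n) (w1 : w 0%N = 1)
  (wm : {homo w : m n / (m <= n)%N >-> m <= n})
  (wD : forall m n, w (m + n)%N <= w m * w n).
Hypotheses (hk : forall m, nrm w (kd m) <= kb) (hp : forall m, nrm w (pd m) <= pb)
  (hq : forall m, nrm w (qd m) <= qb)
  (hk2 : forall m, nrm (fun n => w n * n%:R ^+ 2) (kd m) <= k2b).
Hypotheses (e10 : 0 <= e1) (e20 : 0 <= e2) (b_0 : 0 <= b) (s10 : 0 <= s1).

(** [cA] bounds zeta, and [cG] the part [fg] of the source, on the set where xi and xi_y are bounded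
    by [e1], xi_yy by [e2], be by [b] and a by [2 * kb]. The inequalities below make this set
    invariant: H1 serves a, H2 xi_yy, H3 with Hs xi_y, H4 xi, and H5 be. *)
Definition cA := e1 + (qb * (e2 + pb * e1) + b).
Definition cG := mu * (pb * e1) + (kb * kb * (e1 + b) + kb * kb * (cA * cA) * (2 * kb)).

Hypotheses (H1 : kb * cA * (2 * kb) <= kb) (H2 : T * k2b + mu^-1 * cG <= e2)
  (H3 : s1 * (kb + cG) <= e1) (H4 : T * (kb + cG) <= e1) (Hs : T <= s1 ^+ 2 * mu)
  (H5 : b0 + (pi / L0 * (b * b) + (nu / L0 * (2 * pi * (e1 * kb) * b) +
          nu / L0 * (T * (2 * pi * (2 * kb * kb) * b)))) <= b).

Lemma nrm_mul_le l l' (r r' : R) : wfl T l -> wfl T l' -> nrm w l <= r -> nrm w l' <= r' ->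
  nrm w (lmul l l') <= r * r'.
Proof.
move=> hl hl' h h'; apply: le_trans (nrm_mul w0 wm wD hl hl') _.
by apply: ler_pM => //; apply: (@nrm_ge0 _ T).
Qed.

Let kb0 : 0 <= kb. Proof. by apply: le_trans (hk 0); apply: (@nrm_ge0 _ T). Qed.

Definition st_ok m := [/\ nrm w (fxi (stf m)) <= e1, nrm w (ldyn 1 (fxi (stf m))) <= e1,
  nrm w (ldyn 2 (fxi (stf m))) <= e2, nrm w (sta m) <= 2 * kb & nrm w (stb m) <= b].

Lemma zeta_bound m : st_ok m ->
  nrm w (fzeta (pd m) (qd m) (stf m) (stb m)) <= cA.
Proof.
move=> [h1 h2 h3 h4 h5]; have [hf ha hb] := st_wf m.
rewrite !nrm_cat; apply: lerD => //; apply: lerD => //.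
apply: nrm_mul_le => //.
  apply: wfl_cat; first by apply: wfl_dyn; exact: wfl_xi.
  by apply: wfl_scale; apply: wfl_mul => //; apply: wfl_dyn; exact: wfl_xi.
rewrite nrm_cat; apply: lerD => //; rewrite nrm_scale normrN1 mul1r.
by apply: nrm_mul_le => //; apply: wfl_dyn; exact: wfl_xi.
Qed.

Lemma g_bound m : st_ok m ->
  nrm w (fg (kd m) (pd m) (qd m) (stf m) (sta m) (stb m)) <= cG.
Proof.
move=> ok; have [h1 h2 h3 h4 h5] := ok; have [hf ha hb] := st_wf m.
have hz := wfl_zeta (@wp m) (@wq m) hf hb.
rewrite !nrm_cat !nrm_scale normrN (gtr0_norm mu0) normrN1 mul1r.
apply: lerD.
  apply: ler_wpM2l; first exact: ltW.
  by apply: nrm_mul_le => //; apply: wfl_dyn; exact: wfl_xi.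
apply: lerD.
  apply: nrm_mul_le; [exact: wfl_mul|by apply: wfl_cat => //; exact: wfl_xi|exact: nrm_mul_le|].
  by rewrite nrm_cat lerD.
apply: nrm_mul_le => //; first by apply: wfl_mul; exact: wfl_mul.
apply: nrm_mul_le; [exact: wfl_mul|exact: wfl_mul|exact: nrm_mul_le|].
by apply: nrm_mul_le => //; exact: zeta_bound.
Qed.

Lemma D_bound m : st_ok m -> nrm w (fD (kd m) (sta m) (stb m)) <= 2 * pi * (2 * kb * kb) * b.
Proof.
move=> [h1 h2 h3 h4 h5]; have [hf ha hb] := st_wf m.
apply: nrm_mul_le => //; first by apply: wfl_mean; exact: wfl_mul.
apply: le_trans (nrm_mean w0 (wfl_mul ha (@wk m))) _.
by rewrite ler_wpM2l ?mulr_ge0 ?pi_ge0//; exact: nrm_mul_le.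
Qed.

Lemma F_bound m : st_ok m -> nrm w (stf m.+1) <= kb + cG.
Proof.
move=> ok; rewrite stfS nrm_cat nrm_scale normrN1 mul1r.
by apply: lerD => //; exact: g_bound.
Qed.

Lemma st_bound m : st_ok m.
Proof.
elim: m => [|m ok].
  by rewrite /st_ok /stf /sta /stb /= !nrm_nil; split => //; rewrite mulr_ge0.
have [h1 h2 h3 h4 h5] := ok; have [hf ha hb] := st_wf m.
have [hf' ha' hb'] := st_wf m.+1.
have hz := wfl_zeta (@wp m) (@wq m) hf hb.
have Fb := F_bound ok.
split.
- apply: le_trans (@nrm_heat R T mu w _ w0 hf') _; apply: le_trans _ H4.
  by rewrite ler_wpM2l// ltW.
- apply: le_trans (nrm_heat1 T0 mu0 s10 Hs w0 hf') _; apply: le_trans _ H3.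
  by rewrite ler_wpM2l.
(* For xi_yy the source is split: - k is estimated with both derivatives on it and the factor T, the
   remainder [fg] by the gain 1 / mu. H2 adds the two. *)
- have hg := wfl_g (@wk m) (@wp m) (@wq m) hf ha hb.
  have -> : ldyn 2 (fxi (stf m.+1)) = ldyn 2 (fxi (lscale (-1) (kd m))) ++
      ldyn 2 (fxi (fg (kd m) (pd m) (qd m) (stf m) (sta m) (stb m))).
    by rewrite stfS /fF /fxi /lheat /ldyn !map_cat.
  rewrite nrm_cat; apply: le_trans _ H2; apply: lerD.
    have hsk : wfl T (lscale (-1) (kd m)) by exact: wfl_scale.
    have hh : nrm w (ldyn 2 (fxi (lscale (-1) (kd m)))) <= T * nrm w (ldyn 2 (lscale (-1) (kd m))) by exact: nrm_heat2'.
    apply: le_trans hh _.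
    rewrite ler_wpM2l ?(ltW T0)// nrm_dyn nrm_scale normrN1 mul1r; exact: hk2.
  apply: le_trans (nrm_heat2 mu0 w0 hg) _.
  by rewrite ler_wpM2l ?invr_ge0 ?(ltW mu0)//; exact: g_bound.
- rewrite staS nrm_cat nrm_scale normrN1 mul1r mulr_natl mulr2n; apply: lerD => //.
  apply: le_trans _ H1; apply: nrm_mul_le => //; first exact: wfl_mul.
  by apply: nrm_mul_le => //; exact: zeta_bound.
- have piL : 0 <= pi / L0 by rewrite divr_ge0 ?pi_ge0 ?(ltW L00).
  have nuL : 0 <= nu / L0 by rewrite divr_ge0 ?(ltW nu0) ?(ltW L00).
  rewrite stbS !nrm_cat !nrm_scale !normrN (ger0_norm piL) (ger0_norm nuL).
  apply: le_trans _ H5; apply: lerD.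
    by rewrite nrm_cons nrm_nil addr0 /= w1 mul1r.
  apply: lerD; first by apply: ler_wpM2l => //; exact: nrm_mul_le.
  apply: lerD; apply: ler_wpM2l => //.
    apply: nrm_mul_le => //.
      by apply: wfl_mean; apply: wfl_mul => //; exact: wfl_xi.
    apply: le_trans (nrm_mean w0 (wfl_mul (wfl_xi hf) (@wk m))) _.
    by rewrite ler_wpM2l ?mulr_ge0 ?pi_ge0//; apply: nrm_mul_le => //; exact: wfl_xi.
  by rewrite nrm_prim ler_wpM2l ?(ltW T0)//; exact: D_bound.
Qed.

End Bounds.
End Iteration.

Lemma seq_lim_unique {R : realType} (u : nat -> R) (a b : R) :
  u @ \oo --> a -> u @ \oo --> b -> a = b.
Proof. by move=> h1 h2; rewrite -(cvg_lim _ h1)// -(cvg_lim _ h2). Qed.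

Section PolyWeight.
Context {R : realType}.
Variables (lam : R) (j : nat).
Hypothesis (lam0 : 0 < lam).

(** Equal to 1 at frequency 0 and submultiplicative for every lam > 0, yet it dominates a multiple
    of n^j: a bound in this norm controls j derivatives. *)
Definition pweight (n : nat) : R := (1 + lam * n%:R) ^+ j.

Let base_ge1 n : 1 <= 1 + lam * n%:R.
Proof. by rewrite lerDl mulr_ge0// ltW. Qed.

Lemma pweight_ge0 n : 0 <= pweight n.
Proof. by rewrite exprn_ge0// (le_trans ler01). Qed.

Lemma pweight0 : pweight 0 = 1.
Proof. by rewrite /pweight mulr0 addr0 expr1n. Qed.

Lemma pweight_mono : {homo pweight : m n / (m <= n)%N >-> m <= n}.
Proof.
move=> m n mn; apply: lerXn2r; rewrite ?nnegrE ?(le_trans ler01)//.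
by rewrite lerD2l ler_wpM2l ?(ltW lam0)// ler_nat.
Qed.

Lemma pweightD m n : pweight (m + n)%N <= pweight m * pweight n.
Proof.
rewrite /pweight -exprMn; apply: lerXn2r; rewrite ?nnegrE ?mulr_ge0 ?(le_trans ler01)//.
rewrite natrD -subr_ge0.
have -> : (1 + lam * m%:R) * (1 + lam * n%:R) - (1 + lam * (m%:R + n%:R)) =
  (lam * m%:R) * (lam * n%:R) by ring.
by rewrite !mulr_ge0// ltW.
Qed.

Lemma exprn_pweight n : n%:R ^+ j <= lam ^- j * pweight n.
Proof.
rewrite mulrC ler_pdivlMr ?exprn_gt0// -exprMn mulrC.
apply: lerXn2r; [|by rewrite nnegrE (le_trans ler01)|by rewrite lerDr].
by rewrite nnegrE mulr_ge0// ltW.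
Qed.
End PolyWeight.

Section LocalSolution.
Context {R : realType}.
Variables (T mu nu L0 b0 : R) (W : R -> R) (kd pd qd : nat -> seq (@atom R)) (k p q : R -> R).
Hypotheses (T0 : 0 < T) (mu0 : 0 < mu) (nu0 : 0 < nu) (L00 : 0 < L0).
Hypotheses (cW : continuous W) (b00 : 0 <= b0)
  (W_le : forall t, 0 <= t <= T -> `|W t| <= b0).
Hypotheses (wk : forall m, wfl T (kd m)) (wp : forall m, wfl T (pd m))
  (wq : forall m, wfl T (qd m)).
Hypotheses (sk : forall m, sublist (kd m) (kd m.+1))
  (sp : forall m, sublist (pd m) (pd m.+1))
  (sq : forall m, sublist (qd m) (qd m.+1)).
Variable (Bd : nat -> R).
Hypotheses (Bd0 : Bd @ \oo --> 0)
  (rk : forall m t y, `|ev (kd m) t y - k y| <= Bd m)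
  (rp : forall m t y, `|ev (pd m) t y - p y| <= Bd m)
  (rq : forall m t y, `|ev (qd m) t y - q y| <= Bd m).
Variables (e1 e2 b kb pb qb k2b s1 : R) (lam : nat -> R).
Hypothesis (lam0 : forall j, 0 < lam j).
Hypotheses (hk : forall j m, nrm (pweight (lam j) j) (kd m) <= kb)
  (hp : forall j m, nrm (pweight (lam j) j) (pd m) <= pb)
  (hq : forall j m, nrm (pweight (lam j) j) (qd m) <= qb)
  (hk2 : forall j m, nrm (fun n => pweight (lam j) j n * n%:R ^+ 2) (kd m) <= k2b).
Hypotheses (e10 : 0 <= e1) (e20 : 0 <= e2) (b_0 : 0 <= b) (s10 : 0 <= s1).
Local Notation cA := (cA e1 e2 b pb qb).
Local Notation cG := (cG mu e1 e2 b kb pb qb).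
Hypotheses (H1 : kb * cA * (2 * kb) <= kb) (H2 : T * k2b + mu^-1 * cG <= e2)
  (H3 : s1 * (kb + cG) <= e1) (H4 : T * (kb + cG) <= e1) (Hs : T <= s1 ^+ 2 * mu)
  (H5 : b0 + (pi / L0 * (b * b) + (nu / L0 * (2 * pi * (e1 * kb) * b) +
          nu / L0 * (T * (2 * pi * (2 * kb * kb) * b)))) <= b).
Hypothesis (kq : forall y, k y ^+ 2 * q y = mu).

(** Orders 1 and 2 keep the small bounds obtained with the constant weight; the other orders pay the
    factor [lam j ^- j], which is 1 at order 0. *)
Definition xi_bound (j : nat) : R :=
  if j == 1%N then e1 else if j == 2%N then e2 else lam j ^- j * e1.
Definition ka_bound (j : nat) : R := lam j ^- j * (2 * kb).

(** All lists of the iteration converge with their derivatives in y, so its defining relations pass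
    to the limit. The limit [ff] of the sources is then eliminated, since it combines with mu xi_yy
    into - a. *)
Theorem local_solution : exists (xi ka : nat -> R -> R -> R) (be J : R -> R),
  [/\ [/\ forall j, cont_on (slab T) (fun q => xi j q.1 q.2),
          forall j, cont_on (slab T) (fun q => ka j q.1 q.2),
          forall j t y, 0 <= t <= T -> `|xi j t y| <= xi_bound j,
          forall j t y, 0 <= t <= T -> `|ka j t y| <= ka_bound j &
          cont_on (`[0, T]%classic : set R) be],
      [/\ forall j t y, 0 <= t <= T -> wderiv setT (xi j t) y (xi j.+1 t y),
          forall j t y, 0 <= t <= T -> wderiv setT (ka j t) y (ka j.+1 t y),
          forall j t y, xi j t (y + 2 * pi) = xi j t y &
          forall j t y, ka j t (y + 2 * pi) = ka j t y],
      [/\ forall j t y, 0 <= t <= T -> wderiv `[0, T]%classic (fun s => xi j s y) t (- ka j t y),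
          forall j y, xi j 0 y = 0 &
          forall t y, 0 <= t <= T -> ka 0%N t y = k y - k y *
            (xi 0%N t y + q y * (xi 2%N t y - p y * xi 1%N t y) + be t) * ka 0%N t y] &
      [/\ forall t, 0 <= t <= T -> `|be t| <= b,
          forall t, 0 <= t <= T -> be t = W t - pi / L0 * (be t) ^+ 2
            - nu / L0 * (int2pi (fun y => xi 0%N t y * k y) * be t) - nu / L0 * J t,
          J 0 = 0 &
          forall t, 0 <= t <= T -> wderiv `[0, T]%classic J t
            (int2pi (fun y => ka 0%N t y * k y) * be t)]].
Proof.
have tt0 : (0 : R) <= 0 <= T by rewrite lexx ltW.
pose F m := stf T mu nu L0 b0 W kd pd qd m.
pose A m := sta T mu nu L0 b0 W kd pd qd m.
pose B m := stb T mu nu L0 b0 W kd pd qd m.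
pose X m := fxi T mu (F m).
have wf m : [/\ wfl T (F m), wfl T (A m) & wfl T (B m)] by exact: st_wf.
have sub m : [/\ sublist (F m) (F m.+1), sublist (A m) (A m.+1) & sublist (B m) (B m.+1)].
  exact: st_sub.
have wFX m : wfl T (X m) by have [h _ _] := wf m; exact: wfl_xi.
have ok j m := @st_bound R T mu nu L0 b0 W kd pd qd T0 mu0 nu0 L00 cW b00 W_le wk wp wq
  e1 e2 b kb pb qb k2b s1 _ (pweight_ge0 j (lam0 j)) (pweight0 _ _) (pweight_mono j (lam0 j))
  (pweightD j (lam0 j)) (hk j) (hp j) (hq j) (hk2 j) e10 e20 b_0 s10 H1 H2 H3 H4 Hs H5 m.
have n0 j n : 0 <= n%:R ^+ j :> R by rewrite exprn_ge0.
have lej j l c : wfl T l -> nrm (pweight (lam j) j) l <= c ->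
    nrm (fun n => n%:R ^+ j) l <= lam j ^- j * c.
  move=> hl hc; apply: le_trans (nrm_le (exprn_pweight j (lam0 j)) hl) _.
  by rewrite ler_wpM2l// invr_ge0 exprn_ge0// ltW.
have lz j : 0 <= lam j ^- j by rewrite invr_ge0 exprn_ge0// ltW.
have w00 n : pweight (lam 0%N) 0 n = 1 by rewrite /pweight expr0.
have nX j m : nrm (fun n => n%:R ^+ j) (X m) <= xi_bound j.
  rewrite /xi_bound; case: eqP => [->|_].
    have [_ h _ _ _] := ok 0%N m; apply: le_trans h; rewrite nrm_dyn.
    by rewrite le_eqVlt; apply/orP; left; apply/eqP; congr nrm; apply/funext => n; rewrite w00 mul1r.
  case: eqP => [->|_].
    have [_ _ h _ _] := ok 0%N m; apply: le_trans h; rewrite nrm_dyn.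
    by rewrite le_eqVlt; apply/orP; left; apply/eqP; congr nrm; apply/funext => n; rewrite w00 mul1r.
  by have [h _ _ _ _] := ok j m; exact: lej.
have nA j m : nrm (fun n => n%:R ^+ j) (A m) <= ka_bound j.
  by have [_ _ _ h _] := ok j m; have [_ hA _] := wf m; exact: lej.
have nB j m : nrm (fun n => n%:R ^+ j) (B m) <= lam j ^- j * b.
  by have [_ _ _ _ h] := ok j m; have [_ _ hB] := wf m; exact: lej.
have kb0 : 0 <= kb by apply: le_trans (hk 0 0%N); apply: (@nrm_ge0 _ T) => // n; exact: pweight_ge0.
have nF j m : nrm (fun n => n%:R ^+ j) (F m) <= lam j ^- j * (kb + cG).
  have [hF _ _] := wf m; apply: lej => //.
  have FS i : nrm (pweight (lam j) j) (F i.+1) <= kb + cG.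
    by apply: F_bound (ok j i) => //; [exact: pweight_ge0|exact: pweight_mono|exact: pweightD].
  case: m {hF} => [|m]; last exact: FS.
  rewrite /F /stf /= nrm_nil; apply: le_trans (FS 0%N); apply: (@nrm_ge0 _ T).
    by move=> n; exact: pweight_ge0.
  by have [] := wf 1%N.
have sX m : sublist (X m) (X m.+1) by have [h _ _] := sub m; exact: sublist_heat.
have [xi [Bx [Bx0 hx bx dx [px cx]]]] := list_limit T0 wFX sX nX.
have [ka [Ba [Ba0 ha ba da [pa ca]]]] := list_limit T0 (fun m => let: And3 _ h _ := wf m in h)
  (fun m => let: And3 _ h _ := sub m in h) nA.
have [bb [Bb [Bb0 hb bbb db [pb' cb]]]] := list_limit T0 (fun m => let: And3 _ _ h := wf m in h)
  (fun m => let: And3 _ _ h := sub m in h) nB.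
have [ff [Bf [Bf0 hf bf df [pf cf]]]] := list_limit T0 (fun m => let: And3 h _ _ := wf m in h)
  (fun m => let: And3 h _ _ := sub m in h) nF.
pose D m := fD (kd m) (A m) (B m).
have wD m : wfl T (D m) by have [_ h1 h2] := wf m; exact: wfl_D.
have sD m : sublist (D m) (D m.+1) by have [_ h1 h2] := sub m; exact: sublist_D.
have nD0 j m : nrm (pweight (lam j) j) (D m) <= 2 * pi * (2 * kb * kb) * b.
  apply: D_bound (ok j m) => //; [exact: pweight_ge0|exact: pweight_mono|exact: pweightD].
have nD j m : nrm (fun n => n%:R ^+ j) (D m) <= lam j ^- j * (2 * pi * (2 * kb * kb) * b).
  exact: lej.
have [dd [BD [BD0 hD bD dD [pD cD]]]] := list_limit T0 wD sD nD.
have wJ m : wfl T (lprim T (D m)) by exact: wfl_prim.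
have nJ j m : nrm (fun n => n%:R ^+ j) (lprim T (D m)) <= T * (lam j ^- j * (2 * pi * (2 * kb * kb) * b)).
  by rewrite nrm_prim ler_wpM2l// ltW.
have [jj [BJ [BJ0 hJ bJ dJ [pJ cJ]]]] := list_limit T0 wJ (fun m => sublist_prim T (sD m)) nJ.
pose be t := bb 0%N t 0.
have cvx j t y : 0 <= t <= T -> ev (ldyn j (X m)) t y @[m --> \oo] --> xi j t y.
  by move=> ht; apply: bound_cvg (Bx0 j) => m; exact: hx.
have cva t y : 0 <= t <= T -> ev (A m) t y @[m --> \oo] --> ka 0%N t y.
  by move=> ht; apply: bound_cvg (Ba0 0%N) => m; rewrite -ev_dyn0; exact: ha.
have cvb t y : 0 <= t <= T -> ev (B m) t y @[m --> \oo] --> be t.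
  move=> ht; apply: bound_cvg (Bb0 0%N) => m; rewrite ev_freq0; last exact: st_freq0.
  by rewrite -ev_dyn0; exact: hb.
have cvf t y : 0 <= t <= T -> ev (F m) t y @[m --> \oo] --> ff 0%N t y.
  by move=> ht; apply: bound_cvg (Bf0 0%N) => m; rewrite -ev_dyn0; exact: hf.
have cvk t y : ev (kd m) t y @[m --> \oo] --> k y by apply: bound_cvg Bd0 => m; exact: rk.
have cvp t y : ev (pd m) t y @[m --> \oo] --> p y by apply: bound_cvg Bd0 => m; exact: rp.
have cvq t y : ev (qd m) t y @[m --> \oo] --> q y by apply: bound_cvg Bd0 => m; exact: rq.
pose ze t y := xi 0%N t y + q y * (xi 2%N t y - p y * xi 1%N t y) + be t.
have cvX t y : 0 <= t <= T -> ev (X m) t y @[m --> \oo] --> xi 0%N t y.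
  by move=> ht; have := cvx 0%N t y ht; under eq_fun do rewrite ev_dyn0.
have cvz t y : 0 <= t <= T -> ev (fzeta T mu (pd m) (qd m) (F m) (B m)) t y @[m --> \oo] --> ze t y.
  move=> ht; under eq_fun do rewrite ev_zeta.
  apply: cvgD; last exact: cvb.
  apply: cvgD; first exact: cvX.
  apply: cvgM => //; apply: cvgB; first exact: cvx.
  by apply: cvgM => //; exact: cvx.
have kaE t y : 0 <= t <= T -> ka 0%N t y = k y - k y * ze t y * ka 0%N t y.
  move=> ht; have h1 := cva t y ht; rewrite -(cvg_shiftS (fun m => ev (A m) t y)) in h1.
  have h2 : ev (A m.+1) t y @[m --> \oo] --> k y - k y * ze t y * ka 0%N t y.
    have AE m : ev (A m.+1) t y = ev (kd m) t y - ev (kd m) t y * ev (fzeta T mu (pd m) (qd m) (F m) (B m)) t y * ev (A m) t y.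
      by rewrite /A staS /fK ev_cat ev_scale !ev_mul mulN1r.
    under eq_fun do rewrite AE.
    by apply: cvgB => //; apply: cvgM; [apply: cvgM => //; exact: cvz|exact: cva].
  exact: (seq_lim_unique h1 h2).
have ffE t y : 0 <= t <= T -> mu * xi 2%N t y + ff 0%N t y = - ka 0%N t y.
  move=> ht; have h1 := cvf t y ht; rewrite -(cvg_shiftS (fun m => ev (F m) t y)) in h1.
  have h2 : ev (F m.+1) t y @[m --> \oo] --> - k y + (- mu * (p y * xi 1%N t y) + (k y * k y * (xi 0%N t y + be t) -
      k y * k y * (ze t y * ze t y) * ka 0%N t y)).
    have FE m : ev (F m.+1) t y = - ev (kd m) t y +
        (- mu * (ev (pd m) t y * ev (ldyn 1 (X m)) t y) +
        (ev (kd m) t y * ev (kd m) t y * (ev (X m) t y + ev (B m) t y) -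
        ev (kd m) t y * ev (kd m) t y * (ev (fzeta T mu (pd m) (qd m) (F m) (B m)) t y *
        ev (fzeta T mu (pd m) (qd m) (F m) (B m)) t y) * ev (A m) t y)).
      rewrite /F stfS /fF /fg -/(F m) -/(A m) -/(B m).
      move: (fzeta T mu (pd m) (qd m) (F m) (B m)) => z.
      by rewrite !ev_cat !ev_scale !ev_mul ev_cat !mulN1r.
    under eq_fun do rewrite FE.
    apply: cvgD; first exact: cvgN.
    apply: cvgD; first by apply: cvgMr; apply: cvgM => //; exact: cvx.
    apply: cvgB; first by apply: cvgM; [exact: cvgM|apply: cvgD; [exact: cvX|exact: cvb]].
    apply: cvgM; last exact: cva.
    by apply: cvgM; [exact: cvgM|apply: cvgM; exact: cvz].
  have -> := seq_lim_unique h1 h2.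
  (* The relation k zeta a = k - a, used twice, turns k^2 zeta^2 a into k^2 zeta - k + a; in k^2
     zeta the coefficient of xi_yy is k^2 q = mu. *)
  have kz : k y * ze t y * ka 0%N t y = k y - ka 0%N t y by have := kaE t y ht; lra.
  have -> : k y * k y * (ze t y * ze t y) * ka 0%N t y = k y * ze t y * (k y * ze t y * ka 0%N t y) by ring.
  rewrite kz mulrBr kz.
  have -> : k y * ze t y * k y = k y * k y * (xi 0%N t y + be t) + (k y ^+ 2 * q y) * (xi 2%N t y - p y * xi 1%N t y).
    by rewrite /ze; ring.
  by rewrite kq; ring.
have ffjE j t y : 0 <= t <= T -> mu * xi j.+2 t y + ff j t y = - ka j t y.
  move=> ht; elim: j y => [|j IH] y; first exact: ffE.
  have h1 := wderivD (wderivZ setT mu (dx j.+2 t y ht)) (df j t y ht).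
  have h2 := wderivN (da j t y ht).
  apply: (@wderiv_unique _ setT _ y _ _ I _ h1); first by exists 1; split=> //; left.
  by apply: wderiv_ext h2 => z; rewrite IH.
have ckk : continuous k.
  apply: cont_on_setT; apply: (@cont_on_lim _ _ setT (fun m y => ev (kd m) 0 y) k Bd) => //.
  by move=> m; apply: cont_onT; apply: ev_cont2; exact: wk.
have cxy j t : 0 <= t <= T -> continuous (xi j t).
  by move=> ht; apply: (@wderiv_continuous _ _ (xi j.+1 t)) => y; exact: dx.
have cay j t : 0 <= t <= T -> continuous (ka j t).
  by move=> ht; apply: (@wderiv_continuous _ _ (ka j.+1 t)) => y; exact: da.
have mean_cvg (Lm : nat -> seq (@atom R)) (f : R -> R) (Bm : nat -> R) t :
   (forall m, wfl T (Lm m)) -> continuous f -> Bm @ \oo --> 0 ->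
   (forall m y, `|ev (Lm m) t y - f y| <= Bm m) ->
   ev (lmean (Lm m)) t 0 @[m --> \oo] --> int2pi f.
  move=> hw cff hB hh; apply: (@bound_cvg _ _ (fun m => Bm m * (2 * pi))).
    move=> m; rewrite -(int2pi_ev t (hw m)); apply: int2pi_le => //.
    by apply: ev_cont2; exact: hw.
  by rewrite -[X in _ --> X](mul0r (2 * pi)); apply: cvgMl.
have kd_le m t y : 0 <= t <= T -> `|ev (kd m) t y| <= kb.
  move=> ht; apply: le_trans (ev_le_nrm y ht (@wk m)) _.
  apply: le_trans (hk 0%N m); rewrite le_eqVlt; apply/orP; left; apply/eqP.
  by congr nrm; apply/funext => n; rewrite w00.
have prod_cvg (Lm : nat -> seq (@atom R)) (f : R -> R -> R) (Bm : nat -> R) (c t : R) :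
   0 <= t <= T -> (forall m, wfl T (Lm m)) -> continuous (f t) -> Bm @ \oo --> 0 ->
   (forall m y, `|ev (Lm m) t y - f t y| <= Bm m) -> (forall y, `|f t y| <= c) ->
   ev (lmean (lmul (Lm m) (kd m))) t 0 @[m --> \oo] --> int2pi (fun y => f t y * k y).
  move=> ht hw cft hB hh fc.
  apply: (@mean_cvg _ _ (fun m => Bm m * kb + c * Bd m)).
  - by move=> m; exact: wfl_mul.
  - by move=> y; apply: cvgM; [exact: cft|exact: ckk].
  - rewrite [X in _ --> X](_ : 0 = 0 * kb + c * 0); last by ring.
    by apply: cvgD; [exact: cvgMl|exact: cvgMr].
  - move=> m y; rewrite ev_mul.
    have -> : ev (Lm m) t y * ev (kd m) t y - f t y * k y =
      (ev (Lm m) t y - f t y) * ev (kd m) t y + f t y * (ev (kd m) t y - k y) by ring.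
    apply: le_trans (ler_normD _ _) _; rewrite !normrM.
    by apply: lerD; apply: ler_pM => //; exact: kd_le.
have cvX1 t : 0 <= t <= T -> ev (lmean (lmul (X m) (kd m))) t 0 @[m --> \oo] --> int2pi (fun y => xi 0%N t y * k y).
  move=> ht; apply: (@prod_cvg _ _ (Bx 0%N) (xi_bound 0)) => //; first exact: cxy.
    by move=> m y; rewrite -ev_dyn0; exact: hx.
  by move=> y; exact: bx.
have cvA1 t : 0 <= t <= T -> ev (lmean (lmul (A m) (kd m))) t 0 @[m --> \oo] --> int2pi (fun y => ka 0%N t y * k y).
  move=> ht; apply: (@prod_cvg _ _ (Ba 0%N) (ka_bound 0)) => //; first by move=> m; have [] := wf m.
  - exact: cay.
  - by move=> m y; rewrite -ev_dyn0; exact: ha.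
  - by move=> y; exact: ba.
have cT a c s : (`[0, T]%classic : set R) a -> `[0, T]%classic c -> Num.min a c <= s <= Num.max a c -> `[0, T]%classic s.
  rewrite /= !in_itv/= => /andP[a0 aT] /andP[c0 cT'] /andP[h1 h2].
  apply/andP; split; first by apply: le_trans h1; rewrite le_min a0.
  by apply: le_trans h2 _; rewrite ge_max aT.
exists xi, ka, be, (fun t => jj 0%N t 0).
split; split => //.
- apply: (@cont_on_comp _ _ _ (slab T) _ (fun q => bb 0%N q.1 q.2) (fun t => (t, 0))) => //.
    by move=> t _; apply: cvg_within_filter; exact: line_continuous.
- move=> j t y ht.
  (* The iterates solve a heat equation exactly, and their time derivatives converge uniformly to
     the j-th derivative in y of mu xi_yy + f, that is of - a. *)
  apply: (@wderiv_lim _ _ (fun m s => ev (ldyn j (X m)) s y)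
    (fun m s => mu * ev (ldyn j.+2 (X m)) s y + ev (ldyn j (F m)) s y)
    (fun s => xi j s y) (fun s => - ka j s y) (fun m => `|Bx j m| + (mu * `|Bx j.+2 m| + `|Bf j m|))) => //.
  + move=> m s hs; apply: (@wderiv_sub _ setT) => //; apply: (@ev_heat_deriv _ T).
    by have [] := wf m.
  + move=> m s hs; apply: le_trans (hx j m s y hs) _.
    apply: le_trans (ler_norm _) _; rewrite lerDl addr_ge0// mulr_ge0// ltW//.
  + move=> m s hs; rewrite -ffjE//.
    have -> : mu * ev (ldyn j.+2 (X m)) s y + ev (ldyn j (F m)) s y - (mu * xi j.+2 s y + ff j s y) =
      mu * (ev (ldyn j.+2 (X m)) s y - xi j.+2 s y) + (ev (ldyn j (F m)) s y - ff j s y) by ring.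
    apply: le_trans (ler_normD _ _) _; rewrite normrM (gtr0_norm mu0).
    apply: (@le_trans _ _ (mu * `|Bx j.+2 m| + `|Bf j m|)); last by rewrite lerDr.
    apply: lerD; last by apply: le_trans (hf j m s y hs) (ler_norm _).
    by rewrite ler_wpM2l ?(ltW mu0)//; apply: le_trans (hx j.+2 m s y hs) (ler_norm _).
  + apply: cvg0_eventually.
    rewrite [X in _ --> X](_ : 0 = `|0 : R| + (mu * `|0 : R| + `|0 : R|) :> R); last by rewrite normr0; ring.
    apply: cvgD; first exact: cvg_norm.
    by apply: cvgD; [apply: cvgMr|]; exact: cvg_norm.
- move=> j y; apply: (seq_lim_unique (cvx j 0 y tt0)).
  have X0 m : ev (ldyn j (X m)) 0 y = 0 by apply: (@ev_heat0 _ T); have [] := wf m.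
  under eq_fun do rewrite X0; exact: cvg_cst.
- by move=> t ht; have := bbb 0%N t 0 ht; rewrite /be expr0 invr1 mul1r.
- move=> t ht; have h1 := cvb t 0 ht; rewrite -(cvg_shiftS (fun m => ev (B m) t 0)) in h1.
  apply: (seq_lim_unique h1).
  have BE m : ev (B m.+1) t 0 = W t - pi / L0 * (ev (B m) t 0 * ev (B m) t 0)
     - nu / L0 * (ev (lmean (lmul (X m) (kd m))) t 0 * ev (B m) t 0)
     - nu / L0 * ev (lprim T (D m)) t 0.
    rewrite /B stbS /fB !ev_cat !ev_scale !ev_mul ev_cons ev_nil addr0.
    have -> : aev (Atom W 0 0 b0) t 0 = W t by rewrite /aev /= mul0r addr0 cos0 mulr1.
    by rewrite !mulNr !addrA.
  under eq_fun do rewrite BE.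
  apply: cvgB; last first.
    apply: cvgMr; apply: bound_cvg (BJ0 0%N) => m; rewrite -ev_dyn0; exact: hJ.
  apply: cvgB; last by apply: cvgMr; apply: cvgM; [exact: cvX1|exact: cvb].
  apply: cvgB; first exact: cvg_cst.
  by rewrite expr2; apply: cvgMr; apply: cvgM; exact: cvb.
- have cJ0 : ev (lprim T (D m)) 0 0 @[m --> \oo] --> jj 0%N 0 0.
    by apply: bound_cvg (BJ0 0%N) => m; rewrite -ev_dyn0; exact: hJ.
  apply: (seq_lim_unique cJ0).
  have D00 m : ev (lprim T (D m)) 0 0 = 0 by exact: (@ev_prim0 _ T).
  under eq_fun do rewrite D00; exact: cvg_cst.
- move=> t ht.
  have <- : dd 0%N t 0 = int2pi (fun y => ka 0%N t y * k y) * be t.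
    have h1 : ev (D m) t 0 @[m --> \oo] --> dd 0%N t 0.
      by apply: bound_cvg (BD0 0%N) => m; rewrite -ev_dyn0; exact: hD.
    apply: (seq_lim_unique h1); rewrite /D /fD.
    under eq_fun do rewrite ev_mul.
    by apply: cvgM; [exact: cvA1|exact: cvb].
  apply: (@wderiv_lim _ _ (fun m s => ev (lprim T (D m)) s 0) (fun m s => ev (D m) s 0)
    (fun s => jj 0%N s 0) (fun s => dd 0%N s 0) (fun m => `|BJ 0%N m| + `|BD 0%N m|)) => //.
  + move=> m s hs; apply: (@wderiv_sub _ setT) => //; apply: (@ev_prim_deriv _ T); exact: wD.
  + move=> m s hs; rewrite -ev_dyn0; apply: le_trans (hJ 0%N m s 0 hs) _.
    by apply: le_trans (ler_norm _) _; rewrite lerDl.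
  + move=> m s hs; rewrite -ev_dyn0; apply: le_trans (hD 0%N m s 0 hs) _.
    by apply: le_trans (ler_norm _) _; rewrite lerDr.
  + apply: cvg0_eventually; rewrite [X in _ --> X](_ : 0 = `|0 : R| + `|0 : R| :> R); last by rewrite normr0 addr0.
    by apply: cvgD; apply: cvg_norm.
Qed.

End LocalSolution.

(** * Fourier inversion *)

Lemma periodic_nat {R : realType} {A : Type} (g : R -> A) (y : R) (n : nat) :
  (forall y, g (y + 2 * pi) = g y) -> g (y + 2 * pi * n%:R) = g y.
Proof.
move=> pg; elim: n => [|n IH]; first by rewrite mulr0 addr0.
by rewrite -[n.+1%:R]natr1 mulrDr mulr1 addrA pg.
Qed.

(** The codomain is an arbitrary type, so that several functions can be reduced by the same multiple
    of the period after grouping them in a tuple. *)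
Lemma periodic_reduce {R : realType} {A : Type} (g : R -> A) (y b : R) :
  (forall y, g (y + 2 * pi) = g y) -> exists2 y', b <= y' < b + 2 * pi & g y' = g y.
Proof.
move=> pg; have p0 : 0 < 2 * pi :> R by rewrite mulr_gt0// pi_gt0.
pose N := (Num.truncn `|(y - b) / (2 * pi)|).+1.
pose z := y - b + 2 * pi * N%:R.
have z0 : 0 <= z / (2 * pi).
  rewrite /z mulrDl [2 * pi * _]mulrC mulfK ?gt_eqF//.
  have /andP[_ h] := truncn_itv (normr_ge0 ((y - b) / (2 * pi))).
  have := ler_norm (- ((y - b) / (2 * pi))); rewrite normrN => h'.
  by rewrite -lerBlDl sub0r (le_trans h')// ltW.
have /andP[h1 h2] := truncn_itv z0; set k := Num.truncn _ in h1 h2.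
exists (b + (z - 2 * pi * k%:R)).
  move: h1 h2; rewrite ler_pdivlMr// ltr_pdivrMr// -[k.+1%:R]natr1 => h1 h2.
  by apply/andP; split; lra.
rewrite -[LHS](periodic_nat _ k)// -[RHS](periodic_nat _ N)//; congr g.
by rewrite /z; ring.
Qed.

Section Fourier.
Context {R : realType}.
Implicit Types (f g : R -> R) (phi y : R) (n : nat).

Let pi20 : 2 * pi != 0 :> R. Proof. by rewrite mulf_neq0// gt_eqF// pi_gt0. Qed.
Let pi2p : 0 < 2 * pi :> R. Proof. by rewrite mulr_gt0// pi_gt0. Qed.

Lemma int2piD f g : continuous f -> continuous g ->
  int2pi (fun y => f y + g y) = int2pi f + int2pi g.
Proof.
move=> cf cg; rewrite (@int2pi_anti _ _ (fun y => prim f y + prim g y)).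
- by rewrite (prim0 cf) (prim0 cg) addr0 subr0.
- by move=> y; apply: cvgD; [exact: cf|exact: cg].
- by move=> y; apply: wderivD; apply: is_derive_wderiv; exact: prim_derive.
Qed.

Lemma int2piZ c f : continuous f -> int2pi (fun y => c * f y) = c * int2pi f.
Proof.
move=> cf; rewrite (@int2pi_anti _ _ (fun y => c * prim f y)).
- by rewrite (prim0 cf) mulr0 subr0.
- by move=> y; apply: cvgM; [exact: cvg_cst|exact: cf].
- by move=> y; apply: wderivZ; apply: is_derive_wderiv; exact: prim_derive.
Qed.

Lemma int2pi_cst c : int2pi (fun=> c) = c * (2 * pi) :> R.
Proof.
rewrite (@int2pi_anti _ _ (fun y => c * y)).
- by rewrite mulr0 subr0.
- by move=> y; exact: cvg_cst.
- by move=> y; have := wderivZ setT c (wderiv_id setT y); rewrite mulr1.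
Qed.

Lemma wderiv_cosl n phi y : wderiv setT (fun y => cos (n%:R * y + phi)) y (- (n%:R * sin (n%:R * y + phi))).
Proof.
have -> : - (n%:R * sin (n%:R * y + phi)) = - sin (n%:R * y + phi) * n%:R by ring.
apply: (@wderiv_comp _ setT setT (fun s => n%:R * s + phi) cos) => //.
  have := wderivD (wderivZ setT n%:R (wderiv_id setT y)) (wderiv_cst setT phi y).
  by rewrite mulr1 addr0.
by apply: is_derive_wderiv; exact: is_derive_cos.
Qed.

Lemma wderiv_sinl n phi y : wderiv setT (fun y => sin (n%:R * y + phi)) y (n%:R * cos (n%:R * y + phi)).
Proof.
rewrite mulrC; apply: (@wderiv_comp _ setT setT (fun s => n%:R * s + phi) sin) => //.
  have := wderivD (wderivZ setT n%:R (wderiv_id setT y)) (wderiv_cst setT phi y).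
  by rewrite mulr1 addr0.
by apply: is_derive_wderiv; exact: is_derive_sin.
Qed.

Lemma cosl_cont n phi : continuous (fun y => cos (n%:R * y + phi) : R).
Proof. exact: wderiv_continuous (@wderiv_cosl n phi). Qed.

Lemma sinl_cont n phi : continuous (fun y => sin (n%:R * y + phi) : R).
Proof. exact: wderiv_continuous (@wderiv_sinl n phi). Qed.

Lemma cosl_periodic n phi y : cos (n%:R * (y + 2 * pi) + phi) = cos (n%:R * y + phi) :> R.
Proof.
have := @aev_periodic R (Atom (fun=> 1) n phi 1) 0 y.
by rewrite /aev /= !mul1r.
Qed.

Lemma sinl_periodic n phi y : sin (n%:R * (y + 2 * pi) + phi) = sin (n%:R * y + phi) :> R.
Proof.
have sc u : sin u = cos (u - pi / 2) :> R by rewrite cosB cos_pihalf sin_pihalf mulr0 mulr1 add0r.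
by rewrite !sc -!addrA; exact: cosl_periodic.
Qed.

Lemma int2pi_cosl n phi : int2pi (fun y => cos (n%:R * y + phi)) =
  (if n == 0%N then 2 * pi * cos phi else 0) :> R.
Proof.
case: eqP => [->|/eqP n0].
  under eq_fun do rewrite mul0r add0r.
  by rewrite int2pi_cst mulrC.
have nz : n%:R != 0 :> R by rewrite pnatr_eq0.
rewrite (@int2pi_anti _ _ (fun y => n%:R^-1 * sin (n%:R * y + phi))).
- by rewrite -{1}[2 * pi]add0r sinl_periodic subrr.
- exact: cosl_cont.
- move=> y; have := wderivZ setT n%:R^-1 (@wderiv_sinl n phi y).
  by rewrite mulrA mulVf// mul1r.
Qed.

(** The coefficient is not normalized; the free phase treats cosines and sines together, phi = - pi
    / 2 giving the sine. *)
Definition fcoef f n phi := int2pi (fun y => f y * cos (n%:R * y + phi)).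

(** An integration by parts shifts the phase by a quarter turn; the boundary terms cancel by
    periodicity. *)
Lemma fcoef_parts f f' n phi : (forall y, wderiv setT f y (f' y)) -> continuous f' ->
  f (2 * pi) = f 0 -> n%:R * fcoef f n phi = - fcoef f' n (phi - pi / 2).
Proof.
move=> hf cf' per; have cf := wderiv_continuous hf.
have sc u : sin u = cos (u - pi / 2) :> R by rewrite cosB cos_pihalf sin_pihalf mulr0 mulr1 add0r.
have cc : continuous (fun y => f y * cos (n%:R * y + phi)).
  by move=> y; apply: cvgM; [exact: cf|exact: cosl_cont].
have cs : continuous (fun y => f' y * sin (n%:R * y + phi)).
  by move=> y; apply: cvgM; [exact: cf'|exact: sinl_cont].
have : int2pi (fun y => f' y * sin (n%:R * y + phi) + n%:R * (f y * cos (n%:R * y + phi))) = 0.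
  rewrite (@int2pi_anti _ _ (fun y => f y * sin (n%:R * y + phi))).
  - by rewrite per -{1}[2 * pi]add0r sinl_periodic subrr.
  - by move=> y; apply: cvgD; [exact: cs|apply: cvgM; [exact: cvg_cst|exact: cc]].
  - move=> y; have := wderivM (hf y) (@wderiv_sinl n phi y).
    by congr (wderiv _ _ _ _); ring.
rewrite int2piD ?int2piZ//; last by move=> y; apply: cvgM; [exact: cvg_cst|exact: cc].
move=> h; apply/eqP; rewrite -addr_eq0 -[X in _ == X]h addrC /fcoef; apply/eqP; congr (_ + _).
by congr int2pi; apply/funext => y; rewrite sc addrA.
Qed.

Lemma continuous_bounded f : continuous f ->
  exists2 M : R, 0 <= M & forall y, 0 <= y <= 2 * pi -> `|f y| <= M.
Proof.
move=> cf; have [c _ hc] : exists2 c, c \in `[0, 2 * pi] & forall t, t \in `[0, 2 * pi] -> `|f t| <= `|f c|.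
  apply: (@EVT_max R (fun y => `|f y|)); first exact: ltW.
  by apply: continuous_subspaceT => y; apply: cvg_norm; exact: cf.
by exists `|f c| => // y hy; apply: hc; rewrite in_itv.
Qed.

Variable (f : nat -> R -> R).
Hypotheses (df : forall j y, wderiv setT (f j) y (f j.+1 y))
  (pf : forall y, f 0%N (y + 2 * pi) = f 0%N y).

Let cf j : continuous (f j). Proof. exact: wderiv_continuous (@df j). Qed.

Lemma deriv_periodic j y : f j (y + 2 * pi) = f j y.
Proof.
elim: j y => [//|j IH] y.
have h1 : wderiv setT (fun z => f j (z + 2 * pi)) y (f j.+1 (y + 2 * pi)).
  rewrite -[X in wderiv _ _ _ X]mulr1.
  apply: (@wderiv_comp _ setT setT (fun z => z + 2 * pi) (f j)) => //.
  by have := wderivD (wderiv_id setT y) (wderiv_cst setT (2 * pi) y); rewrite addr0.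
apply: (@wderiv_unique _ setT _ y _ _ I _ h1); first by exists 1; split=> //; left.
by apply: wderiv_ext (@df j y) => z; rewrite IH.
Qed.

Lemma fcoef_bound s : exists2 C : R, 0 <= C & forall n phi, n%:R ^+ s * `|fcoef (f 0%N) n phi| <= C.
Proof.
have key s' n phi : n%:R ^+ s' * `|fcoef (f 0%N) n phi| = `|fcoef (f s') n (phi - s'%:R * (pi / 2))|.
  elim: s' => [|s' IH]; first by rewrite expr0 mul1r mul0r subr0.
  have nE : n%:R = `|n%:R| :> R by rewrite ger0_norm.
  rewrite exprS -mulrA IH// {1}nE -normrM.
  rewrite (@fcoef_parts _ (f s'.+1))//; last by rewrite -{1}[2 * pi]add0r deriv_periodic.
  rewrite normrN; congr (`|fcoef _ _ _|); rewrite -(natr1 s'); ring.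
have [M M0 hM] := continuous_bounded (@cf s).
exists (M * (2 * pi)); first by rewrite mulr_ge0// ltW.
move=> n phi; rewrite key /fcoef.
set h := fun y => _.
have ch : continuous h by move=> y; apply: cvgM; [exact: cf|exact: cosl_cont].
have := @int2pi_le _ h (fun=> 0) M ch _ _.
rewrite int2pi_cst mul0r subr0; apply; first by move=> y; exact: cvg_cst.
move=> y hy; rewrite subr0 normrM -[X in _ <= X]mulr1 ler_pM ?hM//.
by rewrite ler_norml cos_geN1 cos_le1.
Qed.

Definition fa n : R := (if n == 0%N then 2^-1 else 1) / pi * fcoef (f 0%N) n 0.
Definition fb n : R := pi^-1 * fcoef (f 0%N) n (- (pi / 2)).
Definition fatoms n : seq (@atom R) :=
  [:: Atom (fun=> fa n) n 0 `|fa n|; Atom (fun=> fb n) n (- (pi / 2)) `|fb n|].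
Fixpoint flist m : seq (@atom R) := if m is n.+1 then flist n ++ fatoms n else [::].

Lemma flist_wf T m : wfl T (flist m).
Proof.
elim: m => [|m IH] //=; apply: wfl_cat => // x; rewrite !inE => /orP[] /eqP ->;
  by split => //= t; exact: cvg_cst.
Qed.

Lemma flist_sub m : sublist (flist m) (flist m.+1).
Proof. by exists (fatoms m). Qed.

Lemma ev_flist_const m t y : ev (flist m) t y = ev (flist m) 0 y.
Proof. by elim: m => [|m IH]; rewrite /= ?ev_nil// !ev_cat IH !ev_cons !ev_nil. Qed.

(** Integrating by parts s + 2 times bounds the n-th term by a multiple of 1 / n^2, which is at most
    the telescoping 2 / n - 2 / (n + 1). *)
Lemma flist_nrm s : exists C, forall m, nrm (fun n => n%:R ^+ s) (flist m) <= C.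
Proof.
have [C C0 hC] := fcoef_bound s; have [C2 C20 hC2] := fcoef_bound s.+2.
have pip : 0 < pi^-1 :> R by rewrite invr_gt0 pi_gt0.
have ha n : `|fa n| <= pi^-1 * `|fcoef (f 0%N) n 0|.
  rewrite /fa normrM ler_wpM2r// normrM (gtr0_norm pip) ler_piMl ?(ltW pip)//.
  by case: eqP => _; rewrite ?normr1// ger0_norm// invf_le1// ler1n.
have hb n : `|fb n| <= pi^-1 * `|fcoef (f 0%N) n (- (pi / 2))|.
  by rewrite /fb normrM (gtr0_norm pip).
have step n : nrm (fun n => n%:R ^+ s) (fatoms n.+1) <= pi^-1 * (2 * C2) / n.+1%:R ^+ 2.
  rewrite !nrm_cons nrm_nil addr0 /=; have np : 0 < n.+1%:R ^+ 2 :> R by rewrite exprn_gt0.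
  rewrite ler_pdivlMr//.
  apply: (@le_trans _ _ (pi^-1 * (n.+1%:R ^+ s.+2 * `|fcoef (f 0%N) n.+1 0|) + pi^-1 * (n.+1%:R ^+ s.+2 * `|fcoef (f 0%N) n.+1 (- (pi / 2))|))).
    rewrite mulrDl -[s.+2]addn2 exprD; apply: lerD.
      have -> : n.+1%:R ^+ s * `|fa n.+1| * n.+1%:R ^+ 2 = (n.+1%:R ^+ s * n.+1%:R ^+ 2) * `|fa n.+1| by ring.
      by rewrite [leRHS]mulrCA ler_wpM2l// mulr_ge0 ?exprn_ge0.
    have -> : n.+1%:R ^+ s * `|fb n.+1| * n.+1%:R ^+ 2 = (n.+1%:R ^+ s * n.+1%:R ^+ 2) * `|fb n.+1| by ring.
    by rewrite [leRHS]mulrCA ler_wpM2l// mulr_ge0 ?exprn_ge0.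
  have -> : pi^-1 * (2 * C2) = pi^-1 * C2 + pi^-1 * C2 by ring.
  by apply: lerD; rewrite ler_pM2l.
exists (nrm (fun n => n%:R ^+ s) (fatoms 0) + pi^-1 * (2 * C2) * 2) => m.
have D0 : 0 <= pi^-1 * (2 * C2) by rewrite !mulr_ge0// ltW.
have nf0 : 0 <= nrm (fun n => n%:R ^+ s) (fatoms 0).
  by rewrite !nrm_cons nrm_nil addr0 /= addr_ge0// mulr_ge0// exprn_ge0.
suff h n : nrm (fun n => n%:R ^+ s) (flist n.+1) <= nrm (fun n => n%:R ^+ s) (fatoms 0) + pi^-1 * (2 * C2) * (2 - 2 * n.+1%:R^-1).
  case: m => [|m]; first by rewrite /= nrm_nil addr_ge0// mulr_ge0.
  apply: le_trans (h m) _; rewrite lerD2l ler_wpM2l// gerDl oppr_le0 mulr_ge0// invr_ge0//.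
elim: n => [|n IH]; first by rewrite /= lerDl mulr_ge0// invr1 mulr1 subrr.
have -> : flist n.+2 = flist n.+1 ++ fatoms n.+1 by [].
rewrite nrm_cat; apply: le_trans (lerD IH (step n)) _.
rewrite -addrA lerD2l -mulrDr ler_wpM2l//.
have x0 : 0 < n.+1%:R :> R by rewrite ltr0n.
rewrite -[n.+2%:R]natr1; set x := n.+1%:R : R in x0 *.
have x1 : 0 < x + 1 by lra.
have x1' : 1 <= x by rewrite /x ler1n.
rewrite -subr_ge0.
have -> : 2 - 2 / (x + 1) - (2 - 2 / x + x ^- 2) = (x - 1) / (x ^+ 2 * (x + 1)).
  by field; rewrite !gt_eqF.
by rewrite divr_ge0 ?subr_ge0// mulr_ge0 ?exprn_ge0// ltW.
Qed.

Lemma cos_norm (u : R) : cos `|u| = cos u.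
Proof. by case: ger0P => // _; rewrite cosN. Qed.

(* The powers of [(1 + cos (y - y0)) / 2] are trigonometric polynomials that
   concentrate at [y0]. *)
Lemma kernel_concentration (g : R -> R) : continuous g ->
  (forall y, g (y + 2 * pi) = g y) ->
  (forall l : seq (@atom R), wfl 1 l -> int2pi (fun y => g y * ev l 0 y) = 0) ->
  forall y0, 0 < y0 < 2 * pi -> g y0 <= 0.
Proof.
move=> cg pg g0 y0 /andP[y00 y02]; rewrite leNgt; apply/negP => gp.
have [M M0 hM] := continuous_bounded cg.
pose c := g y0 / 2; have c0 : 0 < c by rewrite divr_gt0.
have /cvgrPdist_le/(_ _ c0) := cg y0.
move=> /nbhs_ballP[d1 /= d10 hd1].
(* Besides keeping g >= c, d is smaller than the distance from y0 to either end of the period: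
   within [0, 2 pi], a point at distance at least d from y0 is then also far from it modulo 2 pi. *)
pose d := Num.min (d1 / 2) (Num.min (y0 / 2) ((2 * pi - y0) / 2)).
have d0 : 0 < d by rewrite !lt_min !divr_gt0// subr_gt0.
have [dd1 dy dy2] : [/\ d < d1, d < y0 & d < 2 * pi - y0].
  have h (x : R) : 0 < x -> x / 2 < x by move=> ?; lra.
  split.
  - by apply: le_lt_trans (h _ d10); rewrite ge_min lexx.
  - by apply: le_lt_trans (h _ y00); rewrite !ge_min lexx orbT.
  - by apply: le_lt_trans (h _ _); rewrite ?subr_gt0// !ge_min lexx !orbT.
have gc y : `|y - y0| <= d -> c <= g y.
  move=> yd; have := hd1 y; rewrite /ball /= distrC => /(_ (le_lt_trans yd dd1)).
  by rewrite ler_norml => /andP[_]; rewrite /c; lra.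
have pd : d < pi by have := pi_gt0 R; lra.
pose kc y : R := 2^-1 + 2^-1 * cos (y - y0).
pose l0 : seq (@atom R) := [:: Atom (fun=> 2^-1) 0 0 2^-1; Atom (fun=> 2^-1) 1 (- y0) 2^-1].
pose l1 : seq (@atom R) := [:: Atom (fun=> 1) 0 0 1].
pose lN N := iter N (lmul l0) l1.
have wl0 : wfl 1 l0.
  by move=> x; rewrite !inE => /orP[] /eqP ->; split => //= t; rewrite ?ger0_norm//; exact: cvg_cst.
have wlN N : wfl 1 (lN N).
  elim: N => [|N IH]; last exact: wfl_mul.
  by move=> x; rewrite /lN /= inE => /eqP ->; split => //= t; rewrite ?normr1//; exact: cvg_cst.
have evN N y : ev (lN N) 0 y = kc y ^+ N.
  elim: N => [|N IH].
    by rewrite expr0 /lN /= ev_cons ev_nil /aev /= mul0r !addr0 cos0 mulr1.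
  rewrite exprS -IH /lN iterS ev_mul; congr (_ * _).
  by rewrite !ev_cons ev_nil /aev /= mul0r !addr0 cos0 mulr1 mul1r.
(* The values of the kernel at distances d and d / 2 from y0; q < q1 drives the contradiction. *)
pose q := 2^-1 + 2^-1 * cos d; pose q1 := 2^-1 + 2^-1 * cos (d / 2).
have cdec (u v : R) : 0 <= u -> u < v -> v <= pi -> cos v < cos u.
  move=> u0 uv vp.
  by rewrite ltr_cos// in_itv/= ?u0 ?vp ?(le_trans u0 (ltW uv)) ?(le_trans (ltW uv) vp).
have qq1 : q < q1 by rewrite /q /q1 ltrD2l ltr_pM2l//; apply: cdec; lra.
have q0 : 0 < q.
  have := cdec d pi (ltW d0) pd (lexx _); rewrite cospi /q; lra.
have kc0 y : 0 <= kc y by have := cos_geN1 (y - y0); rewrite /kc; lra.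
have cosle u : d <= `|u| -> `|u| <= 2 * pi - d -> cos u <= cos d.
  rewrite -(cos_norm u); move: `|u| => v v1 v2.
  have [vp|pv] := leP v pi.
    have [->//|] := eqVneq v d => vd; apply/ltW/cdec => //; first exact: ltW.
    by rewrite lt_neqAle eq_sym vd.
  have -> : cos v = cos (2 * pi - v).
    by rewrite -[RHS]cosN opprB -[in LHS](subrK (2 * pi) v) [2 * pi]mulrC mulr_natr cosD2pi.
  have [->//|vd] := eqVneq (2 * pi - v) d; apply/ltW/cdec; [exact: ltW| |lra].
  by rewrite lt_neqAle eq_sym vd/=; lra.
have kq y : 0 <= y <= 2 * pi -> d <= `|y - y0| -> kc y <= q.
  move=> /andP[y1 y2] dy'; rewrite /kc /q lerD2l ler_pM2l// cosle//.
  by rewrite ler_norml; apply/andP; split; lra.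
have kq1 y : `|y - y0| <= d / 2 -> q1 <= kc y.
  move=> dy'; rewrite /kc /q1 lerD2l ler_pM2l// -(cos_norm (y - y0)).
  have [->//|nd] := eqVneq `|y - y0| (d / 2); apply/ltW/cdec => //; last by lra.
  by rewrite lt_neqAle nd.
(* The integral of g times the N-th power of the kernel vanishes. The interval of length d around
   y0, where g >= c and the kernel is at least q1, contributes at least the left side; negative
   values of g occur only where the kernel is at most q. *)
have key N : c * q1 ^+ N * d <= M * q ^+ N * (2 * pi).
  pose G y := g y * kc y ^+ N.
  have GE : G = (fun y => g y * ev (lN N) 0 y) by apply/funext => y; rewrite evN.
  have cG : continuous G.
    by rewrite GE => y; apply: cvgM; [exact: cg|exact: (ev_cont2 (wlN N))].
  have PG y : wderiv setT (prim G) y (G y) by apply: is_derive_wderiv; exact: prim_derive.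
  have I0 : prim G (2 * pi) = 0 by have := g0 _ (wlN N); rewrite -GE.
  have Glow y : 0 <= y <= 2 * pi -> - (M * q ^+ N) <= G y.
    move=> hy; have [dy'|dy'] := leP d `|y - y0|.
      rewrite lerNl; apply: (@le_trans _ _ (`|g y| * kc y ^+ N)).
        by rewrite -mulNr ler_wpM2r ?exprn_ge0// -normrN ler_norm.
      apply: ler_pM; rewrite ?exprn_ge0//; first exact: hM.
      by apply: lerXn2r; rewrite ?nnegrE ?(ltW q0)//; exact: kq.
    apply: (@le_trans _ _ 0); first by rewrite oppr_le0 mulr_ge0// exprn_ge0// ltW.
    by rewrite mulr_ge0 ?exprn_ge0// (le_trans (ltW c0))// gc// ltW.
  set K := M * q ^+ N in Glow *.
  have K0 : 0 <= K by rewrite mulr_ge0// exprn_ge0// ltW.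
  have lin (C : R) y : wderiv setT (fun y => C * y) y C.
    by have := wderivZ setT C (wderiv_id setT y); rewrite mulr1.
  have mono u v : 0 <= u -> u <= v -> v <= 2 * pi -> prim G u + K * u <= prim G v + K * v.
    move=> u0 uv v2; apply: (@wderiv_ge0_le _ setT (fun y => prim G y + K * y) (fun y => G y + K)) => //.
      by move=> y _; apply: wderivD.
    move=> y /andP[h1 h2]; have := Glow y; rewrite (le_trans u0 h1) (le_trans h2 v2) => /(_ isT).
    by lra.
  pose a := y0 - d / 2; pose b := y0 + d / 2.
  have mid : prim G a - c * q1 ^+ N * a <= prim G b - c * q1 ^+ N * b.
    apply: (@wderiv_ge0_le _ setT (fun y => prim G y - c * q1 ^+ N * y) (fun y => G y - c * q1 ^+ N)) => //.
    - by rewrite /a /b; lra.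
    - by move=> y _; apply: wderivB.
    - move=> y /andP[h1 h2].
      have yd : `|y - y0| <= d / 2 by rewrite ler_norml; apply/andP; rewrite /a /b in h1 h2; split; lra.
      rewrite subr_ge0 /G ler_pM ?(ltW c0) ?exprn_ge0 ?(ltW (lt_trans q0 qq1))//.
        by apply: gc; lra.
      by apply: lerXn2r; rewrite ?nnegrE ?(ltW (lt_trans q0 qq1))//; exact: kq1.
  have h1 := mono 0 a (lexx 0) _ _; have h2 := mono b (2 * pi) _ _ (lexx _).
  have a0 : 0 <= a by rewrite /a; lra.
  have a2 : a <= 2 * pi by rewrite /a; lra.
  have b0 : 0 <= b by rewrite /b; lra.
  have b2 : b <= 2 * pi by rewrite /b; lra.
  have {}h1 := h1 a0 a2; have {}h2 := h2 b0 b2.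
  rewrite (prim0 cG) I0 mulr0 addr0 add0r in h1 h2.
  have Kab : K * a <= K * b by rewrite ler_wpM2l// /a /b; lra.
  have ab : c * q1 ^+ N * d = c * q1 ^+ N * b - c * q1 ^+ N * a.
    have alg (C u v : R) : C * u = C * (v + u / 2) - C * (v - u / 2) by field.
    exact: alg.
  by rewrite ab; lra.
have q10 : 0 < q1 by exact: lt_trans qq1.
pose z := q / q1.
have z1 : `|z| < 1 by rewrite gtr0_norm ?divr_gt0// ltr_pdivrMr// mul1r.
have zc : (fun N => M * (2 * pi) * z ^+ N) @ \oo --> 0.
  rewrite [X in _ --> X](_ : 0 = M * (2 * pi) * 0); last by rewrite mulr0.
  by apply: cvgMr; exact: cvg_expr.
have cd : 0 < c * d by rewrite mulr_gt0.
have [N hN] := cvg0_eventually zc (divr_gt0 cd (@ltr0n R 2)).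
have := key N; have := hN N (leqnn N).
have qN : 0 < q1 ^+ N by rewrite exprn_gt0.
rewrite /z expr_div_n [M * (2 * pi) * _]mulrA ler_pdivrMr// => h1 h2.
have : c * d * q1 ^+ N <= c * d / 2 * q1 ^+ N by apply: le_trans h1; move: h2; lra.
by rewrite ler_pM2r//; lra.
Qed.

Lemma fcoefD g h n phi : continuous g -> continuous h ->
  fcoef (fun y => g y + h y) n phi = fcoef g n phi + fcoef h n phi.
Proof.
move=> cg ch; rewrite /fcoef -int2piD; first by congr int2pi; apply/funext => y; rewrite mulrDl.
- by move=> y; apply: cvgM; [exact: cg|exact: cosl_cont].
- by move=> y; apply: cvgM; [exact: ch|exact: cosl_cont].
Qed.

Lemma fcoef_cosl c n' psi n phi : fcoef (fun y => c * cos (n'%:R * y + psi)) n phi =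
  if n == n' then (if n == 0%N then c * (2 * pi) * cos psi * cos phi else c * pi * cos (psi - phi)) else 0.
Proof.
have e1 (x x' : @atom R) y : aev x 0 y * aev x' 0 y = aev (amulp x x') 0 y + aev (amulm x x') 0 y.
  by rewrite aev_mul.
pose x := Atom (fun=> c) n' psi `|c|; pose x' := Atom (fun=> 1 : R) n phi 1.
have -> : fcoef (fun y => c * cos (n'%:R * y + psi)) n phi = int2pi (fun y => aev (amulp x x') 0 y + aev (amulm x x') 0 y).
  rewrite /fcoef; congr int2pi; apply/funext => y; rewrite -e1 /aev /=; ring.
have ca (z : @atom R) : continuous (aev z 0).
  by move=> y; apply: cvgM; [exact: cvg_cst|exact: cosl_cont].
have ia (z : @atom R) : int2pi (aev z 0) = acoef z 0 * (if afreq z == 0%N then 2 * pi * cos (aphase z) else 0).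
  by rewrite /aev int2piZ ?int2pi_cosl//; exact: cosl_cont.
rewrite int2piD// !ia /=.
have [<-{n' x x' e1 ca ia}|nn] := eqVneq n n'.
  rewrite leqnn subnn eqxx; case: n => [|k] /=.
    by rewrite cosD cosB; field.
  by rewrite mulr0 add0r; field.
have -> : ((n' + n)%N == 0%N) = false.
  by apply/negP; rewrite addn_eq0 => /andP[/eqP n0 /eqP n'0]; rewrite n0 n'0 eqxx in nn.
have -> : ((if (n <= n')%N then (n' - n)%N else (n - n')%N) == 0%N) = false.
  case: leqP => h; apply/negP; rewrite subn_eq0 => h'.
    by rewrite eqn_leq h h' in nn.
  by rewrite leqNgt h in h'.
by rewrite !mulr0 addr0.
Qed.

Lemma fcoef_flist m n phi : (n < m)%N -> fcoef (ev (flist m) 0) n phi = fcoef (f 0%N) n phi.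
Proof.
have cl k : continuous (ev (flist k) 0) by exact: (ev_cont2 (@flist_wf 1 k)).
have ca k : continuous (ev (fatoms k) 0).
  have w : wfl 1 (fatoms k) by have := @flist_wf 1 k.+1; exact: wfl_catr.
  exact: (ev_cont2 w).
have fS k : fcoef (ev (flist k.+1) 0) n phi = fcoef (ev (flist k) 0) n phi + fcoef (ev (fatoms k) 0) n phi.
  by rewrite -fcoefD//; congr fcoef; apply/funext => y; rewrite /= ev_cat.
have fe k : fcoef (ev (fatoms k) 0) n phi = fcoef (fun y => fa k * cos (k%:R * y + 0)) n phi +
    fcoef (fun y => fb k * cos (k%:R * y + - (pi / 2))) n phi.
  rewrite -fcoefD.
  - by congr fcoef; apply/funext => y; rewrite !ev_cons ev_nil addr0.
  - by move=> y; apply: cvgM; [exact: cvg_cst|exact: cosl_cont].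
  - by move=> y; apply: cvgM; [exact: cvg_cst|exact: cosl_cont].
have piz : pi != 0 :> R by rewrite gt_eqF// pi_gt0.
have fne k : k != n -> fcoef (ev (fatoms k) 0) n phi = 0.
  by move=> kn; rewrite fe !fcoef_cosl eq_sym (negbTE kn) addr0.
have feq : fcoef (ev (fatoms n) 0) n phi = fcoef (f 0%N) n phi.
  have cfc psi : continuous (fun y => f 0%N y * cos (n%:R * y + psi)).
    by move=> y; apply: cvgM; [exact: cf|exact: cosl_cont].
  have split2 : fcoef (f 0%N) n phi = cos phi * fcoef (f 0%N) n 0 - sin phi * fcoef (f 0%N) n (- (pi / 2)).
    rewrite /fcoef -mulNr -!int2piZ// -int2piD.
    - congr int2pi; apply/funext => y; rewrite addr0 cosD (cosB (n%:R * y)) cos_pihalf sin_pihalf; ring.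
    - by move=> y; apply: cvgM; [exact: cvg_cst|exact: cfc].
    - by move=> y; apply: cvgM; [exact: cvg_cst|exact: cfc].
  rewrite fe !fcoef_cosl eqxx split2 /fa /fb; case: eqP => [n0|_].
    have fz : fcoef (f 0%N) 0 (- (pi / 2)) = 0.
      rewrite /fcoef (_ : (fun y => _) = (fun=> 0)) ?int2pi_cst ?mul0r//.
      by apply/funext => y; rewrite mul0r add0r cosN cos_pihalf mulr0.
    rewrite n0 fz cos0 !(mulr0, mul0r) subr0 addr0 mulr1.
    by move: piz; generalize (pi : R) => P Pz; field.
  rewrite sub0r cosN (cosB (- (pi / 2))) cosN cos_pihalf sinN sin_pihalf.
  move: (fcoef (f 0%N) n 0) (fcoef (f 0%N) n (- (pi / 2))) piz.
  by generalize (pi : R) => P u v Pz; field.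
have fz k : (k <= n)%N -> fcoef (ev (flist k) 0) n phi = 0.
  elim: k => [_|k IHk kn].
    rewrite /fcoef (_ : (fun y => _) = (fun=> 0)) ?int2pi_cst ?mul0r//.
    by apply/funext => y; rewrite ev_nil mul0r.
  rewrite fS IHk ?(ltnW kn)// fne ?addr0//.
  by rewrite neq_ltn kn.
elim: m => [//|m IH]; rewrite ltnS leq_eqVlt => /predU1P[<-{IH m}|h].
  by rewrite fS feq fz ?leqnn// add0r.
by rewrite fS IH// fne ?addr0// neq_ltn h orbT.
Qed.

(** The summable norms give a uniform limit E of the partial sums, with the coefficients of f; hence
    f - E is orthogonal to every trigonometric polynomial, and the concentrating kernels, applied to
    f - E and to E - f, force it to vanish. *)
Theorem fourier_inversion : exists2 B : nat -> R, B @ \oo --> 0 &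
  forall m t y, `|ev (flist m) t y - f 0%N y| <= B m.
Proof.
have [C hC] := choice flist_nrm.
have [F [B [B0 hB bF dF [pF cF]]]] := list_limit ltr01 (@flist_wf 1) flist_sub (fun j m => hC j m).
have t01 : ((0 : R) <= 0) && ((0 : R) <= 1) by rewrite lexx ler01.
pose E := F 0%N 0.
have hE m y : `|ev (flist m) 0 y - E y| <= B 0%N m by rewrite -ev_dyn0; exact: hB.
have cE : continuous E by apply: (@wderiv_continuous _ _ (F 1%N 0)) => y; exact: dF.
have pE y : E (y + 2 * pi) = E y by exact: pF.
have coefE n phi : fcoef E n phi = fcoef (f 0%N) n phi.
  apply: (@seq_lim_unique _ (fun m => fcoef (ev (flist m) 0) n phi)).
    apply: (@bound_cvg _ _ (fun m => B 0%N m * (2 * pi))).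
      move=> m; apply: int2pi_le.
      - by move=> y; apply: cvgM; [exact: (ev_cont2 (@flist_wf 1 m))|exact: cosl_cont].
      - by move=> y; apply: cvgM; [exact: cE|exact: cosl_cont].
      - move=> y _; rewrite -mulrBl normrM -[X in _ <= X]mulr1 ler_pM//.
        by rewrite ler_norml cos_geN1 cos_le1.
    by rewrite -[X in _ --> X](mul0r (2 * pi)); apply: cvgMl; exact: B0.
  apply/cvgrPdist_le => e e0; exists n.+1 => // m /= nm.
  by rewrite fcoef_flist// subrr normr0 ltW.
have key (s : R) : `|s| <= 1 -> forall y, 0 < y < 2 * pi -> s * (f 0%N y - E y) <= 0.
  move=> _; apply: kernel_concentration.
  - by move=> y; apply: cvgM; [exact: cvg_cst|apply: cvgB; [exact: cf|exact: cE]].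
  - by move=> y; rewrite pE pf.
  - have cg y : {for y, continuous (fun y => s * (f 0%N y - E y))}.
      by apply: cvgM; [exact: cvg_cst|apply: cvgB; [exact: cf|exact: cE]].
    elim=> [|x l IH] hl.
      rewrite (_ : (fun y => _) = (fun=> 0)) ?int2pi_cst ?mul0r//.
      by apply/funext => y; rewrite ev_nil mulr0.
    have [_ hl'] := wfl_cons hl.
    have -> : (fun y => s * (f 0%N y - E y) * ev (x :: l) 0 y) =
      (fun y => (s * acoef x 0) * (f 0%N y * cos ((afreq x)%:R * y + aphase x)) +
        ((- (s * acoef x 0)) * (E y * cos ((afreq x)%:R * y + aphase x)) +
         s * (f 0%N y - E y) * ev l 0 y)).
      by apply/funext => y; rewrite ev_cons /aev; ring.
    have c1 : continuous (fun y => f 0%N y * cos ((afreq x)%:R * y + aphase x)).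
      by move=> y; apply: cvgM; [exact: cf|exact: cosl_cont].
    have c2 : continuous (fun y => E y * cos ((afreq x)%:R * y + aphase x)).
      by move=> y; apply: cvgM; [exact: cE|exact: cosl_cont].
    have c3 : continuous (fun y => s * (f 0%N y - E y) * ev l 0 y).
      by move=> y; apply: cvgM; [exact: cg|exact: (ev_cont2 hl')].
    rewrite int2piD; first last.
    + by move=> y; apply: cvgD; [apply: cvgM; [exact: cvg_cst|exact: c2]|exact: c3].
    + by move=> y; apply: cvgM; [exact: cvg_cst|exact: c1].
    rewrite int2piD; first last.
    + exact: c3.
    + by move=> y; apply: cvgM; [exact: cvg_cst|exact: c2].
    by rewrite IH// addr0 !int2piZ// -!/(fcoef _ _ _) coefE mulNr subrr.
have eqE y : 0 < y < 2 * pi -> f 0%N y = E y.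
  move=> hy; have h1 := key 1 _ y hy; have h2 := key (-1) _ y hy.
  rewrite normr1 in h1; rewrite normrN1 in h2.
  by have {}h1 := h1 (lexx _); have {}h2 := h2 (lexx _); lra.
(* The kernel argument covers the interior of the period; the endpoint follows by continuity along u
   n = pi / (n + 1). *)
have eq0 : f 0%N 0 = E 0.
  pose u n : R := (2 * pi) * (2^-1 * n.+1%:R^-1).
  have u0 : u @ \oo --> 0.
    rewrite [X in _ --> X](_ : 0 = 2 * pi * (2^-1 * 0)); last by rewrite !mulr0.
    by apply: cvgMr; apply: cvgMr; exact: cvg_harmonic.
  have up n : 0 < u n < 2 * pi.
    have x1 : (1 : R) <= n.+1%:R by rewrite ler1n.
    have hx : (n.+1%:R^-1 : R) <= 1 by rewrite invf_le1// ltr0n.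
    have hx0 : 0 < (n.+1%:R^-1 : R) by rewrite invr_gt0 ltr0n.
    rewrite /u; apply/andP; split; first by rewrite !mulr_gt0// pi_gt0.
    rewrite -[X in _ < X]mulr1 ltr_pM2l//; move: hx hx0; move: (n.+1%:R^-1) => v; lra.
  apply: (@seq_lim_unique _ (fun n => f 0%N (u n))).
    exact: (cvg_comp _ _ u0 (@cf 0%N 0)).
  under eq_fun do rewrite (eqE _ (up _)).
  exact: (cvg_comp _ _ u0 (cE 0)).
have eqall y : f 0%N y = E y.
  have [y' /andP[y0 y2] yE] := @periodic_reduce R _ (fun y => (f 0%N y, E y)) y 0 (fun y => congr2 pair (pf y) (pE y)).
  have [<- <-] := yE; move: y0; rewrite le_eqVlt => /predU1P[<-//|y0].
  by apply: eqE; rewrite y0 -[X in _ < X]add0r.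
exists (B 0%N) => // m t y.
by rewrite ev_flist_const eqall; exact: hE.
Qed.

End Fourier.

(** * Families with uniformly bounded derivatives *)

(* A frame describes a family, indexed by [I], of domains of a space [P], with
   a time direction [None] and space directions [Some l]. The amplitude of an
   index measures how much each time derivative may cost. *)
Record frame (R : realType) (P : topologicalType) (I L : Type) := Frame {
  fdom : I -> set P;
  fline : option L -> P -> R -> P;
  fpos : option L -> P -> R;
  fax : option L -> P -> set R;
  famp : I -> R;
  fline_pos : forall l p, fline l p (fpos l p) = p;
  famp_ge1 : forall i, 1 <= famp i;
  fdom_near : forall i l p, fdom i p -> exists2 d : R, 0 < d &
    forall s, fax l p s -> `|s - fpos l p| < d -> fdom i (fline l p s);
  fax_pos : forall i l p, fdom i p -> fax l p (fpos l p);
  fax_side : forall i l p, fdom i p -> exists d : R, 0 < d /\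
    ((forall s, fpos l p <= s < fpos l p + d -> fax l p s) \/
     (forall s, fpos l p - d < s <= fpos l p -> fax l p s)) }.

Section SmoothClass.
Context {R : realType} {P : topologicalType} {I L : Type} (F : frame R P I L).
Implicit Types (f g : I -> P -> R).

Definition has_deriv l f f' : Prop := forall i p, fdom F i p ->
  wderiv (fax F l p) (fun s => f i (fline F l p s)) (fpos F l p) (f' i p).

(** C is common to all indices: the dependence on the index is confined to a power of the
    amplitude. *)
Definition amp_bounded (N : nat) f : Prop :=
  (exists C : R, forall i p, fdom F i p -> `|f i p| <= C * famp F i ^+ N) /\
  forall i, cont_on (fdom F i) (f i).

(* [j] bounds the number of time derivatives, [m] that of space derivatives. *)
Fixpoint smooth_class (j : nat) : nat -> nat -> (I -> P -> R) -> Prop :=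
  fix space_class (m N : nat) (f : I -> P -> R) {struct m} : Prop :=
    [/\ amp_bounded N f,
        (if m is m'.+1 then forall l, exists2 f', has_deriv (Some l) f f' & space_class m' N f'
         else True) &
        (if j is j'.+1 then exists2 f', has_deriv None f f' & smooth_class j' m N.+1 f'
         else True)].

Lemma smooth_classE j m N f : smooth_class j m N f <->
  [/\ amp_bounded N f,
      (forall m', m = m'.+1 -> forall l, exists2 f', has_deriv (Some l) f f' & smooth_class j m' N f') &
      (forall j', j = j'.+1 -> exists2 f', has_deriv None f f' & smooth_class j' m N.+1 f')].
Proof.
case: j m => [|j] [|m] /=; split=> -[h1 h2 h3]; split => //.
- by move=> ? [<-].
- exact: h2.
- by move=> ? [<-].
- exact: h3.
- by move=> ? [<-].
- by move=> ? [<-].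
- exact: h2.
- exact: h3.
Qed.

(** A lexicographic induction: one time derivative fewer buys any number of space derivatives, as is
    needed when an equation trades the former for the latter. *)
Lemma class_ind (Q : nat -> nat -> Prop) :
  (forall j m, (forall m', m = m'.+1 -> Q j m') ->
     (forall j', j = j'.+1 -> forall m', Q j' m') -> Q j m) ->
  forall j m, Q j m.
Proof.
move=> h; elim=> [|j IHj]; elim=> [|m IHm]; apply: h => //.
- by move=> m' [<-].
- by move=> j' [<-].
- by move=> m' [<-].
- by move=> j' [<-].
Qed.

(** Equality on the domain suffices because [fdom_near] keeps the line of differentiation inside the
    domain near its base point. *)
Lemma has_deriv_ext l f g f' g' : (forall i p, fdom F i p -> f i p = g i p) ->
  (forall i p, fdom F i p -> f' i p = g' i p) -> has_deriv l f f' -> has_deriv l g g'.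
Proof.
move=> fg fg' h i p ip; rewrite -fg'//.
have [d d0 hd] := fdom_near l ip.
apply: (wderiv_near d0) (h i p ip); last by rewrite fline_pos fg.
by move=> s As sd; apply: fg; exact: hd.
Qed.

Lemma has_deriv_unique l f f' g' : has_deriv l f f' -> has_deriv l f g' ->
  forall i p, fdom F i p -> f' i p = g' i p.
Proof.
move=> h1 h2 i p ip; have [d hd] := fax_side l ip.
by apply: (@wderiv_unique _ _ _ _ _ _ (fax_pos l ip) _ (h1 i p ip) (h2 i p ip)); exists d.
Qed.

Lemma amp_bounded_ext N f g : (forall i p, fdom F i p -> f i p = g i p) ->
  amp_bounded N f -> amp_bounded N g.
Proof.
move=> fg [[C hC] hc]; split; first by exists C => i p ip; rewrite -fg// hC.
by move=> i; apply: (cont_on_eq _ (hc i)) => p; exact: fg.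
Qed.

Lemma smooth_class_ext f g j m N : (forall i p, fdom F i p -> f i p = g i p) ->
  smooth_class j m N f -> smooth_class j m N g.
Proof.
move=> fg /smooth_classE[h1 h2 h3]; apply/smooth_classE; split.
- exact: amp_bounded_ext h1.
- move=> m' mE l; have [f' h hf'] := h2 _ mE l; exists f' => //.
  exact: has_deriv_ext h.
- move=> j' jE; have [f' h hf'] := h3 _ jE; exists f' => //.
  exact: has_deriv_ext h.
Qed.

Lemma smooth_class_amp j m N f : smooth_class j m N f -> amp_bounded N f.
Proof. by case/smooth_classE. Qed.

Lemma smooth_class_dx j m N f l f' : smooth_class j m.+1 N f -> has_deriv (Some l) f f' ->
  smooth_class j m N f'.
Proof.
case/smooth_classE => _ h _ hf; have [g' hg cg] := h _ erefl l.
by apply: smooth_class_ext cg => i p ip; exact: (has_deriv_unique hg hf).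
Qed.

Lemma smooth_class_dt j m N f f' : smooth_class j.+1 m N f -> has_deriv None f f' ->
  smooth_class j m N.+1 f'.
Proof.
case/smooth_classE => _ _ h hf; have [g' hg cg] := h _ erefl.
by apply: smooth_class_ext cg => i p ip; exact: (has_deriv_unique hg hf).
Qed.

Lemma amp_bounded_le N N' f : (N <= N')%N -> amp_bounded N f -> amp_bounded N' f.
Proof.
move=> NN [[C hC] hc]; split => //; exists `|C| => i p ip.
apply: le_trans (hC i p ip) _; apply: (@le_trans _ _ (`|C| * famp F i ^+ N)).
  by rewrite ler_wpM2r ?ler_norm// exprn_ge0// (le_trans ler01) ?famp_ge1.
by rewrite ler_wpM2l// ler_weXn2l// famp_ge1.
Qed.

Lemma smooth_class_mono j m : forall N N' f, (N <= N')%N -> smooth_class j m N f ->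
  smooth_class j m N' f.
Proof.
move: j m; apply: class_ind => j m IHm IHj N N' f NN /smooth_classE[h1 h2 h3].
apply/smooth_classE; split; first exact: amp_bounded_le h1.
- move=> m' mE l; have [f' h hf] := h2 m' mE l; exists f' => //.
  exact: IHm hf.
- move=> j' jE; have [f' h hf] := h3 j' jE; exists f' => //.
  by apply: IHj hf.
Qed.

Lemma smooth_class_le j m : forall j' m' N f, (j' <= j)%N -> (m' <= m)%N ->
  smooth_class j m N f -> smooth_class j' m' N f.
Proof.
move: j m; apply: class_ind => j m IHm IHj j' m' N f jj mm /smooth_classE[h1 h2 h3].
apply/smooth_classE; split=> //.
- move=> a aE l; rewrite aE in mm; case: m mm IHm h2 IHj h1 h3 => // m mm IHm h2 _ _ _.
  have [f' h hf] := h2 _ erefl l; exists f' => //.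
  by apply: IHm hf.
- move=> a aE; rewrite aE in jj; case: j jj IHm h3 IHj h1 h2 => // j jj _ h3 IHj _ _.
  have [f' h hf] := h3 _ erefl; exists f' => //.
  by apply: IHj hf.
Qed.

Lemma amp_boundedD N f g : amp_bounded N f -> amp_bounded N g ->
  amp_bounded N (fun i p => f i p + g i p).
Proof.
move=> [[C hC] cf] [[C' hC'] cg]; split; last by move=> i; apply: cont_onD.
exists (C + C') => i p ip; rewrite mulrDl; apply: le_trans (ler_normD _ _) _.
by rewrite lerD ?hC ?hC'.
Qed.

Lemma amp_boundedM N N' f g : amp_bounded N f -> amp_bounded N' g ->
  amp_bounded (N + N') (fun i p => f i p * g i p).
Proof.
move=> [[C hC] cf] [[C' hC'] cg]; split; last by move=> i; apply: cont_onM.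
exists (C * C') => i p ip; rewrite normrM exprD mulrACA.
by rewrite ler_pM ?hC ?hC'.
Qed.

Lemma has_derivD l f g f' g' : has_deriv l f f' -> has_deriv l g g' ->
  has_deriv l (fun i p => f i p + g i p) (fun i p => f' i p + g' i p).
Proof. by move=> hf hg i p ip; apply: wderivD; [exact: hf|exact: hg]. Qed.

Lemma has_derivM l f g f' g' : has_deriv l f f' -> has_deriv l g g' ->
  has_deriv l (fun i p => f i p * g i p) (fun i p => f' i p * g i p + f i p * g' i p).
Proof.
move=> hf hg i p ip; have := wderivM (hf i p ip) (hg i p ip).
by rewrite fline_pos.
Qed.

Lemma has_deriv_cst l (c : I -> R) : has_deriv l (fun i _ => c i) (fun _ _ => 0).
Proof. by move=> i p ip; exact: wderiv_cst. Qed.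

Lemma has_derivV l f f' : (forall i p, fdom F i p -> f i p != 0) -> has_deriv l f f' ->
  has_deriv l (fun i p => (f i p)^-1) (fun i p => - 1 * (f' i p * ((f i p)^-1 * (f i p)^-1))).
Proof.
move=> f0 hf i p ip; have := wderivV (hf i p ip).
rewrite fline_pos => /(_ (f0 i p ip)).
by rewrite expr2 invfM mulN1r mulNr.
Qed.

Lemma smooth_class_bcst j m : forall N (c : I -> R) (C : R), (forall i, `|c i| <= C * famp F i ^+ N) ->
  smooth_class j m N (fun i _ => c i).
Proof.
move: j m; apply: class_ind => j m IHm IHj N c C hc; apply/smooth_classE; split.
- by split; [exists C|move=> i; exact: cont_on_cst].
- move=> m' mE l; exists (fun _ _ => 0); first exact: has_deriv_cst.
  by apply: (IHm _ mE _ (fun=> 0) 0) => i; rewrite normr0 mul0r.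
- move=> j' jE; exists (fun _ _ => 0); first exact: has_deriv_cst.
  by apply: (IHj _ jE _ _ (fun=> 0) 0) => i; rewrite normr0 mul0r.
Qed.

Lemma smooth_class_cst j m (c : R) : smooth_class j m 0 (fun _ _ => c).
Proof. by apply: (@smooth_class_bcst _ _ _ (fun=> c) `|c|) => i; rewrite expr0 mulr1. Qed.

Lemma smooth_classD j m : forall N f g, smooth_class j m N f -> smooth_class j m N g ->
  smooth_class j m N (fun i p => f i p + g i p).
Proof.
move: j m; apply: class_ind => j m IHm IHj N f g /smooth_classE[f1 f2 f3] /smooth_classE[g1 g2 g3].
apply/smooth_classE; split; first exact: amp_boundedD.
- move=> m' mE l; have [f' hf cf] := f2 _ mE l; have [g' hg cg] := g2 _ mE l.
  by exists (fun i p => f' i p + g' i p); [exact: has_derivD|exact: IHm].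
- move=> j' jE; have [f' hf cf] := f3 _ jE; have [g' hg cg] := g3 _ jE.
  by exists (fun i p => f' i p + g' i p); [exact: has_derivD|exact: IHj].
Qed.

Lemma smooth_classM j m : forall N N' f g, smooth_class j m N f -> smooth_class j m N' g ->
  smooth_class j m (N + N') (fun i p => f i p * g i p).
Proof.
move: j m; apply: class_ind => j m IHm IHj N N' f g Cf Cg.
have /smooth_classE[f1 f2 f3] := Cf; have /smooth_classE[g1 g2 g3] := Cg.
apply/smooth_classE; split; first exact: amp_boundedM.
- move=> m' mE l; have [f' hf cf] := f2 _ mE l; have [g' hg cg] := g2 _ mE l.
  exists (fun i p => f' i p * g i p + f i p * g' i p); first exact: has_derivM.
  by apply: smooth_classD; apply: IHm => //; [apply: smooth_class_le Cg|apply: smooth_class_le Cf];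
    rewrite ?mE.
- move=> j' jE; have [f' hf cf] := f3 _ jE; have [g' hg cg] := g3 _ jE.
  exists (fun i p => f' i p * g i p + f i p * g' i p); first exact: has_derivM.
  by apply: smooth_classD; [rewrite -addSn|rewrite -addnS];
    apply: IHj => //; [apply: smooth_class_le Cg|apply: smooth_class_le Cf]; rewrite ?jE.
Qed.

Lemma smooth_classN j m N f : smooth_class j m N f -> smooth_class j m N (fun i p => - f i p).
Proof.
move=> h; have := smooth_classM (smooth_class_cst j m (-1)) h; rewrite add0n.
by apply: smooth_class_ext => i p _; rewrite mulN1r.
Qed.

Lemma smooth_classB j m N f g : smooth_class j m N f -> smooth_class j m N g ->
  smooth_class j m N (fun i p => f i p - g i p).
Proof. by move=> hf hg; apply: smooth_classD => //; exact: smooth_classN. Qed.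

(** The derivative - f' / f^2 is a product of f' with inverses at a lower order. The index 0 of the
    class is what closes the induction: powers of 1 / f add no amplitude. *)
Lemma smooth_classV (c : R) j m f : 0 < c -> (forall i p, fdom F i p -> c <= f i p) ->
  smooth_class j m 0 f -> smooth_class j m 0 (fun i p => (f i p)^-1).
Proof.
move=> c0 hc; have f0 i p : fdom F i p -> f i p != 0.
  by move=> ip; rewrite gt_eqF// (lt_le_trans c0)// hc.
move: j m; apply: class_ind => j m IHm IHj Cf.
have /smooth_classE[[[C hC] cf] f2 f3] := Cf; apply/smooth_classE; split.
- split; last by move=> i; apply: cont_onV => // p; exact: f0.
  exists c^-1 => i p ip; rewrite expr0 mulr1 ger0_norm ?invr_ge0 ?(le_trans (ltW c0)) ?hc//.
  by rewrite lef_pV2 ?posrE// ?hc// (lt_le_trans c0)// hc.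
- move=> m' mE l; have [f' hf h] := f2 _ mE l; eexists; first exact: has_derivV hf.
  have hV : smooth_class j m' 0 (fun i p => (f i p)^-1).
    by apply: IHm => //; apply: smooth_class_le Cf; rewrite ?mE.
  exact: (smooth_classM (smooth_class_cst _ _ (-1)) (smooth_classM h (smooth_classM hV hV))).
- move=> j' jE; have [f' hf h] := f3 _ jE; eexists; first exact: has_derivV hf.
  have hV : smooth_class j' m 0 (fun i p => (f i p)^-1).
    by apply: IHj => //; apply: smooth_class_le Cf; rewrite ?jE.
  exact: (smooth_classM (smooth_class_cst _ _ (-1)) (smooth_classM h (smooth_classM hV hV))).
Qed.

End SmoothClass.

(** * Families on the time strip: composition and integration over a period *)

Section Strip.
Context {R : realType} {I : Type} (T : R) (A : I -> R).
Hypotheses (T0 : 0 < T) (A1 : forall i, 1 <= A i).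

Let strip_line (l : option unit) (q : R * R) (s : R) : R * R :=
  if l is Some _ then (q.1, s) else (s, q.2).
Let strip_pos (l : option unit) (q : R * R) : R := if l is Some _ then q.2 else q.1.
Let strip_ax (l : option unit) (q : R * R) : set R := if l is Some _ then setT else `[0, T]%classic.

Lemma strip_line_pos l q : strip_line l q (strip_pos l q) = q.
Proof. by case: l q => [u|] []. Qed.

Lemma strip_dom_near (i : I) l p : slab T p -> exists2 d : R, 0 < d &
    forall s, strip_ax l p s -> `|s - strip_pos l p| < d -> slab T (strip_line l p s).
Proof.
by exists 1 => // s; case: l => //=; rewrite in_itv.
Qed.

Lemma strip_ax_pos (i : I) l p : slab T p -> strip_ax l p (strip_pos l p).
Proof. by case: l => //=; rewrite /slab /= in_itv. Qed.

Lemma strip_ax_side (i : I) l p : slab T p -> exists d : R, 0 < d /\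
    ((forall s, strip_pos l p <= s < strip_pos l p + d -> strip_ax l p s) \/
     (forall s, strip_pos l p - d < s <= strip_pos l p -> strip_ax l p s)).
Proof.
case: l => [u|] /=; first by exists 1; split => //; left.
move=> /andP[p0 pT]; have [pp|pp] := ltP p.1 T.
  exists (T - p.1); split; first by rewrite subr_gt0.
  by left => s /andP[h1 h2]; rewrite in_itv/=; apply/andP; split; lra.
exists T; split => //; right => s /andP[h1 h2]; rewrite in_itv/=; apply/andP; split; lra.
Qed.

Definition strip : frame R (R * R)%type I unit :=
  @Frame R (R * R)%type I unit (fun=> slab T) strip_line strip_pos strip_ax A
    strip_line_pos A1 strip_dom_near strip_ax_pos strip_ax_side.

End Strip.

Section ChainRule.
Context {R : realType}.
Implicit Types (T t : R) (f : R * R -> R).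

Lemma cont_on_slab_near T f t y (e : R) : cont_on (slab T) f -> 0 <= t <= T -> 0 < e ->
  exists2 d : R, 0 < d & forall s z : R, 0 <= s <= T -> `|s - t| < d -> `|z - y| < d ->
    `|f (s, z) - f (t, y)| <= e.
Proof.
move=> cf tT e0; have /cvgrPdist_le/(_ _ e0) := cf (t, y) tT.
rewrite near_withinE => /nbhs_ballP[d /= d0 hd]; exists d => // s z sT st zy.
rewrite distrC; apply: (hd (s, z)) => //.
by split; rewrite /ball /= distrC.
Qed.

(** The increment is split at (s, th t). The space part, at the moving time s, is handled by the
    mean value inequality and the continuity of [fx]; the time part by differentiability in time at
    the single point (t, th t). *)
Lemma wderiv_chain T f (fx : R * R -> R) (th : R -> R) t ft th' : 0 <= t <= T ->
  cont_on (slab T) fx ->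
  (forall s y : R, 0 <= s <= T -> wderiv setT (fun z => f (s, z)) y (fx (s, y))) ->
  wderiv `[0, T]%classic (fun s => f (s, th t)) t ft ->
  wderiv `[0, T]%classic th t th' ->
  wderiv `[0, T]%classic (fun s => f (s, th s)) t (ft + fx (t, th t) * th').
Proof.
move=> tT cfx hx /wderivP hft /wderivP hth; apply/wderivP => e e0.
set fx0 := fx (t, th t).
pose K := `|th'| + 1; have K0 : 0 < K by rewrite ltr_wpDl.
pose H := `|fx0| + 1; have H0 : 0 < H by rewrite ltr_wpDl.
have e1 : 0 < e / (3 * K) by rewrite divr_gt0// mulr_gt0.
have e2 : 0 < e / (3 * H) by rewrite divr_gt0// mulr_gt0.
have e3 : 0 < e / 3 by rewrite divr_gt0.
have [d1 d10 h1] := cont_on_slab_near (th t) cfx tT e1.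
have [d2 d20 h2] := hth _ e2; have [d2' d20' h2'] := hth _ ltr01; have [d3 d30 h3] := hft _ e3.
exists (Num.min (Num.min d1 (d1 / K)) (Num.min (Num.min d2 d2') d3)).
  by rewrite !lt_min d10 d20 d20' d30 divr_gt0.
move=> s sT; rewrite !lt_min => /andP[/andP[s1 s1'] /andP[/andP[s2 s2'] s3]].
have sT' : 0 <= s <= T by move: sT; rewrite /= in_itv.
have thK : `|th s - th t| <= K * `|s - t|.
  have -> : th s - th t = (th s - th t - th' * (s - t)) + th' * (s - t) by ring.
  apply: le_trans (ler_normD _ _) _; rewrite normrM /K mulrDl addrC lerD2l mul1r.
  by have := h2' _ sT s2'; rewrite mul1r.
have A1 : `|f (s, th s) - f (s, th t) - fx0 * (th s - th t)| <= e / (3 * K) * `|th s - th t|.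
  have -> : f (s, th s) - f (s, th t) - fx0 * (th s - th t) =
    (f (s, th s) - fx0 * th s) - (f (s, th t) - fx0 * th t) by ring.
  apply: (@wderiv_le_norm _ setT (fun z => f (s, z) - fx0 * z) (fun z => fx (s, z) - fx0)) => //.
    move=> z _; apply: wderivB; first exact: hx.
    by have := wderivZ setT fx0 (wderiv_id setT z); rewrite mulr1.
  move=> z hz; apply: h1 => //.
  have : `|th s - th t| < d1.
    by apply: le_lt_trans thK _; rewrite mulrC -ltr_pdivlMr.
  apply: le_lt_trans; move: hz.
  have [le|le] := leP (th t) (th s); move=> /andP[z1 z2].
    by rewrite !ger0_norm ?subr_ge0// lerD2r.
  by rewrite !ler0_norm ?subr_le0 ?(ltW le)// !opprB lerD2l lerN2.
have A2 : `|fx0 * (th s - th t - th' * (s - t))| <= e / 3 * `|s - t|.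
  rewrite normrM; apply: (@le_trans _ _ (H * (e / (3 * H) * `|s - t|))).
    by apply: ler_pM => //; [rewrite lerDl|exact: h2].
  by rewrite mulrA; have -> : H * (e / (3 * H)) = e / 3 by field; rewrite gt_eqF.
have A3 := h3 _ sT s3.
have -> : f (s, th s) - f (t, th t) - (ft + fx0 * th') * (s - t) =
  (f (s, th s) - f (s, th t) - fx0 * (th s - th t)) +
  (fx0 * (th s - th t - th' * (s - t)) + (f (s, th t) - f (t, th t) - ft * (s - t))) by ring.
apply: le_trans (ler_normD _ _) _.
have -> : e * `|s - t| = e / 3 * `|s - t| + (e / 3 * `|s - t| + e / 3 * `|s - t|) by field.
apply: lerD; last by apply: le_trans (ler_normD _ _) _; apply: lerD.
apply: le_trans A1 _; apply: (@le_trans _ _ (e / (3 * K) * (K * `|s - t|))).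
  by rewrite ler_wpM2l// ltW.
by rewrite mulrA; have -> : e / (3 * K) * K = e / 3 by field; rewrite gt_eqF.
Qed.

End ChainRule.

Section Composition.
Context {R : realType} {I1 I2 L : Type} {P : topologicalType}.
Variables (T : R) (A : I1 -> R) (T0 : 0 < T) (A1 : forall i, 1 <= A i).
Variables (F : frame R P I2 L) (phi : I2 -> I1) (tp : P -> R).
Hypotheses (tp_dom : forall i p, fdom F i p -> 0 <= tp p <= T)
  (tp_cont : forall i, cont_on (fdom F i) tp)
  (tp_line : forall p s, tp (fline F None p s) = s)
  (tp_pos : forall p, fpos F None p = tp p)
  (tp_ax : forall p, fax F None p = `[0, T]%classic)
  (tp_space : forall l p s, tp (fline F (Some l) p s) = tp p)
  (tp_amp : forall i, famp F i = A (phi i)).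
Let S := strip T0 A1.

(* The inner function of a composition need not be bounded: only its
   derivatives matter. *)
Definition inner_class j m (th : I2 -> P -> R) :=
  [/\ forall i, cont_on (fdom F i) (th i),
      (forall m', m = m'.+1 -> forall l, exists2 th', has_deriv F (Some l) th th' &
         smooth_class F j m' 0 th') &
      (forall j', j = j'.+1 -> exists2 th', has_deriv F None th th' &
         smooth_class F j' m 1 th')].

Lemma smooth_inner j m th : smooth_class F j m 0 th -> inner_class j m th.
Proof. by case/smooth_classE => -[_ c] h1 h2; split. Qed.

Lemma inner_class_le j m j' m' th : (j' <= j)%N -> (m' <= m)%N -> inner_class j m th ->
  inner_class j' m' th.
Proof.
move=> jj mm [h1 h2 h3]; split => //.
- move=> a aE l; rewrite aE in mm; case: m mm h2 {h3} => // m mm /(_ _ erefl l)[th' h c].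
  by exists th' => //; apply: smooth_class_le c.
- move=> a aE; rewrite aE in jj; case: j jj h3 {h2} => // j jj /(_ _ erefl)[th' h c].
  by exists th' => //; apply: smooth_class_le c.
Qed.

Lemma amp_bounded_comp N f th : amp_bounded S N f -> (forall i, cont_on (fdom F i) (th i)) ->
  amp_bounded F N (fun i p => f (phi i) (tp p, th i p)).
Proof.
move=> [[C hC] cf] cth; split.
  by exists C => i p ip; rewrite tp_amp; apply: hC; exact: (tp_dom ip).
move=> i; apply: (cont_on_comp (A := slab T) (f := f (phi i)) (g := fun p => (tp p, th i p))) => //.
- by move=> p ip; exact: (tp_dom ip).
- by move=> p ip; exact: (cvg_pair (@tp_cont i p ip) (cth i p ip)).
- exact: cf.
Qed.

(** The outer family is smooth to every space order because each derivative of the composition, the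
    time derivative included, differentiates it once more in space. *)
Lemma smooth_class_comp j m : forall N f th, (forall m', smooth_class S j m' N f) ->
  inner_class j m th -> smooth_class F j m N (fun i p => f (phi i) (tp p, th i p)).
Proof.
move: j m; apply: class_ind => j m IHm IHj N f th Cf Cth.
have [c2 f2 f3] := Cth.
have /smooth_classE[bf xf _] := Cf 1%N.
have [fx hx cfx] := xf _ erefl tt.
have Cfx m' : smooth_class S j m' N fx by exact: smooth_class_dx (Cf m'.+1) hx.
apply/smooth_classE; split; first exact: amp_bounded_comp.
- move=> m' mE l; have [th' hth cth] := f2 _ mE l.
  exists (fun i p => fx (phi i) (tp p, th i p) * th' i p).
    move=> i p ip; have tT := tp_dom ip.
    have h := hx (phi i) (tp p, th i p) tT; rewrite /= in h.
    have := @wderiv_comp _ _ setT _ (fun z => f (phi i) (tp p, z)) _ _ _ (fun _ _ => I) (hth i p ip).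
    rewrite fline_pos => /(_ _ h); apply: wderiv_ext => s.
    by rewrite tp_space.
  rewrite -[N]addn0; apply: smooth_classM => //; apply: (IHm _ mE) => //.
  by apply: inner_class_le Cth; rewrite ?mE.
- move=> j' jE; have [th' hth cth] := f3 _ jE.
  have /smooth_classE[_ _ tf] := Cf 1%N.
  have [ft ht cft] := tf _ jE.
  have Cft m' : smooth_class S j' m' N.+1 ft.
    by have := Cf m'; rewrite jE => h; apply: smooth_class_dt h ht.
  have Cth' : inner_class j' m th by apply: inner_class_le Cth; rewrite ?jE.
  exists (fun i p => ft (phi i) (tp p, th i p) + fx (phi i) (tp p, th i p) * th' i p).
    move=> i p ip; have tT := tp_dom ip.
    have [[_ cx] _ _] := (smooth_classE _ _ _ _ _).1 (Cfx 0%N).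
    have h1 := ht (phi i) (tp p, th i p) tT.
    have h2 := hth i p ip; rewrite tp_ax tp_pos in h2.
    have pE : th i p = th i (fline F None p (tp p)) by rewrite -tp_pos fline_pos.
    rewrite /= pE in h1 *.
    have := @wderiv_chain _ T (f (phi i)) (fx (phi i)) (fun s => th i (fline F None p s)) (tp p)
      _ _ tT (cx (phi i)) _ h1 h2.
    rewrite tp_ax tp_pos => h; apply: wderiv_ext (h _) => s; first by rewrite tp_line.
    by move=> y sT; exact: (hx (phi i) (s, y) sT).
  apply: smooth_classD; first exact: IHj.
  rewrite -addn1; apply: smooth_classM => //; apply: IHj => // m'.
  by apply: smooth_class_le (Cfx m'); rewrite ?jE.
Qed.

End Composition.

Section IntegralClass.
Context {R : realType} {I : Type} (T : R) (A : I -> R).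
Hypotheses (T0 : 0 < T) (A1 : forall i, 1 <= A i).
Let S := strip T0 A1.

Lemma slab_line (f : R * R -> R) t : cont_on (slab T) f -> 0 <= t <= T ->
  continuous (fun y => f (t, y)).
Proof.
move=> cf tT; apply: cont_on_setT.
apply: (cont_on_comp (A := slab T) (f := f) (g := fun y => (t, y))) => //.
by move=> y _; apply: cvg_within_filter; exact: (cvg_pair (cvg_cst t) cvg_id).
Qed.

Lemma slab_uniform (f : R * R -> R) t (a b e : R) : cont_on (slab T) f -> 0 <= t <= T -> 0 < e ->
  exists2 d : R, 0 < d & forall s y : R, 0 <= s <= T -> `|s - t| < d -> a <= y <= b ->
    `|f (s, y) - f (t, y)| <= e.
Proof.
move=> cf tT e0.
have e2 : 0 < e / 2 by rewrite divr_gt0.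
have h y : exists d : R, 0 < d /\ forall s z, 0 <= s <= T -> `|s - t| < d -> `|z - y| < d ->
    `|f (s, z) - f (t, y)| <= e / 2.
  by have [d d0 hd] := cont_on_slab_near y cf tT e2; exists d.
have [d hd] := choice h.
have : compact `[a, b]%classic by exact: segment_compact.
rewrite compact_cover => /(_ R setT (fun y => ball y (d y))).
case.
- by move=> y _; exact: (@ball_open _ R^o y (d y)).
- by move=> y _; exists y => //; apply: ballxx; exact: (hd y).1.
move=> D _ cov.
pose d0 := \big[Num.min/1]_(y <- finmap.enum_fset D) d y.
have d00 : 0 < d0.
  by rewrite /d0; elim/big_ind: _ => // [x z x0 z0|y _]; [rewrite lt_min x0|exact: (hd y).1].
exists d0 => // s y sT st yab.
have [z zD yz] : exists2 z : R, z \in finmap.enum_fset D & ball z (d z) y.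
  by have [|z zD yz] := cov y; [rewrite /= in_itv|exists z].
have dz : d0 <= d z.
  rewrite /d0; move: zD; elim: (finmap.enum_fset D) => // x l IH; rewrite big_cons inE => /predU1P[->|zl].
    by rewrite ge_min lexx.
  by rewrite ge_min IH ?orbT.
have yz' : `|y - z| < d z by move: yz; rewrite /ball /= distrC.
have h1 := (hd z).2 s y sT (lt_le_trans st dz) yz'.
have h2 : `|f (t, y) - f (t, z)| <= e / 2.
  by apply: (hd z).2 => //; rewrite subrr normr0; exact: (hd z).1.
have -> : f (s, y) - f (t, y) = (f (s, y) - f (t, z)) - (f (t, y) - f (t, z)) by ring.
apply: le_trans (ler_normB _ _) _; lra.
Qed.

Lemma wderiv_int2pi (f ft : R * R -> R) t : cont_on (slab T) f -> cont_on (slab T) ft ->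
  (forall s y : R, 0 <= s <= T -> wderiv `[0, T]%classic (fun u => f (u, y)) s (ft (s, y))) ->
  0 <= t <= T ->
  wderiv `[0, T]%classic (fun s => int2pi (fun y => f (s, y))) t (int2pi (fun y => ft (t, y))).
Proof.
move=> cf ct hf tT; apply/wderivP => e e0.
have pi2 : 0 < 2 * pi :> R by rewrite mulr_gt0// pi_gt0.
have e1 : 0 < e / (2 * pi) by rewrite divr_gt0.
have [d d0 hd] := slab_uniform 0 (2 * pi) ct tT e1.
exists d => // s; rewrite /= in_itv/= => sT st.
have c1 := slab_line cf sT; have c2 := slab_line cf tT; have c3 := slab_line ct tT.
have -> : int2pi (fun y => f (s, y)) - int2pi (fun y => f (t, y)) -
    int2pi (fun y => ft (t, y)) * (s - t) =
  int2pi (fun y => f (s, y)) - int2pi (fun y => f (t, y) + (s - t) * ft (t, y)).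
  rewrite int2piD//; last by move=> y; apply: cvgM; [exact: cvg_cst|exact: c3].
  by rewrite int2piZ//; ring.
have -> : e * `|s - t| = e / (2 * pi) * `|s - t| * (2 * pi).
  by rewrite mulrAC divfK// gt_eqF.
apply: int2pi_le => //.
  by move=> y; apply: cvgD; [exact: c2|apply: cvgM; [exact: cvg_cst|exact: c3]].
move=> y yI.
have -> : f (s, y) - (f (t, y) + (s - t) * ft (t, y)) =
  (f (s, y) - ft (t, y) * s) - (f (t, y) - ft (t, y) * t) by ring.
have sub u : Num.min t s <= u <= Num.max t s -> 0 <= u <= T /\ `|u - t| <= `|s - t|.
  move: tT sT => /andP[t1 t2] /andP[s1 s2].
  have [le|le] := leP t s => /andP[u1 u2]; split.
  - by apply/andP; split; lra.
  - by rewrite !ger0_norm ?subr_ge0// lerD2r.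
  - by apply/andP; split; lra.
  - by rewrite !ler0_norm ?subr_le0 ?(ltW le)// !opprB lerD2l lerN2.
apply: (@wderiv_le_norm _ `[0, T]%classic (fun u => f (u, y) - ft (t, y) * u)
   (fun u => ft (u, y) - ft (t, y))).
- by move=> u /sub[uT _]; rewrite /= in_itv.
- move=> u /sub[uT _]; apply: wderivB; first exact: hf.
  by have := wderivZ `[0, T]%classic (ft (t, y)) (wderiv_id `[0, T]%classic u); rewrite mulr1.
- by move=> u /sub[uT ut]; apply: hd => //; exact: le_lt_trans st.
Qed.

Lemma int2pi_norm (f : R -> R) (C : R) : continuous f -> (forall y, 0 <= y <= 2 * pi -> `|f y| <= C) ->
  `|int2pi f| <= C * (2 * pi).
Proof.
move=> cf hf; have := @int2pi_le _ f (fun=> 0) C cf _ _.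
rewrite int2pi_cst mul0r subr0; apply; first by move=> y; exact: cvg_cst.
by move=> y hy; rewrite subr0 hf.
Qed.

Lemma smooth_class_int j m : forall N f, smooth_class S j m N f ->
  smooth_class S j m N (fun i q => int2pi (fun y => f i (q.1, y))).
Proof.
move: j m; apply: class_ind => j m IHm IHj N f /smooth_classE[[[C hC] cf] _ f3].
have pi2 : 0 < 2 * pi :> R by rewrite mulr_gt0// pi_gt0.
apply/smooth_classE; split.
- split.
    exists (C * (2 * pi)) => i q iq; rewrite -mulrA [2 * pi * _]mulrC mulrA.
    apply: int2pi_norm; first exact: (slab_line (cf i) iq).
    by move=> y _; exact: (hC i (q.1, y)).
  move=> i q iq; apply/cvgrPdist_le => e e0; rewrite near_withinE.
  have e1 : 0 < e / (2 * pi) by rewrite divr_gt0.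
  have [d d0 hd] := slab_uniform 0 (2 * pi) (cf i) iq e1.
  apply/nbhs_ballP; exists d => // -[s y] [/= sq _] sT.
  have -> : e = e / (2 * pi) * (2 * pi) by rewrite mulfVK// gt_eqF.
  apply: int2pi_le; [exact: (slab_line (cf i) iq)|exact: (slab_line (cf i) sT)|].
  by move=> z hz; rewrite distrC; apply: hd => //; rewrite distrC.
- move=> m' mE l; exists (fun _ _ => 0); first by move=> i q iq /=; exact: wderiv_cst.
  by apply: smooth_class_mono (smooth_class_cst _ _ _ _).
- move=> j' jE; have [ft ht ct] := f3 _ jE.
  exists (fun i q => int2pi (fun y => ft i (q.1, y))); last exact: IHj.
  have [_ cft] := smooth_class_amp ct.
  move=> i q iq; apply: (wderiv_int2pi (cf i) (cft i)) iq.
  by move=> s y sT; exact: (ht i (s, y) sT).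
Qed.

End IntegralClass.

(** * Smooth functions of one variable *)

Section SmoothFunctions.
Context {R : realType}.
Implicit Types (f g : R -> R).

Definition deriv_of f f' : Prop := forall y : R, wderiv setT f y (f' y).

Fixpoint diffn (n : nat) f : Prop :=
  if n is n'.+1 then exists2 f', deriv_of f f' & diffn n' f' else True.

Definition smooth f := forall n, diffn n f.

Lemma wderiv_uniqueT f t l m : wderiv setT f t l -> wderiv setT f t m -> l = m.
Proof. by apply: wderiv_unique => //; exists 1; split => //; left. Qed.

Lemma diffn_le n n' f : (n' <= n)%N -> diffn n f -> diffn n' f.
Proof.
elim: n n' f => [|n IH] [|n'] f //= nn [f' h hf]; exists f' => //.
exact: IH hf.
Qed.

Lemma diffn_derive n f f' : diffn n.+1 f -> deriv_of f f' -> diffn n f'.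
Proof.
move=> [g hg cg] hf; suff -> : f' = g by [].
by apply/funext => y; exact: wderiv_uniqueT (hf y) (hg y).
Qed.

Lemma smooth_derive f f' : smooth f -> deriv_of f f' -> smooth f'.
Proof. by move=> h hf n; exact: diffn_derive (h n.+1) hf. Qed.

Lemma diffn_cst n (c : R) : diffn n (fun=> c).
Proof.
elim: n c => //= n IH c; exists (fun=> 0); last exact: IH.
by move=> y; exact: wderiv_cst.
Qed.

Lemma diffnD n f g : diffn n f -> diffn n g -> diffn n (fun y => f y + g y).
Proof.
elim: n f g => //= n IH f g [f' hf cf] [g' hg cg].
exists (fun y => f' y + g' y); last exact: IH.
by move=> y; apply: wderivD; [exact: hf|exact: hg].
Qed.

Lemma diffnM n f g : diffn n f -> diffn n g -> diffn n (fun y => f y * g y).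
Proof.
elim: n f g => // n IH f g cf cg; have [f' hf cf'] := cf; have [g' hg cg'] := cg.
exists (fun y => f' y * g y + f y * g' y).
  by move=> y; apply: wderivM; [exact: hf|exact: hg].
apply: diffnD; apply: IH => //; [exact: diffn_le cg|exact: diffn_le cf].
Qed.

Lemma diffnN n f : diffn n f -> diffn n (fun y => - f y).
Proof.
move=> h; have := diffnM (diffn_cst n (-1)) h.
by under eq_fun do rewrite mulN1r.
Qed.

Lemma diffnV n f : (forall y, f y != 0) -> diffn n f -> diffn n (fun y => (f y)^-1).
Proof.
move=> f0; elim: n => // n IH cf; have [f' hf cf'] := cf.
exists (fun y => - f' y * ((f y)^-1 * (f y)^-1)).
  by move=> y; have := wderivV (hf y) (f0 y); rewrite expr2 invfM.
have h : diffn n (fun y => (f y)^-1) by apply: IH; exact: diffn_le cf.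
by apply: diffnM; [exact: diffnN|exact: diffnM].
Qed.

Lemma deriv_of_comp f g f' g' : deriv_of f f' -> deriv_of g g' ->
  deriv_of (fun y => g (f y)) (fun y => g' (f y) * f' y).
Proof. by move=> hf hg y; apply: (@wderiv_comp _ setT setT). Qed.

Lemma diffn_comp n f g : diffn n f -> diffn n g -> diffn n (fun y => g (f y)).
Proof.
elim: n f g => // n IH f g cf cg; have [f' hf cf'] := cf; have [g' hg cg'] := cg.
exists (fun y => g' (f y) * f' y); first exact: deriv_of_comp.
by apply: diffnM => //; apply: IH => //; exact: diffn_le cf.
Qed.

Lemma smooth_trig : smooth (@sin R) /\ smooth (@cos R).
Proof.
suff h n : diffn n (@sin R) /\ diffn n (@cos R) by split => n; have [] := h n.
elim: n => // n [IHs IHc]; split.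
  exists cos => // y; apply: is_derive_wderiv; exact: is_derive_sin.
exists (fun y => - sin y); last exact: diffnN.
by move=> y; apply: is_derive_wderiv; exact: is_derive_cos.
Qed.

Lemma deriv_of_derive1 f f' : deriv_of f f' -> f^`()%classic = f'.
Proof.
move=> h; apply/funext => y.
have hd := @wderiv_is_derive _ f y (f' y) 1 setT ltr01 (fun _ _ => I) (h y).
by rewrite derive1E; exact: derive_val.
Qed.

Lemma smooth_derive1n f : smooth f -> forall j,
  deriv_of (derive1n j f) (derive1n j.+1 f) /\ smooth (derive1n j f).
Proof.
move=> cf j; have main g : smooth g -> deriv_of g g^`()%classic /\ smooth g^`()%classic.
  move=> cg; have [g' hg _] := cg 1%N.
  have E := deriv_of_derive1 hg; rewrite E; split=> //; exact: smooth_derive hg.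
have sm : smooth (derive1n j f).
  by elim: j => [//|j IH]; rewrite derive1nS; exact: (main _ IH).2.
by split => //; rewrite derive1nS; exact: (main _ sm).1.
Qed.

Lemma smooth_continuous f : smooth f -> continuous f.
Proof. by move=> /(_ 1%N)[f' h _]; exact: wderiv_continuous h. Qed.

Lemma smooth_chain f F : F 0%N = f -> (forall j, deriv_of (F j) (F j.+1)) ->
  smooth f.
Proof.
move=> <- h n; have g j : diffn n (F j); last exact: g.
by elim: n j => // n IH j; exists (F j.+1).
Qed.

End SmoothFunctions.

(** * Choice of the weights and of the parameters of the iteration *)

Section Weights.
Context {R : realType}.

(** As a function of lam in [0, 1], the convex (1 + lam n)^j lies below its chord between 0 and 1;
    the induction on j proves this chord inequality. *)
Lemma pweight_le (lam : R) j n : 0 <= lam <= 1 ->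
  pweight lam j n <= 1 + lam * (2 ^+ j * (1 + n%:R ^+ j)).
Proof.
move=> /andP[l0 l1]; rewrite /pweight.
have n0 : 0 <= n%:R :> R by [].
have step : (1 + lam * n%:R) ^+ j <= 1 + lam * ((1 + n%:R) ^+ j - 1).
  elim: j => [|j IH]; first by rewrite !expr0 subrr mulr0 addr0.
  rewrite exprSr; apply: le_trans (ler_wpM2r _ IH) _; first by rewrite addr_ge0// mulr_ge0.
  set z := (1 + n%:R) ^+ j; have z1 : 1 <= z by apply: exprn_ege1; rewrite lerDl.
  rewrite exprSr -/z -subr_ge0.
  have -> : 1 + lam * (z * (1 + n%:R) - 1) - (1 + lam * (z - 1)) * (1 + lam * n%:R) =
    lam * ((1 - lam) * ((z - 1) * n%:R)) by ring.
  by rewrite !mulr_ge0// subr_ge0.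
apply: le_trans step _; rewrite lerD2l ler_wpM2l//.
apply: (@le_trans _ _ ((1 + n%:R) ^+ j)); first by rewrite gerBl.
have [->|n1] := posnP n.
  rewrite addr0 expr1n mulrDr mulr1 (@le_trans _ _ (2 ^+ j))//; first by rewrite exprn_ege1// ler1n.
  by rewrite lerDl mulr_ge0// exprn_ge0.
have hn : 1 <= n%:R :> R by rewrite ler1n.
apply: (@le_trans _ _ ((2 * n%:R) ^+ j)).
  by apply: lerXn2r; rewrite ?nnegrE ?addr_ge0 ?mulr_ge0//; lra.
by rewrite exprMn ler_wpM2l ?exprn_ge0// lerDr.
Qed.

Lemma nrm_linear (w1 w2 : nat -> R) (a b : R) (l : seq (@atom R)) :
  nrm (fun n => a * w1 n + b * w2 n) l = a * nrm w1 l + b * nrm w2 l.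
Proof.
rewrite /nrm !mulr_sumr -big_split; apply: eq_bigr => x _ /=.
by rewrite mulrDl !mulrA.
Qed.

(* The weights [(1 + lam n) ^ j] tend to 1 with [lam], so the smallness needed by
   the iteration can be met by the same time interval for all orders [j]. *)
Lemma small_weights (Q : seq (@atom R) -> Prop) (T : R) (C : nat -> R) :
  (forall s, 0 <= C s) ->
  (forall l, Q l -> wfl T l /\ forall s, nrm (fun n => n%:R ^+ s) l <= C s) ->
  exists lam : nat -> R, forall j, 0 < lam j /\ forall l, Q l ->
    nrm (pweight (lam j) j) l <= C 0%N + 1 /\
    nrm (fun n => pweight (lam j) j n * n%:R ^+ 2) l <= C 2%N + 1.
Proof.
move=> C0 hQ.
pose Z j : R := 2 ^+ j * (C 0%N + C j + (C 2%N + C (j + 2)%N)).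
have Z0 j : 0 <= Z j by rewrite mulr_ge0 ?exprn_ge0// !addr_ge0.
exists (fun j => (1 + Z j)^-1) => j.
have Z1 : 0 < 1 + Z j by rewrite ltr_pwDl.
split=> [|l /hQ[hl hC]]; first by rewrite invr_gt0.
set lam := _^-1; have lam0 : 0 < lam by rewrite invr_gt0.
have lam1 : lam <= 1 by rewrite invf_le1// lerDl.
have lamZ : lam * Z j <= 1.
  by rewrite /lam mulrC ler_pdivrMr// mul1r lerDr.
have pw n : pweight lam j n <= 1 + lam * (2 ^+ j * (1 + n%:R ^+ j)).
  by apply: pweight_le; rewrite (ltW lam0).
have p2 : 0 <= 2 ^+ j :> R by rewrite exprn_ge0.
have h2 : 0 <= lam * 2 ^+ j by rewrite mulr_ge0// ltW.
have aux s : nrm (fun n => (1 + lam * (2 ^+ j * (1 + n%:R ^+ j))) * n%:R ^+ s) l <=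
    C s + lam * (2 ^+ j * (C s + C (j + s)%N)).
  have -> : (fun n => (1 + lam * (2 ^+ j * (1 + n%:R ^+ j))) * n%:R ^+ s) =
    (fun n : nat => (1 + lam * 2 ^+ j) * n%:R ^+ s + (lam * 2 ^+ j) * n%:R ^+ (j + s)) :> (_ -> R).
    by apply/funext => n; rewrite exprD; ring.
  rewrite nrm_linear; apply: (@le_trans _ _ ((1 + lam * 2 ^+ j) * C s + (lam * 2 ^+ j) * C (j + s)%N)).
    by apply: lerD; apply: ler_wpM2l => //; rewrite addr_ge0.
  by rewrite le_eqVlt; apply/orP; left; apply/eqP; ring.
have fin s : C s + C (j + s)%N <= C 0%N + C j + (C 2%N + C (j + 2)%N) ->
    C s + lam * (2 ^+ j * (C s + C (j + s)%N)) <= C s + 1.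
  move=> h; rewrite lerD2l; apply: le_trans lamZ; rewrite ler_wpM2l ?(ltW lam0)//.
  by rewrite ler_wpM2l.
split.
- apply: le_trans (fin 0%N _); last by rewrite addn0 lerDl addr_ge0.
  apply: le_trans (aux 0%N); rewrite -[leRHS]mul1r; apply: (@nrm_le _ T _ _ 1 l) => //.
  by move=> n; rewrite mul1r expr0 mulr1.
- apply: le_trans (fin 2%N _); last by rewrite lerDr addr_ge0.
  apply: le_trans (aux 2%N); rewrite -[leRHS]mul1r; apply: (@nrm_le _ T _ _ 1 l) => //.
  by move=> n; rewrite mul1r ler_wpM2r ?exprn_ge0.
Qed.

(** Let xi, xi_y and be have size s^2 and xi_yy size s. Then zeta has size s, while [cG], quadratic
    in zeta and linear in the smaller quantities, has size s^2, so that mu^-1 cG stays below e2 = s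
    once s is small. Q collects the conditions on s = 1 / Q. The time is chosen afterwards, small
    with respect to s, and Z collects its conditions. *)
Lemma small_parameters (kb pb qb k2b mu nu L0 r : R) : 1 <= kb -> 0 <= pb -> 0 <= qb -> 0 <= k2b ->
  0 < mu -> 0 < nu -> 0 < L0 -> 0 < r ->
  exists e1 e2 b b0 T0 : R, [/\ [/\ 0 < e1, 0 < e2, 0 < b, 0 < b0 & 0 < T0],
    [/\ e1 <= r, b <= r, cA e1 e2 b pb qb <= r & kb * cA e1 e2 b pb qb * (2 * kb) <= kb] &
    forall T, 0 < T <= T0 -> let s1 := Num.sqrt (T / mu) in
    [/\ T * k2b + mu^-1 * cG mu e1 e2 b kb pb qb <= e2,
        s1 * (kb + cG mu e1 e2 b kb pb qb) <= e1,
        T * (kb + cG mu e1 e2 b kb pb qb) <= e1,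
        T <= s1 ^+ 2 * mu &
        b0 + (pi / L0 * (b * b) + (nu / L0 * (2 * pi * (e1 * kb) * b) +
          nu / L0 * (T * (2 * pi * (2 * kb * kb) * b)))) <= b]].
Proof.
move=> kb1 pb0 qb0 k2b0 mu0 nu0 L00 r0.
have kb0 : 0 <= kb by rewrite (le_trans ler01).
have pi0 : 0 <= pi :> R by exact: pi_ge0.
pose a := 2 + qb * (1 + pb).
have a0 : 0 <= a by rewrite addr_ge0// mulr_ge0// addr_ge0.
pose g := mu * pb + 2 * kb ^+ 2 + 2 * kb ^+ 3 * a ^+ 2.
have g0 : 0 <= g by rewrite !addr_ge0// !mulr_ge0// ?exprn_ge0// ltW.
pose z := pi / L0 + nu / L0 * (2 * pi * kb).
have z0 : 0 <= z by rewrite addr_ge0 ?divr_ge0 ?mulr_ge0 ?(ltW L00) ?(ltW nu0)// invr_ge0 ltW.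
pose Q := 1 + (r^-1 * (1 + a) + (2 * (mu^-1 * g) + (2 * (a * kb) + 4 * z))).
have t1 : 0 <= r^-1 * (1 + a) by apply: mulr_ge0; [rewrite invr_ge0 ltW|apply: addr_ge0].
have t2 : 0 <= mu^-1 * g by rewrite mulr_ge0// invr_ge0 ltW.
have t3 : 0 <= a * kb by rewrite mulr_ge0.
have Q1 : 1 <= Q by rewrite /Q; lra.
have Q0 : 0 < Q by rewrite (lt_le_trans ltr01).
pose s := Q^-1; have s0 : 0 < s by rewrite invr_gt0.
have sX X : X <= Q -> s * X <= 1 by move=> h; rewrite mulrC ler_pdivrMr// mul1r.
have s1 : s <= 1 by rewrite invf_le1.
have k1 : s * (r^-1 * (1 + a)) <= 1 by apply: sX; rewrite /Q; lra.
have k2 : s * (2 * (mu^-1 * g)) <= 1 by apply: sX; rewrite /Q; lra.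
have k3 : s * (2 * (a * kb)) <= 1 by apply: sX; rewrite /Q; lra.
have k4 : s * (4 * z) <= 1 by apply: sX; rewrite /Q; lra.
have sr : s * (1 + a) <= r.
  by rewrite -[r]mul1r -ler_pdivrMr// -mulrA [_ / r]mulrC.
have ss : s ^+ 2 <= s by rewrite expr2 -[leRHS]mulr1 ler_wpM2l// ltW.
have s20 : 0 < s ^+ 2 by rewrite exprn_gt0.
pose A := cA (s ^+ 2) s (s ^+ 2) pb qb.
have As : A <= s * a.
  have h1 : pb * s ^+ 2 <= pb * s by rewrite ler_wpM2l.
  have : qb * (s + pb * s ^+ 2) <= qb * (s + pb * s) by rewrite ler_wpM2l// lerD2l.
  have e : s * a = s + (qb * (s + pb * s) + s) by rewrite /a; ring.
  by rewrite e /A /cA => h; rewrite lerD// lerD.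
have A0 : 0 <= A by rewrite /A /cA !addr_ge0// ?mulr_ge0// ?addr_ge0// ?mulr_ge0// ltW.
have A2 : A * A <= s ^+ 2 * a ^+ 2 by rewrite -exprMn -expr2; apply: lerXn2r => //; rewrite nnegrE mulr_ge0// ltW.
pose G := cG mu (s ^+ 2) s (s ^+ 2) kb pb qb.
have Gs : G <= s ^+ 2 * g.
  have e : s ^+ 2 * g = mu * (pb * s ^+ 2) + (kb * kb * (s ^+ 2 + s ^+ 2) + kb * kb * (s ^+ 2 * a ^+ 2) * (2 * kb)).
    by rewrite /g; ring.
  rewrite e /G /cG -/A !lerD2l ler_wpM2r ?mulr_ge0//.
  by rewrite ler_wpM2l// mulr_ge0.
have G0 : 0 <= G.
  by rewrite /G /cG -/A !addr_ge0// !mulr_ge0// ?addr_ge0// ltW.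
have Gg : G <= g.
  apply: le_trans Gs _; rewrite -[leRHS]mul1r ler_wpM2r//.
  exact: le_trans ss s1.
pose H := kb + g; have H0 : 0 <= H by rewrite addr_ge0.
pose u := nu / L0 * (2 * pi * (2 * kb * kb)).
have u0 : 0 <= u by rewrite !mulr_ge0// ?invr_ge0 ltW.
pose Z := 1 + (2 * k2b / s + (H / s ^+ 2 + (H ^+ 2 / (mu * (s ^+ 2) ^+ 2) + 4 * u))).
have y1 : 0 <= 2 * k2b / s by rewrite !mulr_ge0// invr_ge0 ltW.
have y2 : 0 <= H / s ^+ 2 by rewrite mulr_ge0// invr_ge0 ltW.
have y3 : 0 <= H ^+ 2 / (mu * (s ^+ 2) ^+ 2).
  by rewrite mulr_ge0 ?exprn_ge0// invr_ge0 mulr_ge0 ?exprn_ge0// ltW.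
have Z1 : 1 <= Z by rewrite /Z; lra.
have Z0 : 0 < Z by rewrite (lt_le_trans ltr01).
exists (s ^+ 2), s, (s ^+ 2), (s ^+ 2 / 4), (Z^-1).
have sar : s * a <= r by apply: le_trans sr; rewrite ler_pM2l// lerDr.
split.
- by split; rewrite ?divr_gt0 ?invr_gt0.
- have s_r : s <= r by apply: le_trans sr; rewrite -[leLHS]mulr1 ler_pM2l// lerDl.
  split; [exact: le_trans ss _|exact: le_trans ss _|exact: le_trans As _|].
  rewrite -/A; apply: (@le_trans _ _ (kb * (s * a) * (2 * kb))).
    by rewrite ler_wpM2r ?mulr_ge0// ler_wpM2l.
  have -> : kb * (s * a) * (2 * kb) = kb * (s * (2 * (a * kb))) by ring.
  by rewrite -[leRHS]mulr1 ler_wpM2l.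
move=> T /andP[T0 TZ] q1.
have TX X : X <= Z -> T * X <= 1.
  move=> XZ; have [X0|X0] := leP 0 X; last by rewrite (le_trans _ ler01)// pmulr_rle0// ltW.
  apply: (@le_trans _ _ (Z^-1 * Z)); last by rewrite mulVf// gt_eqF.
  by apply: ler_pM => //; exact: ltW.
have l1 : T * (2 * k2b / s) <= 1 by apply: TX; rewrite /Z; lra.
have l2 : T * (H / s ^+ 2) <= 1 by apply: TX; rewrite /Z; lra.
have l3 : T * (H ^+ 2 / (mu * (s ^+ 2) ^+ 2)) <= 1 by apply: TX; rewrite /Z; lra.
have l4 : T * (4 * u) <= 1 by apply: TX; rewrite /Z; lra.
have kG : kb + G <= H by rewrite lerD2l.
have kG0 : 0 <= kb + G by rewrite addr_ge0.
rewrite -/G; split.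
- have h1 : T * k2b <= s / 2.
    have := ler_wpM2r (ltW s0) l1; rewrite mul1r.
    have -> : T * (2 * k2b / s) * s = 2 * (T * k2b) by field; rewrite gt_eqF.
    by lra.
  have h2 : mu^-1 * G <= s / 2.
    apply: (@le_trans _ _ (mu^-1 * (s ^+ 2 * g))); first by rewrite ler_wpM2l// invr_ge0 ltW.
    have := ler_wpM2r (ltW s0) k2; rewrite mul1r.
    have -> : s * (2 * (mu^-1 * g)) * s = 2 * (mu^-1 * (s ^+ 2 * g)) by ring.
    by lra.
  by lra.
- apply: (@le_trans _ _ (q1 * H)); first by rewrite ler_wpM2l// sqrtr_ge0.
  have hT : 0 <= T / mu by apply: divr_ge0; exact: ltW.
  rewrite -(@ler_pXn2r _ 2)//; last 2 first.
  + by rewrite nnegrE mulr_ge0// sqrtr_ge0.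
  + by rewrite nnegrE ltW.
  rewrite exprMn /q1 sqr_sqrtr//.
  have := ler_wpM2r (ltW (exprn_gt0 2 s20)) l3; rewrite mul1r.
  have -> // : T * (H ^+ 2 / (mu * (s ^+ 2) ^+ 2)) * (s ^+ 2) ^+ 2 = T / mu * H ^+ 2.
  by field; rewrite !gt_eqF.
- apply: (@le_trans _ _ (T * H)); first by rewrite ler_wpM2l// ltW.
  have := ler_wpM2r (ltW s20) l2; rewrite mul1r.
  by have -> // : T * (H / s ^+ 2) * s ^+ 2 = T * H by field; rewrite gt_eqF.
- by rewrite /q1 sqr_sqrtr ?divr_ge0// ?(ltW T0) ?(ltW mu0)// divfK// gt_eqF.
- have -> : s ^+ 2 / 4 + (pi / L0 * (s ^+ 2 * s ^+ 2) + (nu / L0 * (2 * pi * (s ^+ 2 * kb) * s ^+ 2) +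
    nu / L0 * (T * (2 * pi * (2 * kb * kb) * s ^+ 2)))) =
    s ^+ 2 / 4 + (s ^+ 2 * (s ^+ 2 * z) + s ^+ 2 * (T * u)).
    by rewrite /z /u; ring.
  have h1 : s ^+ 2 * z <= 1 / 4.
    apply: (@le_trans _ _ (s * z)); first by rewrite ler_wpM2r.
    by move: k4; lra.
  have h2 : T * u <= 1 / 4 by lra.
  have := ler_wpM2l (ltW s20) h1; have := ler_wpM2l (ltW s20) h2.
  by lra.
Qed.

End Weights.

Section UniformSolution.
Context {R : realType}.
Variables (k p q : R -> R) (mu nu L0 : R).
Hypotheses (ck : smooth k) (cp : smooth p) (cq : smooth q).
Hypotheses (pk : forall y, k (y + 2 * pi) = k y) (pp : forall y, p (y + 2 * pi) = p y)
  (pq : forall y, q (y + 2 * pi) = q y).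
Hypotheses (mu0 : 0 < mu) (nu0 : 0 < nu) (L00 : 0 < L0).
Hypothesis (kq : forall y, k y ^+ 2 * q y = mu).

(** The time, the threshold for W and all bounds are determined by the Fourier data of k, p and q
    and by r before W is given; W enters through its supremum. *)
Theorem uniform_solution (r : R) : 0 < r ->
  exists (T0 b0 : R) (XB KB : nat -> R), [/\ 0 < T0, 0 < b0 &
  forall T W, 0 < T <= T0 -> continuous W -> (forall t, 0 <= t <= T -> `|W t| <= b0) ->
  exists (xi ka : nat -> R -> R -> R) (be J : R -> R),
  [/\ [/\ forall j, cont_on (slab T) (fun q => xi j q.1 q.2),
          forall j, cont_on (slab T) (fun q => ka j q.1 q.2),
          forall j t y, 0 <= t <= T -> `|xi j t y| <= XB j,
          forall j t y, 0 <= t <= T -> `|ka j t y| <= KB j &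
          cont_on (`[0, T]%classic : set R) be],
      [/\ forall j t y, 0 <= t <= T -> wderiv setT (xi j t) y (xi j.+1 t y),
          forall j t y, 0 <= t <= T -> wderiv setT (ka j t) y (ka j.+1 t y),
          forall j t y, xi j t (y + 2 * pi) = xi j t y &
          forall j t y, ka j t (y + 2 * pi) = ka j t y],
      [/\ forall j t y, 0 <= t <= T -> wderiv `[0, T]%classic (fun s => xi j s y) t (- ka j t y),
          forall j y, xi j 0 y = 0 &
          forall t y, 0 <= t <= T -> ka 0%N t y = k y - k y *
            (xi 0%N t y + q y * (xi 2%N t y - p y * xi 1%N t y) + be t) * ka 0%N t y],
      [/\ forall t, 0 <= t <= T -> be t = W t - pi / L0 * (be t) ^+ 2
            - nu / L0 * (int2pi (fun y => xi 0%N t y * k y) * be t) - nu / L0 * J t,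
          J 0 = 0 &
          forall t, 0 <= t <= T -> wderiv `[0, T]%classic J t
            (int2pi (fun y => ka 0%N t y * k y) * be t)] &
      forall t y, 0 <= t <= T -> [/\ `|be t| <= r, `|xi 0%N t y| <= r, `|xi 1%N t y| <= r &
        `|xi 0%N t y + q y * (xi 2%N t y - p y * xi 1%N t y) + be t| <= r]]].
Proof.
move=> r0.
have dk := smooth_derive1n ck; have dp := smooth_derive1n cp; have dq := smooth_derive1n cq.
have dk' j := (dk j).1; have dp' j := (dp j).1; have dq' j := (dq j).1.
have [Bk Bk0 hBk] := fourier_inversion (f := fun j => derive1n j k) dk' pk.
have [Bp Bp0 hBp] := fourier_inversion (f := fun j => derive1n j p) dp' pp.
have [Bq Bq0 hBq] := fourier_inversion (f := fun j => derive1n j q) dq' pq.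
pose kd := flist (fun j => derive1n j k); pose pd := flist (fun j => derive1n j p).
pose qd := flist (fun j => derive1n j q).
have wf T f m : wfl T (@flist R f m) by exact: flist_wf.
have [Ck hCk] := choice (flist_nrm (f := fun j => derive1n j k) dk' pk).
have [Cp hCp] := choice (flist_nrm (f := fun j => derive1n j p) dp' pp).
have [Cq hCq] := choice (flist_nrm (f := fun j => derive1n j q) dq' pq).
have nn s f m : 0 <= nrm (fun n => n%:R ^+ s) (@flist R f m).
  by apply: (@nrm_ge0 _ 1) => // n; rewrite exprn_ge0.
have Ck0 s : 0 <= Ck s := le_trans (nn s _ 0%N) (hCk s 0%N).
have Cp0 s : 0 <= Cp s := le_trans (nn s _ 0%N) (hCp s 0%N).
have Cq0 s : 0 <= Cq s := le_trans (nn s _ 0%N) (hCq s 0%N).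
pose C s := Ck s + Cp s + Cq s.
have C0 s : 0 <= C s by rewrite !addr_ge0.
pose Q l := exists m, [\/ l = kd m, l = pd m | l = qd m].
have hQ l : Q l -> wfl 1 l /\ forall s, nrm (fun n => n%:R ^+ s) l <= C s.
  move=> [m hm]; split; first by case: hm => ->; exact: wf.
  move=> s; case: hm => ->.
  - by apply: le_trans (hCk s m) _; rewrite /C -addrA lerDl addr_ge0.
  - by apply: le_trans (hCp s m) _; rewrite /C addrAC lerDr addr_ge0.
  - by apply: le_trans (hCq s m) _; rewrite /C lerDr addr_ge0.
have [lam hlam] := small_weights C0 hQ.
have Qk m : Q (kd m) by exists m; constructor 1.
have Qp m : Q (pd m) by exists m; constructor 2.
have Qq m : Q (qd m) by exists m; constructor 3.
pose kb := C 0%N + 1; pose k2b := C 2%N + 1.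
have kb1 : 1 <= kb by rewrite lerDr.
have kb0 : 0 <= kb := le_trans ler01 kb1.
have k2b0 : 0 <= k2b by rewrite addr_ge0.
have [e1 [e2 [b [b0 [T0 [[e10 e20 b_0 b00 T00] [e1r br Ar H1] HT]]]]]] :=
  small_parameters kb1 kb0 kb0 k2b0 mu0 nu0 L00 r0.
exists T0, b0, (xi_bound e1 e2 lam), (ka_bound kb lam); split => // T W TT cW W_le.
have /andP[Tp _] := TT; have [H2 H3 H4 Hs H5] := HT T TT.
pose Bd n := Bk n + Bp n + Bq n.
have Bd0 : Bd @ \oo --> 0.
  rewrite [X in _ --> X](_ : 0 = 0 + 0 + 0); last by rewrite !addr0.
  by apply: cvgD; [apply: cvgD|].
have B0 (f : nat -> R -> R) (B : nat -> R) (g : R -> R) :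
    (forall m t y, `|ev (flist f m) t y - g y| <= B m) -> forall m, 0 <= B m.
  by move=> h m; exact: le_trans (normr_ge0 _) (h m 0 0).
have Bk' := B0 _ _ _ hBk; have Bp' := B0 _ _ _ hBp; have Bq' := B0 _ _ _ hBq.
have rk m t y : `|ev (kd m) t y - k y| <= Bd m.
  by apply: le_trans (hBk m t y) _; rewrite /Bd -addrA lerDl addr_ge0.
have rp m t y : `|ev (pd m) t y - p y| <= Bd m.
  by apply: le_trans (hBp m t y) _; rewrite /Bd addrAC lerDr addr_ge0.
have rq m t y : `|ev (qd m) t y - q y| <= Bd m.
  by apply: le_trans (hBq m t y) _; rewrite /Bd lerDr addr_ge0.
have lam0 j := (hlam j).1.
have hk j m := ((hlam j).2 _ (Qk m)).1; have hp j m := ((hlam j).2 _ (Qp m)).1.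
have hq j m := ((hlam j).2 _ (Qq m)).1; have hk2 j m := ((hlam j).2 _ (Qk m)).2.
have [xi [ka [be [J [h1 h2 h3 h4]]]]] := @local_solution R T mu nu L0 b0 W kd pd qd k p q
  Tp mu0 nu0 L00 cW (ltW b00) W_le (fun m => wf T _ m) (fun m => wf T _ m) (fun m => wf T _ m)
  (fun m => flist_sub _ m) (fun m => flist_sub _ m) (fun m => flist_sub _ m) Bd Bd0 rk rp rq
  e1 e2 b kb kb kb k2b _ lam lam0 hk hp hq hk2 (ltW e10) (ltW e20) (ltW b_0) (sqrtr_ge0 _)
  H1 H2 H3 H4 Hs H5 kq.
have [c1 c2 bx bk c3] := h1; have [bb eqb J0 dJ] := h4.
exists xi, ka, be, J; split => // t y tT.
have x0 : `|xi 0%N t y| <= e1.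
  by have := bx 0%N t y tT; rewrite /xi_bound /= expr0 invr1 mul1r.
have x1 : `|xi 1%N t y| <= e1 by have := bx 1%N t y tT.
have x2 : `|xi 2%N t y| <= e2 by have := bx 2%N t y tT.
(* The partial sums are bounded by [C 0], and their error is at most 1 for some m, which the summand
   1 in [kb] covers. *)
have hev (f : nat -> R -> R) (B : nat -> R) (g : R -> R) : B @ \oo --> 0 ->
    (forall m t y, `|ev (flist f m) t y - g y| <= B m) ->
    (forall m, nrm (fun n => n%:R ^+ 0) (flist f m) <= C 0%N) -> `|g y| <= kb.
  move=> hB hf hC.
  have [m hm] := cvg0_eventually hB ltr01.
  have -> : g y = ev (flist f m) 0 y - (ev (flist f m) 0 y - g y) by ring.
  apply: le_trans (ler_normB _ _) _; apply: lerD; last exact: le_trans (hf m 0 y) (hm m _).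
  have t0 : 0 <= (0 : R) <= 1 by rewrite lexx ler01.
  apply: le_trans (hC m); apply: le_trans (ev_le_nrm y t0 (@wf 1 f m)) _.
  by rewrite le_eqVlt; apply/orP; left; apply/eqP; congr nrm; apply/funext => n; rewrite expr0.
have nk (l : seq (@atom R)) : Q l -> nrm (fun n => n%:R ^+ 0) l <= C 0%N by move=> /hQ[].
have qy : `|q y| <= kb by apply: hev Bq0 hBq _ => m; exact: nk (Qq m).
have py : `|p y| <= kb by apply: hev Bp0 hBp _ => m; exact: nk (Qp m).
split; [exact: le_trans (bb t tT) br|exact: le_trans x0 e1r|exact: le_trans x1 e1r|].
apply: le_trans Ar; rewrite /cA -addrA; apply: le_trans (ler_normD _ _) _.
apply: lerD => //; apply: le_trans (ler_normD _ _) _; apply: lerD; last exact: bb.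
rewrite normrM ler_pM//; apply: le_trans (ler_normB _ _) _; apply: lerD => //.
by rewrite normrM ler_pM.
Qed.

End UniformSolution.

Section ClassTools.
Context {R : realType} {I : Type} (T : R) (A : I -> R).
Hypotheses (T0 : 0 < T) (A1 : forall i, 1 <= A i).
Let S := strip T0 A1.

Lemma periodic_bounded (f : R -> R) : continuous f -> (forall y, f (y + 2 * pi) = f y) ->
  exists2 C : R, 0 <= C & forall y, `|f y| <= C.
Proof.
move=> cf pf; have [C C0 hC] := continuous_bounded cf; exists C => // y.
have [y' /andP[y0 y2] <-] := periodic_reduce y 0 pf.
by apply: hC; rewrite y0/= ltW// -[X in _ < X]add0r.
Qed.

Lemma cont_on_snd (f : R -> R) : continuous f -> cont_on (slab T) (fun q => f q.2).
Proof.
move=> cf; apply: cont_onT => q.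
exact: (@continuous_comp _ _ _ snd f q cvg_snd (cf q.2)).
Qed.

Lemma cont_on_fst (f : R -> R) : cont_on (`[0, T]%classic : set R) f ->
  cont_on (slab T) (fun q => f q.1).
Proof.
move=> cf; apply: (cont_on_comp (A := `[0, T]%classic) (f := f) (g := fst)) => //.
by move=> q _; apply: cvg_within_filter; exact: cvg_fst.
Qed.

Lemma wderiv_periodic (f f' : R -> R) : deriv_of f f' -> (forall y, f (y + 2 * pi) = f y) ->
  forall y, f' (y + 2 * pi) = f' y.
Proof.
move=> hf pf y; apply: (@wderiv_uniqueT _ (fun z => f (z + 2 * pi)) y).
  have h : wderiv setT (fun z => z + 2 * pi) y (1 + 0).
    by apply: wderivD; [exact: wderiv_id|exact: wderiv_cst].
  have := @wderiv_comp _ setT setT _ f _ _ _ (fun _ _ => Logic.I) h (hf (y + 2 * pi)).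
  by rewrite addr0 mulr1.
by apply: wderiv_ext (hf y) => z; rewrite pf.
Qed.

Lemma smooth_class_space (f : R -> R) j m : smooth f -> (forall y, f (y + 2 * pi) = f y) ->
  smooth_class S j m 0 (fun _ q => f q.2).
Proof.
move: j m f; apply: class_ind => j m IHm IHj f sf pf.
have cf := smooth_continuous sf.
have [C C0 hC] := periodic_bounded cf pf.
apply/smooth_classE; split.
- split; first by exists C => i q _; rewrite expr0 mulr1.
  by move=> i; exact: cont_on_snd.
- move=> m' mE l; have [f' hf _] := sf 1%N.
  exists (fun _ q => f' q.2); first by move=> i q iq; exact: hf.
  by apply: IHm => //; [exact: smooth_derive sf hf|exact: wderiv_periodic hf pf].
- move=> j' jE; exists (fun _ _ => 0); first by move=> i q iq /=; exact: wderiv_cst.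
  by apply: smooth_class_mono (smooth_class_cst _ _ _ _).
Qed.

(** Meant for the arclength coordinate, which is unbounded but has a periodic derivative. *)
Lemma inner_class_space (f f' : R -> R) j m : deriv_of f f' -> smooth f' ->
  (forall y, f' (y + 2 * pi) = f' y) -> inner_class S j m (fun _ q => f q.2).
Proof.
move=> hf sf pf; split.
- by move=> i; apply: cont_on_snd; exact: wderiv_continuous hf.
- move=> m' mE l; exists (fun _ q => f' q.2); first by move=> i q iq; exact: hf.
  exact: smooth_class_space.
- move=> j' jE; exists (fun _ _ => 0); first by move=> i q iq /=; exact: wderiv_cst.
  by apply: smooth_class_mono (smooth_class_cst _ _ _ _).
Qed.

Lemma strip_comp (f f' : R -> R) j m N (g : I -> R * R -> R) : deriv_of f f' -> smooth f' ->
  (forall y, f' (y + 2 * pi) = f' y) -> (forall m', smooth_class S j m' N g) ->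
  smooth_class S j m N (fun i q => g i (q.1, f q.2)).
Proof.
move=> hf sf pf hg.
have := @smooth_class_comp R I I unit (R * R)%type T A T0 A1 S id fst.
apply=> //; last exact: inner_class_space hf sf pf.
by move=> i; apply: cont_onT => q; exact: cvg_fst.
Qed.

(** One amplitude bounds the forcing together with its derivatives up to order N, so differentiating
    it costs nothing beyond the first factor; [a + j <= N] keeps the derivatives in range. *)
Lemma forcing_class (N : nat) (vd : nat -> I -> R -> R) :
  (forall a i t, (a <= N)%N -> 0 <= t <= T -> `|vd a i t| <= A i) ->
  (forall a i t, 0 <= t <= T -> wderiv `[0, T]%classic (vd a i) t (vd a.+1 i t)) ->
  forall j m a, (a + j <= N)%N -> smooth_class S j m 1 (fun i q => vd a i q.1).
Proof.
move=> hb hd; apply: class_ind => j m IHm IHj a aj; apply/smooth_classE; split.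
- split.
    by exists 1 => i q iq; rewrite expr1 mul1r hb// (leq_trans _ aj)// leq_addr.
  move=> i; apply: cont_on_fst => t; rewrite /= in_itv/= => tT.
  exact: wderiv_cvg (hd a i t tT).
- move=> m' mE l; exists (fun _ _ => 0); first by move=> i q iq /=; exact: wderiv_cst.
  by apply: smooth_class_mono (smooth_class_cst _ _ _ _).
- move=> j' jE; exists (fun i q => vd a.+1 i q.1); first by move=> i q iq; exact: hd.
  by apply: (smooth_class_mono (N := 1%N)) => //; apply: IHj => //; rewrite addSnnS -jE.
Qed.

End ClassTools.

Section SolutionClass.
Context {R : realType} {I : Type} (T : R) (A : I -> R).
Hypotheses (T0 : 0 < T) (A1 : forall i, 1 <= A i).
Let S := strip T0 A1.
Variables (k p q : R -> R) (nu L0 c : R).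
Hypotheses (sk : smooth k) (sp : smooth p) (sq : smooth q).
Hypotheses (pk : forall y, k (y + 2 * pi) = k y) (pp : forall y, p (y + 2 * pi) = p y)
  (pq : forall y, q (y + 2 * pi) = q y).
Hypotheses (L00 : 0 < L0).
Variables (xi ka : nat -> I -> R -> R -> R) (be : I -> R -> R) (vd : nat -> I -> R -> R) (N : nat).
Hypotheses (vb : forall a i t, (a <= N)%N -> 0 <= t <= T -> `|vd a i t| <= A i)
  (dv : forall a i t, 0 <= t <= T -> wderiv `[0, T]%classic (vd a i) t (vd a.+1 i t)).
Variables (XB KB : nat -> R) (r : R).
Hypotheses (cx : forall j i, cont_on (slab T) (fun q => xi j i q.1 q.2))
  (ck : forall j i, cont_on (slab T) (fun q => ka j i q.1 q.2))
  (bx : forall j i t y, 0 <= t <= T -> `|xi j i t y| <= XB j)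
  (bk : forall j i t y, 0 <= t <= T -> `|ka j i t y| <= KB j)
  (bb : forall i t, 0 <= t <= T -> `|be i t| <= r)
  (dx : forall j i t y, 0 <= t <= T -> wderiv setT (xi j i t) y (xi j.+1 i t y))
  (dk : forall j i t y, 0 <= t <= T -> wderiv setT (ka j i t) y (ka j.+1 i t y))
  (tx : forall j i t y, 0 <= t <= T ->
     wderiv `[0, T]%classic (fun s => xi j i s y) t (- ka j i t y)).
Let ze i t y := xi 0%N i t y + q y * (xi 2%N i t y - p y * xi 1%N i t y) + be i t.
Let len i t := L0 + nu * int2pi (fun y => xi 0%N i t y * k y) + 2 * pi * be i t.
Hypotheses (kaE : forall i t y, 0 <= t <= T -> ka 0%N i t y = k y * (1 + k y * ze i t y)^-1)
  (zlow : forall i t y, 0 <= t <= T -> 2^-1 <= 1 + k y * ze i t y)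
  (lenlow : forall i t, 0 <= t <= T -> L0 / 2 <= len i t)
  (tb : forall i t, 0 <= t <= T ->
     wderiv `[0, T]%classic (be i) t ((2 * pi - c * vd 0%N i t) / len i t)).

(** Order j + 1 is reached for xi, then be, then ka: the time derivative of xi is - ka, of order j
    and free of [v]; that of be is a quotient with one factor [v] and everything else of order j; ka
    is algebraic in xi and be, and its derivatives in y are read off the class of ka itself. *)
Lemma solution_class j : (j <= N)%N ->
  [/\ forall m n, smooth_class S j m 0 (fun i q => xi n i q.1 q.2),
      forall m n, smooth_class S j m 0 (fun i q => ka n i q.1 q.2) &
      forall m, smooth_class S j m 0 (fun i q => be i q.1)].
Proof.
elim: j => [|j IH] jN.
  suff h : (forall m n, smooth_class S 0 m 0 (fun i q => xi n i q.1 q.2)) /\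
      forall m n, smooth_class S 0 m 0 (fun i q => ka n i q.1 q.2).
    split; [exact: h.1|exact: h.2|].
    move=> m; apply/smooth_classE; split => //.
    - split; first by exists r => i s iq; rewrite expr0 mulr1 bb.
      move=> i; apply: cont_on_fst => t; rewrite /= in_itv/= => tT.
      have htb := @tb i t tT; exact: (wderiv_cvg htb).
    - move=> m' mE l; exists (fun _ _ => 0); first by move=> i s iq /=; exact: wderiv_cst.
      by apply: smooth_class_mono (smooth_class_cst _ _ _ _).
  split; elim=> [|m IHm] n; apply/smooth_classE; split => //.
  - split; [by exists (XB n) => i s iq; rewrite expr0 mulr1 bx|by move=> i; exact: cx].
  - split; [by exists (XB n) => i s iq; rewrite expr0 mulr1 bx|by move=> i; exact: cx].
  - move=> m' [<-] l; exists (fun i s => xi n.+1 i s.1 s.2) => // i s iq; exact: dx.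
  - split; [by exists (KB n) => i s iq; rewrite expr0 mulr1 bk|by move=> i; exact: ck].
  - split; [by exists (KB n) => i s iq; rewrite expr0 mulr1 bk|by move=> i; exact: ck].
  - move=> m' [<-] l; exists (fun i s => ka n.+1 i s.1 s.2) => // i s iq; exact: dk.
have {IH}[IHx IHk IHb] := IH (ltnW jN).
have ks j' m : smooth_class S j' m 0 (fun _ s => k s.2) by exact: smooth_class_space.
have ps j' m : smooth_class S j' m 0 (fun _ s => p s.2) by exact: smooth_class_space.
have qs j' m : smooth_class S j' m 0 (fun _ s => q s.2) by exact: smooth_class_space.
have cs j' m (x : R) : smooth_class S j' m 0 (fun _ _ => x) by exact: smooth_class_cst.
have Cx m n : smooth_class S j.+1 m 0 (fun i q => xi n i q.1 q.2).
  elim: m n => [|m IHm] n; apply/smooth_classE; split => //.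
  - split; [by exists (XB n) => i s iq; rewrite expr0 mulr1 bx|by move=> i; exact: cx].
  - move=> j' [<-]; exists (fun i s => - ka n i s.1 s.2); first by move=> i s iq; exact: tx.
    by apply: (smooth_class_mono (N := 0%N)) => //; exact: smooth_classN.
  - split; [by exists (XB n) => i s iq; rewrite expr0 mulr1 bx|by move=> i; exact: cx].
  - move=> m' [<-] l; exists (fun i s => xi n.+1 i s.1 s.2) => // i s iq; exact: dx.
  - move=> j' [<-]; exists (fun i s => - ka n i s.1 s.2); first by move=> i s iq; exact: tx.
    by apply: (smooth_class_mono (N := 0%N)) => //; exact: smooth_classN.
have Cl m : smooth_class S j m 0 (fun i s => len i s.1).
  apply: smooth_classD; last exact: (smooth_classM (cs _ _ _)).
  apply: smooth_classD => //; apply: (smooth_classM (cs _ _ _)).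
  apply: (smooth_class_int (f := fun i s => xi 0%N i s.1 s.2 * k s.2)).
  exact: (smooth_classM (IHx _ _) (ks _ _)).
have Cb m : smooth_class S j.+1 m 0 (fun i q => be i q.1).
  apply/smooth_classE; split => //.
  - split; first by exists r => i s iq; rewrite expr0 mulr1 bb.
    move=> i; apply: cont_on_fst => t; rewrite /= in_itv/= => tT.
    have htb := @tb i t tT; exact: (wderiv_cvg htb).
  - move=> m' mE l; exists (fun _ _ => 0); first by move=> i s iq /=; exact: wderiv_cst.
    exact: cs.
  - move=> j' [<-].
    exists (fun i s => (2 * pi - c * vd 0%N i s.1) / len i s.1); first by move=> i s iq; exact: tb.
    have L2 : 0 < L0 / 2 by rewrite divr_gt0.
    have LV : smooth_class S j m 0 (fun i s => (len i s.1)^-1).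
      by apply: (smooth_classV L2) => // i s iq; exact: lenlow.
    apply: (@smooth_classM _ _ _ _ _ _ _ 1 0) => //; apply: smooth_classB.
      by apply: (smooth_class_mono (N := 0%N)).
    apply: (@smooth_classM _ _ _ _ _ _ _ 0 1) => //.
    by apply: (forcing_class T0 A1 vb dv); rewrite add0n ltnW.
have Ck0 m : smooth_class S j.+1 m 0 (fun i q => ka 0%N i q.1 q.2).
  apply: (smooth_class_ext (f := fun i s => k s.2 * (1 + k s.2 * ze i s.1 s.2)^-1)).
    by move=> i s iq; rewrite kaE.
  have Cz : smooth_class S j.+1 m 0 (fun i s => ze i s.1 s.2).
    apply: smooth_classD => //; apply: smooth_classD => //.
    by apply: (smooth_classM (qs _ _)); apply: smooth_classB => //; exact: (smooth_classM (ps _ _)).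
  apply: (smooth_classM (ks _ _)); apply: (@smooth_classV _ _ _ _ _ 2^-1) => //.
    by move=> i s iq; exact: zlow.
  by apply: smooth_classD => //; exact: (smooth_classM (ks _ _)).
split=> // m n; elim: n m => // n IHn m.
apply: (smooth_class_dx (l := tt) (IHn m.+1)).
by move=> i s iq; exact: dk.
Qed.

End SolutionClass.

(** * Curves parametrized by their normal angle *)

Section Integrals.
Context {R : realType}.

Lemma pi2_gt0 : 0 < 2 * pi :> R.
Proof. by rewrite mulr_gt0// pi_gt0. Qed.

Lemma integral_int2pi (f : R -> R) : continuous f ->
  \int[@lebesgue_measure R]_(x in `[0, 2 * pi]) f x = int2pi f.
Proof.
move=> cf; rewrite /Rintegral.
have hF (t : R) : is_derive t 1 (prim f) (f t) by exact: prim_derive.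
rewrite (@continuous_FTC2 R f (prim f) 0 (2 * pi)).
- by rewrite (prim0 cf) sube0.
- exact: pi2_gt0.
- by apply: continuous_subspaceT; exact: cf.
- split.
  + by move=> t _; have [] := hF t.
  + by apply: cvg_at_right_filter; exact: prim_continuous.
  + by apply: cvg_at_left_filter; exact: prim_continuous.
- by move=> t _; rewrite derive1E; exact: (@derive_val _ _ _ _ _ _ _ (hF t)).
Qed.

Lemma deriv_of_cst0 (f : R -> R) : deriv_of f (fun=> 0) -> forall x y, f x = f y.
Proof.
move=> h x y; apply/eqP; rewrite -subr_eq0 -normr_le0.
have := @wderiv_le_norm _ setT f (fun=> 0) y x 0 (fun _ _ => I) (fun s _ => h s).
by rewrite mul0r; apply => s _; rewrite normr0.
Qed.

Lemma deriv_of_is_derive (f f' : R -> R) : deriv_of f f' -> forall t : R, is_derive t 1 f (f' t).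
Proof. by move=> h t; apply: (@wderiv_is_derive _ f t (f' t) 1 setT). Qed.

Lemma is_derive_deriv_of (f f' : R -> R) : (forall t : R, is_derive t 1 f (f' t)) -> deriv_of f f'.
Proof. by move=> h t; exact: is_derive_wderiv. Qed.

Lemma sin_per (x : R) : sin (x + 2 * pi) = sin x.
Proof. by rewrite [2 * pi]mulrC mulr_natr sinD2pi. Qed.

Lemma cos_per (x : R) : cos (x + 2 * pi) = cos x.
Proof. by rewrite [2 * pi]mulrC mulr_natr cosD2pi. Qed.

Lemma deriv_of_sin : deriv_of (@sin R) cos.
Proof. by apply: is_derive_deriv_of => t; exact: is_derive_sin. Qed.

Lemma deriv_of_cos : deriv_of (@cos R) (fun t => - sin t).
Proof. by apply: is_derive_deriv_of => t; exact: is_derive_cos. Qed.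

End Integrals.

Section SupportLine.
Context {R : realType}.
Variables (X : R -> R * R) (rho : R -> R).
Hypotheses (d1 : deriv_of (fun a => (X a).1) (fun a => - (rho a * sin a)))
  (d2 : deriv_of (fun a => (X a).2) (fun a => rho a * cos a))
  (perX : forall a, X (a + 2 * pi) = X a).

(* The defect of this inequality is the one of the curve with radius of
   curvature [rho - r0], that is of an inner parallel curve. *)
Lemma support_line (r0 : R) : (forall a, r0 <= rho a) -> forall s th,
  dotp (X s - X th) (normal th) <= - (r0 * (1 - cos (s - th))).
Proof.
move=> hr s th.
pose g a := (X (th + a) - X th).1 * cos th + (X (th + a) - X th).2 * sin th + r0 * (1 - cos a).
have pg a : g (a + 2 * pi) = g a by rewrite /g addrA perX cos_per.
suff h a : 0 <= a <= 2 * pi -> g a <= 0.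
  have [y /andP[y0 y2] gE] := periodic_reduce (s - th) 0 pg.
  have := h y; rewrite y0 /= -[2 * pi]add0r ltW// => /(_ isT).
  by rewrite gE /g [th + _]addrC subrK /dotp /normal/=; lra.
have dg : deriv_of g (fun a => - ((rho (th + a) - r0) * sin a)).
  move=> {}a.
  have sh : deriv_of (fun a => th + a) (fun=> 1).
    move=> b; rewrite -[1]add0r; apply: wderivD; [exact: wderiv_cst|exact: wderiv_id].
  have e1 := @deriv_of_comp _ _ _ _ _ sh d1 a; have e2 := @deriv_of_comp _ _ _ _ _ sh d2 a.
  have e3 := wderivM (wderivB e1 (wderiv_cst setT (X th).1 a)) (wderiv_cst setT (cos th) a).
  have e4 := wderivM (wderivB e2 (wderiv_cst setT (X th).2 a)) (wderiv_cst setT (sin th) a).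
  have e5 := wderivZ setT r0 (wderivB (wderiv_cst setT 1 a) (@deriv_of_cos R a)).
  have := wderivD (wderivD e3 e4) e5; rewrite !subr0 !mulr1 !mulr0 !addr0 sub0r opprK.
  have -> // : - (rho (th + a) * sin (th + a)) * cos th + rho (th + a) * cos (th + a) * sin th +
      r0 * sin a = - ((rho (th + a) - r0) * sin a).
  have -> : sin a = sin (th + a) * cos th - cos (th + a) * sin th.
    by rewrite -sinB addrAC subrr add0r.
  by ring.
have g0 : g 0 = 0 by rewrite /g addr0 subrr cos0/= subrr !mul0r mulr0 !addr0.
have g2 : g (2 * pi) = 0 by rewrite -[2 * pi]add0r pg.
move=> /andP[a0 a2]; have [ap|pa] := leP a pi.
  rewrite -oppr_ge0 -[leLHS]oppr0 -g0.
  apply: (@wderiv_ge0_le _ setT (fun a => - g a) (fun a => (rho (th + a) - r0) * sin a)) => //.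
    by move=> b _; have := wderivN (dg b); rewrite opprK.
  move=> b /andP[b0 ba]; rewrite mulr_ge0 ?subr_ge0// sin_ge0_pi//.
  by rewrite b0 (le_trans ba).
rewrite -g2; apply: (@wderiv_ge0_le _ setT g (fun a => - ((rho (th + a) - r0) * sin a))) => //.
move=> b /andP[b0 ba]; rewrite -mulrN mulr_ge0 ?subr_ge0// -sinN.
rewrite -sin_per sin_ge0_pi//; apply/andP; split; lra.
Qed.

End SupportLine.

Section CurveCalculus.
Context {R : realType}.
Implicit Types (X : R -> R * R) (rho : R -> R).

(** The derivative of X is rho times the tangent, rho being the radius of curvature: in the normal
    angle, the geometry of the curve becomes algebra in one positive periodic function. *)
Definition gauss_radius X rho : Prop :=
  [/\ deriv_of (fun a => (X a).1) (fun a => - (rho a * sin a)),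
      deriv_of (fun a => (X a).2) (fun a => rho a * cos a),
      (forall a, X (a + 2 * pi) = X a), smooth rho & forall a, 0 < rho a].

Lemma coord_dth X m (i : 'I_2) : (fun a => Defs.coord i (dth m X a)) = derive1n m (fun a => Defs.coord i (X a)).
Proof. by apply/funext => a; rewrite /Defs.coord; case: ifP. Qed.

Lemma gauss_radius_smooth X rho : gauss_radius X rho ->
  smooth (fun a => (X a).1) /\ smooth (fun a => (X a).2).
Proof.
move=> [d1 d2 _ sr _]; have [ss sc] := @smooth_trig R.
split=> -[//|n].
- exists (fun a => - (rho a * sin a)) => //; apply: diffnN; apply: diffnM; [exact: sr|exact: ss].
- exists (fun a => rho a * cos a) => //; apply: diffnM; [exact: sr|exact: sc].
Qed.

Lemma gauss_radius_dth1 X rho : gauss_radius X rho -> forall a, dth 1 X a = rho a *: tangent a.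
Proof.
move=> [d1 d2 _ _ _] a; rewrite /dth /= (deriv_of_derive1 d1) (deriv_of_derive1 d2).
by rewrite /tangent -mulrN.
Qed.

Lemma enorm_scale_tangent (x a : R) : 0 <= x -> enorm (x *: tangent a) = x.
Proof.
move=> x0; rewrite /enorm /dotp /tangent /GRing.scale /=.
have -> : x * - sin a * (x * - sin a) + x * cos a * (x * cos a) = x ^+ 2 * (cos a ^+ 2 + sin a ^+ 2).
  by ring.
by rewrite cos2Dsin2 mulr1 sqrtr_sqr ger0_norm.
Qed.

Lemma gauss_radius_speed X rho : gauss_radius X rho -> speed X = rho.
Proof.
move=> h; apply/funext => a; rewrite /speed (gauss_radius_dth1 h) enorm_scale_tangent//.
by have [_ _ _ _ /(_ a)/ltW] := h.
Qed.

Lemma gauss_radius_curv X rho : gauss_radius X rho -> forall a, curv X a = (rho a)^-1.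
Proof.
move=> h a; rewrite /curv (gauss_radius_speed h) (gauss_radius_dth1 h).
have [d1 d2 _ sr rp] := h; have [rho' hr _] := sr 1%N.
have r0 : rho a != 0 by rewrite gt_eqF.
have -> : dth 2 X a = (- (rho' a * sin a + rho a * cos a), rho' a * cos a + rho a * - sin a).
  rewrite /dth !derive1nS /= (deriv_of_derive1 d1) (deriv_of_derive1 d2).
  rewrite (@deriv_of_derive1 _ _ (fun a => - (rho' a * sin a + rho a * cos a))); last first.
    by move=> b; apply: wderivN; apply: wderivM; [exact: hr|exact: deriv_of_sin].
  rewrite (@deriv_of_derive1 _ _ (fun a => rho' a * cos a + rho a * - sin a))//.
  by move=> b; apply: wderivM; [exact: hr|exact: deriv_of_cos].
rewrite /tangent /GRing.scale /=.
have -> : rho a * - sin a * (rho' a * cos a + rho a * - sin a) -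
  rho a * cos a * - (rho' a * sin a + rho a * cos a) = rho a ^+ 2 * (cos a ^+ 2 + sin a ^+ 2) by ring.
by rewrite cos2Dsin2 mulr1; field.
Qed.

Lemma gauss_radius_periodic X rho : gauss_radius X rho -> forall a, rho (a + 2 * pi) = rho a.
Proof.
move=> h a; have [d1 d2 pX _ _] := h.
have p1 b : (X (b + 2 * pi)).1 = (X b).1 by rewrite pX.
have p2 b : (X (b + 2 * pi)).2 = (X b).2 by rewrite pX.
have e1 := wderiv_periodic d1 p1 a; have e2 := wderiv_periodic d2 p2 a.
rewrite sin_per in e1; rewrite cos_per in e2.
have e r : r = (- (r * sin a)) * - sin a + (r * cos a) * cos a.
  by rewrite mulrNN -!mulrA -mulrDr -!expr2 addrC cos2Dsin2 mulr1.
by rewrite (e (rho (a + _))) e1 e2 -e.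
Qed.

Lemma gauss_radius_lower X rho : gauss_radius X rho ->
  exists2 r0 : R, 0 < r0 & forall a, r0 <= rho a.
Proof.
move=> h; have pr := gauss_radius_periodic h; have [_ _ _ sr rp] := h.
have r0 a : rho a != 0 by rewrite gt_eqF.
have cV : continuous (fun a => (rho a)^-1).
  by move=> a; apply: cvgV => //; exact: smooth_continuous.
have [C C0 hC] := periodic_bounded cV (fun y => congr1 (fun z => z^-1) (pr y)).
have Cp : 0 < C by apply: lt_le_trans (hC 0); rewrite normr_gt0 invr_neq0.
exists C^-1; first by rewrite invr_gt0.
move=> a; rewrite -[rho a]invrK lef_pV2 ?posrE ?invr_gt0//.
by apply: le_trans (hC a); exact: ler_norm.
Qed.

(** The strict supporting property is [support_line] with a positive lower bound of rho; equality
    would make the cosine of the difference of the angles equal to 1, so that they agree modulo the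
    period. *)
Lemma gauss_radius_curve X rho : gauss_radius X rho -> gauss_curve X.
Proof.
move=> h; have [d1 d2 pX sr rp] := h; have [s1 s2] := gauss_radius_smooth h; split => //.
- move=> i m th; rewrite coord_dth.
  have hs : smooth (fun a => Defs.coord i (X a)) by rewrite /Defs.coord; case: (i == ord0).
  have [hd _] := smooth_derive1n hs m.
  by have [] := deriv_of_is_derive hd th.
- by move=> th; exists (rho th) => //; exact: gauss_radius_dth1.
- by move=> th; rewrite (gauss_radius_curv h) invr_gt0.
- move=> th th' neq; have [r0 r00 hr] := gauss_radius_lower h.
  apply: le_lt_trans (support_line d1 d2 pX hr th' th) _.
  rewrite oppr_lt0 pmulr_rgt0// subr_gt0 lt_neqAle cos_le1 andbT.
  apply: contra_neq neq => c1.
  pose f a := X (th + a).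
  have pf a : f (a + 2 * pi) = f a by rewrite /f addrA pX.
  have [y /andP[y0 y2] [fE cE]] :=
    periodic_reduce (g := fun a => (f a, cos a)) (th' - th) 0 (fun a => congr2 pair (pf a) (cos_per a)).
  move: fE; rewrite /f [th + (_ - _)]addrC subrK => <-.
  rewrite c1 in cE.
  suff -> : y = 0 by rewrite addr0.
  apply/eqP; rewrite eq_le y0 andbT leNgt; apply/negP => yp.
  have [yle|ygt] := leP y pi.
    by have : cos y < cos 0; [rewrite ltr_cos ?in_itv/= ?lexx ?pi_ge0 ?y0 ?yle|rewrite cos0 cE ltxx].
  have : cos (2 * pi - y) < cos 0.
    by rewrite ltr_cos ?in_itv/= ?lexx ?pi_ge0//; [lra|apply/andP; split; lra].
  by rewrite -cosN opprB -cos_per subrK cE cos0 ltxx.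
Qed.

Lemma gauss_curve_radius X : gauss_curve X -> exists rho, gauss_radius X rho.
Proof.
move=> [sX pX hr _ _].
have hr' a : exists r : R, 0 < r /\ dth 1 X a = r *: tangent a by have [r r0 e] := hr a; exists r.
have [rho hrho] := choice hr'.
exists rho.
have comp (i : 'I_2) m : deriv_of (derive1n m (fun a => Defs.coord i (X a))) (derive1n m.+1 (fun a => Defs.coord i (X a))).
  move=> a; apply: is_derive_wderiv; rewrite -coord_dth.
  by apply: DeriveDef; [exact: sX|rewrite derive1nS derive1E coord_dth].
have e1 a : (dth 1 X a).1 = - (rho a * sin a) by rewrite (hrho a).2 -mulrN.
have e2 a : (dth 1 X a).2 = rho a * cos a by rewrite (hrho a).2.
have sc (i : 'I_2) m : smooth (derive1n m (fun a => Defs.coord i (X a))).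
  by apply: (smooth_chain (F := fun j => derive1n (m + j) (fun a => Defs.coord i (X a))));
    [rewrite addn0|move=> j; rewrite addnS; exact: comp].
split => //.
- by move=> a; rewrite -e1; exact: (comp ord0 0%N).
- by move=> a; rewrite -e2; exact: (comp ord_max 0%N).
- have [ss sco] := @smooth_trig R.
  (* rho was chosen point by point; as the projection of the derivative of X on the tangent it is
     smooth. *)
  have -> : rho = (fun a => derive1n 1 (fun a => Defs.coord ord_max (X a)) a * cos a -
      derive1n 1 (fun a => Defs.coord ord0 (X a)) a * sin a).
    apply/funext => a; have := e1 a; have := e2 a; rewrite /dth /= => -> ->.
    by rewrite mulNr opprK -!mulrA -mulrDr -!expr2 cos2Dsin2 mulr1.
  move=> n; apply: diffnD; last apply: diffnN; apply: diffnM.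
  + exact: sc. + exact: sco. + exact: sc. + exact: ss.
- by move=> a; exact: (hrho a).1.
Qed.

Lemma gauss_radius_clen X rho : gauss_radius X rho -> clen X = int2pi rho.
Proof.
move=> h; rewrite /clen (gauss_radius_speed h); apply: integral_int2pi.
by apply: smooth_continuous; have [] := h.
Qed.

Lemma gauss_radius_avg X rho : gauss_radius X rho -> avg_curv X = 2 * pi / clen X.
Proof.
move=> h; rewrite /avg_curv; congr (_ / _).
have -> : (fun th => curv X th * speed X th) = (fun=> 1).
  apply/funext => a; rewrite (gauss_radius_speed h) (gauss_radius_curv h) mulVf//.
  by have [_ _ _ _ /(_ a)] := h => ?; rewrite gt_eqF.
rewrite integral_int2pi; last by move=> ?; exact: cvg_cst.
by rewrite int2pi_cst mul1r.
Qed.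

End CurveCalculus.

(** * Iterated time derivatives *)

Section Derw.
Context {R : realType}.
Implicit Types (A : set R) (f g : R -> R).

Definition one_sided A (t : R) := exists d : R, 0 < d /\
  ((forall s, t <= s < t + d -> A s) \/ (forall s, t - d < s <= t -> A s)).

Lemma one_sided_proper A t : one_sided A t -> ProperFilter (within A t^').
Proof.
move=> [d [d0 h]]; apply: Build_ProperFilter_ex.
move=> P; rewrite /within /dnbhs /= => /nbhs_ballP[e /= e0 he].
pose z := Num.min d e / 2.
have z0 : 0 < z by rewrite divr_gt0// lt_min d0.
have zd : z < d by apply: lt_le_trans (_ : Num.min d e <= _); rewrite ?ge_min ?lexx// /z ltr_pdivrMr// ltr_pMr ?lt_min ?d0// ltr1n.
have ze : z < e by apply: lt_le_trans (_ : Num.min d e <= _); rewrite ?ge_min ?lexx ?orbT// /z ltr_pdivrMr// ltr_pMr ?lt_min ?d0// ltr1n.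
case: h => h; [exists (t + z)|exists (t - z)]; apply: he.
- by rewrite /ball /= opprD addrA subrr sub0r normrN gtr0_norm.
- by rewrite -subr_eq0 addrAC subrr add0r gt_eqF.
- by apply: h; rewrite lerDl ltW//= ltrD2l.
- by rewrite /ball /= opprB addrCA subrr addr0 gtr0_norm.
- by rewrite -subr_eq0 addrAC subrr add0r oppr_eq0 gt_eqF.
- by apply: h; rewrite gerBl ltW// andbT ltrD2l ltrN2.
Qed.

Lemma wderiv_derivable_w A f t l : wderiv A f t l -> derivable_w A f t.
Proof. by move=> h; apply/cvg_ex; exists l. Qed.

Lemma wderiv_derw A f t l : one_sided A t -> wderiv A f t l -> derw A f t = l.
Proof. by move=> /one_sided_proper h hf; apply: cvg_lim. Qed.

Lemma one_sided_cc (T t : R) : 0 < T -> 0 <= t <= T -> one_sided `[0, T]%classic t.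
Proof.
move=> T0 /andP[t0 tT]; have [tp|] := ltP t T.
  exists (T - t); split; first by rewrite subr_gt0.
  by left => s /andP[h1 h2]; rewrite /= in_itv/=; apply/andP; split; lra.
move=> Tt; exists T; split => //; right => s /andP[h1 h2]; rewrite /= in_itv/=; apply/andP; split; lra.
Qed.

Lemma derwn_chain A (F : nat -> R -> R) n :
  (forall t, A t -> one_sided A t) ->
  (forall a t, A t -> wderiv A (F a) t (F a.+1 t)) ->
  forall t, A t -> derwn A n (F 0%N) t = F n t.
Proof.
move=> hA hF; elim: n => // n IH t At; rewrite /derwn iterS -/(derwn A n (F 0%N)).
apply: wderiv_derw; first exact: hA.
by apply: wderiv_eqon At (hF n t At) => s /set_mem As; rewrite IH.
Qed.

Lemma smooth_w_chain A f : smooth_w A f -> forall a t, A t ->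
  wderiv A (derwn A a f) t (derwn A a.+1 f t).
Proof. by move=> h a t At; exact: h. Qed.

End Derw.

Section ClassDerwn.
Context {R : realType} {P : topologicalType} {I L : Type} (F : frame R P I L) (A : set R).
Hypotheses (F_ax : forall p, fax F None p = A)
  (F_line : forall p s s', fline F None (fline F None p s) s' = fline F None p s')
  (F_pos : forall p s, fpos F None (fline F None p s) = s).

(** [derwn] iterates a limit that has a meaning only where it converges; the class provides actual
    derivatives on the domain, and the two are identified one order at a time. Agreement of g with f
    near p is what a local branch of the angle offers. *)
Lemma class_derwn j m : forall a N f, (a <= j)%N -> smooth_class F j m N f ->
  exists2 f', smooth_class F (j - a) m (N + a) f' &
  forall i p (g : R -> R), fdom F i p ->
    (exists2 d : R, 0 < d & forall s, A s -> `|s - fpos F None p| < d -> g s = f i (fline F None p s)) ->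
    derwn A a g (fpos F None p) = f' i p /\
    ((a < j)%N -> derivable_w A (derwn A a g) (fpos F None p)).
Proof.
elim=> [|a IH] N f aj Cf.
  exists f; first by rewrite subn0 addn0.
  move=> i p g ip [d d0 hg].
  have Ap : A (fpos F None p) by have := fax_pos None ip; rewrite F_ax.
  split; first by rewrite /= hg// ?subrr ?normr0// fline_pos.
  case: j aj Cf => // j _ /smooth_classE[_ _ /(_ _ erefl)[ft ht _]] _.
  apply: (wderiv_derivable_w (l := ft i p)); rewrite /= -(F_ax p).
  apply: (wderiv_near d0) (ht i p ip); first by move=> s; rewrite F_ax => As sd; rewrite hg.
  by rewrite hg// subrr normr0.
have [fa Ca ha] := IH N f (ltnW aj) Cf.
move: Ca; rewrite (_ : (j - a = (j - a.+1).+1)%N); last by rewrite subnSK.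
case/smooth_classE => _ _ /(_ _ erefl)[ft ht Ct].
exists ft; first by rewrite addnS.
move=> i p g ip [d d0 hg].
have Ap : A (fpos F None p) by have := fax_pos None ip; rewrite F_ax.
have [d1 d10 hd1] := fdom_near None ip.
have near s : A s -> `|s - fpos F None p| < Num.min d1 d ->
    derwn A a g s = fa i (fline F None p s).
  rewrite lt_min => As /andP[s1 s2].
  have ip' : fdom F i (fline F None p s) by apply: hd1 => //; rewrite F_ax.
  have [] := ha i (fline F None p s) g ip' _; last by rewrite F_pos.
  exists (d - `|s - fpos F None p|); first by rewrite subr_gt0.
  move=> s'; rewrite F_pos F_line => As' hs'; apply: hg => //.
  rewrite ltrBrDr in hs'; apply: le_lt_trans hs'.
  by apply: le_trans (ler_normD _ _); rewrite addrA subrK.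
have dm : 0 < Num.min d1 d by rewrite lt_min d10.
have W : wderiv A (derwn A a g) (fpos F None p) (ft i p).
  have htp := ht i p ip; rewrite F_ax in htp; apply: (wderiv_near dm) htp.
    by move=> s As sd; rewrite near.
  by rewrite near// subrr normr0.
have side q : fdom F i q -> one_sided A (fpos F None q).
  by move=> iq; have := fax_side None iq; rewrite F_ax.
have E : derwn A a.+1 g (fpos F None p) = ft i p.
  by rewrite /derwn iterS; apply: wderiv_derw W; exact: side.
split => // aj'.
move: Ct; rewrite (_ : (j - a.+1 = (j - a.+2).+1)%N); last by rewrite subnSK.
case/smooth_classE => _ _ /(_ _ erefl)[ftt htt _].
apply: (wderiv_derivable_w (l := ftt i p)).
have http := htt i p ip; rewrite F_ax in http.
apply: (wderiv_near dm) http; last by rewrite fline_pos E.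
move=> s As sd.
have ip' : fdom F i (fline F None p s).
  by apply: hd1; [rewrite F_ax|apply: lt_le_trans sd _; rewrite ge_min lexx].
rewrite /derwn iterS; apply: esym; apply: wderiv_derw.
  by have := side _ ip'; rewrite F_pos.
have h := ht i _ ip'; rewrite F_ax F_pos in h; rewrite -/(derwn A a g).
have em : 0 < Num.min d1 d - `|s - fpos F None p| by rewrite subr_gt0.
apply: (wderiv_near em) h; last by rewrite F_line near.
move=> s' As' hs'; rewrite F_line near//.
rewrite ltrBrDr in hs'; apply: le_lt_trans hs'.
by apply: le_trans (ler_normD _ _); rewrite addrA subrK.
Qed.

End ClassDerwn.

Section StripDerivatives.
Context {R : realType} {I : Type} (T : R) (A : I -> R).
Hypotheses (T0 : 0 < T) (A1 : forall i, 1 <= A i).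
Let S := strip T0 A1.

Lemma class_derive1n j : forall b m N f, (b <= m)%N -> smooth_class S j m N f ->
  exists2 f', smooth_class S j (m - b) N f' &
  forall i t y, 0 <= t <= T -> derive1n b (fun z => f i (t, z)) y = f' i (t, y).
Proof.
elim=> [|b IH] m N f bm Cf; first by exists f; rewrite ?subn0.
have [fb Cb hb] := IH m N f (ltnW bm) Cf.
move: Cb; rewrite (_ : (m - b = (m - b.+1).+1)%N); last by rewrite subnSK.
case/smooth_classE => _ /(_ _ erefl tt)[fx hx Cx] _.
exists fx => // i t y tT; rewrite derive1nS.
rewrite (_ : derive1n b (fun z => f i (t, z)) = (fun z => fb i (t, z))); last first.
  by apply/funext => z; exact: hb.
have h : deriv_of (fun z => fb i (t, z)) (fun z => fx i (t, z)).
  by move=> z; exact: (hx i (t, z)).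
by rewrite (deriv_of_derive1 h).
Qed.

Lemma class_dt_dth j m N (Xc : 'I_2 -> I -> R * R -> R) (X : I -> R -> R -> R * R) c k b :
  (k <= j)%N -> (b <= m)%N ->
  smooth_class S j m N (Xc c) -> (forall i t th, Defs.coord c (X i t th) = Xc c i (t, th)) ->
  exists2 f', smooth_class S (j - k) (m - b) (N + k) f' &
  forall i t th, 0 <= t <= T -> dt_dth T k b c (X i) t th = f' i (t, th) /\
   ((k < j)%N -> derivable_w `[0, T]%classic (fun s => dt_dth T k b c (X i) s th) t).
Proof.
move=> kj bm Cf XE.
have [fb Cb hb] := class_derive1n bm Cf.
have [fk Ck hk] := class_derwn (A := `[0, T]%classic) (F := S) (fun p => erefl)
  (fun p s s' => erefl) (fun p s => erefl) kj Cb.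
exists fk => // i t th tT.
apply: (hk i (t, th)) => //; exists 1 => // s; rewrite /= in_itv/= => sT _.
have E : (fun a => Defs.coord c (X i s a)) = (fun a => Xc c i (s, a)) by apply/funext => a; exact: XE.
by have := congr1 (fun f => f th) (coord_dth (X i s) b c); rewrite E hb.
Qed.

End StripDerivatives.

(** * The flow of a family of forcings *)

Section InverseFunction.
Context {R : realType}.

(** Y expands distances by at least c, hence is injective, and it is onto by the intermediate value
    theorem. The inverse is then Lipschitz, which turns the expansion of Y at Th y into one of Th at
    y. *)
Lemma inverse_function (Y Y' : R -> R) (c : R) : 0 < c -> deriv_of Y Y' -> (forall a, c <= Y' a) ->
  exists Th : R -> R, [/\ cancel Th Y, cancel Y Th & deriv_of Th (fun y => (Y' (Th y))^-1)].
Proof.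
move=> c0 dY hc.
have grow a b : a <= b -> c * (b - a) <= Y b - Y a.
  move=> ab; rewrite -subr_ge0.
  have := @wderiv_ge0_le _ setT (fun a => Y a - c * a) (fun a => Y' a - c) a b ab (fun _ _ => I).
  have h s : a <= s <= b -> wderiv setT (fun a => Y a - c * a) s (Y' s - c).
    move=> _; apply: wderivB; first exact: dY.
    by have := wderivZ setT c (wderiv_id setT s); rewrite mulr1.
  move=> /(_ h) h2; have : Y a - c * a <= Y b - c * b by apply: h2 => s _; rewrite subr_ge0.
  by lra.
have lip a b : c * `|b - a| <= `|Y b - Y a|.
  have [ab|/ltW ba] := leP a b.
    rewrite (ger0_norm (x := b - a)) ?subr_ge0//; apply: le_trans (grow a b ab) _; exact: ler_norm.
  rewrite distrC (ger0_norm (x := a - b)) ?subr_ge0// distrC.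
  by apply: le_trans (grow b a ba) _; exact: ler_norm.
have cY : continuous Y by exact: wderiv_continuous dY.
have surj y : exists a, Y a = y.
  pose M := `|y - Y 0| / c.
  have M0 : 0 <= M by rewrite divr_ge0// ltW.
  have cM : c * M = `|y - Y 0| by rewrite /M mulrCA divff ?mulr1// gt_eqF.
  have h1 : y <= Y M.
    have := grow 0 M M0; rewrite subr0 cM => h; have := ler_norm (y - Y 0); lra.
  have h2 : Y (- M) <= y.
    have := grow (- M) 0; rewrite oppr_le0 sub0r opprK cM => /(_ M0) h.
    by have := ler_norm (- (y - Y 0)); rewrite normrN; lra.
  have MM : - M <= M by lra.
  have [||a _ <-] := @IVT _ Y (- M) M y MM; last by exists a.
    by apply: continuous_subspaceT; exact: cY.
  have h3 := le_trans h2 h1.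
  by rewrite min_l// max_r// h2.
have [Th hTh] := choice surj.
have inj a b : Y a = Y b -> a = b.
  move=> e; apply/eqP; rewrite eq_sym -subr_eq0 -normr_le0 -(ler_pM2l c0) mulr0.
  by apply: le_trans (lip a b) _; rewrite e subrr normr0.
exists Th; split => //; first by move=> a; apply: inj; rewrite hTh.
move=> y; apply/wderivP => e e0.
have Y0 : 0 < Y' (Th y) by exact: lt_le_trans (hc _).
have e1 : 0 < e * c * Y' (Th y) by rewrite !mulr_gt0.
have /wderivP/(_ _ e1)[d d0 hd] := dY (Th y).
exists (c * d); first by rewrite mulr_gt0.
move=> s _ sy.
have ts : c * `|Th s - Th y| <= `|s - y| by have := lip (Th y) (Th s); rewrite !hTh.
have := hd (Th s) I _; rewrite !hTh => /(_ _) h.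
have {}h : `|s - y - Y' (Th y) * (Th s - Th y)| <= e * c * Y' (Th y) * `|Th s - Th y|.
  by apply: h; rewrite -(ltr_pM2l c0); exact: le_lt_trans sy.
have -> : Th s - Th y - (Y' (Th y))^-1 * (s - y) =
  - (Y' (Th y))^-1 * (s - y - Y' (Th y) * (Th s - Th y)).
  by field; rewrite gt_eqF.
rewrite normrM normrN (ger0_norm (x := (Y' (Th y))^-1)) ?invr_ge0 ?(ltW Y0)//.
apply: (@le_trans _ _ ((Y' (Th y))^-1 * (e * c * Y' (Th y) * `|Th s - Th y|))).
  by rewrite ler_wpM2l// invr_ge0 ltW.
have -> : (Y' (Th y))^-1 * (e * c * Y' (Th y) * `|Th s - Th y|) = e * (c * `|Th s - Th y|).
  by field; rewrite gt_eqF.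
by rewrite ler_wpM2l// ltW.
Qed.

End InverseFunction.

Section ArclengthCoordinate.
Context {R : realType}.
Variable (rho : R -> R).
Hypotheses (sr : smooth rho) (pr : forall a, rho (a + 2 * pi) = rho a).
Variable (r0 : R).
Hypotheses (r00 : 0 < r0) (hr : forall a, r0 <= rho a).

Lemma smooth_prim (f : R -> R) : smooth f -> deriv_of (prim f) f.
Proof. by move=> sf; apply: is_derive_deriv_of => t; apply: prim_derive; exact: smooth_continuous. Qed.

Lemma smooth_of_derive (f f' : R -> R) : deriv_of f f' -> smooth f' -> smooth f.
Proof. by move=> h sf [|n]//; exists f'. Qed.

Lemma int2pi_ge (f : R -> R) (c : R) : continuous f -> (forall a, c <= f a) -> c * (2 * pi) <= int2pi f.
Proof.
move=> cf hc; have pi2 := @pi2_gt0 R.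
have := @wderiv_ge0_le _ setT (fun t => prim f t - c * t) (fun t => f t - c) 0 (2 * pi) (ltW pi2) (fun _ _ => I).
have h s : 0 <= s <= 2 * pi -> wderiv setT (fun t => prim f t - c * t) s (f s - c).
  move=> _; apply: wderivB; first by apply: is_derive_wderiv; exact: prim_derive.
  by have := wderivZ setT c (wderiv_id setT s); rewrite mulr1.
move=> /(_ h) h2; have : prim f 0 - c * 0 <= prim f (2 * pi) - c * (2 * pi).
  by apply: h2 => s _; rewrite subr_ge0.
by rewrite (prim0 cf) mulr0 subrr /int2pi subr_ge0.
Qed.

(** Y is arclength scaled to total length 2 pi. In the variable y the operator d^2/dtheta^2 reads q
    (d^2/dy^2 - p d/dy), and k^2 q is constant: the linearized curvature equation has a constant
    principal coefficient. The last clause is the change of variables dtheta = nu k dy. *)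
Lemma arclength_coordinate (nu := int2pi rho / (2 * pi)) :
  exists Y k p q : R -> R, [/\ [/\ 0 < nu, 0 < int2pi rho, deriv_of Y (fun a => rho a / nu) &
      forall a, Y (a + 2 * pi) = Y a + 2 * pi],
    [/\ smooth k, smooth p & smooth q],
    [/\ forall y, k (y + 2 * pi) = k y, forall y, p (y + 2 * pi) = p y &
        forall y, q (y + 2 * pi) = q y],
    [/\ forall a, k (Y a) = (rho a)^-1, forall y, 0 < k y,
        forall y, k y ^+ 2 * q y = nu ^- 2, forall a, q (Y a) = (rho a / nu) ^+ 2 &
        deriv_of (fun a => rho a / nu) (fun a => - (p (Y a) * q (Y a)))] &
    forall f : R -> R, continuous f -> nu * int2pi (fun y => f y * k y) = int2pi (fun a => f (Y a))].
Proof.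
have rp a : 0 < rho a by exact: lt_le_trans (hr a).
have rn a : rho a != 0 by rewrite gt_eqF.
have cr := smooth_continuous sr.
have L0 : 0 < int2pi rho.
  by apply: lt_le_trans (int2pi_ge cr hr); rewrite mulr_gt0// pi2_gt0.
have nu0 : 0 < nu by rewrite divr_gt0// pi2_gt0.
have nun : nu != 0 by rewrite gt_eqF.
have sY' : smooth (fun a => rho a / nu).
  by move=> n; apply: diffnM; [exact: sr|exact: diffn_cst].
pose Y := prim (fun a => rho a / nu).
have dY : deriv_of Y (fun a => rho a / nu) by exact: smooth_prim.
have cY' := smooth_continuous sY'.
have Y0 : Y 0 = 0 by exact: prim0.
have pi2 := @pi2_gt0 R.
have Y2 : Y (2 * pi) = 2 * pi.
  rewrite /Y -/(int2pi _).
  have -> : (fun a => rho a / nu) = (fun a => nu^-1 * rho a) by apply/funext => a; rewrite mulrC.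
  by rewrite int2piZ// /nu invf_div mulrC mulrCA divff ?mulr1// gt_eqF.
have YP a : Y (a + 2 * pi) = Y a + 2 * pi.
  suff h : Y (a + 2 * pi) - Y a = Y (0 + 2 * pi) - Y 0.
    by move: h; rewrite add0r Y2 Y0 subr0 => h; lra.
  apply: (@deriv_of_cst0 _ (fun a => Y (a + 2 * pi) - Y a)) => b.
  have sh : deriv_of (fun a : R => a + 2 * pi) (fun=> 1).
    by move=> x; have := wderivD (wderiv_id setT x) (wderiv_cst setT (2 * pi) x); rewrite addr0.
  have := wderivB (@deriv_of_comp _ _ _ _ _ sh dY b) (@dY b).
  by rewrite pr mulr1 subrr.
have hlow a : r0 / nu <= rho a / nu by rewrite ler_wpM2r ?hr// invr_ge0 ltW.
have [Th [ThK YK dTh]] := inverse_function (divr_gt0 r00 nu0) dY hlow.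
have ThP y : Th (y + 2 * pi) = Th y + 2 * pi.
  by rewrite -{1}[y]ThK -YP YK.
have sTh : smooth Th.
  elim=> // n IH; exists (fun y => (rho (Th y) / nu)^-1) => //.
  apply: diffnV; first by move=> y; rewrite mulf_neq0// invr_eq0.
  exact: (diffn_comp IH (sY' n)).
pose k y := (rho (Th y))^-1.
have k0 y : 0 < k y by rewrite invr_gt0.
have kn y : k y != 0 by rewrite gt_eqF.
have sk : smooth k by move=> n; apply: diffnV => //; exact: (diffn_comp (sTh n) (sr n)).
have kP y : k (y + 2 * pi) = k y by rewrite /k ThP pr.
have [k' dk _] := sk 1%N.
have sk' := smooth_derive sk dk.
have k'P := wderiv_periodic dk kP.
have kY a : k (Y a) = (rho a)^-1 by rewrite /k YK.
(* Since rho / nu = 1 / (nu k(Y)), its derivative in the angle is - (k' / k) q, which dictates p =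
   k' / k. *)
exists Y, k, (fun y => k' y / k y), (fun y => nu ^- 2 * ((k y)^-1 * (k y)^-1)).
have sV : smooth (fun y => (k y)^-1) by move=> n; apply: diffnV.
split => //.
- split => // n; first by apply: diffnM; [exact: sk'|exact: sV].
  by apply: diffnM; [exact: diffn_cst|apply: diffnM; exact: sV].
- by split => // y; rewrite ?k'P kP.
- split => //.
  + by move=> y; field; rewrite kn nun.
  + by move=> a; rewrite kY invrK; field.
  + move=> a; have h1 := @deriv_of_comp _ _ _ _ _ dY dk a.
    have h2 := wderivM (wderivV h1 (kn (Y a))) (wderiv_cst setT nu^-1 a).
    have -> : - (k' (Y a) / k (Y a) * (nu ^- 2 * ((k (Y a))^-1 * (k (Y a))^-1))) =
      - (k' (Y a) * (rho a / nu)) / k (Y a) ^+ 2 * nu^-1 + (k (Y a))^-1 * 0.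
      have -> : rho a = (k (Y a))^-1 by rewrite kY invrK.
      by field; rewrite kn nun.
    by apply: wderiv_ext h2 => b; rewrite kY invrK.
- move=> f cf.
  have cfk : continuous (fun y => f y * k y) by move=> y; apply: cvgM; [exact: cf|exact: smooth_continuous].
  have cfY : continuous (fun a => f (Y a)).
    by move=> a; apply: continuous_comp; [exact: (wderiv_continuous dY)|exact: cf].
  rewrite (@int2pi_anti _ (fun a => f (Y a)) (fun a => nu * prim (fun y => f y * k y) (Y a))) //.
    by rewrite Y2 Y0 (prim0 cfk) mulr0 subr0.
  move=> a; have dG : deriv_of (prim (fun y => f y * k y)) (fun y => f y * k y).
    by apply: is_derive_deriv_of => t; exact: prim_derive.
  have := wderivZ setT nu (@deriv_of_comp _ _ _ _ _ dY dG a).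
  by rewrite kY (_ : nu * _ = f (Y a))//; field; rewrite rn nun.
Qed.

End ArclengthCoordinate.

Section FlowFamily.
Context {R : realType}.

(** A forcing comes with its primitive and with the sequence of its derivatives; of these the
    primitive alone is bounded by b. *)
Definition forcing_ok (T b : R) (w : R -> R) (vd : nat -> R -> R) : Prop :=
  [/\ w 0 = 0, (forall t, 0 <= t <= T -> `|w t| <= b),
      (forall t, 0 <= t <= T -> wderiv `[0, T]%classic w t (vd 0%N t)) &
      (forall a t, 0 <= t <= T -> wderiv `[0, T]%classic (vd a) t (vd a.+1 t))].

(** The amplitude is left free: it will be 1 + |v|_{K,T} for the estimates, and any dominating
    function where only smoothness matters. *)
Definition smooth_family (T : R) (I : Type) (vd : nat -> I -> R -> R) (f : I -> R * R -> R) : Prop :=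
  forall (T0 : 0 < T) (A : I -> R) (A1 : forall i, 1 <= A i) (N : nat),
    (forall a i t, (a <= N)%N -> 0 <= t <= T -> `|vd a i t| <= A i) ->
    forall j m, (j <= N)%N -> smooth_class (strip T0 A1) j m 0 f.

(** Extends a path on [0, T] by constants, since the coefficients of atoms are continuous on the
    whole line. *)
Definition clamp (T t : R) : R := Num.max 0 (Num.min t T).

Lemma clamp_id T t : 0 <= t <= T -> clamp T t = t.
Proof. by move=> /andP[t0 tT]; rewrite /clamp min_l// max_r. Qed.

Lemma clamp_in T t : 0 <= T -> 0 <= clamp T t <= T.
Proof. by move=> T0; rewrite /clamp le_max lexx/= ge_max T0 ge_min lexx orbT. Qed.

Lemma clamp_continuous T (f : R -> R) : 0 <= T -> cont_on (`[0, T]%classic : set R) f ->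
  continuous (fun t => f (clamp T t)).
Proof.
move=> T0 cf; apply: cont_on_setT.
apply: (cont_on_comp (A := `[0, T]%classic) (f := f) (g := clamp T)) => //.
  by move=> q _; rewrite /= in_itv; exact: clamp_in.
move=> q _; apply: cvg_within_filter; rewrite /clamp.
have := @continuous_max R R (fun=> 0) (fun t => Num.min t T) q.
apply; first exact: cvg_cst.
by apply: continuous_min; [exact: cvg_id|exact: cvg_cst].
Qed.

Lemma wderiv_eql (A : set R) (f : R -> R) t l m : l = m -> wderiv A f t l -> wderiv A f t m.
Proof. by move=> ->. Qed.

(** Where f vanishes the quotient rule has no term in the derivative of g, so continuity of g
    suffices. It differentiates [be], whose increment is a quotient with [be] itself in the
    denominator. *)
Lemma wderiv_div_continuous (A : set R) (f g : R -> R) t l : wderiv A f t l -> f t = 0 ->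
  g s @[s --> within A (nbhs t)] --> g t -> g t != 0 -> wderiv A (fun s => f s / g s) t (l / g t).
Proof.
move=> hf ft cg gt; rewrite /wderiv ft mul0r.
have -> : (fun s => (s - t)^-1 * (f s / g s - 0)) = (fun s => ((s - t)^-1 * (f s - f t)) * (g s)^-1).
  by apply/funext => s; rewrite ft !subr0 mulrA.
apply: cvgM => //; apply: cvgV => //.
exact: (cvg_trans (cvg_app g (@within_dnbhs R A t)) cg).
Qed.

(* The curve is [g0 + eta n + eta' t] where [n], [t] are the normal and tangent
   vectors and [eta] is the perturbation [xi (t, Y a) + be t] of the support
   function of [g0]. *)
Theorem flow_family (g0 : R -> R * R) (rho0 : R -> R) (c eps : R) : gauss_radius g0 rho0 -> 0 < eps ->
  exists T0 b : R, [/\ 0 < T0, 0 < b &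
  forall T, 0 < T <= T0 -> forall (I : Type) (w : I -> R -> R) (vd : nat -> I -> R -> R),
  (forall i, forcing_ok T b (w i) (fun a => vd a i)) ->
  exists (X : I -> R -> R -> R * R) (rho : I -> R -> R -> R),
  [/\ forall i t, 0 <= t <= T -> gauss_radius (X i t) (rho i t),
      forall i, X i 0 = g0,
      forall i t a, 0 <= t <= T -> [/\ `|rho i t a - rho0 a| <= eps,
        `|(X i t a).1 - (g0 a).1| <= eps & `|(X i t a).2 - (g0 a).2| <= eps],
      forall i t a, 0 <= t <= T -> wderiv `[0, T]%classic (fun s => dotp (X i s a) (normal a)) t
        (- (rho i t a)^-1 + (2 * pi - c * vd 0%N i t) / int2pi (rho i t)) &
      [/\ smooth_family T vd (fun i q => (X i q.1 q.2).1),
          smooth_family T vd (fun i q => (X i q.1 q.2).2) &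
          smooth_family T vd (fun i q => rho i q.1 q.2)]]].
Proof.
move=> hg eps0; have [dg1 dg2 pg sr rp] := hg.
have pr := gauss_radius_periodic hg.
have [r0 r00 hr] := gauss_radius_lower hg.
have pi2 := @pi2_gt0 R.
have [Y [k [p [q [[nu0 L00 dY YP] [sk sp sq] [kP pP qP] [kY k0 kq qY dY2] cov]]]]] :=
  arclength_coordinate sr pr r00 hr.
set L0 := int2pi rho0 in L00 *; set nu := L0 / (2 * pi) in nu0 dY kq qY dY2 cov *.
have nun : nu != 0 by rewrite gt_eqF.
have L0n : L0 != 0 by rewrite gt_eqF.
have cY : continuous Y by exact: wderiv_continuous dY.
have sY' : smooth (fun a => rho0 a / nu) by move=> n; apply: diffnM; [exact: sr|exact: diffn_cst].
have pY' a : rho0 (a + 2 * pi) / nu = rho0 a / nu by rewrite pr.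
have [Cy Cy0 hCy] := periodic_bounded (smooth_continuous sY') pY'.
have [Ck Ck0 hCk] := periodic_bounded (smooth_continuous sk) kP.
have mu0 : 0 < nu ^- 2 by rewrite invr_gt0 exprn_gt0.
(* The perturbation will be bounded by r = 1 / Q: [r1] keeps the curve and its radius of curvature
   within eps, [r2] gives 1 + k zeta >= 1/2, and [r3] keeps the length above L0 / 2. *)
pose Q := 1 + (2 + Cy) / eps + 2 * Ck + 8 * pi / L0.
have q1 : 0 <= (2 + Cy) / eps by rewrite divr_ge0 ?addr_ge0// ltW.
have q2 : 0 <= 8 * pi / L0 by rewrite divr_ge0 ?mulr_ge0 ?pi_ge0// ltW.
have Q0 : 0 < Q by rewrite /Q; lra.
pose r := Q^-1; have rpos : 0 < r by rewrite invr_gt0.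
have rX x : x <= Q -> r * x <= 1 by move=> h; rewrite mulrC ler_pdivrMr// mul1r.
have r1 : r * (2 + Cy) <= eps.
  have : r * ((2 + Cy) / eps) <= 1 by apply: rX; rewrite /Q; lra.
  by rewrite mulrA ler_pdivrMr// mul1r.
have r2 : r * (2 * Ck) <= 1 by apply: rX; rewrite /Q; lra.
have r3 : r * (8 * pi) <= L0.
  have : r * (8 * pi / L0) <= 1 by apply: rX; rewrite /Q; lra.
  by rewrite mulrA ler_pdivrMr// mul1r.
have re : r <= eps.
  apply: le_trans r1; rewrite -[leLHS]mulr1 ler_wpM2l ?(ltW rpos)//; lra.
have [T0 [b0 [XB [KB [T00 b00 sol]]]]] := uniform_solution sk sp sq kP pP qP mu0 nu0 L00 kq rpos.
(* W has the two parts 2 pi t / L0 and - c w / L0; the restrictions on the time and on w bound each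
   by b0 / 2. *)
pose b := b0 * L0 / (2 * (`|c| + 1)).
have c1 : 0 < `|c| + 1 by rewrite ltr_wpDl.
exists (Num.min T0 (b0 * L0 / (4 * pi))), b; split.
- by rewrite lt_min T00 divr_gt0// mulr_gt0// pi_gt0.
- by rewrite /b divr_gt0// mulr_gt0.
move=> T /andP[Tpos]; rewrite le_min => /andP[TT0 TT1] I w vd hw.
have T1 : 2 * pi * T <= b0 * L0 / 2.
  move: TT1; rewrite ler_pdivlMr ?mulr_gt0 ?pi_gt0//; move: (pi : R) => z; clear; lra.
pose W i t := (2 * pi * clamp T t - c * w i (clamp T t)) / L0.
have cW i : continuous (W i).
  have [_ _ dw _] := hw i.
  refine (@clamp_continuous T (fun t => (2 * pi * t - c * w i t) / L0) (ltW Tpos) _).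
  move=> t; rewrite /= in_itv/= => tT.
  apply: (@wderiv_cvg _ _ _ _ ((2 * pi * 1 - c * vd 0%N i t) * L0^-1 + (2 * pi * t - c * w i t) * 0)).
  apply: wderivM; last exact: wderiv_cst.
  apply: wderivB; apply: wderivZ; [exact: wderiv_id|exact: dw].
have Wb i t : 0 <= t <= T -> `|W i t| <= b0.
  move=> tT; have [_ wb _ _] := hw i; rewrite /W clamp_id// normrM [`|L0^-1|]gtr0_norm ?invr_gt0//.
  rewrite ler_pdivrMr//; apply: le_trans (ler_normB _ _) _.
  have h1 : `|2 * pi * t| <= b0 * L0 / 2.
    have /andP[t0 t1] := tT; rewrite ger0_norm; last by rewrite mulr_ge0// ltW.
    by apply: le_trans T1; rewrite ler_wpM2l// ltW.
  have h2 : `|c * w i t| <= b0 * L0 / 2.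
    rewrite normrM; apply: (@le_trans _ _ ((`|c| + 1) * b)).
      by rewrite ler_pM ?wb// lerDl.
    by rewrite /b; have -> : (`|c| + 1) * (b0 * L0 / (2 * (`|c| + 1))) = b0 * L0 / 2
      by field; rewrite gt_eqF.
  by lra.
have TT : 0 < T <= T0 by rewrite Tpos.
pose tup := ((nat -> R -> R -> R) * (nat -> R -> R -> R) * (R -> R) * (R -> R))%type.
have sol' i : exists z : tup, let: (xi, ka, be, J) := z in
  [/\ [/\ forall j, cont_on (slab T) (fun q => xi j q.1 q.2),
          forall j, cont_on (slab T) (fun q => ka j q.1 q.2),
          forall j t y, 0 <= t <= T -> `|xi j t y| <= XB j,
          forall j t y, 0 <= t <= T -> `|ka j t y| <= KB j &
          cont_on (`[0, T]%classic : set R) be],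
      [/\ forall j t y, 0 <= t <= T -> wderiv setT (xi j t) y (xi j.+1 t y),
          forall j t y, 0 <= t <= T -> wderiv setT (ka j t) y (ka j.+1 t y),
          forall j t y, xi j t (y + 2 * pi) = xi j t y &
          forall j t y, ka j t (y + 2 * pi) = ka j t y],
      [/\ forall j t y, 0 <= t <= T -> wderiv `[0, T]%classic (fun s => xi j s y) t (- ka j t y),
          forall j y, xi j 0 y = 0 &
          forall t y, 0 <= t <= T -> ka 0%N t y = k y - k y *
            (xi 0%N t y + q y * (xi 2%N t y - p y * xi 1%N t y) + be t) * ka 0%N t y],
      [/\ forall t, 0 <= t <= T -> be t = W i t - pi / L0 * (be t) ^+ 2
            - nu / L0 * (int2pi (fun y => xi 0%N t y * k y) * be t) - nu / L0 * J t,
          J 0 = 0 &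
          forall t, 0 <= t <= T -> wderiv `[0, T]%classic J t
            (int2pi (fun y => ka 0%N t y * k y) * be t)] &
      forall t y, 0 <= t <= T -> [/\ `|be t| <= r, `|xi 0%N t y| <= r, `|xi 1%N t y| <= r &
        `|xi 0%N t y + q y * (xi 2%N t y - p y * xi 1%N t y) + be t| <= r]].
  by have [xi [ka [be [J h]]]] := sol T (W i) TT (cW i) (Wb i); exists (xi, ka, be, J).
have [z hz] := choice sol'.
pose xi j i t y := (z i).1.1.1 j t y; pose ka j i t y := (z i).1.1.2 j t y.
pose be i t := (z i).1.2 t; pose J i t := (z i).2 t.
have hz' i : [/\ [/\ forall j, cont_on (slab T) (fun q => xi j i q.1 q.2),
          forall j, cont_on (slab T) (fun q => ka j i q.1 q.2),
          forall j t y, 0 <= t <= T -> `|xi j i t y| <= XB j,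
          forall j t y, 0 <= t <= T -> `|ka j i t y| <= KB j &
          cont_on (`[0, T]%classic : set R) (be i)],
      [/\ forall j t y, 0 <= t <= T -> wderiv setT (xi j i t) y (xi j.+1 i t y),
          forall j t y, 0 <= t <= T -> wderiv setT (ka j i t) y (ka j.+1 i t y),
          forall j t y, xi j i t (y + 2 * pi) = xi j i t y &
          forall j t y, ka j i t (y + 2 * pi) = ka j i t y],
      [/\ forall j t y, 0 <= t <= T -> wderiv `[0, T]%classic (fun s => xi j i s y) t (- ka j i t y),
          forall j y, xi j i 0 y = 0 &
          forall t y, 0 <= t <= T -> ka 0%N i t y = k y - k y *
            (xi 0%N i t y + q y * (xi 2%N i t y - p y * xi 1%N i t y) + be i t) * ka 0%N i t y],
      [/\ forall t, 0 <= t <= T -> be i t = W i t - pi / L0 * (be i t) ^+ 2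
            - nu / L0 * (int2pi (fun y => xi 0%N i t y * k y) * be i t) - nu / L0 * J i t,
          J i 0 = 0 &
          forall t, 0 <= t <= T -> wderiv `[0, T]%classic (J i) t
            (int2pi (fun y => ka 0%N i t y * k y) * be i t)] &
      forall t y, 0 <= t <= T -> [/\ `|be i t| <= r, `|xi 0%N i t y| <= r, `|xi 1%N i t y| <= r &
        `|xi 0%N i t y + q y * (xi 2%N i t y - p y * xi 1%N i t y) + be i t| <= r]].
  by have := hz i; rewrite /xi /ka /be /J; case: (z i) => [[[? ?] ?] ?].
clearbody xi ka be J; clear sol sol' z hz.
pose ze i t y := xi 0%N i t y + q y * (xi 2%N i t y - p y * xi 1%N i t y) + be i t.
pose len i t := L0 + nu * int2pi (fun y => xi 0%N i t y * k y) + 2 * pi * be i t.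
have cxi i t j : 0 <= t <= T -> continuous (xi j i t).
  by move=> tT; have [[h _ _ _ _] _ _ _ _] := hz' i; exact: (slab_line (h j) tT).
have cka i t j : 0 <= t <= T -> continuous (ka j i t).
  by move=> tT; have [[_ h _ _ _] _ _ _ _] := hz' i; exact: (slab_line (h j) tT).
have cxY i t j : 0 <= t <= T -> continuous (fun a => xi j i t (Y a)).
  by move=> tT a; apply: continuous_comp; [exact: cY|exact: cxi].
have lenE i t : 0 <= t <= T -> len i t = L0 + int2pi (fun a => xi 0%N i t (Y a)) + 2 * pi * be i t.
  by move=> tT; rewrite /len (cov _ (cxi i t 0%N tT)).
have lenlow i t : 0 <= t <= T -> L0 / 2 <= len i t.
  move=> tT; have [_ _ _ _ hs] := hz' i; rewrite lenE//.
  have h1 : `|int2pi (fun a => xi 0%N i t (Y a))| <= r * (2 * pi).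
    by apply: int2pi_norm; [exact: cxY|move=> y _; have [_ ? _ _] := hs t (Y y) tT].
  have [h2 _ _ _] := hs t 0 tT.
  have h3 : `|2 * pi * be i t| <= 2 * pi * r by rewrite normrM (gtr0_norm pi2) ler_wpM2l// ltW.
  move: h1 h3; rewrite !ler_norml => /andP[h1 _] /andP[h3 _].
  by move: r3 h1 h3; move: (pi : R) => P; clear; lra.
have lenn i t : 0 <= t <= T -> len i t != 0.
  by move=> tT; rewrite gt_eqF// (lt_le_trans _ (lenlow i t tT))// divr_gt0.
have zlow i t y : 0 <= t <= T -> 2^-1 <= 1 + k y * ze i t y.
  move=> tT; have [_ _ _ _ hs] := hz' i; have [_ _ _ h] := hs t y tT.
  have : `|k y * ze i t y| <= Ck * r by rewrite normrM ler_pM.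
  by rewrite ler_norml => /andP[h1 _]; move: r2 h1; clear; lra.
have zn i t y : 0 <= t <= T -> 1 + k y * ze i t y != 0.
  by move=> tT; rewrite gt_eqF// (lt_le_trans _ (zlow i t y tT)).
have kaE i t y : 0 <= t <= T -> ka 0%N i t y = k y * (1 + k y * ze i t y)^-1.
  move=> tT; have [_ _ [_ _ h] _ _] := hz' i.
  apply: (mulIf (zn i t y tT)); rewrite divfK ?zn//.
  by rewrite mulrDr mulr1 {1}h// -/(ze i t y); ring.
have tb i t : 0 <= t <= T -> wderiv `[0, T]%classic (be i) t ((2 * pi - c * vd 0%N i t) / len i t).
  move=> tT; have [[cx ck _ _ cb] _ [dx _ _] [bE _ dJ] _] := hz' i.
  have [_ _ dw _] := hw i.
  pose In s := int2pi (fun y => xi 0%N i s y * k y).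
  have dIn : wderiv `[0, T]%classic In t (int2pi (fun y => - ka 0%N i t y * k y)).
    apply: (@wderiv_int2pi _ T (fun q => xi 0%N i q.1 q.2 * k q.2)
      (fun q => - ka 0%N i q.1 q.2 * k q.2)) => //.
    - by apply: cont_onM => //; apply: cont_on_snd; exact: smooth_continuous.
    - by apply: cont_onM; [apply: cont_onN|apply: cont_on_snd; exact: smooth_continuous].
    - move=> s y sT; have := wderivM (dx 0%N s y sT) (wderiv_cst `[0, T]%classic (k y) s).
      by rewrite mulr0 addr0.
  set Ka := int2pi (fun y => ka 0%N i t y * k y).
  have IKa : int2pi (fun y => - ka 0%N i t y * k y) = - Ka.
    have ckk : continuous (fun y => ka 0%N i t y * k y).
      by move=> y; apply: cvgM; [exact: cka|exact: smooth_continuous].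
    rewrite /Ka -mulN1r -int2piZ//; congr int2pi; apply/funext => y; ring.
  rewrite IKa in dIn.
  pose W' s := (2 * pi * s - c * w i s).
  have dW : wderiv `[0, T]%classic W' t (2 * pi - c * vd 0%N i t).
    rewrite -[2 * pi in X in wderiv _ _ _ X]mulr1.
    by apply: wderivB; apply: wderivZ; [exact: wderiv_id|exact: dw].
  have bE' s : 0 <= s <= T -> L0 * be i s = W' s - pi * be i s ^+ 2 - nu * (In s * be i s) - nu * J i s.
    move=> sT; rewrite {1}bE// /W clamp_id// -/(W' s) -/(In s).
    move: L0n; generalize L0 nu (be i s) (In s) (W' s) (J i s) (pi : R) => ? ? ? ? ? ? ? ?.
  by field.
  have cbt : be i s @[s --> within `[0, T]%classic (nbhs t)] --> be i t.
    by apply: cb; rewrite /= in_itv.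
  (* Subtracting the integral equation at t from the one at s and factoring yields (be s - be t) D s
     = N s. The numerator vanishes at t, with derivative 2 pi - c v because the two terms in [Ka]
     cancel, and D t is the length. *)
  pose N s := (W' s - W' t) - nu * be i t * (In s - In t) - nu * (J i s - J i t).
  pose D s := L0 + pi * (be i s + be i t) + nu * In s.
  have cBt : be i s @[s --> within `[0, T]%classic (nbhs t)] --> be i t.
    by apply: cb; rewrite /= in_itv.
  have Dlow s : 0 <= s <= T -> D s != 0.
    move=> sT; have [_ _ _ _ hs] := hz' i.
    have h1 : `|nu * In s| <= r * (2 * pi).
      rewrite /In (cov _ (cxi i s 0%N sT)).
      by apply: int2pi_norm; [exact: cxY|move=> y _; have [_ ? _ _] := hs s (Y y) sT].
    have [h2 _ _ _] := hs s 0 sT; have [h3 _ _ _] := hs t 0 tT.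
    have h4 : `|pi * (be i s + be i t)| <= pi * (r + r).
      rewrite normrM (ger0_norm (pi_ge0 R)) ler_wpM2l ?pi_ge0//.
      by apply: le_trans (ler_normD _ _) _; exact: lerD.
    have p0 : 0 < r * pi by rewrite mulr_gt0// pi_gt0.
    move: h1 h4; rewrite !ler_norml => /andP[h1 _] /andP[h4 _].
    rewrite gt_eqF// /D; move: r3 h1 h4 p0; move: (pi : R) (In s) => P IS; clear; lra.
  have cD : D s @[s --> within `[0, T]%classic (nbhs t)] --> D t.
    apply: cvgD; last by apply: cvgM; [exact: cvg_cst|exact: wderiv_cvg dIn].
    apply: cvgD; first exact: cvg_cst.
    by apply: cvgM; [exact: cvg_cst|apply: cvgD => //; exact: cvg_cst].
  have dN : wderiv `[0, T]%classic N t (2 * pi - c * vd 0%N i t).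
    have h1 := wderivB dW (wderiv_cst `[0, T]%classic (W' t) t).
    have h2 := wderivZ `[0, T]%classic (nu * be i t) (wderivB dIn (wderiv_cst `[0, T]%classic (In t) t)).
    have h3 := wderivZ `[0, T]%classic nu (wderivB (dJ t tT) (wderiv_cst `[0, T]%classic (J i t) t)).
    have := wderivB (wderivB h1 h2) h3.
    rewrite !subr0 -/Ka.
    have -> // : 2 * pi - c * vd 0%N i t - nu * be i t * - Ka - nu * (Ka * be i t) = 2 * pi - c * vd 0%N i t.
    by ring.
  have N0 : N t = 0 by rewrite /N !subrr !mulr0 !subr0.
  have LD : len i t = D t by rewrite /len /D -/(In t) -[2 * pi * _]mulrA mulr_natl mulr2n; ring.
  rewrite LD; have h := wderivD (wderiv_div_continuous dN N0 cD (Dlow t tT)) (wderiv_cst `[0, T]%classic (be i t) t).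
  rewrite addr0 in h; apply: wderiv_eqon h; last by rewrite /= in_itv.
  move=> s /set_mem; rewrite /= in_itv/= => sT.
  apply: (addIr (- be i t)); rewrite addrK; apply: (mulIf (Dlow s sT)); rewrite divfK ?Dlow//.
  have e1 := bE' s sT; have e2 := bE' t tT.
  have -> : N s = (L0 * be i s + pi * be i s ^+ 2 + nu * (In s * be i s) + nu * J i s) -
      (L0 * be i t + pi * be i t ^+ 2 + nu * (In t * be i t) + nu * J i t) -
      nu * be i t * (In s - In t) - nu * (J i s - J i t) by rewrite e1 e2 /N; ring.
  by rewrite /D; ring.
pose eta i t a := xi 0%N i t (Y a) + be i t.
pose eta1 i t a := xi 1%N i t (Y a) * (rho0 a / nu).
have deta i t : 0 <= t <= T -> deriv_of (eta i t) (eta1 i t).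
  move=> tT a; have [_ [dx _ _ _] _ _ _] := hz' i.
  have := wderivD (@deriv_of_comp _ _ _ _ _ dY (fun y => dx 0%N t y tT) a) (wderiv_cst setT (be i t) a).
  by rewrite addr0.
have deta1 i t : 0 <= t <= T -> deriv_of (eta1 i t) (fun a => ze i t (Y a) - eta i t a).
  move=> tT a; have [_ [dx _ _ _] _ _ _] := hz' i.
  have := wderivM (@deriv_of_comp _ _ _ _ _ dY (fun y => dx 1%N t y tT) a) (@dY2 a).
  rewrite (_ : _ + _ = ze i t (Y a) - eta i t a)//.
  by rewrite /ze /eta qY; ring.
have etaP i t a : eta i t (a + 2 * pi) = eta i t a.
  by have [_ [_ _ px _] _ _ _] := hz' i; rewrite /eta YP px.
have eta1P i t a : eta1 i t (a + 2 * pi) = eta1 i t a.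
  by have [_ [_ _ px _] _ _ _] := hz' i; rewrite /eta1 YP px pr.
pose X i t a := ((g0 a).1 + (eta i t a * cos a - eta1 i t a * sin a),
  (g0 a).2 + (eta i t a * sin a + eta1 i t a * cos a)).
pose rho i t a := rho0 a + ze i t (Y a).
have rhok i t a : rho i t a * k (Y a) = 1 + k (Y a) * ze i t (Y a).
  by rewrite /rho mulrDl {1}kY divff ?gt_eqF// [ze _ _ _ * _]mulrC.
have rhop i t a : 0 <= t <= T -> 0 < rho i t a.
  move=> tT; rewrite -(pmulr_lgt0 _ (k0 (Y a))) rhok.
  by rewrite (lt_le_trans _ (zlow i t _ tT)).
have hGR i t : 0 <= t <= T -> gauss_radius (X i t) (rho i t).
  move=> tT; have [_ [dx _ _ _] _ _ _] := hz' i.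
  have h1 a := @deta i t tT a; have h2 a := @deta1 i t tT a.
  have hs a := @deriv_of_sin R a; have hc a := @deriv_of_cos R a.
  split.
  - move=> a; have := wderivD (@dg1 a) (wderivB (wderivM (h1 a) (hc a)) (wderivM (h2 a) (hs a))).
    by rewrite (_ : _ + _ = - (rho i t a * sin a))// /rho; ring.
  - move=> a; apply: (wderiv_eql _ (wderivD (@dg2 a) (wderivD (wderivM (h1 a) (hs a)) (wderivM (h2 a) (hc a))))).
    by rewrite /rho; ring.
  - by move=> a; rewrite /X pg etaP eta1P sin_per cos_per.
  - have sx n : smooth (xi n i t).
      by apply: (smooth_chain (F := fun j => xi (n + j)%N i t)); [rewrite addn0|
        move=> j y; rewrite addnS; exact: dx].
    have sY : smooth Y by exact: smooth_of_derive dY sY'.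
    move=> n; apply: diffnD; first exact: sr.
    apply: (diffn_comp (sY n)); apply: diffnD; last exact: diffn_cst.
    apply: diffnD; first exact: sx.
    apply: diffnM; first exact: sq.
    by apply: diffnD; [exact: sx|apply: diffnN; apply: diffnM; [exact: sp|exact: sx]].
  - by move=> a; exact: rhop.
have t0T : (0 : R) <= 0 <= T by rewrite lexx ltW.
(* At t = 0 the equation for be is quadratic, with roots 0 and - L0 / pi; smallness excludes the
   second. *)
have be0 i : be i 0 = 0.
  have [_ _ [_ xi0 _] [bE J0 _] hs] := hz' i; have [w0 _ _ _] := hw i.
  have := bE 0 t0T; rewrite J0 /W clamp_id// w0 !mulr0 subrr mul0r !subr0.
  rewrite (_ : (fun y => _) = (fun=> 0)); last by apply/funext => y; rewrite xi0 mul0r.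
  rewrite int2pi_cst !mul0r mulr0 subr0 sub0r => e0.
  have e : be i 0 = - (pi / L0 * be i 0 ^+ 2) := e0.
  have [h2 _ _ _] := hs 0 0 t0T.
  have p0 : 0 < r * pi by rewrite mulr_gt0// pi_gt0.
  have h4 : `|pi * be i 0| <= pi * r by rewrite normrM (ger0_norm (pi_ge0 R)) ler_wpM2l ?pi_ge0.
  have pos : L0 + pi * be i 0 != 0.
    rewrite gt_eqF//; move: h4; rewrite ler_norml => /andP[h4 _].
    by move: r3 h4 p0; generalize L0 r (pi : R) (be i 0) => ? ? ? ?; clear; lra.
  have : be i 0 * (L0 + pi * be i 0) = 0.
    have e' : L0 * be i 0 = - (pi * be i 0 ^+ 2).
      move: e L0n; generalize L0 (pi : R) (be i 0) => L P x ex Ln.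
      have -> : L * x = L * - (P / L * x ^+ 2) by rewrite -ex.
      by field.
    by rewrite mulrDr [_ * L0]mulrC e'; ring.
  by move/eqP; rewrite mulf_eq0 (negPf pos) orbF => /eqP.
exists X, rho; split => //.
- move=> i; apply/funext => a; have [_ _ [_ xi0 _] _ _] := hz' i.
  by rewrite /X /eta /eta1 !xi0 be0 addr0 !mul0r subr0 !addr0 -surjective_pairing.
- move=> i t a tT; have [_ _ _ _ hs] := hz' i; have [b1 b2 b3 b4] := hs t (Y a) tT.
  have e1 : `|eta i t a| <= 2 * r.
    by apply: le_trans (ler_normD _ _) _; rewrite mulr_natl mulr2n lerD.
  have e2 : `|eta1 i t a| <= r * Cy by rewrite normrM ler_pM.
  have tr (x y : R) : `|x| <= 1 -> `|y| <= 1 -> `|eta i t a * x + eta1 i t a * y| <= eps.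
    move=> x1 y1; apply: le_trans r1; apply: le_trans (ler_normD _ _) _.
    rewrite mulrDr lerD// normrM -[leRHS]mulr1 ler_pM//.
    by rewrite mulrC.
  have cl : `|cos a| <= 1 by rewrite ler_norml cos_geN1 cos_le1.
  have sl : `|sin a| <= 1 by rewrite ler_norml sin_geN1 sin_le1.
  split.
  + by rewrite /rho addrC addKr (le_trans b4).
  + by rewrite /X /= [_ - (g0 a).1]addrC addKr -mulrN; apply: tr; rewrite ?normrN.
  + by rewrite /X /= [_ - (g0 a).2]addrC addKr; apply: tr.
- move=> i t a tT; have [_ _ [dx _ _] _ _] := hz' i.
  (* zeta - eta is the derivative of the periodic [eta1], so the length differs from L0 by the
     integral of eta. *)
  have Ln : int2pi (rho i t) = len i t.
    have cz : continuous (fun a => ze i t (Y a) - eta i t a).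
      have cx1 := cxY i t _ tT.
      have cYq : continuous (fun a => q (Y a)).
        by move=> x; apply: continuous_comp; [exact: cY|exact: smooth_continuous].
      have cYp : continuous (fun a => p (Y a)).
        by move=> x; apply: continuous_comp; [exact: cY|exact: smooth_continuous].
      move=> x; apply: cvgB; [apply: cvgD; [apply: cvgD|exact: cvg_cst]|apply: cvgD; [|exact: cvg_cst]].
      - exact: cx1.
      - by apply: cvgM; [exact: cYq|apply: cvgB; [exact: cx1|apply: cvgM; [exact: cYp|exact: cx1]]].
      - exact: cx1.
    have ce : continuous (eta i t) by exact: wderiv_continuous (@deta i t tT).
    have -> : rho i t = (fun a => rho0 a + ((ze i t (Y a) - eta i t a) + eta i t a)).
      by apply/funext => x; rewrite subrK.
    rewrite int2piD; first last.
    - by move=> x; apply: cvgD; [exact: cz|exact: ce].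
    - exact: smooth_continuous.
    rewrite int2piD// (int2pi_anti cz (@deta1 i t tT)).
    rewrite -[2 * pi]add0r eta1P subrr add0r lenE// -addrA; congr (_ + _).
    rewrite /eta int2piD; [|exact: cxY|by move=> x; exact: cvg_cst].
    by rewrite int2pi_cst mulrC.
  rewrite Ln.
  have -> : (fun s => dotp (X i s a) (normal a)) = (fun s => dotp (g0 a) (normal a) + eta i s a).
    apply/funext => s; rewrite /dotp /X /normal /=.
    have cs : cos a * cos a + sin a * sin a = 1 by rewrite -!expr2 cos2Dsin2.
    have -> : ((g0 a).1 + (eta i s a * cos a - eta1 i s a * sin a)) * cos a +
      ((g0 a).2 + (eta i s a * sin a + eta1 i s a * cos a)) * sin a =
      (g0 a).1 * cos a + (g0 a).2 * sin a + eta i s a * (cos a * cos a + sin a * sin a) by ring.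
    by rewrite cs mulr1.
  have -> : (rho i t a)^-1 = ka 0%N i t (Y a).
    rewrite kaE// -rhok; field; rewrite !gt_eqF//; exact: rhop.
  have := wderivD (wderiv_cst `[0, T]%classic (dotp (g0 a) (normal a)) t) (wderivD (dx 0%N t (Y a) tT) (tb i t tT)).
  by rewrite add0r.
- have [sg1 sg2] := gauss_radius_smooth hg.
  have main (Tp : 0 < T) (A : I -> R) (A1 : forall i, 1 <= A i) (N : nat) :
    (forall a i t, (a <= N)%N -> 0 <= t <= T -> `|vd a i t| <= A i) ->
    forall j m, (j <= N)%N ->
    [/\ smooth_class (strip Tp A1) j m 0 (fun i q => eta i q.1 q.2),
        smooth_class (strip Tp A1) j m 0 (fun i q => eta1 i q.1 q.2) &
        smooth_class (strip Tp A1) j m 0 (fun i q => ze i q.1 (Y q.2))].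
    move=> vb j m jN.
    have pY'' y : rho0 (y + 2 * pi) / nu = rho0 y / nu by rewrite pr.
    have dv a i t : 0 <= t <= T -> wderiv `[0, T]%classic (vd a i) t (vd a.+1 i t).
      by have [_ _ _ h] := hw i; exact: h.
    have [||||||||Cx Ck' Cb] := @solution_class R I T A Tp A1 k p q nu L0 c sk sp sq kP pP qP L00
      xi ka be vd N vb dv XB KB r _ _ _ _ _ _ _ _ kaE zlow lenlow tb j jN.
    + by move=> n i; have [[h _ _ _ _] _ _ _ _] := hz' i.
    + by move=> n i; have [[_ h _ _ _] _ _ _ _] := hz' i.
    + by move=> n i t y tT; have [[_ _ h _ _] _ _ _ _] := hz' i; exact: h.
    + by move=> n i t y tT; have [[_ _ _ h _] _ _ _ _] := hz' i; exact: h.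
    + by move=> i t tT; have [_ _ _ _ h] := hz' i; have [] := h t 0 tT.
    + by move=> n i t y tT; have [_ [h _ _ _] _ _ _] := hz' i; exact: h.
    + by move=> n i t y tT; have [_ [_ h _ _] _ _ _] := hz' i; exact: h.
    + by move=> n i t y tT; have [_ _ [h _ _] _ _] := hz' i; exact: h.
    have CxY n m' : smooth_class (strip Tp A1) j m' 0 (fun i q => xi n i q.1 (Y q.2)).
      exact: (@strip_comp R I T A Tp A1 Y _ j m' 0 (fun i q => xi n i q.1 q.2) dY sY' pY'' (fun m'' => Cx m'' n)).
    have Cf f m' : smooth f -> (forall y, f (y + 2 * pi) = f y) ->
        smooth_class (strip Tp A1) j m' 0 (fun _ q => f (Y q.2)).
      move=> sf pf; apply: (@strip_comp R I T A Tp A1 Y _ j m' 0 (fun _ q => f q.2) dY sY' pY'') => m''.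
      exact: smooth_class_space.
    split.
    + by apply: smooth_classD.
    + exact: (smooth_classM (CxY 1%N m) (smooth_class_space Tp A1 j m sY' pY'')).
    + apply: smooth_classD => //; apply: smooth_classD => //; apply: (smooth_classM (Cf q m sq qP)).
      apply: smooth_classB => //; exact: (smooth_classM (Cf p m sp pP) (CxY 1%N m)).
  have [ss sc] := @smooth_trig R.
  have pg1 a : (g0 (a + 2 * pi)).1 = (g0 a).1 by rewrite pg.
  have pg2 a : (g0 (a + 2 * pi)).2 = (g0 a).2 by rewrite pg.
  split=> Tp A A1 N vb j m jN; have [C1 C2 C3] := main Tp A A1 N vb j m jN.
  + apply: smooth_classD; first exact: (smooth_class_space Tp A1 j m sg1 pg1).
    apply: smooth_classB; apply: (@smooth_classM _ _ _ _ _ _ _ 0 0) => //.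
      exact: (smooth_class_space Tp A1 j m sc (@cos_per R)).
    exact: (smooth_class_space Tp A1 j m ss (@sin_per R)).
  + apply: smooth_classD; first exact: (smooth_class_space Tp A1 j m sg2 pg2).
    apply: smooth_classD; apply: (@smooth_classM _ _ _ _ _ _ _ 0 0) => //.
      exact: (smooth_class_space Tp A1 j m ss (@sin_per R)).
    exact: (smooth_class_space Tp A1 j m sc (@cos_per R)).
  + by apply: smooth_classD => //; exact: (smooth_class_space Tp A1 j m sr pr).
Qed.

End FlowFamily.

(** * Uniqueness of the flow *)

Section Extrema.
Context {R : realType}.

Lemma slab_max (T : R) (f : R * R -> R) : 0 <= T -> cont_on (slab T) f ->
  (forall t y, 0 <= t <= T -> f (t, y + 2 * pi) = f (t, y)) ->
  exists2 p, slab T p & forall q, slab T q -> f q <= f p.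
Proof.
move=> T0 cf pf; have pi2 := @pi2_gt0 R.
pose K : set (R * R) := `[0, T]%classic `*` `[0, 2 * pi]%classic.
have KS : K `<=` slab T by move=> q [/= h _]; move: h; rewrite in_itv.
have K0 : K !=set0 by exists (0, 0); split; rewrite /= in_itv/= lexx ?T0 ?ltW.
have cK : compact K by apply: compact_setX; exact: segment_compact.
have cfK : {within K, continuous f} by apply/subspace_continuousP => q Kq; exact: (cont_on_sub KS cf).
have [p /set_mem Kp hp] := compact_EVT_max K0 cK cfK.
exists p; first exact: KS.
move=> -[t y] /= tT.
have [y' /andP[y0 y2] <-] := periodic_reduce y 0 (fun y => pf t y tT).
apply: hp; apply/mem_set; split; rewrite /= in_itv//=.
by rewrite y0 ltW// -[X in _ < X]add0r.
Qed.

Lemma interval_bounded (T : R) (f : R -> R) : 0 <= T -> cont_on (`[0, T]%classic : set R) f ->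
  exists2 C : R, 0 <= C & forall t, 0 <= t <= T -> `|f t| <= C.
Proof.
move=> T0 cf.
have [||p _ hp] := @slab_max T (fun q => `|f q.1|) T0.
- have h := cont_on_fst cf; move=> q qT; apply: cvg_norm; exact: h.
- by [].
- by exists `|f p.1| => // t tT; exact: (hp (t, 0)).
Qed.

Lemma max_first_derivative (f f' : R -> R) t : deriv_of f f' -> (forall s, f s <= f t) -> f' t = 0.
Proof.
move=> df hm; apply/eqP; rewrite -normr_le0; apply/ler_addgt0Pr => e e0; rewrite add0r.
have /wderivP/(_ _ e0)[d d0 hd] := df t.
have d2 : `|d / 2| < d by rewrite ger0_norm ?divr_ge0 ?ltW// ltr_pdivrMr// ltr_pMr// ltr1n.
have h1 := hd (t + d / 2) Logic.I; have h2 := hd (t - d / 2) Logic.I.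
rewrite [t + _ - t]addrC addKr in h1; rewrite [t - _ - t]addrC addKr normrN in h2.
have {}h1 := h1 d2; have {}h2 := h2 d2.
have m1 := hm (t + d / 2); have m2 := hm (t - d / 2).
have p2 : 0 < d / 2 by rewrite divr_gt0.
rewrite (gtr0_norm p2) in h1 h2.
have : `|f' t| * (d / 2) <= e * (d / 2).
  rewrite -{1}(gtr0_norm p2) -normrM ler_norml; apply/andP.
  by move: h1 h2; rewrite !ler_norml => /andP[a1 a2] /andP[b1 b2]; rewrite mulrN in b1 b2; split; lra.
by rewrite ler_pM2r.
Qed.

Lemma max_second_derivative (f f' : R -> R) t l : deriv_of f f' -> wderiv setT f' t l ->
  (forall s, f s <= f t) -> l <= 0.
Proof.
move=> df df' hm; rewrite leNgt; apply/negP => l0.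
have f0 := max_first_derivative df hm.
have l2 : 0 < l / 2 by rewrite divr_gt0.
have /wderivP/(_ _ l2)[d d0 hd] := df'.
have d2 : 0 < d / 2 by rewrite divr_gt0.
have td : t < t + d / 2 by rewrite ltrDl.
have [s /andP[s1 s2] e] := @wderiv_MVT _ setT f f' t (t + d / 2) td (fun _ _ => Logic.I) (fun s _ => df s).
have := hm (t + d / 2); rewrite -subr_le0 e [t + _ - t]addrC addKr pmulr_lle0//.
have st : 0 < s - t by rewrite subr_gt0.
have := hd s Logic.I; rewrite f0 subr0 (gtr0_norm st) => h.
have {}h := h _; have sd : s - t < d by lra.
have := h sd; rewrite ler_norml => /andP[a1 _].
have p : 0 < l * (s - t) by rewrite mulr_gt0.
by lra.
Qed.

(** The value at t is compared with earlier ones, so that t = T is allowed. *)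
Lemma max_left_derivative (T : R) (f : R -> R) t l : 0 < t <= T -> wderiv `[0, T]%classic f t l ->
  (forall s, 0 <= s <= T -> f s <= f t) -> 0 <= l.
Proof.
move=> /andP[t0 tT] df hm; rewrite leNgt; apply/negP => l0.
have l2 : 0 < - l / 2 by rewrite divr_gt0// oppr_gt0.
have /wderivP/(_ _ l2)[d d0 hd] := df.
pose z := Num.min (d / 2) t.
have z0 : 0 < z by rewrite lt_min t0 divr_gt0.
have zt : z <= t by rewrite ge_min lexx orbT.
have zd : z < d by apply: le_lt_trans (_ : d / 2 < d); [rewrite ge_min lexx|rewrite ltr_pdivrMr// ltr_pMr// ltr1n].
have sT : 0 <= t - z <= T by apply/andP; split; lra.
have := hd (t - z); rewrite /= in_itv/= sT [t - z - t]addrC addKr normrN (gtr0_norm z0) => /(_ isT zd).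
rewrite ler_norml mulrN opprK => /andP[a1 _].
have := hm _ sT; have p : l * z < 0 by rewrite nmulr_rlt0.
by lra.
Qed.

End Extrema.

Section FlowFacts.
Context {R : realType}.
Implicit Types (T c : R) (v : R -> R) (X : R -> R -> R * R).

(** The common ground for uniqueness: both the constructed family and an arbitrary flow in the sense
    of [is_flow] provide these facts. *)
Definition flow_facts T c v X (rho : R -> R -> R) : Prop :=
  [/\ forall t, 0 <= t <= T -> gauss_radius (X t) (rho t),
      cont_on (slab T) (fun q => (X q.1 q.2).1) /\ cont_on (slab T) (fun q => (X q.1 q.2).2),
      cont_on (slab T) (fun q => rho q.1 q.2) &
      forall t a, 0 <= t <= T -> wderiv `[0, T]%classic (fun s => dotp (X s a) (normal a)) t
        (- (rho t a)^-1 + (2 * pi - c * v t) / int2pi (rho t))].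

Lemma flow_facts_sub T T' c v X rho : T' <= T -> flow_facts T c v X rho -> flow_facts T' c v X rho.
Proof.
move=> TT [h1 [h2 h2'] h3 h4].
have sub t : 0 <= t <= T' -> 0 <= t <= T by move=> /andP[-> /= h]; exact: le_trans TT.
have SS : slab T' `<=` slab T by move=> q; exact: sub.
split.
- by move=> t /sub; exact: h1.
- by split; [exact: cont_on_sub h2|exact: cont_on_sub h2'].
- exact: cont_on_sub h3.
- move=> t a tT; apply: (wderiv_sub _ (h4 t a (sub t tT))).
  by move=> s; rewrite /= !in_itv; exact: sub.
Qed.

Lemma flow_facts_lower T c v X rho : 0 <= T -> flow_facts T c v X rho ->
  exists2 r0 : R, 0 < r0 & forall t a, 0 <= t <= T -> r0 <= rho t a.
Proof.
move=> T0 [h1 _ h3 _].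
have [||p pT hp] := @slab_max R T (fun q => - rho q.1 q.2) T0.
- exact: cont_onN.
- by move=> t y tT /=; rewrite (gauss_radius_periodic (h1 t tT)).
- exists (rho p.1 p.2); first by have [_ _ _ _ h] := h1 _ pT; exact: h.
  by move=> t a tT; have := hp (t, a) tT; rewrite lerN2.
Qed.

(** Let eta be the difference of the support functions. At a nonzero maximum of exp (- 2 lam t)
    eta^2 the second derivative in the angle gives eta (rho - rho') <= eta^2, and the nonlocal term
    is of the order of |eta| because the lengths differ by the integral of eta. With lam above the
    resulting constant [C1] the time derivative would be negative there. *)
Lemma flow_facts_unique T c v X X' rho rho' (B : R) : 0 < T ->
  flow_facts T c v X rho -> flow_facts T c v X' rho' -> X 0 = X' 0 ->
  (forall t, 0 <= t <= T -> `|v t| <= B) -> forall t a, 0 <= t <= T -> X' t a = X t a.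
Proof.
move=> T0 hF hF' X0 vB.
have [r1 r10 hr1] := flow_facts_lower (ltW T0) hF.
have [r2 r20 hr2] := flow_facts_lower (ltW T0) hF'.
have [g [c1 c2] cr hd] := hF; have [g' [c1' c2'] cr' hd'] := hF'.
pose r0 := Num.min r1 r2; have r00 : 0 < r0 by rewrite lt_min r10.
have lo t a : 0 <= t <= T -> r0 <= rho t a by move=> tT; rewrite ge_min hr1.
have lo' t a : 0 <= t <= T -> r0 <= rho' t a by move=> tT; rewrite ge_min hr2 ?orbT.
have pi2 := @pi2_gt0 R.
pose e1 t a := (X t a).1 - (X' t a).1; pose e2 t a := (X t a).2 - (X' t a).2.
pose eta t a := e1 t a * cos a + e2 t a * sin a.
pose etd t a := e1 t a * - sin a + e2 t a * cos a.
have d_eta t : 0 <= t <= T -> deriv_of (eta t) (etd t).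
  move=> tT a; have [d1 d2 _ _ _] := g t tT; have [d1' d2' _ _ _] := g' t tT.
  have h1 := wderivM (wderivB (@d1 a) (@d1' a)) (@deriv_of_cos R a).
  have h2 := wderivM (wderivB (@d2 a) (@d2' a)) (@deriv_of_sin R a).
  by apply: (wderiv_eql _ (wderivD h1 h2)); rewrite /etd /e1 /e2; ring.
have d_etd t : 0 <= t <= T -> deriv_of (etd t) (fun a => rho t a - rho' t a - eta t a).
  move=> tT a; have [d1 d2 _ _ _] := g t tT; have [d1' d2' _ _ _] := g' t tT.
  have h1 := wderivM (wderivB (@d1 a) (@d1' a)) (wderivN (@deriv_of_sin R a)).
  have h2 := wderivM (wderivB (@d2 a) (@d2' a)) (@deriv_of_cos R a).
  apply: (wderiv_eql _ (wderivD h1 h2)).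
  have cs : sin a * sin a + cos a * cos a = 1 by rewrite addrC -!expr2 cos2Dsin2.
  rewrite -[rho t a - rho' t a]mulr1 -cs /eta /e1 /e2; ring.
have petd t a : 0 <= t <= T -> etd t (a + 2 * pi) = etd t a.
  move=> tT; have [_ _ p _ _] := g t tT; have [_ _ p' _ _] := g' t tT.
  by rewrite /etd /e1 /e2 p p' sin_per cos_per.
have peta t a : 0 <= t <= T -> eta t (a + 2 * pi) = eta t a.
  move=> tT; have [_ _ p _ _] := g t tT; have [_ _ p' _ _] := g' t tT.
  by rewrite /eta /e1 /e2 p p' sin_per cos_per.
have pi0 := @pi_gt0 R.
(* The first term bounds the contribution of the curvatures, the second that of the terms divided by
   the lengths, both through the lower bound r0 of the two radii. *)
pose C1 := r0 ^- 2 + (2 * pi + `|c| * B) * (2 * pi) / (r0 * (2 * pi)) ^+ 2.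
pose lam := C1 + 1.
pose u t a := expR (- (2 * lam) * t) * (eta t a) ^+ 2.
have c_eta : cont_on (slab T) (fun q => eta q.1 q.2).
  apply: cont_onD; apply: cont_onM.
  - exact: (cont_onD c1 (cont_onN c1')).
  - by apply: cont_on_snd; exact: smooth_continuous (@smooth_trig R).2.
  - exact: (cont_onD c2 (cont_onN c2')).
  - by apply: cont_on_snd; exact: smooth_continuous (@smooth_trig R).1.
have d_exp (t : R) A : wderiv A (fun s => expR (- (2 * lam) * s)) t (- (2 * lam) * expR (- (2 * lam) * t)).
  have h1 : deriv_of (fun s : R => - (2 * lam) * s) (fun=> - (2 * lam)).
    by move=> s; have := wderivZ setT (- (2 * lam)) (wderiv_id setT s); rewrite mulr1.
  have h2 : deriv_of (@expR R) expR by apply: is_derive_deriv_of => s; exact: is_derive_expR.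
  apply: (wderiv_sub (A := setT)) => //.
  by apply: (wderiv_eql _ (@deriv_of_comp _ _ _ _ _ h1 h2 t)); exact: mulrC.
have c_exp : continuous (fun s : R => expR (- (2 * lam) * s)).
  by apply: wderiv_continuous => s; exact: d_exp.
have [||p pT hp] := @slab_max R T (fun q => u q.1 q.2) (ltW T0).
- apply: cont_onM; last exact: (cont_onM c_eta c_eta).
  exact: (@cont_on_fst _ T (fun s => expR (- (2 * lam) * s)) (cont_onT c_exp)).
- by move=> t y tT /=; rewrite /u peta.
have ep t : 0 < expR (- (2 * lam) * t) by exact: expR_gt0.
have B0 : 0 <= B by apply: le_trans (vB 0 _); rewrite ?lexx ?(ltW T0).
have C10 : 0 <= C1.
  apply: addr_ge0; first by rewrite invr_ge0 exprn_ge0// ltW.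
  apply: divr_ge0; last by rewrite exprn_ge0// mulr_ge0// ltW.
  by apply: mulr_ge0; [apply: addr_ge0; [exact: ltW|exact: mulr_ge0]|exact: ltW].
have eta_zero : eta p.1 p.2 = 0.
  apply/eqP; apply/negPn/negP => en0.
  set t := p.1 in pT hp en0 *; set a := p.2 in hp en0 *.
  have tT : 0 <= t <= T by [].
  have t0 : 0 < t.
    have /andP[t0 _] := tT; rewrite lt_neqAle t0 andbT; apply: contra_neq en0 => t0'.
    by rewrite /eta /e1 /e2 -t0' X0 !subrr !mul0r addr0.
  have e2p : 0 < eta t a ^+ 2 by rewrite exprn_even_gt0.
  have amax b : eta t b ^+ 2 <= eta t a ^+ 2.
    by have := hp (t, b) tT; rewrite /u /= ler_pM2l.
  have d2eta : deriv_of (fun b => eta t b ^+ 2) (fun b => 2 * (eta t b * etd t b)).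
    move=> b; have := wderivM (@d_eta t tT b) (@d_eta t tT b).
    by apply: wderiv_eql; ring.
  have etd0 : etd t a = 0.
    have := max_first_derivative d2eta amax; move/eqP.
    by rewrite mulf_eq0 pnatr_eq0/= mulf_eq0 (negPf en0)/= => /eqP.
  have sec : eta t a * (rho t a - rho' t a) <= eta t a ^+ 2.
    have h := wderivZ setT 2 (wderivM (@d_eta t tT a) (@d_etd t tT a)).
    have := max_second_derivative d2eta h amax.
    rewrite etd0 mul0r add0r pmulr_rle0// => h2.
    by rewrite -subr_le0; apply: le_trans h2; rewrite le_eqVlt; apply/orP; left; apply/eqP; ring.
  pose L := int2pi (rho t); pose L' := int2pi (rho' t).
  have cr1 : continuous (rho t) by exact: slab_line cr tT.
  have cr2 : continuous (rho' t) by exact: slab_line cr' tT.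
  have L0 : r0 * (2 * pi) <= L by apply: int2pi_ge => // b; exact: lo.
  have L0' : r0 * (2 * pi) <= L' by apply: int2pi_ge => // b; exact: lo'.
  have rpi : 0 < r0 * (2 * pi) by rewrite mulr_gt0.
  have Lp : 0 < L := lt_le_trans rpi L0; have Lp' : 0 < L' := lt_le_trans rpi L0'.
  have ceta : continuous (eta t) by exact: wderiv_continuous (@d_eta t tT).
  have LL : L - L' = int2pi (eta t).
    have cz : continuous (fun b => rho t b - rho' t b - eta t b).
      by move=> b; apply: cvgB; [apply: cvgB; [exact: cr1|exact: cr2]|exact: ceta].
    have e2pi : etd t (2 * pi) = etd t 0 by rewrite -(petd t 0 tT) add0r.
    have z0 := int2pi_anti cz (@d_etd t tT); rewrite e2pi subrr in z0.
    have : L = L' + (int2pi (fun b => rho t b - rho' t b - eta t b) + int2pi (eta t)).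
      rewrite -!int2piD//; last by move=> b; apply: cvgD; [exact: cz|exact: ceta].
      by congr int2pi; apply/funext => b; ring.
    by rewrite z0 add0r => ->; rewrite addrC addKr.
  have LB : `|L - L'| <= `|eta t a| * (2 * pi).
    rewrite LL; apply: int2pi_norm => // b _.
    by rewrite -ler_sqr ?nnegrE// !real_normK ?num_real.
  have dt := wderivM (d_exp t `[0, T]%classic) (wderivM (wderivB (hd t a tT) (hd' t a tT)) (wderivB (hd t a tT) (hd' t a tT))).
  set q := - (rho t a)^-1 + _ - (- (rho' t a)^-1 + _) in dt.
  have eE s : dotp (X s a) (normal a) - dotp (X' s a) (normal a) = eta s a.
    by rewrite /eta /e1 /e2 /dotp /normal /=; ring.
  have ddt : wderiv `[0, T]%classic (fun s => u s a) t
      (expR (- (2 * lam) * t) * (2 * (eta t a * q - lam * eta t a ^+ 2))).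
    apply: wderiv_ext (wderiv_eql _ dt).
      by move=> s; rewrite eE /u expr2.
    by rewrite eE; ring.
  have tT' : 0 < t <= T by rewrite t0; case/andP: tT.
  have := max_left_derivative tT' ddt _ => /(_ _).
  have smax s : 0 <= s <= T -> u s a <= u t a by move=> sT; exact: (hp (s, a)).
  move=> /(_ smax); rewrite pmulr_rge0// pmulr_rge0// subr_ge0 => key.
  have rp : 0 < rho t a := lt_le_trans r00 (lo t a tT).
  have rp' : 0 < rho' t a := lt_le_trans r00 (lo' t a tT).
  have qE : eta t a * q = eta t a * (rho t a - rho' t a) / (rho t a * rho' t a) +
      eta t a * ((2 * pi - c * v t) * (L' - L) / (L * L')).
    by rewrite /q -/L -/L'; field; rewrite !gt_eqF.
  have b1 : eta t a * (rho t a - rho' t a) / (rho t a * rho' t a) <= eta t a ^+ 2 * r0 ^- 2.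
    apply: (@le_trans _ _ (eta t a ^+ 2 / (rho t a * rho' t a))).
      by rewrite ler_wpM2r// invr_ge0 mulr_ge0// ltW.
    rewrite ler_wpM2l ?(ltW e2p)// lef_pV2 ?posrE ?exprn_gt0 ?mulr_gt0//.
    by rewrite expr2 ler_pM ?(ltW r00) ?lo ?lo'.
  have b2 : eta t a * ((2 * pi - c * v t) * (L' - L) / (L * L')) <=
      eta t a ^+ 2 * ((2 * pi + `|c| * B) * (2 * pi) / (r0 * (2 * pi)) ^+ 2).
    apply: le_trans (ler_norm _) _; rewrite !normrM.
    have -> : eta t a ^+ 2 * ((2 * pi + `|c| * B) * (2 * pi) / (r0 * (2 * pi)) ^+ 2) =
      `|eta t a| * ((2 * pi + `|c| * B) * (`|eta t a| * (2 * pi)) / (r0 * (2 * pi)) ^+ 2).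
      by rewrite -[eta t a ^+ 2]real_normK ?num_real// expr2; ring.
    rewrite ler_wpM2l// ler_pM//.
      rewrite ler_pM//; last by rewrite distrC.
      apply: le_trans (ler_normB _ _) _; rewrite (gtr0_norm pi2) lerD2l normrM.
      by rewrite ler_wpM2l// vB.
    rewrite gtr0_norm ?invr_gt0 ?mulr_gt0// lef_pV2 ?posrE ?exprn_gt0 ?mulr_gt0//.
    by rewrite expr2 ler_pM// ltW.
  have : lam * eta t a ^+ 2 <= C1 * eta t a ^+ 2.
    apply: le_trans key _; rewrite qE; apply: le_trans (lerD b1 b2) _.
    by rewrite -mulrDr mulrC.
  rewrite /lam mulrDl mul1r gerDl leNgt e2p//.
have eta0 t a : 0 <= t <= T -> eta t a = 0.
  move=> tT; apply/eqP; rewrite -sqrf_eq0 eq_le sqr_ge0 andbT -(pmulr_rle0 _ (ep t)).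
  by apply: le_trans (hp (t, a) tT) _; rewrite /u eta_zero expr0n mulr0.
move=> t a tT.
(* [eta] is the normal component of the difference of the curves, and its derivative [etd] the
   tangential one; both vanish. *)
have etd0 : etd t a = 0.
  apply: (@wderiv_uniqueT _ (eta t) a); first exact: d_eta.
  have -> : eta t = (fun=> 0) by apply/funext => b; exact: eta0.
  exact: wderiv_cst.
have := eta0 t a tT; move: etd0; rewrite /eta /etd => h2 h1.
have cs : sin a * sin a + cos a * cos a = 1 by rewrite addrC -!expr2 cos2Dsin2.
have z1 : e1 t a = 0.
  have -> : e1 t a = (e1 t a * cos a + e2 t a * sin a) * cos a - (e1 t a * - sin a + e2 t a * cos a) * sin a.
    by rewrite -[LHS]mulr1 -cs; ring.
  by rewrite h1 h2 !mul0r subr0.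
have z2 : e2 t a = 0.
  have -> : e2 t a = (e1 t a * cos a + e2 t a * sin a) * sin a + (e1 t a * - sin a + e2 t a * cos a) * cos a.
    by rewrite -[LHS]mulr1 -cs; ring.
  by rewrite h1 h2 !mul0r addr0.
apply/esym; rewrite [LHS]surjective_pairing [RHS]surjective_pairing; congr pair; apply/eqP.
  by rewrite -subr_eq0; apply/eqP.
by rewrite -subr_eq0; apply/eqP.
Qed.

End FlowFacts.

Section FlowCharacterization.
Context {R : realType}.
Implicit Types (D : set (R * R)) (T c : R) (v : R -> R) (X : R -> R -> R * R).

Lemma slabE T : (`[0, T]%classic `*` setT : set (R * R)) = slab T.
Proof.
apply/seteqP; split => q; rewrite /slab /= in_itv/=; first by case.
by [].
Qed.

Lemma is_flow_facts D g0 v T X : 0 < T -> is_flow D g0 v T X ->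
  flow_facts T (area D / 2) v X (fun t => speed (X t)).
Proof.
move=> T0 [sX X0 gD vel].
have hg t : 0 <= t <= T -> gauss_radius (X t) (speed (X t)).
  move=> tT; have [|g _] := gD t; first by rewrite /= in_itv.
  by have [rho h] := gauss_curve_radius g; rewrite (gauss_radius_speed h).
have cc i m : cont_on (slab T) (fun q => Defs.coord i (dth m (X q.1) q.2)).
  move=> -[t a] tT; have [|_ _] := sX i 0%N m t a; first by rewrite /= in_itv.
  by rewrite slabE.
have wd i t a : 0 <= t <= T ->
    wderiv `[0, T]%classic (fun s => Defs.coord i (X s a)) t (dt_dth T 1 0 i X t a).
  move=> tT; have [|_ h _] := sX i 0%N 0%N t a; first by rewrite /= in_itv.
  have E : (fun s => dt_dth T 0 0 i X s a) = (fun s => Defs.coord i (X s a)).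
    by apply/funext => s; rewrite /dt_dth /= /dth /Defs.coord /=; case: (i == ord0).
  by rewrite E in h; move: h; rewrite /derivable_w /dt_dth /derwn /= -/(derw _ _ _) -E.
split => //.
- split.
  + apply: cont_on_eq (cc ord0 0%N) => q _; exact: erefl.
  + apply: cont_on_eq (cc ord_max 0%N) => q _; exact: erefl.
- apply: (cont_on_eq (f := fun q => Defs.coord ord0 (dth 1 (X q.1) q.2) * - sin q.2 +
      Defs.coord ord_max (dth 1 (X q.1) q.2) * cos q.2)).
    move=> q qT; rewrite (gauss_radius_dth1 (hg _ qT)) /Defs.coord /=.
    set r := speed _ _; rewrite (_ : _ + _ = r * (cos q.2 ^+ 2 + sin q.2 ^+ 2)); last first.
      rewrite /tangent /GRing.scale /=; ring.
    by rewrite cos2Dsin2 mulr1.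
  apply: cont_onD; apply: cont_onM => //.
    by apply: cont_onN; apply: cont_on_snd; exact: smooth_continuous (@smooth_trig R).1.
  by apply: cont_on_snd; exact: smooth_continuous (@smooth_trig R).2.
- move=> t a tT.
  have h := wderivD (wderivM (wd ord0 t a tT) (wderiv_cst `[0, T]%classic (cos a) t))
    (wderivM (wd ord_max t a tT) (wderiv_cst `[0, T]%classic (sin a) t)).
  apply: wderiv_eql h; rewrite !mulr0 !addr0.
  have := vel t a; rewrite /= in_itv/= => /(_ tT).
  rewrite /velocity (gauss_radius_curv (hg t tT)) (gauss_radius_avg (hg t tT)) (gauss_radius_clen (hg t tT)).
  rewrite {1}/dotp /normal /= => e.
  have [r0 r00 hr] := gauss_radius_lower (hg t tT).
  have L0 : int2pi (speed (X t)) != 0.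
    rewrite gt_eqF//; apply: lt_le_trans (int2pi_ge _ hr); first by rewrite mulr_gt0 ?pi2_gt0.
    by apply: smooth_continuous; have [] := hg t tT.
  have s0 : speed (X t) a != 0 by have [_ _ _ _ /(_ a) h0] := hg t tT; rewrite gt_eqF.
  rewrite -[LHS]opprK e; move: L0 s0; generalize (int2pi (speed (X t))) (speed (X t) a) (pi : R) => L r P L0 s0.
  by field; rewrite L0 s0.
Qed.

End FlowCharacterization.

Section FamilyIsFlow.
Context {R : realType} {I : Type}.
Variables (D : set (R * R)) (T : R) (T0 : 0 < T) (g0 : R -> R * R).
Variables (vd : nat -> I -> R -> R) (X : I -> R -> R -> R * R) (rho : I -> R -> R -> R).
Hypothesis (dv : forall i a t, 0 <= t <= T -> wderiv `[0, T]%classic (vd a i) t (vd a.+1 i t)).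

(** For statements without estimates: finitely many continuous derivatives on [0, T] are bounded,
    index by index. *)
Lemma amplitude_exists (N : nat) : exists A : I -> R, (forall i, 1 <= A i) /\
  forall a i t, (a <= N)%N -> 0 <= t <= T -> `|vd a i t| <= A i.
Proof.
have bd a i : exists C : R, 0 <= C /\ forall t, 0 <= t <= T -> `|vd a i t| <= C.
  have [|C C0 hC] := @interval_bounded R T (vd a i) (ltW T0); last by exists C.
  move=> t; rewrite /= in_itv/= => tT; have h := @dv i a t tT; exact: (wderiv_cvg h).
have h i : exists A : R, 1 <= A /\ forall a t, (a <= N)%N -> 0 <= t <= T -> `|vd a i t| <= A.
  have [C hC] := choice (fun a => bd a i).
  have C0 a : 0 <= C a by case: (hC a).
  exists (1 + \sum_(a < N.+1) C a); split; first by rewrite lerDl sumr_ge0.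
  move=> a t aN tT; apply: le_trans ((hC a).2 t tT) _.
  rewrite (bigD1 (Ordinal (aN : (a < N.+1)%N)))//= addrCA lerDl addr_ge0// sumr_ge0//.
by have [A hA] := choice h; exists A; split => [i|a i t]; [exact: (hA i).1|exact: (hA i).2].
Qed.

Hypotheses (f1 : smooth_family T vd (fun i q => (X i q.1 q.2).1))
  (f2 : smooth_family T vd (fun i q => (X i q.1 q.2).2)).

Lemma coord_family (c : 'I_2) : smooth_family T vd (fun i q => Defs.coord c (X i q.1 q.2)).
Proof. by rewrite /Defs.coord; case: (c == ord0). Qed.

Hypotheses (facts : forall i, flow_facts T (area D / 2) (vd 0%N i) (X i) (rho i))
  (X0 : forall i, X i 0 = g0) (XD : forall i t a, 0 <= t <= T -> D (X i t a)).

Lemma family_is_flow i : is_flow D g0 (vd 0%N i) T (X i).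
Proof.
have sm c k m t th : 0 <= t <= T ->
  [/\ derivable (fun a => Defs.coord c (dth m (X i t) a)) th 1,
      derivable_w `[0, T]%classic (fun s => dt_dth T k m c (X i) s th) t &
      dt_dth T k m c (X i) q.1 q.2 @[q --> within (`[0, T]%classic `*` setT) (nbhs (t, th))]
         --> dt_dth T k m c (X i) t th].
  (* Order k + 1, so that the k-th time derivative is itself derivable. *)
  move=> tT; have [A [A1 hA]] := amplitude_exists k.+1.
  have Cl := coord_family c T0 A1 hA m.+1 (leqnn k.+1).
  have [f' Cf hf] := @class_dt_dth R I T A T0 A1 k.+1 m.+1 0
    (fun c i q => Defs.coord c (X i q.1 q.2)) X c k m (leqnSn k) (leqnSn m) Cl (fun _ _ _ => erefl).
  split.
  - have [g _ _ _] := facts i; have [s1 s2] := gauss_radius_smooth (g t tT).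
    rewrite coord_dth.
    have hs : smooth (fun a => Defs.coord c (X i t a)) by rewrite /Defs.coord; case: (c == ord0).
    have [hd _] := smooth_derive1n hs m.
    by have [] := deriv_of_is_derive hd th.
  - exact: (hf i t th tT).2.
  - have [_ cf] := smooth_class_amp Cf.
    rewrite slabE.
    have := @cont_on_eq _ _ (slab T) (f' i) (fun q => dt_dth T k m c (X i) q.1 q.2) _ (cf i) (t, th) tT.
    by apply => -[s b] sT; have [-> _] := hf i s b sT.
split => //.
- move=> t; rewrite /= in_itv/= => tT; have [g _ _ _] := facts i.
  by split; [exact: gauss_radius_curve (g t tT)|move=> th; exact: XD].
- move=> t th; rewrite /= in_itv/= => tT; have [g _ _ vel] := facts i.
  have wd c : wderiv `[0, T]%classic (fun s => Defs.coord c (X i s th)) t (dt_dth T 1 0 c (X i) t th).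
    have [_ h _] := sm c 0%N 0%N t th tT.
    have E : (fun s => dt_dth T 0 0 c (X i) s th) = (fun s => Defs.coord c (X i s th)).
      by apply/funext => s; rewrite /dt_dth /= /dth /Defs.coord /=; case: (c == ord0).
    by rewrite E in h; move: h; rewrite /derivable_w /dt_dth /derwn /= -/(derw _ _ _) -E.
  have h := wderivD (wderivM (wd ord0) (wderiv_cst `[0, T]%classic (cos th) t))
    (wderivM (wd ord_max) (wderiv_cst `[0, T]%classic (sin th) t)).
  have := wderiv_unique_cc T0 tT h (vel t th tT).
  rewrite !mulr0 !addr0 => e.
  rewrite /velocity (gauss_radius_curv (g t tT)) (gauss_radius_avg (g t tT)) (gauss_radius_clen (g t tT)).
  rewrite /dotp /normal /= e.
  have [r0 r00 hr] := gauss_radius_lower (g t tT).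
  have [_ _ _ sr rp] := g t tT.
  have L0 : int2pi (rho i t) != 0.
    rewrite gt_eqF//; apply: lt_le_trans (int2pi_ge _ hr); first by rewrite mulr_gt0 ?pi2_gt0.
    exact: smooth_continuous.
  have s0 : rho i t th != 0 by rewrite gt_eqF.
  move: L0 s0; generalize (int2pi (rho i t)) (rho i t th) (pi : R) => L r P L0 s0.
  by field; rewrite L0 s0.
Qed.

Lemma family_is_unique_flow i : is_unique_flow D g0 (vd 0%N i) T (X i).
Proof.
split; first exact: family_is_flow.
move=> s X' s0 sT hX' t th; rewrite /= in_itv/= => ts.
have F := flow_facts_sub sT (facts i).
have F' := is_flow_facts s0 hX'.
have [|B B0 hB] := @interval_bounded R T (vd 0%N i) (ltW T0).
  move=> u; rewrite /= in_itv/= => uT; have h := @dv i 0%N u uT; exact: (wderiv_cvg h).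
apply: (flow_facts_unique (B := B) s0 F F') => //.
  by have [_ e _ _] := hX'; rewrite e X0.
by move=> u /andP[u0 us]; apply: hB; rewrite u0 (le_trans us).
Qed.

End FamilyIsFlow.

(** * Signed distance and angle *)

Section Euclid.
Context {R : realType}.
Implicit Types (p q x : R * R) (a b : R).

Lemma pairZ a p : a *: p = (a * p.1, a * p.2). Proof. by case: p. Qed.

Lemma pairD p q : p + q = (p.1 + q.1, p.2 + q.2). Proof. by case: p; case: q. Qed.

Lemma enorm_ge0 p : 0 <= enorm p. Proof. exact: sqrtr_ge0. Qed.

Lemma dotp_ge0 p : 0 <= dotp p p.
Proof. by rewrite /dotp -!expr2 addr_ge0// sqr_ge0. Qed.

Lemma enorm_sqr p : enorm p ^+ 2 = dotp p p.
Proof. by rewrite sqr_sqrtr// dotp_ge0. Qed.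

Lemma dotp_normal_le p a : `|dotp p (normal a)| <= enorm p.
Proof.
rewrite -ler_sqr ?nnegrE ?enorm_ge0// enorm_sqr real_normK ?num_real// -subr_ge0.
have cs : cos a ^+ 2 + sin a ^+ 2 = 1 by exact: cos2Dsin2.
have -> : dotp p p - dotp p (normal a) ^+ 2 = (p.1 * sin a - p.2 * cos a) ^+ 2.
  by rewrite -[dotp p p]mulr1 -cs /dotp /normal /=; ring.
exact: sqr_ge0.
Qed.

Lemma enorm_normal a (r : R) : enorm (r *: normal a) = `|r|.
Proof.
rewrite /enorm (_ : dotp _ _ = r ^+ 2) ?sqrtr_sqr//.
have cs : cos a ^+ 2 + sin a ^+ 2 = 1 by exact: cos2Dsin2.
by rewrite pairZ -[RHS]mulr1 -cs /dotp /normal /=; ring.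
Qed.

Lemma dotp_normals a b : dotp (normal a) (normal b) = cos (a - b).
Proof. by rewrite cosB. Qed.

Lemma normal_per a : normal (a + 2 * pi) = normal a :> R * R.
Proof. by rewrite /normal cos_per sin_per. Qed.

Lemma cos_le_far (m z : R) : 0 <= m <= pi -> m <= `|z| <= 2 * pi - m -> cos z <= cos m.
Proof.
move=> /andP[m0 mp] /andP[z1 z2]; rewrite -(cos_norm z); move: `|z| z1 z2 => v v1 v2.
have mono (x y : R) : 0 <= x -> x <= y -> y <= pi -> cos y <= cos x.
  move=> x0; rewrite le_eqVlt => /predU1P[-> //|xy] yp.
  by apply/ltW; rewrite ltr_cos// in_itv/= ?x0 ?yp ?(le_trans x0 (ltW xy)) ?(le_trans (ltW xy) yp).
have [vp|pv] := leP v pi; first exact: mono.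
rewrite -[cos v]cosN -cos_per; apply: mono; rewrite ?(le_trans _ v2)//; lra.
Qed.

Lemma cos_lt1 (m : R) : 0 < m -> m <= pi -> cos m < 1.
Proof.
by move=> m0 mp; rewrite -[X in _ < X]cos0 ltr_cos// in_itv/= ?lexx ?pi_ge0 ?mp ?ltW.
Qed.

(** eta = 1 - cos m with m at most the distance from a to both ends of the branch: there, |z - a| >=
    m entails |z - a| <= 2 pi - m, and the cosine is at most cos m. The strict inequalities for a
    keep it off the cut. *)
Lemma cos_near1 b a (e : R) : b < a < b + 2 * pi -> 0 < e ->
  exists2 eta : R, 0 < eta & forall z, b <= z < b + 2 * pi -> 1 - cos (z - a) < eta -> `|z - a| < e.
Proof.
move=> /andP[ba ab] e0; have pi0 := pi_gt0 R.
pose m := Num.min (Num.min e pi) (Num.min (a - b) (b + 2 * pi - a)).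
have m0 : 0 < m by rewrite !lt_min e0 pi0 !subr_gt0 ba ab.
have [me mp mab mba] : [/\ m <= e, m <= pi, m <= a - b & m <= b + 2 * pi - a].
  by split; rewrite !ge_min lexx ?orbT.
exists (1 - cos m); first by rewrite subr_gt0 cos_lt1.
move=> z /andP[bz zb] h; rewrite ltNge; apply/negP => ez.
have : cos (z - a) <= cos m.
  apply: cos_le_far; first by rewrite (ltW m0).
  rewrite (le_trans me ez)/= ler_norml; apply/andP; split; lra.
by move: h; rewrite ltrD2l ltrN2 => h1 h2; have := lt_le_trans h1 h2; rewrite ltxx.
Qed.

Lemma cos_eq1_branch b (y z : R) : b <= y < b + 2 * pi -> b <= z < b + 2 * pi ->
  cos (y - z) = 1 -> y = z.
Proof.
move=> /andP[y1 y2] /andP[z1 z2] c1; apply/eqP; rewrite -subr_eq0 -normr_le0 leNgt; apply/negP => n0.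
have pi0 := pi_gt0 R.
pose m := Num.min pi (Num.min `|y - z| (2 * pi - `|y - z|)).
have lt2 : `|y - z| < 2 * pi by rewrite ltr_norml; apply/andP; split; lra.
have m0 : 0 < m by rewrite !lt_min pi0 n0 subr_gt0.
have mp : m <= pi by rewrite ge_min lexx.
have m1 : m <= `|y - z| by rewrite !ge_min lexx ?orbT.
have m2 : m <= 2 * pi - `|y - z| by rewrite !ge_min lexx ?orbT.
have := @cos_le_far m (y - z); rewrite (ltW m0) mp m1 /= => /(_ isT) h.
have {}h : cos (y - z) <= cos m by apply: h; lra.
by have := le_lt_trans h (cos_lt1 m0 mp); rewrite c1 ltxx.
Qed.

End Euclid.

Section PartialDerivatives.
Context {R : realType}.
Implicit Types (f : R * R -> R) (p : R * R).

Lemma directional_wderiv (v : R * R) f p (l : R) :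
  wderiv setT (fun s => f (s *: v + p)) 0 l -> 'D_v f p = l.
Proof.
move=> h; rewrite /derive; apply: cvg_lim => //.
move/wderivP in h; apply/cvgrPdist_le => e e0.
have [d d0 hd] := h e e0; rewrite /dnbhs near_withinE; apply/nbhs_ballP; exists d => // s.
rewrite /ball /= sub0r normrN => sd s0.
have := hd s Logic.I; rewrite subr0 => /(_ sd); rewrite scale0r add0r => hs.
have -> : l - s^-1 *: (f (s *: v + p) - f p) = - (s^-1 * (f (s *: v + p) - f p - l * s)).
  rewrite /GRing.scale /=; by field.
by rewrite normrN normrM normfV mulrC ler_pdivrMr// normr_gt0.
Qed.

Lemma partial1_wderiv f p (l : R) : wderiv setT (fun s => f (s, p.2)) p.1 l -> partial1 f p = l.
Proof.
move=> h; apply: directional_wderiv.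
have sh : wderiv setT (fun s : R => s + p.1) 0 (1 + 0).
  by apply: wderivD; [exact: wderiv_id|exact: wderiv_cst].
have := @wderiv_comp _ setT setT _ (fun s => f (s, p.2)) 0 _ l (fun _ _ => Logic.I) sh.
rewrite add0r addr0 mulr1 => /(_ h); apply: wderiv_ext => s.
by congr f; rewrite pairZ pairD /= mulr1 mulr0 add0r.
Qed.

Lemma partial2_wderiv f p (l : R) : wderiv setT (fun s => f (p.1, s)) p.2 l -> partial2 f p = l.
Proof.
move=> h; apply: directional_wderiv.
have sh : wderiv setT (fun s : R => s + p.2) 0 (1 + 0).
  by apply: wderivD; [exact: wderiv_id|exact: wderiv_cst].
have := @wderiv_comp _ setT setT _ (fun s => f (p.1, s)) 0 _ l (fun _ _ => Logic.I) sh.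
rewrite add0r addr0 mulr1 => /(_ h); apply: wderiv_ext => s.
by congr f; rewrite pairZ pairD /= mulr1 mulr0 add0r.
Qed.

End PartialDerivatives.

Section SignedDistance.
Context {R : realType}.
Variables (X : R -> R * R) (rho : R -> R) (r0 : R).
Hypotheses (hX : gauss_radius X rho) (r00 : 0 < r0) (hr : forall a, r0 <= rho a).
Implicit Types (x : R * R) (a b th : R).

(** The signed distance from x to the tangent line at X a. Its maximum over the angles is the signed
    distance to the curve, attained at the foot of x; [slope] is its derivative in the angle. *)
Definition height x a : R := dotp (x - X a) (normal a).
Definition slope x a : R := dotp (x - X a) (tangent a).
Definition foot x th : Prop := forall a, height x a <= height x th.

Lemma height_per x a : height x (a + 2 * pi) = height x a.
Proof. by have [_ _ p _ _] := hX; rewrite /height p normal_per. Qed.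

Lemma height_deriv x : deriv_of (height x) (slope x).
Proof.
move=> a; have [d1 d2 _ _ _] := hX.
have h1 := wderivM (wderivB (wderiv_cst setT x.1 a) (@d1 a)) (@deriv_of_cos R a).
have h2 := wderivM (wderivB (wderiv_cst setT x.2 a) (@d2 a)) (@deriv_of_sin R a).
by apply: (wderiv_eql _ (wderivD h1 h2)); rewrite /slope /dotp /tangent /=; ring.
Qed.

Lemma slope_deriv x : deriv_of (slope x) (fun a => - (rho a + height x a)).
Proof.
move=> a; have [d1 d2 _ _ _] := hX.
have h1 := wderivM (wderivB (wderiv_cst setT x.1 a) (@d1 a)) (wderivN (@deriv_of_sin R a)).
have h2 := wderivM (wderivB (wderiv_cst setT x.2 a) (@d2 a)) (@deriv_of_cos R a).
apply: (wderiv_eql _ (wderivD h1 h2)).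
have cs : cos a ^+ 2 + sin a ^+ 2 = 1 by exact: cos2Dsin2.
by rewrite -[X in - (X + _)]mulr1 -cs /height /dotp /normal /=; ring.
Qed.

Lemma foot_exists x : exists th, foot x th.
Proof.
have [|||p _ hp] := @slab_max R 1 (fun q => height x q.2) => //.
- by apply: cont_on_snd; exact: wderiv_continuous (@height_deriv x).
- by move=> t y _ /=; exact: height_per.
- by exists p.2 => a; apply: (hp (0, a)); rewrite /slab /= lexx ler01.
Qed.

Lemma foot_slope x th : foot x th -> slope x th = 0.
Proof. exact: max_first_derivative (@height_deriv x). Qed.

Lemma footE x th : foot x th -> x = X th + height x th *: normal th.
Proof.
move=> /foot_slope; rewrite /height /slope /dotp /tangent /normal /= => e.
have cs : cos th ^+ 2 + sin th ^+ 2 = 1 by exact: cos2Dsin2.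
rewrite pairZ pairD /= [LHS]surjective_pairing.
set u := x.1 - _ in e *; set w := x.2 - _ in e *.
have eu : u = (u * cos th + w * sin th) * cos th - sin th * (u * - sin th + w * cos th).
  by rewrite -[LHS]mulr1 -cs; ring.
have ew : w = (u * cos th + w * sin th) * sin th + cos th * (u * - sin th + w * cos th).
  by rewrite -[LHS]mulr1 -cs; ring.
rewrite e mulr0 in eu; rewrite e mulr0 in ew; rewrite subr0 in eu; rewrite addr0 in ew.
by rewrite -eu -ew /u /w; congr pair; ring.
Qed.

(** Inside, every height is negative and its absolute value bounds the distance to X a from below,
    so the largest height is the closest to 0. Outside, projecting x - X a on the normal at the
    foot, and using the supporting line there, bounds every distance from below by the height at the
    foot. *)
Lemma sdist_foot x th : foot x th -> sdist X x = height x th.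
Proof.
move=> hf; set d := height x th.
have [d1 d2 pX _ _] := hX.
have at_th : enorm (x - X th) = `|d|.
  by rewrite {1}(footE hf) addrC addKr enorm_normal.
have att : (range (fun a => enorm (x - X a))) `|d| by exists th.
have infE : (forall a, `|d| <= enorm (x - X a)) -> inf (range (fun a => enorm (x - X a))) = `|d|.
  move=> h; apply/eqP; rewrite eq_le; apply/andP; split.
    apply: ge_inf => //; exists 0 => _ [a _ <-]; exact: enorm_ge0.
  by apply: lb_le_inf; [by exists `|d| |move=> _ [a _ <-]].
rewrite /sdist; case: asboolP => [inn|ninn].
  have d0 : d < 0 by exact: inn.
  rewrite infE; first by rewrite ltr0_norm// opprK.
  move=> a; apply: le_trans (dotp_normal_le (x - X a) a); rewrite -/(height x a).
  by rewrite (ltr0_norm d0) (ltr0_norm (inn a : height x a < 0)) lerN2; exact: hf.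
have d0 : 0 <= d.
  rewrite leNgt; apply/negP => d0; apply: ninn => a; exact: le_lt_trans (hf a) d0.
rewrite infE ger0_norm// => a.
apply: le_trans (dotp_normal_le (x - X a) th); apply: le_trans (ler_norm _).
have h := support_line d1 d2 pX hr a th.
have c1 : 0 <= r0 * (1 - cos (a - th)) by rewrite mulr_ge0 ?(ltW r00)// subr_ge0 cos_le1.
have -> : dotp (x - X a) (normal th) = d - dotp (X a - X th) (normal th).
  by rewrite /d /height /dotp /=; ring.
by lra.
Qed.

(** A quantitative maximum: when r0 + r > 0 the height drops by a multiple of 1 - cos, which gives
    uniqueness and stability of the foot. *)
Lemma height_foot_le th (r : R) a :
  height (X th + r *: normal th) a <= r - (r0 + r) * (1 - cos (a - th)).
Proof.
have [d1 d2 pX _ _] := hX.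
have h := support_line d1 d2 pX hr th a.
have -> : height (X th + r *: normal th) a = dotp (X th - X a) (normal a) + r * dotp (normal th) (normal a).
  by rewrite /height pairZ pairD /dotp /=; ring.
rewrite dotp_normals -[cos (a - th)]cosN opprB.
move: h; move: (cos _) => z; lra.
Qed.

Lemma foot_normal_line th (r : R) : - r0 < r -> foot (X th + r *: normal th) th /\
  height (X th + r *: normal th) th = r.
Proof.
move=> r1.
have e : height (X th + r *: normal th) th = r.
  rewrite /height addrC addKr.
  have cs : cos th ^+ 2 + sin th ^+ 2 = 1 by exact: cos2Dsin2.
  by rewrite pairZ -[RHS]mulr1 -cs /dotp /normal /=; ring.
split => // a; rewrite e; apply: le_trans (height_foot_le th r a) _.
by rewrite gerBl mulr_ge0// ?subr_ge0 ?cos_le1//; lra.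
Qed.

Lemma foot_height_le x th a : foot x th ->
  height x a <= height x th - (r0 + height x th) * (1 - cos (a - th)).
Proof. by move=> hf; rewrite {1}(footE hf); exact: height_foot_le. Qed.

(** [is_angle] refers to the gradient of the signed distance on the curve, which must therefore be
    computed before any smoothness is known. An error quadratic in x - X th suffices for this. *)
Lemma sdist_quadratic th x : 0 <= sdist X x - dotp (x - X th) (normal th) <=
  dotp (x - X th) (x - X th) / (2 * r0).
Proof.
have [a hf] := foot_exists x; rewrite (sdist_foot hf).
have h0 : dotp (x - X th) (normal th) <= height x a by exact: hf.
rewrite subr_ge0 h0 /=.
have [d1 d2 pX _ _] := hX; have h := support_line d1 d2 pX hr th a.
set y := x - X th.
have e : height x a = dotp y (normal a) + dotp (X th - X a) (normal a).
  by rewrite /height /y /dotp /=; ring.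
rewrite e; apply: (@le_trans _ _ (dotp y (normal a) - r0 * (1 - cos (th - a)) - dotp y (normal th))).
  by rewrite lerD2r lerD2l.
rewrite ler_pdivlMr ?mulr_gt0// -subr_ge0 cosB.
have cs : cos a ^+ 2 + sin a ^+ 2 = 1 by exact: cos2Dsin2.
have cs' : cos th ^+ 2 + sin th ^+ 2 = 1 by exact: cos2Dsin2.
(* Completing squares; what remains cancels because the normals have length 1. *)
have -> : dotp y y - (dotp y (normal a) - r0 * (1 - (cos th * cos a + sin th * sin a)) - dotp y (normal th)) * (2 * r0) =
  (y.1 - r0 * (cos a - cos th)) ^+ 2 + (y.2 - r0 * (sin a - sin th)) ^+ 2 +
  r0 ^+ 2 * (2 - (cos a ^+ 2 + sin a ^+ 2) - (cos th ^+ 2 + sin th ^+ 2)).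
  by rewrite /dotp /normal /=; ring.
have -> : 2 - (cos a ^+ 2 + sin a ^+ 2) - (cos th ^+ 2 + sin th ^+ 2) = 0 :> R by rewrite cs cs'; lra.
by rewrite mulr0 addr0 addr_ge0 ?sqr_ge0.
Qed.

Lemma sdist_curve th : sdist X (X th) = 0.
Proof.
have r1 : - r0 < 0 by rewrite oppr_lt0.
have [hf e] := foot_normal_line th r1.
by rewrite scale0r addr0 in hf e; rewrite (sdist_foot hf).
Qed.

Lemma grad_sdist th : grad (sdist X) (X th) = normal th.
Proof.
have c0 : 0 < (2 * r0)^-1 by rewrite invr_gt0 mulr_gt0.
have main (v : R * R) (l : R) : dotp v v = 1 -> dotp v (normal th) = l ->
    wderiv setT (fun s => sdist X (s *: v + X th)) 0 l.
  move=> vv vl; apply/wderivP => e e0; exists (e * (2 * r0)); first by rewrite !mulr_gt0.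
  move=> s _; rewrite subr0 => sd; rewrite scale0r add0r sdist_curve subr0.
  have := sdist_quadratic th (s *: v + X th); rewrite addrK.
  have -> : dotp (s *: v) (normal th) = l * s by rewrite -vl pairZ /dotp /=; ring.
  have -> : dotp (s *: v) (s *: v) = s ^+ 2.
    by rewrite pairZ -[RHS]mulr1 -vv /dotp /=; ring.
  move=> /andP[h1 h2]; rewrite ger0_norm//; apply: le_trans h2 _.
  rewrite ler_pdivrMr ?mulr_gt0// -[s ^+ 2]real_normK ?num_real// expr2 mulrAC.
  by rewrite ler_wpM2r// ltW.
rewrite /grad /partial1 /partial2 /normal; congr pair; apply: directional_wderiv; apply: main;
  rewrite /dotp /normal /=; ring.
Qed.

Lemma is_angleP x th : - r0 < sdist X x -> is_angle X x th <-> foot x th.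
Proof.
move=> hd; rewrite /is_angle /curve_point grad_sdist; split => [e|hf].
  by rewrite e; exact: (foot_normal_line th hd).1.
by rewrite (sdist_foot hf); exact: footE.
Qed.

Lemma foot_branch b x : exists th, [/\ b <= th, th < b + 2 * pi & foot x th].
Proof.
have [a hf] := foot_exists x.
pose g z := height x (b + z).
have pg z : g (z + 2 * pi) = g z by rewrite /g addrA height_per.
have [y /andP[y0 y2] e] := periodic_reduce (a - b) 0 pg.
exists (b + y); split; [by rewrite lerDl|by rewrite ltrD2l -[X in _ < X]add0r|].
by move=> z; rewrite -[height x (b + y)]/(g y) e /g [b + _]addrC subrK; exact: hf.
Qed.

Lemma foot_unique b x th th' : - r0 < sdist X x -> foot x th -> foot x th' ->
  b <= th < b + 2 * pi -> b <= th' < b + 2 * pi -> th' = th.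
Proof.
move=> hd hf hf' h1 h2; apply: (cos_eq1_branch h2 h1).
have := foot_height_le th' hf; rewrite -(sdist_foot hf) -(sdist_foot hf').
move=> h; have r1 : 0 < r0 + sdist X x by lra.
by apply/eqP; rewrite eq_le cos_le1 /= -subr_le0 -(pmulr_rle0 _ r1); lra.
Qed.

Lemma angle_fromP b x : - r0 < sdist X x ->
  [/\ b <= angle_from b X x, angle_from b X x < b + 2 * pi & foot x (angle_from b X x)].
Proof.
move=> hd; have [th [h1 h2 h3]] := foot_branch b x.
have hs : [set th | [/\ b <= th, th < b + 2 * pi & is_angle X x th]] th.
  by split => //; apply/is_angleP.
rewrite /angle_from; have [g1 g2 g3] := xgetPex b (ex_intro _ th hs).
by split => //; apply/(is_angleP _ hd).
Qed.

Lemma angle_from_eq b x th : - r0 < sdist X x -> b <= th < b + 2 * pi -> foot x th ->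
  angle_from b X x = th.
Proof.
move=> hd hb hf; have [h1 h2 h3] := angle_fromP b hd.
by apply: (@foot_unique b x) => //; rewrite h1.
Qed.

Lemma curve_point_normal th (r : R) : curve_point X r th = X th + r *: normal th.
Proof. by rewrite /curve_point grad_sdist. Qed.

Lemma sdist_curve_point th (r : R) : - r0 < r -> sdist X (curve_point X r th) = r.
Proof.
by move=> h; have [hf e] := foot_normal_line th h; rewrite curve_point_normal (sdist_foot hf).
Qed.

End SignedDistance.

Section ImplicitFunction.
Context {R : realType}.

(** Given the continuity of Th at s0, the mean value inequality in the second variable replaces
    [gth] by its limit k. This first yields |Th s - Th s0| <= M |s - s0|; inserted in the error
    term, that bound gives the derivative. The set A allows one-sided times. *)
Lemma implicit_wderiv (A : set R) (g gth : R -> R -> R) (Th : R -> R) (s0 gs k : R) : A s0 ->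
  (forall s, A s -> deriv_of (g s) (gth s)) ->
  (exists2 d : R, 0 < d & forall s, A s -> `|s - s0| < d -> g s (Th s) = 0) ->
  wderiv A (fun s => g s (Th s0)) s0 gs -> k != 0 ->
  (forall e : R, 0 < e -> exists2 d : R, 0 < d & forall s y, A s -> `|s - s0| < d ->
     `|y - Th s0| < d -> `|gth s y - k| <= e) ->
  (forall e : R, 0 < e -> exists2 d : R, 0 < d & forall s, A s -> `|s - s0| < d ->
     `|Th s - Th s0| < e) ->
  wderiv A Th s0 (- gs / k).
Proof.
move=> As0 dg [d0 d00 hz] hgs k0 hk hT; apply/wderivP => e e0.
have kp : 0 < `|k| by rewrite normr_gt0.
pose M := 2 * (`|gs| + `|k| / 2) / `|k|.
have M0 : 0 <= M by rewrite divr_ge0// mulr_ge0// addr_ge0// divr_ge0.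
have M1 : 0 < M + 1 by rewrite ltr_wpDl.
pose e1 := Num.min (`|k| / 2) (e * `|k| / (M + 1)).
have e10 : 0 < e1 by rewrite lt_min !divr_gt0// mulr_gt0.
have e1k : e1 <= `|k| / 2 by rewrite ge_min lexx.
have e1e : e1 * (M + 1) <= e * `|k| by rewrite -ler_pdivlMr// ge_min lexx orbT.
have [d1 d10 h1] := hk _ e10; have [d2 d20 h2] := hT _ d10.
have /wderivP/(_ _ e10)[d3 d30 h3] := hgs.
exists (Num.min (Num.min d0 d1) (Num.min d2 d3)); first by rewrite !lt_min d00 d10 d20 d30.
move=> s As; rewrite !lt_min => /andP[/andP[s0' s1] /andP[s2 s3]].
have z0 : g s0 (Th s0) = 0 by apply: hz => //; rewrite subrr normr0.
have zs := hz s As s0'; have hs := h3 s As s3; rewrite z0 subr0 in hs.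
have ht := h2 s As s2.
have hm : `|(g s (Th s) - k * Th s) - (g s (Th s0) - k * Th s0)| <= e1 * `|Th s - Th s0|.
  apply: (@wderiv_le_norm _ setT (fun y => g s y - k * y) (fun y => gth s y - k)) => //.
    move=> y _; apply: wderivB; first exact: dg.
    by have := wderivZ setT k (wderiv_id setT y); rewrite mulr1.
  move=> y hy; apply: h1 => //; apply: le_lt_trans ht.
  move: hy; have [le|le] := leP (Th s0) (Th s); move=> /andP[y1 y2].
    by rewrite !ger0_norm ?subr_ge0// lerD2r.
  by rewrite !ler0_norm ?subr_le0 ?(ltW le)// !opprB lerD2l lerN2.
set u := Th s - Th s0 in hm *; set w := s - s0 in hs *.
have main : `|k * u + gs * w| <= e1 * `|u| + e1 * `|w|.
  have -> : k * u + gs * w = - ((g s (Th s) - k * Th s) - (g s (Th s0) - k * Th s0)) - (g s (Th s0) - gs * w).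
    by rewrite zs /u; ring.
  by apply: le_trans (ler_normB _ _) _; rewrite normrN lerD.
have uM : `|u| <= M * `|w|.
  have h4 : `|k * u| <= e1 * `|u| + e1 * `|w| + `|gs| * `|w|.
    have -> : k * u = (k * u + gs * w) - gs * w by ring.
    by apply: le_trans (ler_normB _ _) _; rewrite normrM lerD.
  rewrite normrM in h4.
  have h5 : e1 * `|u| <= `|k| / 2 * `|u| by rewrite ler_wpM2r.
  have h6 : e1 * `|w| <= `|k| / 2 * `|w| by rewrite ler_wpM2r.
  rewrite /M mulrAC ler_pdivlMr// ; lra.
have -> : u - - gs / k * w = k^-1 * (k * u + gs * w) by field.
rewrite normrM normfV mulrC ler_pdivrMr//; apply: le_trans main _.
apply: (@le_trans _ _ (e1 * (M + 1) * `|w|)).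
  have : e1 * `|u| <= e1 * (M * `|w|) by rewrite ler_wpM2l// ltW.
  lra.
by rewrite [leRHS]mulrAC ler_wpM2r.
Qed.

End ImplicitFunction.

(** * The angle and the signed distance in the tubes *)

Section TubeFrame.
Context {R : realType} {I : Type}.
Variables (T : R) (A : I -> R) (X : I -> R -> R -> R * R) (rho : I -> R -> R -> R) (r0 delta : R).
Hypotheses (T0 : 0 < T) (A1 : forall i, 1 <= A i).
Hypotheses (hX : forall i t, 0 <= t <= T -> gauss_radius (X i t) (rho i t))
  (hr : forall i t a, 0 <= t <= T -> r0 <= rho i t a)
  (cX1 : forall i, cont_on (slab T) (fun q => (X i q.1 q.2).1))
  (cX2 : forall i, cont_on (slab T) (fun q => (X i q.1 q.2).2))
  (crho : forall i, cont_on (slab T) (fun q => rho i q.1 q.2)).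
Hypotheses (r00 : 0 < r0) (delta0 : 0 < delta) (hdelta : 3 * delta <= r0 / 2).

Definition tube_dist (ib : I * R) (p : R * (R * R)) : R := sdist (X ib.1 p.1) p.2.
Definition tube_angle (ib : I * R) (p : R * (R * R)) : R := angle_from ib.2 (X ib.1 p.1) p.2.

(* The set where the branch of the angle with values in [b, b + 2 pi) is
   defined and avoids the cut; the branches [b] are kept bounded. *)
Definition tube_dom (ib : I * R) : set (R * (R * R)) := [set p |
  [/\ 0 <= p.1 <= T, - pi <= ib.2 <= pi, `|tube_dist ib p| < 3 * delta & ib.2 < tube_angle ib p]].

Lemma slab_curve_near i t (e : R) : 0 <= t <= T -> 0 < e -> exists2 d : R, 0 < d &
  forall s a, 0 <= s <= T -> `|s - t| < d ->
    `|(X i s a).1 - (X i t a).1| <= e /\ `|(X i s a).2 - (X i t a).2| <= e.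
Proof.
move=> tT e0.
have [d1 d10 h1] := slab_uniform 0 (2 * pi) (cX1 (i := i)) tT e0.
have [d2 d20 h2] := slab_uniform 0 (2 * pi) (cX2 (i := i)) tT e0.
exists (Num.min d1 d2); first by rewrite lt_min d10.
move=> s a sT; rewrite lt_min => /andP[s1 s2].
have p1 b : X i s (b + 2 * pi) = X i s b by have [_ _ p _ _] := hX i sT.
have p2 b : X i t (b + 2 * pi) = X i t b by have [_ _ p _ _] := hX i tT.
have [y /andP[y0 y2] [<- <-]] :=
  periodic_reduce (g := fun b => (X i s b, X i t b)) a 0 (fun b => congr2 pair (p1 b) (p2 b)).
have yI : 0 <= y <= 2 * pi by rewrite y0 ltW// -[X in _ < X]add0r.
by split; [exact: h1|exact: h2].
Qed.

Lemma tube_dist_gt ib p : `|tube_dist ib p| < 3 * delta -> - (r0 / 2) < tube_dist ib p.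
Proof. by rewrite ltr_norml => /andP[h _]; apply: le_lt_trans h; rewrite lerN2. Qed.

Lemma r0_half : - r0 < - (r0 / 2).
Proof. by rewrite ltrN2 ltr_pdivrMr// ltr_pMr// ltr1n. Qed.

Lemma tube_foot ib p : tube_dom ib p ->
  [/\ foot (X ib.1 p.1) p.2 (tube_angle ib p), ib.2 < tube_angle ib p < ib.2 + 2 * pi,
      tube_dist ib p = height (X ib.1 p.1) p.2 (tube_angle ib p) &
      r0 / 2 <= rho ib.1 p.1 (tube_angle ib p) + tube_dist ib p].
Proof.
move=> [pT hb hd hang].
have d1 : - r0 < sdist (X ib.1 p.1) p.2 by exact: lt_trans r0_half (tube_dist_gt hd).
have [h1 h2 h3] := angle_fromP (hX ib.1 pT) r00 (fun a => hr ib.1 a pT) ib.2 d1.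
split => //; first by rewrite hang.
  exact: (sdist_foot (hX ib.1 pT) r00 (fun a => hr ib.1 a pT) h3).
have := hr ib.1 (tube_angle ib p) pT; have := tube_dist_gt hd; lra.
Qed.

Lemma height_near i t (x : R * R) (om : R) : 0 <= t <= T -> 0 < om -> exists2 d : R, 0 < d &
  forall (p' : R * (R * R)) a, 0 <= p'.1 <= T -> `|p'.1 - t| < d -> `|p'.2.1 - x.1| < d ->
    `|p'.2.2 - x.2| < d -> `|height (X i p'.1) p'.2 a - height (X i t) x a| <= 4 * om.
Proof.
move=> tT om0; have [d1 d10 h1] := slab_curve_near i tT om0.
exists (Num.min d1 om); first by rewrite lt_min d10.
move=> p' a p'T; rewrite !lt_min => /andP[t1 _] /andP[_ x1] /andP[_ x2].
have [c1 c2] := h1 p'.1 a p'T t1.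
have -> : height (X i p'.1) p'.2 a - height (X i t) x a =
  ((p'.2.1 - x.1) - ((X i p'.1 a).1 - (X i t a).1)) * cos a +
  ((p'.2.2 - x.2) - ((X i p'.1 a).2 - (X i t a).2)) * sin a.
  by rewrite /height /dotp /normal /=; ring.
have cl : `|cos a| <= 1 by rewrite ler_norml cos_geN1 cos_le1.
have sl : `|sin a| <= 1 by rewrite ler_norml sin_geN1 sin_le1.
have aux (u v z : R) : `|z| <= 1 -> `|u| <= om -> `|v| <= om -> `|(u - v) * z| <= 2 * om.
  move=> z1 u1 v1; rewrite normrM -[leRHS]mulr1 ler_pM//.
  by apply: le_trans (ler_normB _ _) _; lra.
have a1 := aux _ _ _ cl (ltW x1) c1; have a2 := aux _ _ _ sl (ltW x2) c2.
by apply: le_trans (ler_normD _ _) _; lra.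
Qed.

(** Moving (t, x) changes all heights by at most 4 om, hence also their maximum; the new foot nearly
    maximizes the old height, so by [foot_height_le] it is close to the old one and still off the
    cut. This gives the openness of the domain over [0, T] together with continuity. *)
Lemma tube_near ib p (e : R) : tube_dom ib p -> 0 < e -> exists2 d : R, 0 < d &
  forall p' : R * (R * R), 0 <= p'.1 <= T -> `|p'.1 - p.1| < d -> `|p'.2.1 - p.2.1| < d ->
    `|p'.2.2 - p.2.2| < d ->
    [/\ tube_dom ib p', `|tube_angle ib p' - tube_angle ib p| < e &
        `|tube_dist ib p' - tube_dist ib p| < e].
Proof.
move=> hp e0; have [pT hb hd hang] := hp.
have [hf h12 de _] := tube_foot hp.
set th := tube_angle ib p in hang hf h12 de *; set d0 := tube_dist ib p in hd de *.
have e'0 : 0 < Num.min e (th - ib.2) by rewrite lt_min e0 subr_gt0.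
have [eta eta0 heta] := cos_near1 h12 e'0.
have k0 : 0 < 3 * delta - `|d0| by rewrite subr_gt0.
(* Two changes of at most 4 om give 8 om < eta r0 / 2, whence the 9; the denominators 5 keep 4 om
   strictly below the margin of the tube and below e. *)
pose om := Num.min (Num.min ((3 * delta - `|d0|) / 5) (e / 5)) (eta * (r0 / 2) / 9).
have om0 : 0 < om by rewrite !lt_min !divr_gt0// mulr_gt0// divr_gt0.
have [om1 om2 om3] : [/\ om <= (3 * delta - `|d0|) / 5, om <= e / 5 & om <= eta * (r0 / 2) / 9].
  by split; rewrite !ge_min lexx ?orbT.
clearbody om.
have [d1 d10 h1] := height_near ib.1 p.2 pT om0.
exists d1; first exact: d10.
move=> p' p'T t1 x1 x2.
have hh a := h1 p' a p'T t1 x1 x2.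
have gX := hX ib.1 p'T; have gr a := hr ib.1 a p'T.
have [th' [b1 b2 hf']] := foot_branch gX ib.2 p'.2.
have de' := sdist_foot gX r00 gr hf'.
rewrite -/(tube_dist ib p') in de'.
have dd : `|tube_dist ib p' - d0| <= 4 * om.
  have := hh th; have := hh th'; rewrite -de -de' !ler_norml => /andP[u1 u2] /andP[v1 v2].
  have w1 := hf th'; have w2 := hf' th; rewrite -de in w1; rewrite -de' in w2.
  by apply/andP; split; lra.
have dlt : `|tube_dist ib p'| < 3 * delta.
  have -> : tube_dist ib p' = (tube_dist ib p' - d0) + d0 by ring.
  by apply: le_lt_trans (ler_normD _ _) _; lra.
have dgt : - r0 < sdist (X ib.1 p'.1) p'.2 by exact: lt_trans r0_half (tube_dist_gt dlt).
have bth : ib.2 <= th' < ib.2 + 2 * pi by rewrite b1.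
have ae : tube_angle ib p' = th' by rewrite /tube_angle; exact: (angle_from_eq gX r00 gr dgt bth hf').
have close : `|th' - th| < Num.min e (th - ib.2).
  apply: heta => //.
  have g1 := foot_height_le (hX ib.1 pT) (fun a => hr ib.1 a pT) th' hf; rewrite -de in g1.
  have := hh th'; rewrite -de' !ler_norml => /andP[u1 u2].
  have := dd; rewrite ler_norml => /andP[v1 v2].
  have rd : r0 / 2 < r0 + d0 by have := tube_dist_gt hd; rewrite -/d0; lra.
  have g2 : (r0 + d0) * (1 - cos (th' - th)) <= 8 * om by lra.
  have c0 : 0 <= 1 - cos (th' - th) by rewrite subr_ge0 cos_le1.
  have g3 : r0 / 2 * (1 - cos (th' - th)) <= 8 * om.
    by apply: le_trans g2; rewrite ler_wpM2r// ltW.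
  have r2 : 0 < r0 / 2 by rewrite divr_gt0.
  rewrite -(ltr_pM2l r2); apply: le_lt_trans g3 _.
  have := mulr_gt0 eta0 r2; lra.
move: close; rewrite lt_min => /andP[ce cb].
split.
- split; [exact: p'T|exact: hb|exact: dlt|].
  by rewrite ae; move: cb; rewrite ltr_norml => /andP[u1 u2]; lra.
- by rewrite ae; exact: ce.
- by apply: le_lt_trans dd _; lra.
Qed.

Let tline (l : option bool) (p : R * (R * R)) (s : R) : R * (R * R) :=
  match l with
  | None => (s, p.2)
  | Some false => (p.1, (s, p.2.2))
  | Some true => (p.1, (p.2.1, s))
  end.
Let tpos (l : option bool) (p : R * (R * R)) : R :=
  match l with None => p.1 | Some false => p.2.1 | Some true => p.2.2 end.
Let tax (l : option bool) (p : R * (R * R)) : set R :=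
  if l is None then `[0, T]%classic else setT.

Lemma tube_line_pos l p : tline l p (tpos l p) = p.
Proof. by case: l p => [[]|] [? [? ?]]. Qed.

Lemma tube_line_slab ib l p s : tube_dom ib p -> tax l p s -> 0 <= (tline l p s).1 <= T.
Proof.
by move=> [pT _ _ _]; case: l => [[]|] //=; rewrite in_itv.
Qed.

Lemma tube_line_dist l p s : [/\ `|(tline l p s).1 - p.1| <= `|s - tpos l p|,
  `|(tline l p s).2.1 - p.2.1| <= `|s - tpos l p| & `|(tline l p s).2.2 - p.2.2| <= `|s - tpos l p|].
Proof. by case: l => [[]|] /=; rewrite !subrr !normr0. Qed.

Lemma tube_dom_near ib l p : tube_dom ib p -> exists2 d : R, 0 < d &
    forall s, tax l p s -> `|s - tpos l p| < d -> tube_dom ib (tline l p s).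
Proof.
move=> hp; have [d d0 hd] := tube_near hp ltr01.
exists d; first exact: d0.
move=> s As sd; have [l1 l2 l3] := tube_line_dist l p s.
by have [] := hd _ (tube_line_slab hp As) (le_lt_trans l1 sd) (le_lt_trans l2 sd) (le_lt_trans l3 sd).
Qed.

Lemma tube_ax_pos (ib : I * R) l p : tube_dom ib p -> tax l p (tpos l p).
Proof. by case: l => //= -[pT _ _ _]; rewrite in_itv. Qed.

Lemma tube_ax_side (ib : I * R) l p : tube_dom ib p -> exists d : R, 0 < d /\
    ((forall s, tpos l p <= s < tpos l p + d -> tax l p s) \/
     (forall s, tpos l p - d < s <= tpos l p -> tax l p s)).
Proof.
case: l => [u|] /=; first by exists 1; split => //; left.
by move=> [pT _ _ _]; exact: one_sided_cc.
Qed.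

Definition tube_frame : frame R (R * (R * R))%type (I * R)%type bool :=
  @Frame R (R * (R * R))%type (I * R)%type bool tube_dom tline tpos tax (fun ib => A ib.1)
    tube_line_pos (fun ib => A1 ib.1) tube_dom_near tube_ax_pos tube_ax_side.

Lemma tube_slope_near (ib : I * R) (p : R * (R * R)) (y0 e : R) : 0 <= p.1 <= T -> 0 < e ->
  exists2 d : R, 0 < d & forall (p' : R * (R * R)) (y : R), 0 <= p'.1 <= T -> `|p'.1 - p.1| < d ->
    `|p'.2.1 - p.2.1| < d -> `|p'.2.2 - p.2.2| < d -> `|y - y0| < d ->
    `|- (rho ib.1 p'.1 y + height (X ib.1 p'.1) p'.2 y) - - (rho ib.1 p.1 y0 + height (X ib.1 p.1) p.2 y0)| <= e.
Proof.
move=> pT e0.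
have e3 : 0 < e / 3 by rewrite divr_gt0.
have e12 : 0 < e / 12 by rewrite divr_gt0.
have [d1 d10 h1] := cont_on_slab_near y0 (crho (i := ib.1)) pT e3.
have [d2 d20 h2] := height_near ib.1 p.2 pT e12.
have ch := wderiv_continuous (@height_deriv _ _ _ (hX ib.1 pT) p.2).
have /cvgrPdist_le/(_ _ e3)/nbhs_ballP[d3 /= d30 h3] := ch y0.
exists (Num.min d1 (Num.min d2 d3)); first by rewrite !lt_min d10 d20 d30.
move=> p' y p'T; rewrite !lt_min => /and3P[t1 t2 _] /and3P[_ x1 _] /and3P[_ x2 _] /and3P[y1 _ y3].
have a1 := h1 p'.1 y p'T t1 y1; have a2 := h2 p' y p'T t2 x1 x2.
have a3 : `|height (X ib.1 p.1) p.2 y0 - height (X ib.1 p.1) p.2 y| <= e / 3.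
  by apply: h3; rewrite /ball /= distrC.
have -> : - (rho ib.1 p'.1 y + height (X ib.1 p'.1) p'.2 y) - - (rho ib.1 p.1 y0 + height (X ib.1 p.1) p.2 y0) =
  - (rho ib.1 p'.1 y - rho ib.1 p.1 y0) - ((height (X ib.1 p'.1) p'.2 y - height (X ib.1 p.1) p.2 y) -
   (height (X ib.1 p.1) p.2 y0 - height (X ib.1 p.1) p.2 y)) by ring.
apply: le_trans (ler_normB _ _) _; rewrite normrN.
by have := ler_normB (height (X ib.1 p'.1) p'.2 y - height (X ib.1 p.1) p.2 y)
   (height (X ib.1 p.1) p.2 y0 - height (X ib.1 p.1) p.2 y); lra.
Qed.

(** The foot solves slope = 0, and the derivative of the slope in the angle is - (rho + height), of
    absolute value at least r0 / 2 in the tube. *)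
Lemma tube_angle_wderiv ib l p gs : tube_dom ib p ->
  wderiv (tax l p) (fun s => slope (X ib.1 (tline l p s).1) (tline l p s).2 (tube_angle ib p)) (tpos l p) gs ->
  wderiv (tax l p) (fun s => tube_angle ib (tline l p s)) (tpos l p)
    (gs / (rho ib.1 p.1 (tube_angle ib p) + tube_dist ib p)).
Proof.
move=> hp hgs; have [pT hb hd hang] := hp; have [hf h12 de low] := tube_foot hp.
have rp : 0 < rho ib.1 p.1 (tube_angle ib p) + tube_dist ib p.
  by apply: lt_le_trans low; rewrite divr_gt0.
have E : tline l p (tpos l p) = p by exact: tube_line_pos.
rewrite -[gs / _]mulrNN -invrN.
apply: (@implicit_wderiv _ _ (fun s y => slope (X ib.1 (tline l p s).1) (tline l p s).2 y)
  (fun s y => - (rho ib.1 (tline l p s).1 y + height (X ib.1 (tline l p s).1) (tline l p s).2 y))).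
- exact: (tube_ax_pos l hp).
- by move=> s As; exact: (@slope_deriv _ _ _ (hX ib.1 (tube_line_slab hp As)) _).
- have [d d0 h] := tube_dom_near l hp; exists d; first exact: d0.
  move=> s As sd; have [hf' _ _ _] := tube_foot (h s As sd).
  have fs := @foot_slope _ _ _ (hX ib.1 (tube_line_slab hp As)) _ _ hf'; exact: fs.
- by rewrite E; exact: hgs.
- by rewrite oppr_eq0 gt_eqF.
- move=> e e0; have [d d0 h] := tube_slope_near ib (tube_angle ib p) pT e0.
  exists d; first exact: d0.
  move=> s y As sd; rewrite E => yd; have [l1 l2 l3] := tube_line_dist l p s.
  rewrite de; apply: h; [exact: (tube_line_slab hp As)|exact: le_lt_trans l1 sd|
    exact: le_lt_trans l2 sd|exact: le_lt_trans l3 sd|exact: yd].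
- move=> e e0; have [d d0 h] := tube_near hp e0.
  exists d; first exact: d0.
  move=> s As sd; rewrite E; have [l1 l2 l3] := tube_line_dist l p s.
  by have [] := h _ (tube_line_slab hp As) (le_lt_trans l1 sd) (le_lt_trans l2 sd) (le_lt_trans l3 sd).
Qed.

Lemma tube_cont (f : I * R -> R * (R * R) -> R) :
  (forall ib p (e : R), tube_dom ib p -> 0 < e -> exists2 d : R, 0 < d &
     forall p', tube_dom ib p' -> `|p'.1 - p.1| < d -> `|p'.2.1 - p.2.1| < d -> `|p'.2.2 - p.2.2| < d ->
     `|f ib p' - f ib p| <= e) -> forall ib, cont_on (tube_dom ib) (f ib).
Proof.
move=> h ib p hp; apply/cvgrPdist_le => e e0; rewrite near_withinE.
have [d d0 hd] := h ib p e hp e0; apply/nbhs_ballP; exists d => // -[s [x1 x2]] [/= b1 [b2 b3]] hp'.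
by rewrite distrC; apply: hd => //; rewrite distrC.
Qed.

Lemma tube_class_comp j m N (f : I -> R * R -> R) :
  (forall m', smooth_class (strip T0 A1) j m' N f) -> smooth_class tube_frame j m 0 tube_angle ->
  smooth_class tube_frame j m N (fun ib p => f ib.1 (p.1, tube_angle ib p)).
Proof.
move=> hf ha.
have h1 (ib : I * R) p : fdom tube_frame ib p -> 0 <= p.1 <= T by case.
have h2 (ib : I * R) : cont_on (fdom tube_frame ib) (fun p => p.1).
  by apply: cont_onT => p; exact: cvg_fst.
have h3 (p : R * (R * R)) s : (fline tube_frame None p s).1 = s by [].
have h4 (p : R * (R * R)) : fpos tube_frame None p = p.1 by [].
have h5 (p : R * (R * R)) : fax tube_frame None p = `[0, T]%classic by [].
have h6 l (p : R * (R * R)) s : (fline tube_frame (Some l) p s).1 = p.1 by case: l.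
have h7 (ib : I * R) : famp tube_frame ib = A ib.1 by [].
exact: (@smooth_class_comp R I (I * R)%type bool (R * (R * R))%type T A T0 A1 tube_frame fst fst
  h1 h2 h3 h4 h5 h6 h7 j m N f tube_angle hf (smooth_inner ha)).
Qed.

Lemma tube_angle_amp : amp_bounded tube_frame 0 tube_angle.
Proof.
split.
  exists (3 * pi) => ib p hp; rewrite expr0 mulr1.
  have [_ hb _ _] := hp; have [_ h12 _ _] := tube_foot hp; have pi0 := pi_gt0 R.
  move: hb h12 => /andP[b1 b2] /andP[a1 a2]; rewrite ler_norml; apply/andP; split.
    by apply: le_trans (ltW a1); apply: le_trans b1; move: pi0; generalize (pi : R) => z ?; lra.
  by apply: le_trans (ltW a2) _; move: b2; generalize (pi : R) => z ?; lra.
apply: tube_cont => ib p e hp e0; have [d d0 hd] := tube_near hp e0.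
exists d; first exact: d0.
move=> p' hp' t1 x1 x2; have [p'T _ _ _] := hp'.
by have [_ h _] := hd p' p'T t1 x1 x2; exact: ltW h.
Qed.

Lemma tube_coord_class (C : R) j m : (forall i t a, 0 <= t <= T -> `|(X i t a).1| <= C /\ `|(X i t a).2| <= C) ->
  smooth_class tube_frame j m 0 (fun _ p => p.2.1) /\ smooth_class tube_frame j m 0 (fun _ p => p.2.2).
Proof.
move=> hC.
have bd ib p : tube_dom ib p -> `|p.2.1| <= C + r0 / 2 /\ `|p.2.2| <= C + r0 / 2.
  move=> hp; have [pT _ hd _] := hp; have [hf _ de _] := tube_foot hp.
  have dl : `|tube_dist ib p| <= r0 / 2 by apply: le_trans (ltW hd) _.
  rewrite (@footE _ _ _ (hX ib.1 pT) _ _ hf) -de pairZ pairD /=.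
  have [c1 c2] := hC ib.1 p.1 (tube_angle ib p) pT.
  have cl (z : R) : `|cos z| <= 1 by rewrite ler_norml cos_geN1 cos_le1.
  have sl (z : R) : `|sin z| <= 1 by rewrite ler_norml sin_geN1 sin_le1.
  split; apply: le_trans (ler_normD _ _) _; apply: lerD => //; rewrite normrM -[leRHS]mulr1; exact: ler_pM.
have c1 : continuous (fun p : R * (R * R) => p.2.1).
  by move=> p; apply: continuous_comp; [exact: cvg_snd|exact: cvg_fst].
have c2 : continuous (fun p : R * (R * R) => p.2.2).
  by move=> p; apply: continuous_comp; [exact: cvg_snd|exact: cvg_snd].
have cs j' m' (x : R) : smooth_class tube_frame j' m' 0 (fun _ _ => x) by exact: smooth_class_cst.
split; apply/smooth_classE; split.
- split; first by exists (C + r0 / 2) => ib p hp; rewrite expr0 mulr1; exact: (bd ib p hp).1.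
  by move=> ib; exact: cont_onT.
- move=> m' _ [].
    by exists (fun _ _ => 0); [move=> ib p hp /=; exact: wderiv_cst|exact: cs].
  by exists (fun _ _ => 1); [move=> ib p hp /=; exact: wderiv_id|exact: cs].
- move=> j' _; exists (fun _ _ => 0); first by move=> ib p hp /=; exact: wderiv_cst.
  by apply: smooth_class_mono (cs _ _ _).
- split; first by exists (C + r0 / 2) => ib p hp; rewrite expr0 mulr1; exact: (bd ib p hp).2.
  by move=> ib; exact: cont_onT.
- move=> m' _ [].
    by exists (fun _ _ => 1); [move=> ib p hp /=; exact: wderiv_id|exact: cs].
  by exists (fun _ _ => 0); [move=> ib p hp /=; exact: wderiv_cst|exact: cs].
- move=> j' _; exists (fun _ _ => 0); first by move=> ib p hp /=; exact: wderiv_cst.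
  by apply: smooth_class_mono (cs _ _ _).
Qed.

(** A first derivative of the angle is a function of time and angle divided by rho + dist, and dist
    is in turn a function of the position, the time and the angle: all of these are known at a lower
    order. A time derivative brings in that of X, hence one amplitude. *)
Lemma tube_angle_class (N : nat) :
  (forall j m, (j <= N)%N -> [/\ smooth_class (strip T0 A1) j m 0 (fun i q => (X i q.1 q.2).1),
     smooth_class (strip T0 A1) j m 0 (fun i q => (X i q.1 q.2).2) &
     smooth_class (strip T0 A1) j m 0 (fun i q => rho i q.1 q.2)]) ->
  forall j m, (j <= N)%N ->
    smooth_class tube_frame j m 0 tube_angle /\ smooth_class tube_frame j m 0 tube_dist.
Proof.
move=> hN.
have [C hC] : exists C : R, forall i t a, 0 <= t <= T -> `|(X i t a).1| <= C /\ `|(X i t a).2| <= C.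
  have [k1 k2 _] := hN 0%N 0%N (leq0n N).
  have [[C1 h1] _] := smooth_class_amp k1; have [[C2 h2] _] := smooth_class_amp k2.
  exists (Num.max C1 C2) => i t a tT.
  have := h1 i (t, a) tT; have := h2 i (t, a) tT; rewrite /= !expr0 !mulr1 => u2 u1.
  by rewrite !le_max u1 u2 orbT.
have [ss sc] := @smooth_trig R.
have trig j m : smooth_class (strip T0 A1) j m 0 (fun _ q => sin q.2) /\
    smooth_class (strip T0 A1) j m 0 (fun _ q => cos q.2).
  by split; apply: smooth_class_space => // y; [exact: sin_per|exact: cos_per].
have dist_of j m : (j <= N)%N -> smooth_class tube_frame j m 0 tube_angle ->
    smooth_class tube_frame j m 0 tube_dist.
  move=> jN ha.
  have k1 := @tube_class_comp j m 0 _ (fun m' => (let: And3 h _ _ := hN j m' jN in h)) ha.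
  have k2 := @tube_class_comp j m 0 _ (fun m' => (let: And3 _ h _ := hN j m' jN in h)) ha.
  have ks := @tube_class_comp j m 0 _ (fun m' => (trig j m').1) ha.
  have kc := @tube_class_comp j m 0 _ (fun m' => (trig j m').2) ha.
  have [x1 x2] := tube_coord_class j m hC.
  apply: (smooth_class_ext (f := fun ib p => (p.2.1 - (X ib.1 p.1 (tube_angle ib p)).1) * cos (tube_angle ib p) +
     (p.2.2 - (X ib.1 p.1 (tube_angle ib p)).2) * sin (tube_angle ib p))).
    by move=> ib p hp; have [_ _ -> _] := tube_foot hp.
  apply: smooth_classD.
    exact: (smooth_classM (smooth_classB x1 k1) kc).
  exact: (smooth_classM (smooth_classB x2 k2) ks).
have r2 : 0 < r0 / 2 by rewrite divr_gt0.
have inv_of j m : (j <= N)%N -> smooth_class tube_frame j m 0 tube_angle ->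
    smooth_class tube_frame j m 0 (fun ib p => (rho ib.1 p.1 (tube_angle ib p) + tube_dist ib p)^-1).
  move=> jN ha; apply: (smooth_classV r2).
    by move=> ib p hp; have [_ _ _ h] := tube_foot hp.
  apply: smooth_classD; last exact: dist_of.
  exact: (@tube_class_comp j m 0 _ (fun m' => (let: And3 _ _ h := hN j m' jN in h)) ha).
suff main : forall j m, (j <= N)%N -> smooth_class tube_frame j m 0 tube_angle.
  by move=> j m jN; split; [exact: main|apply: dist_of => //; exact: main].
apply: class_ind => j m IHm IHj jN; apply/smooth_classE; split; first exact: tube_angle_amp.
- move=> m' mE l; have ha := IHm m' mE jN.
  have ks := @tube_class_comp j m' 0 _ (fun m' => (trig j m').1) ha.
  have kc := @tube_class_comp j m' 0 _ (fun m' => (trig j m').2) ha.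
  exists (fun ib p => (if l then cos (tube_angle ib p) else - sin (tube_angle ib p)) *
      (rho ib.1 p.1 (tube_angle ib p) + tube_dist ib p)^-1).
    move=> ib p hp; apply: tube_angle_wderiv; first exact: hp.
    have cst (x : R) := @wderiv_cst R setT x; have idd := @wderiv_id R setT.
    case: l => /=; rewrite /slope /dotp /tangent /=.
      have := wderivD (cst ((p.2.1 - (X ib.1 p.1 (tube_angle ib p)).1) * - sin (tube_angle ib p)) p.2.2)
        (wderivM (wderivB (idd p.2.2) (cst (X ib.1 p.1 (tube_angle ib p)).2 p.2.2)) (cst (cos (tube_angle ib p)) p.2.2)).
      by apply: wderiv_eql; ring.
    have := wderivD (wderivM (wderivB (idd p.2.1) (cst (X ib.1 p.1 (tube_angle ib p)).1 p.2.1)) (cst (- sin (tube_angle ib p)) p.2.1))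
      (cst ((p.2.2 - (X ib.1 p.1 (tube_angle ib p)).2) * cos (tube_angle ib p)) p.2.1).
    by apply: wderiv_eql; ring.
  apply: (@smooth_classM _ _ _ _ _ _ _ 0 0); last exact: inv_of.
  by case: l => //; exact: smooth_classN.
- move=> j' jE; have jN' : (j' <= N)%N by rewrite (leq_trans _ jN)// jE.
  have ha m' := IHj j' jE m' jN'.
  have [hx1 hx2 _] := hN j m jN.
  have := hx1; rewrite {1}jE => /smooth_classE[_ _ /(_ _ erefl)[X1t dX1 _]].
  have := hx2; rewrite {1}jE => /smooth_classE[_ _ /(_ _ erefl)[X2t dX2 _]].
  have cX1t m' : smooth_class (strip T0 A1) j' m' 1 X1t.
    by have [h _ _] := hN j m' jN; rewrite jE in h; exact: smooth_class_dt h dX1.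
  have cX2t m' : smooth_class (strip T0 A1) j' m' 1 X2t.
    by have [_ h _] := hN j m' jN; rewrite jE in h; exact: smooth_class_dt h dX2.
  have k1 := @tube_class_comp j' m 1 _ cX1t (ha m); have k2 := @tube_class_comp j' m 1 _ cX2t (ha m).
  have ks := @tube_class_comp j' m 0 _ (fun m' => (trig j' m').1) (ha m).
  have kc := @tube_class_comp j' m 0 _ (fun m' => (trig j' m').2) (ha m).
  exists (fun ib p => (X1t ib.1 (p.1, tube_angle ib p) * sin (tube_angle ib p) -
      X2t ib.1 (p.1, tube_angle ib p) * cos (tube_angle ib p)) *
      (rho ib.1 p.1 (tube_angle ib p) + tube_dist ib p)^-1).
    move=> ib p hp; have [pT _ _ _] := hp; apply: tube_angle_wderiv; first exact: hp.
    have w1 := dX1 ib.1 (p.1, tube_angle ib p) pT; have w2 := dX2 ib.1 (p.1, tube_angle ib p) pT.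
    rewrite /= in w1 w2.
    have cst (x : R) := @wderiv_cst R `[0, T]%classic x p.1.
    rewrite /= /slope /dotp /tangent /=.
    have := wderivD (wderivM (wderivB (cst p.2.1) w1) (cst (- sin (tube_angle ib p))))
       (wderivM (wderivB (cst p.2.2) w2) (cst (cos (tube_angle ib p)))).
    by apply: wderiv_eql; ring.
  apply: (@smooth_classM _ _ _ _ _ _ _ 1 0); last by apply: inv_of.
  apply: smooth_classB; [exact: (@smooth_classM _ _ _ _ _ _ _ 1 0)|exact: (@smooth_classM _ _ _ _ _ _ _ 1 0)].
Qed.

Definition partial_of (l : bool) (u : R * R -> R) : R * R -> R := if l then partial2 u else partial1 u.

(** [pd] applies to functions on the whole plane, whereas the classes live on the tube; agreement on
    the open slice at time t is preserved by partial derivatives. *)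
Definition agrees (f : I * R -> R * (R * R) -> R) ib t (u : R * R -> R) :=
  forall x, tube_dom ib (t, x) -> u x = f ib (t, x).

Lemma agrees_wderiv (l : bool) f f' ib t u : has_deriv tube_frame (Some l) f f' -> agrees f ib t u ->
  forall x, tube_dom ib (t, x) ->
  wderiv setT (fun s => u (if l then (x.1, s) else (s, x.2))) (if l then x.2 else x.1) (f' ib (t, x)).
Proof.
move=> hf hu x hx; have [d d0 hd] := tube_dom_near (Some l) hx.
have h := hf ib (t, x) hx.
move: hf hd h; case: l => hf hd h; (apply: (wderiv_near d0) h;
  [by move=> s _ sd; rewrite hu//; apply: hd|by rewrite hu /= -?surjective_pairing]).
Qed.

Lemma class_partial (l : bool) j m N f : smooth_class tube_frame j m.+1 N f ->
  exists2 f', smooth_class tube_frame j m N f' &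
    forall ib t u, agrees f ib t u -> agrees f' ib t (partial_of l u).
Proof.
move=> /smooth_classE[_ /(_ _ erefl l)[f' hf Cf'] _]; exists f' => // ib t u hu x hx.
have h := agrees_wderiv hf hu hx.
by move: h; rewrite /partial_of; case: (l) => h; [exact: partial2_wderiv|exact: partial1_wderiv].
Qed.

Lemma class_pd j m1 m2 : forall m N f, (m1 + m2 <= m)%N -> smooth_class tube_frame j m N f ->
  exists2 f', smooth_class tube_frame j (m - (m1 + m2)) N f' &
    forall ib t u, agrees f ib t u -> agrees f' ib t (pd m1 m2 u).
Proof.
elim: m1 => [|m1 IH1].
  elim: m2 => [|m2 IH2] m N f mm Cf; first by exists f; rewrite ?subn0.
  have [g Cg hg] := IH2 m N f (ltnW mm) Cf.
  move: Cg; rewrite (_ : (m - (0 + m2) = (m - (0 + m2.+1)).+1)%N); last by rewrite !add0n subnSK.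
  by move=> /(class_partial true)[g' Cg' hg']; exists g' => // ib t u /hg/hg'.
move=> m N f mm Cf; have [g Cg hg] := IH1 m N f (ltnW mm) Cf.
move: Cg; rewrite (_ : (m - (m1 + m2) = (m - (m1.+1 + m2)).+1)%N); last by rewrite subnSK.
by move=> /(class_partial false)[g' Cg' hg']; exists g' => // ib t u /hg/hg'.
Qed.

Lemma class_differentiable j m N f ib t u x : smooth_class tube_frame j m.+1 N f ->
  agrees f ib t u -> tube_dom ib (t, x) -> differentiable u x.
Proof.
move=> Cf hu hx.
have /smooth_classE[_ hx' _] := Cf.
have [f1 h1 /smooth_class_amp[_ c1]] := hx' _ erefl false.
have [f2 h2 /smooth_class_amp[_ c2]] := hx' _ erefl true.
have near_dom : \forall y \near x, tube_dom ib (t, y).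
  have [tT _ _ _] := hx; have [d d0 hd] := tube_near hx ltr01.
  apply/nbhs_ballP; exists d => // -[y1 y2] [b1 b2]; rewrite /ball /= in b1 b2.
  have [] := hd (t, (y1, y2)); rewrite /= ?subrr ?normr0//; first by rewrite distrC.
  by rewrite distrC.
have cont f0 : cont_on (tube_dom ib) (f0 ib) -> {for x, continuous (fun y => f0 ib (t, y))}.
  move=> cf; apply/cvgrPdist_le => e e0.
  have /cvgrPdist_le/(_ _ e0) := cf (t, x) hx; rewrite near_withinE => /nbhs_ballP[d /= d0 hd].
  have dd : \forall y \near x, `|f0 ib (t, x) - f0 ib (t, y)| <= e \/ ~ tube_dom ib (t, y).
    apply/nbhs_ballP; exists d => // y yb.
    have [hy|] := pselect (tube_dom ib (t, y)); last by right.
    by left; apply: (hd (t, y)) => //; split; [exact: ballxx|exact: yb].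
  by apply: filterS2 near_dom dd => y hy [|/(_ hy)].
apply: (@differentiable_partials R u (fun y => f1 ib (t, y)) (fun y => f2 ib (t, y)) x).
- near=> y; have hy : tube_dom ib (t, y) by near: y.
  exact: (agrees_wderiv h1 hu hy).
- near=> y; have hy : tube_dom ib (t, y) by near: y.
  exact: (agrees_wderiv h2 hu hy).
- exact: cont (c1 ib).
- exact: cont (c2 ib).
Unshelve. all: by end_near. Qed.

Lemma class_dt_pd j m N f k m1 m2 : (k <= j)%N -> (m1 + m2 <= m)%N -> smooth_class tube_frame j m N f ->
  exists2 f', smooth_class tube_frame (j - k) (m - (m1 + m2)) (N + k) f' &
  forall ib (u : R -> R * R -> R), (forall s, agrees f ib s (u s)) ->
  forall t x, tube_dom ib (t, x) -> dt_pd T k m1 m2 u t x = f' ib (t, x) /\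
    ((k < j)%N -> derivable_w `[0, T]%classic (fun s => dt_pd T k m1 m2 u s x) t).
Proof.
move=> kj mm Cf; have [g Cg hg] := class_pd mm Cf.
have [g' Cg' hg'] := class_derwn (A := `[0, T]%classic) (F := tube_frame) (fun p => erefl)
  (fun p s s' => erefl) (fun p s => erefl) kj Cg.
exists g' => // ib u hu t x hx.
have [d d0 hd] := tube_dom_near None hx.
apply: (hg' ib (t, x)); first exact: hx.
exists d; first exact: d0.
move=> s sT sd; apply: (hg ib s (u s)); first exact: hu.
exact: (hd s sT sd).
Qed.

(** By [tube_near], all points over [0, T] close to a point of the domain belong to the domain, so
    continuity relative to the domain implies continuity relative to U. *)
Lemma class_smooth_tx f k m1 m2 (U : set (R * (R * R))) ib (u : R -> R * R -> R) t x N :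
  smooth_class tube_frame k.+1 (m1 + m2).+1 N f -> (forall s, agrees f ib s (u s)) ->
  U `<=` [set q | 0 <= q.1 <= T] -> tube_dom ib (t, x) ->
  [/\ differentiable (pd m1 m2 (u t)) x,
      derivable_w `[0, T]%classic (fun s => dt_pd T k m1 m2 u s x) t &
      dt_pd T k m1 m2 u q.1 q.2 @[q --> within U (nbhs (t, x))] --> dt_pd T k m1 m2 u t x].
Proof.
move=> Cf hu hU hx.
have [f' Cf' hf'] := class_dt_pd (leqnSn k) (leqnSn (m1 + m2)) Cf.
split.
- have [g Cg hg] := class_pd (leqnSn (m1 + m2)) Cf.
  rewrite subSnn in Cg.
  exact: (class_differentiable Cg (hg ib t (u t) (hu t)) hx).
- exact: (hf' ib u hu t x hx).2.
- have [_ cf] := smooth_class_amp Cf'.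
  rewrite (hf' ib u hu t x hx).1; apply/cvgrPdist_le => e e0; rewrite near_withinE.
  have /cvgrPdist_le/(_ _ e0) := cf ib (t, x) hx; rewrite near_withinE => /nbhs_ballP[d /= d0 hd].
  have [d1 d10 hd1] := tube_near hx ltr01.
  apply/nbhs_ballP; exists (Num.min d d1); first by rewrite /= lt_min d0.
  move=> [s [y1 y2]] [/= b1 [b2 b3]] Uq.
  have [bb1 bb2 bb3] : [/\ `|s - t| < d1, `|y1 - x.1| < d1 & `|y2 - x.2| < d1].
    move: b1 b2 b3; rewrite /ball /= !lt_min ![`|_ - s|]distrC ![`|_ - y1|]distrC ![`|_ - y2|]distrC.
    by move=> /andP[_ ->] /andP[_ ->] /andP[_ ->].
  have [hq _ _] := hd1 (s, (y1, y2)) (hU _ Uq) bb1 bb2 bb3.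
  rewrite (hf' ib u hu s (y1, y2) hq).1; apply: hd; last exact: hq.
  move: b1 b2 b3; rewrite /ball /= !lt_min => /andP[c1 _] /andP[c2 _] /andP[c3 _].
  by split; [exact: c1|split; [exact: c2|exact: c3]].
Qed.

(** The branch that starts at the angle minus pi places the point opposite to the cut. *)
Lemma tube_dom_angle i t x : 0 <= t <= T -> `|sdist (X i t) x| < 3 * delta ->
  tube_dom (i, angle (X i t) x - pi) (t, x) /\
  tube_angle (i, angle (X i t) x - pi) (t, x) = angle (X i t) x.
Proof.
move=> tT hd; have gX := hX i tT; have gr a := hr i a tT.
have hd' : - r0 < sdist (X i t) x by exact: lt_trans r0_half (@tube_dist_gt (i, 0) (t, x) hd).
have [a1 a2 a3] := angle_fromP gX r00 gr 0 hd'.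
rewrite -/(angle (X i t) x) in a1 a2 a3; rewrite add0r in a2.
have pi0 := pi_gt0 R.
have e : tube_angle (i, angle (X i t) x - pi) (t, x) = angle (X i t) x.
  apply: (angle_from_eq gX r00 gr hd' _ a3) => /=.
  by apply/andP; split; move: pi0; generalize (pi : R) => z ?; lra.
split; last exact: e.
split; [exact: tT| |exact: hd|].
  by apply/andP => /=; split; move: a1 a2 pi0; generalize (pi : R) => z ? ? ?; lra.
by rewrite e /= ltrBlDr ltrDl.
Qed.

Lemma tube_angle_unique i t x : 0 <= t <= T -> `|sdist (X i t) x| < 3 * delta ->
  exists! th, [/\ 0 <= th, th < 2 * pi & is_angle (X i t) x th].
Proof.
move=> tT hd; have gX := hX i tT; have gr a := hr i a tT.
have hd' : - r0 < sdist (X i t) x by exact: lt_trans r0_half (@tube_dist_gt (i, 0) (t, x) hd).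
have [a1 a2 a3] := angle_fromP gX r00 gr 0 hd'; rewrite add0r in a2.
exists (angle_from 0 (X i t) x); split.
  by split => //; apply/(is_angleP gX r00 gr _ hd').
move=> th [t1 t2 /(is_angleP gX r00 gr _ hd') hf].
by apply: (angle_from_eq gX r00 gr hd' _ hf); rewrite t1 add0r.
Qed.

(** On the curve the distance vanishes, and the gradient of the angle is the unit tangent divided by
    rho. *)
Lemma tube_grad_angle i t th : 0 <= t <= T -> 0 <= th < 2 * pi ->
  enorm (grad_angle (X i t) (X i t th)) ^- 2 = rho i t th ^+ 2.
Proof.
move=> tT hth; have gX := hX i tT; have gr a := hr i a tT.
have s0 : sdist (X i t) (X i t th) = 0 by exact: (sdist_curve gX r00 gr th).
have hd : `|sdist (X i t) (X i t th)| < 3 * delta by rewrite s0 normr0 mulr_gt0.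
have [hp ea] := tube_dom_angle tT hd.
have r1 : - r0 < 0 by rewrite oppr_lt0.
have [hf _] := foot_normal_line gX gr th r1; rewrite scale0r addr0 in hf.
have at_ : angle (X i t) (X i t th) = th.
  by apply: (angle_from_eq gX r00 gr _ _ hf); rewrite ?s0// add0r.
rewrite /grad_angle /local_angle; rewrite at_ in hp ea *.
set b := th - pi in hp ea *; set x := X i t th in s0 hd hp ea hf *.
have rp : 0 < rho i t th by have [_ _ _ _ h] := gX; exact: h.
have dd : tube_dist (i, b) (t, x) = 0 by exact: s0.
have cst (c : R) := @wderiv_cst R setT c; have idd := @wderiv_id R setT.
have g1 : partial1 (angle_from b (X i t)) x = - sin th / rho i t th.
  apply: partial1_wderiv.
  have := @tube_angle_wderiv (i, b) (Some false) (t, x) (- sin th) hp.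
  rewrite ea dd addr0 /=; apply; rewrite /slope /dotp /tangent /=.
  have := wderivD (wderivM (wderivB (idd x.1) (cst (X i t th).1 x.1)) (cst (- sin th) x.1))
      (cst ((x.2 - (X i t th).2) * cos th) x.1).
  by apply: wderiv_eql; ring.
have g2 : partial2 (angle_from b (X i t)) x = cos th / rho i t th.
  apply: partial2_wderiv.
  have := @tube_angle_wderiv (i, b) (Some true) (t, x) (cos th) hp.
  rewrite ea dd addr0 /=; apply; rewrite /slope /dotp /tangent /=.
  have := wderivD (cst ((x.1 - (X i t th).1) * - sin th) x.2)
      (wderivM (wderivB (idd x.2) (cst (X i t th).2 x.2)) (cst (cos th) x.2)).
  by apply: wderiv_eql; ring.
rewrite enorm_sqr /grad g1 g2 /dotp /=.
have -> : - sin th / rho i t th * (- sin th / rho i t th) + cos th / rho i t th * (cos th / rho i t th) =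
  (cos th ^+ 2 + sin th ^+ 2) / rho i t th ^+ 2 by field; rewrite gt_eqF.
by rewrite cos2Dsin2 mul1r invrK.
Qed.

End TubeFrame.

(** * Uniform bounds *)

Section DomainMargin.
Context {R : realType}.
Implicit Types (D : set (R * R)) (g : R -> R * R).

Lemma curve_margin D g : open D -> continuous g -> (forall a, g (a + 2 * pi) = g a) ->
  (forall a, D (g a)) -> exists2 r : R, 0 < r & forall a p,
    `|p.1 - (g a).1| < r -> `|p.2 - (g a).2| < r -> D p.
Proof.
move=> oD cg pg gD.
have loc a : exists2 r : R, 0 < r & forall p, `|p.1 - (g a).1| < r -> `|p.2 - (g a).2| < r -> D p.
  have /nbhs_ballP[r /= r0 hr] : nbhs (g a) D by apply: open_nbhs_nbhs; split.
  by exists r => // p p1 p2; apply: hr; split; rewrite /ball /= distrC.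
have cK : compact (`[0, 2 * pi]%classic : set R) by exact: (@segment_compact R 0 (2 * pi)).
move/compact_near_coveringP in cK.
have := cK R 0^'+ (fun e a => forall p, `|p.1 - (g a).1| < e -> `|p.2 - (g a).2| < e -> D p) _.
have h a : `[0, 2 * pi]%classic a -> \forall a' \near a & e \near 0^'+,
    forall p, `|p.1 - (g a').1| < e -> `|p.2 - (g a').2| < e -> D p.
  move=> _; have [r r0 hr] := loc a.
  have r2 : 0 < r / 2 by rewrite divr_gt0.
  have /cvgrPdist_lt/(_ _ r2) n1 : (g a').1 @[a' --> a] --> (g a).1.
    by apply: continuous_comp; [exact: cg|exact: cvg_fst].
  have /cvgrPdist_lt/(_ _ r2) n2 : (g a').2 @[a' --> a] --> (g a).2.
    by apply: continuous_comp; [exact: cg|exact: cvg_snd].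
  exists ([set a' | `|(g a).1 - (g a').1| < r / 2 /\ `|(g a).2 - (g a').2| < r / 2], [set e | e < r / 2]).
    split => /=; first by apply: filterI; [exact: n1|exact: n2].
    by apply: nbhs_right_lt.
  move=> [a' e] /= [[g1 g2] er] p p1 p2; apply: hr.
    have -> : p.1 - (g a).1 = (p.1 - (g a').1) - ((g a).1 - (g a').1) by ring.
    by apply: le_lt_trans (ler_normB _ _) _; lra.
  have -> : p.2 - (g a).2 = (p.2 - (g a').2) - ((g a).2 - (g a').2) by ring.
  by apply: le_lt_trans (ler_normB _ _) _; lra.
move=> /(_ _ h) [] /= e e0 he.
have e2 : 0 < e / 2 by rewrite divr_gt0.
exists (e / 2) => // a p.
have [y /andP[y0 y2] <-] := periodic_reduce a 0 pg.
apply: (he (e / 2)) => //=.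
- by rewrite sub0r normrN gtr0_norm// ltr_pdivrMr// ltr_pMr// ltr1n.
- by rewrite in_itv/= y0 ltW// -[X in _ < X]add0r.
Qed.

(** Otherwise D would be open and closed, and a horizontal segment leaving the bounded set would
    stay in D by connectedness. It matters because the distance to the boundary in [good_tubes] is
    an infimum over boundary points. *)
Lemma bdry_nonempty D : open D -> D !=set0 -> bounded_set D -> exists y, bdry D y.
Proof.
move=> oD [p Dp] [M [Mr hM]]; apply: contrapT => nb.
have cl : closure D `<=` D.
  move=> y cy; apply: contrapT => nDy; apply: nb; exists y; split => //.
  by have -> : D° = D by apply/interior_id.
pose s0 := 2 * (`|M| + `|p.1| + 1).
pose phi (s : R) := (p.1 + s, p.2) : R * R.
have cphi : continuous phi.
  move=> s; have h1 : p.1 + s' @[s' --> s] --> p.1 + s by apply: cvgD; [exact: cvg_cst|exact: cvg_id].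
  exact: (cvg_pair h1 (cvg_cst p.2)).
have s00 : 0 <= s0 by rewrite mulr_ge0// !addr_ge0.
have con := @segment_connected R 0 s0.
have := con (`[0, s0]%classic `&` phi @^-1` D).
have -> : (`[0, s0]%classic `&` phi @^-1` D) !=set0 = True.
  apply/propext; split => // _; exists 0; split; first by rewrite /= in_itv/= lexx s00.
  by rewrite /phi /= addr0 -surjective_pairing.
move=> /(_ I) h.
have E : `[0, s0]%classic `&` phi @^-1` D = `[0, s0]%classic.
  apply: h.
  - by exists (phi @^-1` D) => //; apply: open_comp => // s _; exact: cphi.
  - exists (phi @^-1` D) => //.
    have -> : phi @^-1` D = phi @^-1` (closure D).
      by apply/seteqP; split => s /=; [exact: subset_closure|exact: cl].
    apply: preimage_closed; first by move=> s _; exact: cphi.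
    exact: closed_closure.
have [_ Ds] : (`[0, s0]%classic `&` phi @^-1` D) s0 by rewrite E /= in_itv/= s00 lexx.
have := hM (`|M| + 1) _ (phi s0) Ds; rewrite /phi => hn.
have : `|p.1 + s0| <= `|M| + 1.
  apply: le_trans (hn _); last first.
    by apply: le_lt_trans (ler_norm M) _; rewrite ltrDl.
  by rewrite /Num.norm /= le_max lexx.
move=> h1; have := ler_norm (p.1 + s0); have := ler_norm (- p.1); rewrite normrN /s0.
have := normr_ge0 M; have := normr_ge0 p.1; lra.
Qed.

End DomainMargin.

Section CkNorm.
Context {R : realType}.

(** Here 1 + |v|_{N,T} itself becomes the amplitude: it is finite and dominates the forcing with its
    derivatives up to order N. *)
Lemma cknorm_chain (N : nat) (T : R) (vd : nat -> R -> R) : 0 < T ->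
  (forall a t, 0 <= t <= T -> wderiv `[0, T]%classic (vd a) t (vd a.+1 t)) ->
  exists A : R, [/\ 1 <= A, (1 + cknorm N T (vd 0%N))%E = A%:E &
    forall a t, (a <= N)%N -> 0 <= t <= T -> `|vd a t| <= A].
Proof.
move=> T0 dv.
have t00 : `[0%R, T]%classic (0 : R) by rewrite /= in_itv/= lexx ltW.
have E a t : 0 <= t <= T -> derwn `[0, T]%classic a (vd 0%N) t = vd a t.
  move=> tT; apply: (@derwn_chain R `[0, T]%classic vd a) => //.
  - by move=> s; rewrite /= in_itv/=; exact: one_sided_cc.
pose S a : \bar R := ereal_sup [set `|derwn `[0%R, T]%classic a (vd 0%N) t|%:E | t in `[0%R, T]].
have S0 a : (0 <= S a)%E.
  apply: (@le_trans _ _ `|derwn `[0, T]%classic a (vd 0%N) 0|%:E); first by rewrite lee_fin.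
  by apply: ereal_sup_ubound; exists 0.
have Sfin a : (S a \is a fin_num).
  have [|C C0 hC] := @interval_bounded R T (vd a) (ltW T0).
    move=> t; rewrite /= in_itv/= => tT; have h := @dv a t tT; exact: (wderiv_cvg h).
  rewrite ge0_fin_numE// (@le_lt_trans _ _ C%:E) ?ltry//.
  apply: ge_ereal_sup => y [t]; rewrite /= in_itv/= => tT <-.
  by rewrite lee_fin E// hC.
have Sb a t : 0 <= t <= T -> `|vd a t| <= fine (S a).
  move=> tT; rewrite -lee_fin fineK//; apply: ereal_sup_ubound.
  by exists t; rewrite /= ?in_itv//= E.
have f0 a : 0 <= fine (S a) by exact: fine_ge0.
exists (1 + \sum_(a < N.+1) fine (S a)); split.
- by rewrite lerDl sumr_ge0.
- rewrite /cknorm EFinD; congr (_ + _)%E.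
  by rewrite -sumEFin; apply: eq_bigr => a _; rewrite fineK.
- move=> a t aN tT; apply: le_trans (Sb a t tT) _.
  rewrite (bigD1 (Ordinal (aN : (a < N.+1)%N)))//= addrCA lerDl addr_ge0// sumr_ge0//.
Qed.

End CkNorm.

Section FiniteBound.
Context {R : realType}.

(** Merges finitely many constants into one by summing their absolute values. *)
Lemma finite_bound (n : nat) (P : nat -> nat -> nat -> R -> Prop) :
  (forall a b c, (a <= n)%N -> (b <= n)%N -> (c <= n)%N -> exists C : R, P a b c C) ->
  (forall a b c (C C' : R), C <= C' -> P a b c C -> P a b c C') ->
  exists C : R, forall a b c, (a <= n)%N -> (b <= n)%N -> (c <= n)%N -> P a b c C.
Proof.
move=> hP hm.
have h (x : 'I_n.+1 * 'I_n.+1 * 'I_n.+1) : exists C : R, P x.1.1 x.1.2 x.2 C.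
  by apply: hP; exact: leq_ord.
have [C hC] := choice h.
exists (\sum_x `|C x|) => a b c a1 b1 c1.
pose x := (Ordinal (a1 : (a < n.+1)%N), Ordinal (b1 : (b < n.+1)%N), Ordinal (c1 : (c < n.+1)%N)).
apply: (hm _ _ _ (C x)); last exact: (hC x).
by rewrite (bigD1 x)//=; apply: le_trans (ler_norm _) _; rewrite lerDl sumr_ge0.
Qed.

End FiniteBound.

Section FamilyBounds.
Context {R : realType} {I : Type}.
Variables (T : R) (T0 : 0 < T) (vd : nat -> I -> R -> R).
Variables (X : I -> R -> R -> R * R) (rho : I -> R -> R -> R) (r0 delta : R).
Hypotheses (dv : forall i a t, 0 <= t <= T -> wderiv `[0, T]%classic (vd a i) t (vd a.+1 i t))
  (hX : forall i t, 0 <= t <= T -> gauss_radius (X i t) (rho i t))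
  (hr : forall i t a, 0 <= t <= T -> r0 <= rho i t a)
  (r00 : 0 < r0) (delta0 : 0 < delta) (hdelta : 3 * delta <= r0 / 2).
Hypotheses (f1 : smooth_family T vd (fun i q => (X i q.1 q.2).1))
  (f2 : smooth_family T vd (fun i q => (X i q.1 q.2).2))
  (f3 : smooth_family T vd (fun i q => rho i q.1 q.2)).

Lemma smooth_family_cont (f : I -> R * R -> R) : smooth_family T vd f ->
  forall i, cont_on (slab T) (f i).
Proof.
move=> sf i; have [A [A1 hA]] := amplitude_exists T0 dv 0.
by have [_ h] := smooth_class_amp (sf T0 A A1 0%N hA 0%N 0%N (leqnn 0)); exact: h.
Qed.

Let cX1 := smooth_family_cont f1.
Let cX2 := smooth_family_cont f2.
Let crho := smooth_family_cont f3.

Lemma family_classes (N : nat) (A : I -> R) (A1 : forall i, 1 <= A i) :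
  (forall a i t, (a <= N)%N -> 0 <= t <= T -> `|vd a i t| <= A i) ->
  forall j m, (j <= N)%N ->
    [/\ smooth_class (strip T0 A1) j m 0 (fun i q => (X i q.1 q.2).1),
     smooth_class (strip T0 A1) j m 0 (fun i q => (X i q.1 q.2).2) &
     smooth_class (strip T0 A1) j m 0 (fun i q => rho i q.1 q.2)].
Proof.
by move=> hA j m jN; split; [exact: (f1 T0 A1 hA)|exact: (f2 T0 A1 hA)|exact: (f3 T0 A1 hA)].
Qed.

(** Smoothness of every order is asked without estimates, so an amplitude is produced separately for
    each order k. *)
Lemma family_good_tubes (D : set (R * R)) (e : R) i : open D -> bdry D !=set0 -> 3 * delta < e ->
  (forall t a p, 0 <= t <= T -> `|p.1 - (X i t a).1| < e -> `|p.2 - (X i t a).2| < e -> D p) ->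
  good_tubes D delta T (X i).
Proof.
move=> oD [y0 by0] de hD.
have sub : tubes D delta T (X i) `<=` [set q | 0 <= q.1 <= T].
  by move=> q [] /=; rewrite in_itv.
have tubeP t x : tubes D delta T (X i) (t, x) -> 0 <= t <= T /\ `|sdist (X i t) x| < 3 * delta.
  by move=> [] /=; rewrite in_itv /tube /= => tT [].
split.
- move=> t; rewrite /= in_itv/= => tT; apply: lt_le_trans de _.
  apply: lb_le_inf; first by exists (enorm (X i t 0 - y0)), 0, y0.
  move=> _ [th [y [by_ ->]]]; rewrite leNgt; apply/negP => lt.
  have /interior_id oD' := oD; have [_] := by_; rewrite oD'; apply.
  have le1 (p : R * R) : `|p.1| <= enorm p.
    rewrite -sqrtr_sqr ler_wsqrtr// /dotp -expr2 lerDl -expr2; exact: sqr_ge0.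
  have le2 (p : R * R) : `|p.2| <= enorm p.
    rewrite -sqrtr_sqr ler_wsqrtr// /dotp -[p.2 * _]expr2 lerDr -expr2; exact: sqr_ge0.
  apply: (hD t th y tT); rewrite distrC.
    exact: le_lt_trans (le1 (X i t th - y)) lt.
  exact: le_lt_trans (le2 (X i t th - y)) lt.
- move=> t x /tubeP[tT hd] k m1 m2.
  have [hp _] := tube_dom_angle hX hr r00 hdelta tT hd.
  have [A [A1 hA]] := amplitude_exists T0 dv k.+1.
  have [_ Cd] := tube_angle_class hX hr cX1 cX2 crho r00 hdelta (family_classes A1 hA) (m1 + m2).+1 (leqnn k.+1).
  by apply: (class_smooth_tx (u := fun s => sdist (X i s)) Cd _ sub hp) => s z _.
- by move=> t x /tubeP[tT hd]; exact: (tube_angle_unique hX hr r00 hdelta tT hd).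
- move=> t x /tubeP[tT hd] k m1 m2.
  have [hp _] := tube_dom_angle hX hr r00 hdelta tT hd.
  have [A [A1 hA]] := amplitude_exists T0 dv k.+1.
  have [Cd _] := tube_angle_class hX hr cX1 cX2 crho r00 hdelta (family_classes A1 hA) (m1 + m2).+1 (leqnn k.+1).
  by apply: (class_smooth_tx (u := fun s => local_angle (X i t) x (X i s)) Cd _ sub hp) => s z _.
Qed.

Variables (K M : nat) (A : I -> R) (A1 : forall i, 1 <= A i).
Hypothesis (hA : forall a i t, (a <= K)%N -> 0 <= t <= T -> `|vd a i t| <= A i).

Lemma amp_mono i k (C C' : R) (x : R) : C <= C' -> x <= C * A i ^+ k -> x <= C' * A i ^+ k.
Proof.
move=> CC h; apply: le_trans h _; apply: ler_wpM2r => //.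
by rewrite exprn_ge0// (le_trans ler01).
Qed.

Lemma dt_dth_bound : exists C : R, forall k m (c : 'I_2) i t th, (k <= K)%N -> (m <= M)%N ->
  0 <= t <= T -> `|dt_dth T k m c (X i) t th| <= C * A i ^+ k.
Proof.
have main (c : 'I_2) : exists C : R, forall k m b, (k <= K + M)%N -> (m <= K + M)%N -> (b <= K + M)%N ->
    (k <= K)%N -> (m <= M)%N ->
    forall i t th, 0 <= t <= T -> `|dt_dth T k m c (X i) t th| <= C * A i ^+ k.
  apply: (@finite_bound R (K + M) (fun k m _ C => (k <= K)%N -> (m <= M)%N ->
    forall i t th, 0 <= t <= T -> `|dt_dth T k m c (X i) t th| <= C * A i ^+ k)).
    move=> k m _ _ _ _.
    have [kK|kK] := leqP k K; last by exists 0.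
    have Cl : smooth_class (strip T0 A1) K m 0 (fun i q => Defs.coord c (X i q.1 q.2)).
      exact: (coord_family f1 f2 c T0 A1 hA).
    have [f' Cf hf] := @class_dt_dth R I T A T0 A1 K m 0
      (fun c i q => Defs.coord c (X i q.1 q.2)) X c k m kK (leqnn m) Cl (fun _ _ _ => erefl).
    have [[C hC] _] := smooth_class_amp Cf.
    by exists C => _ _ i t th tT; have [-> _] := hf i t th tT; exact: (hC i (t, th) tT).
  by move=> k m _ C C' CC h kK mM i t th tT; apply: amp_mono CC _; exact: h.
have [C hC] := choice main.
exists (\sum_c `|C c|) => k m c i t th kK mM tT.
apply: (@amp_mono i k (C c)).
  by rewrite (bigD1 c)//=; apply: le_trans (ler_norm _) _; rewrite lerDl sumr_ge0.
by apply: (hC c k m 0%N) => //; [exact: leq_trans kK (leq_addr _ _)|exact: leq_trans mM (leq_addl _ _)].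
Qed.

Lemma dt_pd_angle_bound : exists C : R, forall k m1 m2 i t x, (k <= K)%N -> (m1 + m2 <= M)%N ->
  0 <= t <= T -> `|sdist (X i t) x| < 3 * delta ->
  `|dt_pd_angle T k m1 m2 (X i) t x| <= C * A i ^+ k.
Proof.
have [C hC] : exists C : R, forall k m1 m2, (k <= K + M)%N -> (m1 <= K + M)%N -> (m2 <= K + M)%N ->
    (k <= K)%N -> (m1 + m2 <= M)%N -> forall i t x, 0 <= t <= T -> `|sdist (X i t) x| < 3 * delta ->
    `|dt_pd_angle T k m1 m2 (X i) t x| <= C * A i ^+ k.
  apply: (@finite_bound R (K + M) (fun k m1 m2 C => (k <= K)%N -> (m1 + m2 <= M)%N ->
    forall i t x, 0 <= t <= T -> `|sdist (X i t) x| < 3 * delta ->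
    `|dt_pd_angle T k m1 m2 (X i) t x| <= C * A i ^+ k)).
    move=> k m1 m2 _ _ _.
    have [kK|kK] := leqP k K; last by exists 0.
    have [Ca _] := tube_angle_class hX hr cX1 cX2 crho r00 hdelta (family_classes A1 hA) (m1 + m2) (leqnn K).
    have [f' Cf hf] := class_dt_pd kK (leqnn (m1 + m2)) Ca.
    have [[C hC] _] := smooth_class_amp Cf.
    exists C => _ _ i t x tT hd.
    have [hp _] := tube_dom_angle hX hr r00 hdelta tT hd.
    rewrite /dt_pd_angle (hf (i, angle (X i t) x - pi) (fun s => local_angle (X i t) x (X i s)) (fun s z _ => erefl) t x hp).1.
    exact: (hC (i, angle (X i t) x - pi) (t, x) hp).
  by move=> k m1 m2 C C' CC h kK mM i t th tT hd; apply: amp_mono CC _; exact: h.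
exists C => k m1 m2 i t x kK mM tT hd.
have m1M : (m1 <= M)%N by exact: leq_trans (leq_addr _ _) mM.
have m2M : (m2 <= M)%N by exact: leq_trans (leq_addl _ _) mM.
by apply: (hC k m1 m2) => //; [exact: leq_trans kK (leq_addr _ _)|exact: leq_trans m1M (leq_addl _ _)|exact: leq_trans m2M (leq_addl _ _)].
Qed.

Lemma pd_sdist_bound : exists C : R, forall m1 m2 i t x, (m1 + m2 <= M)%N ->
  0 <= t <= T -> `|sdist (X i t) x| < 3 * delta -> `|pd m1 m2 (sdist (X i t)) x| <= C.
Proof.
have [C hC] : exists C : R, forall m1 m2 b, (m1 <= M)%N -> (m2 <= M)%N -> (b <= M)%N ->
    forall i t x, 0 <= t <= T -> `|sdist (X i t) x| < 3 * delta -> `|pd m1 m2 (sdist (X i t)) x| <= C.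
  apply: (@finite_bound R M (fun m1 m2 _ C =>
    forall i t x, 0 <= t <= T -> `|sdist (X i t) x| < 3 * delta -> `|pd m1 m2 (sdist (X i t)) x| <= C)).
    move=> m1 m2 _ _ _ _.
    have [_ Cd] := tube_angle_class hX hr cX1 cX2 crho r00 hdelta (family_classes A1 hA) (m1 + m2) (leq0n K).
    have [f' Cf hf] := class_pd (leqnn (m1 + m2)) Cd.
    have [[C hC] _] := smooth_class_amp Cf.
    exists C => i t x tT hd.
    have [hp _] := tube_dom_angle hX hr r00 hdelta tT hd.
    have -> := hf (i, angle (X i t) x - pi) t (sdist (X i t)) (fun z _ => erefl) x hp.
    by have := hC (i, angle (X i t) x - pi) (t, x) hp; rewrite expr0 mulr1.
  by move=> m1 m2 _ C C' CC h i t th tT hd; apply: le_trans CC; exact: h.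
exists C => m1 m2 i t x mM tT hd.
have m1M : (m1 <= M)%N by exact: leq_trans (leq_addr _ _) mM.
have m2M : (m2 <= M)%N by exact: leq_trans (leq_addl _ _) mM.
exact: (hC m1 m2 0%N).
Qed.

Lemma radius_bound : exists C : R, forall i t th, 0 <= t <= T -> `|rho i t th| <= C.
Proof.
have [_ _ c3] := family_classes A1 hA 0%N (leq0n K).
have [[C hC] _] := smooth_class_amp c3.
by exists C => i t th tT; have := hC i (t, th) tT; rewrite expr0 mulr1.
Qed.

Lemma geometry_bound : exists C : R, forall i t th, 0 <= t <= T -> 0 <= th < 2 * pi ->
  [/\ forall m1 m2, (m1 + m2 <= M)%N -> `|pd m1 m2 (sdist (X i t)) (X i t th)| <= C,
      forall m1 m2 r, (m1 + m2 <= M)%N -> `|r| < 3 * delta ->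
        `|pd_angle m1 m2 (X i t) (curve_point (X i t) r th)| <= C,
      forall m, (m <= M)%N -> enorm (dth m (X i t) th) <= C,
      enorm (grad_angle (X i t) (X i t th)) ^- 2 <= C &
      (clen (X i t))^-1 <= C].
Proof.
have [C1 h1] := dt_dth_bound; have [C2 h2] := dt_pd_angle_bound.
have [C3 h3] := pd_sdist_bound; have [C4 h4] := radius_bound.
pose C := `|C1| + `|C1| + `|C2| + `|C3| + C4 ^+ 2 + (r0 * (2 * pi))^-1.
have pi2 := @pi2_gt0 R.
have n1 := normr_ge0 C1; have n2 := normr_ge0 C2; have n3 := normr_ge0 C3; have n4 := sqr_ge0 C4.
have n5 : 0 <= (r0 * (2 * pi))^-1 by rewrite invr_ge0 mulr_ge0// ltW.
have l2 := ler_norm C2; have l3 := ler_norm C3; have l1 := ler_norm C1.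
exists C => i t th tT hth; split.
- move=> m1 m2 mM; apply: le_trans (h3 m1 m2 i t _ mM tT _) _; last by rewrite /C; lra.
  by rewrite (sdist_curve (hX i tT) r00 (fun a => hr i a tT)) normr0 mulr_gt0.
- move=> m1 m2 r mM hr'; have := h2 0%N m1 m2 i t (curve_point (X i t) r th) (leq0n K) mM tT.
  rewrite expr0 mulr1 (sdist_curve_point (hX i tT) r00 (fun a => hr i a tT)).
    by move=> /(_ hr') h; apply: le_trans h _; rewrite /C; lra.
  move: hr'; rewrite ltr_norml => /andP[h _]; by apply: lt_trans h; apply: lt_le_trans (r0_half r00) _; rewrite lerN2.
- move=> m mM.
  have b0 := h1 0%N m ord0 i t th (leq0n K) mM tT.
  have b1 := h1 0%N m ord_max i t th (leq0n K) mM tT.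
  rewrite expr0 mulr1 /dt_dth /= /Defs.coord /= in b0 b1.
  apply: (@le_trans _ _ (`|(dth m (X i t) th).1| + `|(dth m (X i t) th).2|)); last by rewrite /C; lra.
  rewrite -ler_sqr ?nnegrE ?enorm_ge0// ?addr_ge0// enorm_sqr /dotp -!expr2 sqrrD !real_normK ?num_real//.
  by rewrite lerD2r lerDl mulrn_wge0// mulr_ge0.
- rewrite (tube_grad_angle hX hr cX1 cX2 crho r00 delta0 hdelta i tT hth).
  apply: (@le_trans _ _ (C4 ^+ 2)); last by rewrite /C; lra.
  have h := h4 i t th tT; rewrite -(real_normK (num_real (rho i t th))) ler_sqr//.
  by rewrite nnegrE; apply: le_trans h.
- rewrite (gauss_radius_clen (hX i tT)).
  apply: (@le_trans _ _ (r0 * (2 * pi))^-1); last by rewrite /C; lra.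
  have [_ _ _ sr _] := hX i tT.
  rewrite lef_pV2 ?posrE ?mulr_gt0// ?pi_gt0//; first exact: (int2pi_ge (smooth_continuous sr) (fun a => hr i a tT)).
  apply: lt_le_trans (int2pi_ge (smooth_continuous sr) (fun a => hr i a tT)).
  by rewrite mulr_gt0.
Qed.

End FamilyBounds.

Section DeterministicFlows.
Context {R : realType}.

Theorem deterministic_flows (K M : nat) (D : set (R * R)) (g0 : R -> R * R) :
  smooth_bounded_domain D -> gauss_curve g0 -> (forall a, D (g0 a)) ->
  exists2 delta0 : R, 0 < delta0 & forall delta, 0 < delta < delta0 ->
  exists T0 eta : R, [/\ 0 < T0, 0 < eta & forall T, 0 < T <= T0 ->
  exists2 C : R, 0 < C & forall (w : R -> R) (vd : nat -> R -> R), forcing_ok T eta w vd ->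
  exists X : R -> R -> R * R,
  let bound := (C%:E * (1 + cknorm K T (vd 0%N)) ^+ K)%E in
  [/\ is_unique_flow D g0 (vd 0%N) T X, good_tubes D delta T X,
    forall k m (c : 'I_2) t th, (k <= K)%N -> (m <= M)%N -> 0 <= t <= T ->
      (`|dt_dth T k m c X t th|%:E <= bound)%E,
    forall k m1 m2 t x, (k <= K)%N -> (m1 + m2 <= M)%N -> tubes D delta T X (t, x) ->
      (`|dt_pd_angle T k m1 m2 X t x|%:E <= bound)%E &
    forall t th, 0 <= t <= T -> 0 <= th < 2 * pi ->
    [/\ forall m1 m2, (m1 + m2 <= M)%N -> `|pd m1 m2 (sdist (X t)) (X t th)| <= C,
        forall m1 m2 r, (m1 + m2 <= M)%N -> `|r| < 3 * delta ->
          `|pd_angle m1 m2 (X t) (curve_point (X t) r th)| <= C,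
        forall m, (m <= M)%N -> enorm (dth m (X t) th) <= C,
        enorm (grad_angle (X t) (X t th)) ^- 2 <= C &
        (clen (X t))^-1 <= C]]].
Proof.
move=> [oD _ nD bD _] /gauss_curve_radius[rho0 hg] gD.
have [y0 by0] := bdry_nonempty oD nD bD.
have [r1 r10 hr1] := gauss_radius_lower hg.
have [dg1 dg2 pg _ _] := hg.
have cg : continuous g0.
  move=> a; have c1 := @wderiv_continuous _ _ _ dg1 a; have c2 := @wderiv_continuous _ _ _ dg2 a.
  have -> : g0 = (fun b => ((g0 b).1, (g0 b).2)) by apply/funext => b; rewrite -surjective_pairing.
  exact: (cvg_pair c1 c2).
have [r r_0 hr] := curve_margin oD cg pg gD.
(* A third of the margin of g0 in D is left to the motion of the curve, which stays at distance 2 r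
   / 3 from the complement; r1 / 2 keeps the radius of curvature above r0 = r1 / 2. *)
pose eps := Num.min (r / 3) (r1 / 2).
have eps0 : 0 < eps by rewrite lt_min !divr_gt0.
have [er er1] : eps <= r / 3 /\ eps <= r1 / 2 by rewrite !ge_min !lexx ?orbT.
pose r0 := r1 / 2; have r00 : 0 < r0 by rewrite divr_gt0.
exists (Num.min (r / 3) (r0 / 2) / 3); first by rewrite divr_gt0// lt_min !divr_gt0.
move=> delta /andP[delta0]; rewrite ltr_pdivlMr// mulrC lt_min => /andP[d1 d2].
have hdelta : 3 * delta <= r0 / 2 by exact: ltW.
have [T0 [eta [T00 eta0 fam]]] := flow_family (area D / 2) hg eps0.
exists T0, eta; split => // T TT; have /andP[Tpos _] := TT.
(* The index is the forcing itself with its primitive: a single family contains all admissible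
   forcings, and its constants are fixed before one of them is picked. *)
pose I := {z : (R -> R) * (nat -> R -> R) | forcing_ok T eta z.1 z.2}.
pose vd a (i : I) := (sval i).2 a.
have fok (i : I) : forcing_ok T eta (sval i).1 (fun a => vd a i) by exact: (svalP i).
have [X [rho [hX X0 near vel [f1 f2 f3]]]] := fam T TT I (fun i => (sval i).1) vd fok.
have dv i a t : 0 <= t <= T -> wderiv `[0, T]%classic (vd a i) t (vd a.+1 i t).
  by have [_ _ _ h] := fok i; exact: h.
have hA (i : I) := @cknorm_chain R K T (fun a => vd a i) Tpos (fun a t => @dv i a t).
have [A hA'] := choice hA.
have A1 i : 1 <= A i by case: (hA' i).
have AE i : (1 + cknorm K T (vd 0%N i))%E = (A i)%:E by case: (hA' i).
have Ab a i t : (a <= K)%N -> 0 <= t <= T -> `|vd a i t| <= A i.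
  by have [_ _ h] := hA' i; exact: h.
have hrho i t a : 0 <= t <= T -> r0 <= rho i t a.
  move=> tT; have [n1 _ _] := near i t a tT; move: n1; rewrite ler_norml => /andP[n1 _].
  by have := hr1 a; move: er1 n1; rewrite /r0; clear; lra.
have XD i t a : 0 <= t <= T -> D (X i t a).
  by move=> tT; have [_ n1 n2] := near i t a tT; clear - hr n1 n2 er r_0; apply: (hr a); lra.
have crho := smooth_family_cont Tpos dv f3.
have facts i : flow_facts T (area D / 2) (vd 0%N i) (X i) (rho i).
  by split; [exact: hX|split; [exact: (smooth_family_cont Tpos dv f1)|exact: (smooth_family_cont Tpos dv f2)]|exact: crho|exact: vel].
have [C1 h1] := dt_dth_bound Tpos f1 f2 M A1 Ab.
have [C2 h2] := dt_pd_angle_bound Tpos dv hX hrho r00 hdelta f1 f2 f3 M A1 Ab.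
have [C3 h3] := geometry_bound Tpos dv hX hrho r00 delta0 hdelta f1 f2 f3 M A1 Ab.
have n1 := normr_ge0 C1; have n2 := normr_ge0 C2; have n3 := normr_ge0 C3.
have l2 := ler_norm C2; have l3 := ler_norm C3; have l1 := ler_norm C1.
pose C := 1 + `|C1| + `|C2| + `|C3|.
have C0 : 0 < C by rewrite /C; clear - n1 n2 n3; lra.
have c1 : C1 <= C by rewrite /C; clear - n2 n3 l1; lra.
have c2 : C2 <= C by rewrite /C; clear - n1 n3 l2; lra.
have c3 : C3 <= C by rewrite /C; clear - n1 n2 l3; lra.
exists C; first exact: C0.
move=> w v hv; pose i : I := exist _ (w, v) hv; exists (X i) => bound.
have bE : bound = (C * A i ^+ K)%:E by rewrite /bound (AE i) -EFin_expe -EFinM.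
have amp k (x C' : R) : (k <= K)%N -> C' <= C -> x <= C' * A i ^+ k -> (x%:E <= bound)%E.
  move=> kK CC h; rewrite bE lee_fin; apply: le_trans h _.
  apply: (@le_trans _ _ (C * A i ^+ k)).
    by apply: ler_wpM2r => //; rewrite exprn_ge0// (le_trans ler01).
  by apply: ler_wpM2l; [exact: ltW|apply: ler_weXn2l].
split.
- exact: (family_is_unique_flow Tpos dv f1 f2 facts X0 XD i).
- apply: (@family_good_tubes R I T Tpos vd X rho r0 delta dv hX hrho r00 hdelta f1 f2 f3 D (r * (2 / 3)) i).
  + exact: oD.
  + by exists y0.
  + by clear - d1 r_0; lra.
  + move=> t a p tT p1 p2; have [_ n4 n5] := near i t a tT; apply: (hr a).
      have -> : p.1 - (g0 a).1 = (p.1 - (X i t a).1) + ((X i t a).1 - (g0 a).1) by ring.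
      by apply: le_lt_trans (ler_normD _ _) _; clear - p1 n4 er r_0; lra.
    have -> : p.2 - (g0 a).2 = (p.2 - (X i t a).2) + ((X i t a).2 - (g0 a).2) by ring.
    by apply: le_lt_trans (ler_normD _ _) _; clear - p2 n5 er r_0; lra.
- move=> k m c t th kK mM tT; apply: (amp k _ C1) => //; exact: h1.
- move=> k m1 m2 t x kK mM [/=]; rewrite in_itv/= => tT [_ hd].
  by apply: (amp k _ C2) => //; exact: h2.
- move=> t th tT hth; have [g1 g2 g3 g4 g5] := h3 i t th tT hth.
  split.
  + by move=> m1 m2 mM; apply: le_trans (g1 _ _ mM) c3.
  + by move=> m1 m2 s mM sd; apply: le_trans (g2 _ _ _ mM sd) c3.
  + by move=> m mM; apply: le_trans (g3 _ mM) c3.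
  + exact: le_trans g4 c3.
  + exact: le_trans g5 c3.
Qed.

End DeterministicFlows.

(** * The stopping time *)

Section ExitTime.
Context {R : realType} {dd : measure_display} {Omega : measurableType dd}.
Variables (w : Omega -> R -> R) (T0 eta : R).
Hypotheses (T00 : 0 < T0) (eta0 : 0 < eta).

(* The times are rational to make [exit_time om < s] a countable union of events;
   for a continuous path this changes nothing. *)
Definition exit_times (om : Omega) : set R :=
  [set T0] `|` [set x | exists2 q : rat, x = ratr q & 0 < x /\ eta < `|w om x|].

Definition exit_time (om : Omega) : R := inf (exit_times om).

Lemma exit_times_T0 om : exit_times om T0. Proof. by left. Qed.

Lemma exit_times_lb om : lbound (exit_times om) 0.
Proof. by move=> x [->|[q _ [h _]]]; exact: ltW. Qed.

Lemma exit_time_le om x : exit_times om x -> exit_time om <= x.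
Proof. by move=> h; apply: ge_inf => //; exists 0; exact: exit_times_lb. Qed.

Lemma exit_time_lt om s : exit_time om < s <-> exists2 x, exit_times om x & x < s.
Proof.
split; last by move=> [x hx xs]; exact: le_lt_trans (exit_time_le hx) xs.
move=> h; apply: contrapT => hn; move: h; apply/negP; rewrite -leNgt.
apply: lb_le_inf; first by exists T0; exact: exit_times_T0.
by move=> x hx; rewrite leNgt; apply/negP => xs; apply: hn; exists x.
Qed.

(** The event exit_time < s is a countable union over rational times q < s of events in F q, hence
    in F s; the right continuity of the filtration passes from < to <=. *)
Lemma exit_time_stopping (P : probability Omega R) (F : R -> set (set Omega)) :
  is_filtration P F -> adapted F w -> stopping_time F exit_time.
Proof.
move=> [sg _ mono rc _] ad.
have setT_in s : 0 <= s -> F s setT.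
  by move=> s0; have [h0 hC _] := sg s s0; rewrite -(setD0 setT); exact: hC.
have big_in s q : 0 <= q -> q <= s -> F s [set om | eta < `|w om q|].
  move=> q0 qs; apply: (mono q s q0 qs).
  apply: (ad q [set x | eta < `|x|] q0).
  rewrite (_ : [set x | eta < `|x|] = `]eta, +oo[%classic `|` `]-oo, - eta[%classic).
    by apply: measurableU; exact: measurable_itv.
  apply/seteqP; split => x /=; rewrite !in_itv/= andbT.
    by rewrite ltr_normr => /orP[|h]; [left|right; rewrite ltrNr].
  by rewrite ltr_normr => -[->//|h]; apply/orP; right; rewrite ltrNr.
have lt_in s : 0 < s -> F s [set om | exit_time om < s].
  move=> s0; have [h0 hC hU] := sg s (ltW s0).
  have [Ts|sT] := ltP T0 s.
    rewrite (_ : [set om | exit_time om < s] = setT); first exact/setT_in/ltW.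
    by apply/seteqP; split => // om _; apply/exit_time_lt; exists T0 => //; left.
  (* The rationals are enumerated by [unpickle]; numbers that code no rational, and rationals
     outside (0, s), contribute the empty event. *)
  pose B n : set Omega := if unpickle n is Some q then
     if 0 < (ratr q : R) < s then [set om | eta < `|w om (ratr q)|] else set0 else set0.
  rewrite (_ : [set om | exit_time om < s] = \bigcup_n B n).
    apply: hU => n; rewrite /B; case: (unpickle n) => // q; case: ifP => // /andP[q0 qs].
    by apply: big_in; exact: ltW.
  apply/seteqP; split => om /=.
    move=> /exit_time_lt[x [->|[q xq [x0 xw]]] xs]; first by move: xs; rewrite ltNge sT.
    exists (pickle q); first exact: Logic.I.
    rewrite /B pickleK -xq x0 xs; exact: xw.
  move=> [n _]; rewrite /B; case: (unpickle n) => // q; case: ifP => // /andP[q0 qs] h.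
  by apply/exit_time_lt; exists (ratr q) => //; right; exists q.
move=> t t0; apply: (rc t _ t0) => s ts.
have s0 : 0 <= s by rewrite ltW// (le_lt_trans t0).
have [h0 hC hU] := sg s s0.
(* The event exit_time <= t is the intersection of the events exit_time < tn n, where tn n decreases
   to t and tn 0 = s. *)
pose tn n : R := t + (s - t) / n.+1%:R.
have tn_s n : tn n <= s.
  rewrite /tn -lerBrDl ler_pdivrMr// ler_peMr ?ler1n//.
  by rewrite subr_ge0 ltW.
have t_tn n : t < tn n by rewrite /tn ltrDl divr_gt0// subr_gt0.
rewrite (_ : [set om | exit_time om <= t] = setT `\` \bigcup_n (setT `\` [set om | exit_time om < tn n])).
  apply: (hC); apply: hU => n; apply: hC.
  have tn0 : 0 < tn n by exact: le_lt_trans t0 (t_tn n).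
  by apply: (mono (tn n)) => //; [exact: ltW|exact: lt_in].
apply/seteqP; split => om /=.
  move=> h; split => // -[n _ [_]]; apply; exact: le_lt_trans h (t_tn n).
move=> [_ h]; apply/ler_addgt0Pr => e e0; rewrite leNgt; apply/negP => lt; apply: h.
have [n hn] : exists n : nat, (s - t) / n.+1%:R <= e.
  exists (Num.truncn ((s - t) / e)).
  rewrite ler_pdivrMr// mulrC -ler_pdivrMr//.
  by apply/ltW/truncnS_gt; rewrite divr_ge0// ?subr_ge0 ltW.
exists n => //; split => //; apply/negP; rewrite -leNgt; apply: le_trans (ltW lt).
by rewrite lerD2l.
Qed.

Hypotheses (om : Omega) (w0 : w om 0 = 0) (cw : {within `[0, +oo[, continuous (w om)}).

Let w_near t (e : R) : 0 <= t -> 0 < e -> exists2 d : R, 0 < d & forall s, 0 <= s -> `|s - t| < d ->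
  `|w om s - w om t| < e.
Proof.
move=> t0 e0.
have /subspace_continuousP/(_ t) := cw; rewrite /= in_itv/= andbT => /(_ t0).
move/cvgrPdist_lt => /(_ _ e0); rewrite near_withinE => /nbhs_ballP[d /= d0 hd].
exists d => // s s0 sd; rewrite distrC; apply: hd; first by rewrite /ball /= distrC.
by rewrite /= in_itv/= andbT.
Qed.

Lemma exit_time_gt0 : 0 < exit_time om.
Proof.
have [d d0 hd] := w_near (lexx 0) eta0.
apply: (@lt_le_trans _ _ (Num.min T0 d)); first by rewrite lt_min T00.
apply: lb_le_inf; first by exists T0; exact: exit_times_T0.
move=> x [->|[q _ [x0 xw]]]; first by rewrite ge_min lexx.
rewrite ge_min leNgt; apply/orP; right; rewrite leNgt; apply/negP => xd.
have := hd x (ltW x0); rewrite subr0 gtr0_norm// w0 subr0 => /(_ xd).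
by move=> /lt_trans/(_ xw); rewrite ltxx.
Qed.

(** By continuity an excess at t would already occur at a rational time shortly before t, hence
    before the exit time. *)
Lemma exit_time_bound t : 0 <= t <= exit_time om -> `|w om t| <= eta.
Proof.
move=> /andP[t0 tT]; rewrite leNgt; apply/negP => wt.
have tp : 0 < t.
  by rewrite lt_neqAle t0 andbT eq_sym; apply: contraTneq wt => ->; rewrite w0 normr0 -leNgt ltW.
have w1 : 0 < `|w om t| - eta by rewrite subr_gt0.
have [d d0 hd] := w_near t0 w1.
have [|q] := @rat_in_itvoo R (Num.max 0 (t - d)) t.
  by rewrite gt_max tp ltrBlDr ltrDl.
rewrite in_itv/= gt_max => /andP[/andP[q0 qd] qt].
suff : exit_time om <= ratr q by move=> /(le_trans tT); rewrite leNgt qt.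
apply: exit_time_le; right; exists q => //; split => //.
have := hd (ratr q) (ltW q0); rewrite ltr0_norm ?subr_lt0// opprB ltrBlDl -ltrBlDr => /(_ qd) h.
have := ler_normB (w om (ratr q)) (w om (ratr q) - w om t); rewrite opprB addrC subrK; lra.
Qed.

End ExitTime.

(** * Admissible forcings from the approximations, and the theorem *)

Section Approximation.
Context {R : realType}.

Lemma holder_norm_sup (h T : R) (f : R -> R) (e : R) : 0 < T -> (holder_norm h T f < e%:E)%E ->
  forall t, 0 <= t <= T -> `|f t| < e.
Proof.
move=> T0 he t tT; rewrite -lte_fin; apply: le_lt_trans he; rewrite /holder_norm -[leLHS]addr0.
apply: leeD.
  by apply: ereal_sup_ubound; exists t => //; rewrite /= in_itv.
(* The pair (0, T) shows that the seminorm is nonnegative, so the supremum of |f| is below the full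
   norm. *)
apply: (@le_trans _ _ (`|f T - f 0| / (`|T - 0| `^ h))%:E).
  by rewrite lee_fin divr_ge0// powR_ge0.
apply: ereal_sup_ubound; exists 0, T; split=> //.
- by rewrite /= in_itv/= lexx ltW.
- by rewrite /= in_itv/= lexx ltW.
- by rewrite lt_eqF.
Qed.

Lemma holder_cvg_uniform (h T e : R) (we : R -> R -> R) (w : R -> R) : 0 < T -> 0 < e ->
  holder_norm h T (fun t => we eps t - w t) @[eps --> 0^'+] --> 0%E ->
  exists2 eps0 : R, 0 < eps0 <= 1 & forall eps, 0 < eps <= eps0 -> forall t, 0 <= t <= T ->
    `|we eps t - w t| < e.
Proof.
move=> T0 e0 cv.
have : \forall eps \near 0^'+, (holder_norm h T (fun t => (we eps t - w t)%R) < e%:E)%E.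
  apply: (cv [set y | (y < e%:E)%E]); apply: open_nbhs_nbhs; split; last by rewrite /= lte_fin.
  exact: open_ereal_lt_ereal.
move=> [d /= d0 hd]; exists (Num.min 1 (d / 2)).
  by rewrite lt_min ltr01 divr_gt0// ge_min lexx.
move=> eps /andP[p0]; rewrite le_min => /andP[_ pd] t tT.
apply: (@holder_norm_sup h T (fun t => we eps t - w t)) => //; apply: hd => //=.
by rewrite sub0r normrN gtr0_norm//; apply: le_lt_trans pd _; rewrite ltr_pdivrMr// ltr_pMr// ltr1n.
Qed.

(** The approximation may start anywhere; its value at 0 is subtracted to normalize the
    primitive. *)
Lemma forcing_chain (Omega : Type) (alpha : R) (we : R -> Omega -> R -> R) eps om (T b : R) :
  smooth_w `[0, +oo[ (we eps om) ->
  (forall t, 0 <= t <= T -> `|alpha * (we eps om t - we eps om 0)| <= b) ->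
  forcing_ok T b (fun t => alpha * (we eps om t - we eps om 0))
    (fun a t => alpha * derwn `[0, +oo[ a.+1 (we eps om) t).
Proof.
move=> sw hb.
have sub : `[0, T]%classic `<=` (`[0, +oo[%classic : set R).
  by move=> t; rewrite /= !in_itv/= andbT => /andP[].
have ch a t : 0 <= t <= T -> wderiv `[0, T]%classic (derwn `[0, +oo[ a (we eps om)) t
    (derwn `[0, +oo[ a.+1 (we eps om) t).
  move=> tT; apply: (wderiv_sub sub); apply: (smooth_w_chain sw).
  by apply: sub; rewrite /= in_itv.
split; first by rewrite subrr mulr0.
- exact: hb.
- move=> t tT; apply: wderivZ; rewrite -[derwn _ _ _ _]subr0.
  by apply: wderivB; [exact: ch 0%N _ tT|exact: wderiv_cst].
- by move=> a t tT; apply: wderivZ; exact: ch.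
Qed.

End Approximation.

Section FlowConstant.
Context {R : realType}.

(** [C_VT] ranges over arbitrary flows; uniqueness identifies each of them with the one whose bounds
    are known. *)
Lemma C_VT_bounded (D : set (R * R)) (g0 : R -> R * R) (delta : R) (M : nat) (V : set (R -> R)) (T C : R) :
  0 < T ->
  (forall v, V v -> exists2 X, is_unique_flow D g0 v T X & forall t th, 0 <= t <= T -> 0 <= th < 2 * pi ->
    [/\ forall m1 m2, (m1 + m2 <= M)%N -> `|pd m1 m2 (sdist (X t)) (X t th)| <= C,
        forall m1 m2 r, (m1 + m2 <= M)%N -> `|r| < 3 * delta ->
          `|pd_angle m1 m2 (X t) (curve_point (X t) r th)| <= C,
        forall m, (m <= M)%N -> enorm (dth m (X t) th) <= C,
        enorm (grad_angle (X t) (X t th)) ^- 2 <= C &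
        (clen (X t))^-1 <= C]) ->
  (C_VT D g0 delta M V T < +oo)%E.
Proof.
move=> T0 hV; apply: (@le_lt_trans _ _ C%:E); last exact: ltry.
apply: ge_ereal_sup => y [v [X' [t [th [Vv fl tT hth hy]]]]].
have [X [_ un] hX] := hV v Vv.
have E : X' t = X t by apply/funext => a; exact: (un T X').
have tT' : 0 <= t <= T by move: tT; rewrite /= in_itv.
have [g1 g2 g3 g4 g5] := hX t th tT' hth; rewrite E in hy.
case: hy.
- by move=> [m1 [m2 [mM ->]]]; rewrite lee_fin; exact: g1.
- by move=> [m1 [m2 [r [mM rd ->]]]]; rewrite lee_fin; exact: g2.
- by move=> [m [mM ->]]; rewrite lee_fin; exact: g3.
- by move=> [->|->]; rewrite lee_fin.
Qed.

End FlowConstant.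

Theorem lemma5p1 (R : realType) (K M : nat) (hK : (6 < K)%N) (hM : (0 < M)%N) :
  exists N : nat,
  forall (dd : measure_display) (Omega : measurableType dd)
    (P : probability Omega R) (F : R -> set (set Omega))
    (w : Omega -> R -> R) (we : R -> Omega -> R -> R)
    (alpha : R) (D : set (R * R)) (g0 : R -> R * R)
    (sigmae : R -> Omega -> R) (sigma : Omega -> R)
    (Xe : R -> Omega -> R -> R -> R * R) (X0 : Omega -> R -> R -> R * R)
    (O : set (R * R)),
  is_filtration P F -> is_brownian P F w -> is_approximation P F w we ->
  0 < alpha -> smooth_bounded_domain D ->
  gauss_curve g0 -> (forall th, D (g0 th)) ->
  (forall eps, 0 < eps <= 1 -> stopping_time F (sigmae eps)) ->
  stopping_time F sigma ->
  {ae P, forall om eps, 0 < eps <= 1 -> 0 < sigmae eps om} ->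
  {ae P, forall om, 0 < sigma om} ->
  {ae P, forall om eps, 0 < eps <= 1 ->
     is_unique_flow D g0 (forcing alpha we eps om) (sigmae eps om)
       (Xe eps om)} ->
  is_unique_strat_flow P F w alpha D g0 sigma X0 ->
  open O -> (forall th, O (g0 th)) ->
  (forall (T' : R) (m' : nat), 0 < T' ->
     {ae P, forall om,
       let de eps t := sdist (Xe eps om (Num.min t (sigmae eps om))) in
       let d0 t := sdist (X0 om (Num.min t (sigma om))) in
       [/\ forall eps, 0 < eps <= 1 -> in_C_Cm T' m' O (de eps),
           in_C_Cm T' m' O d0,
           sigmae eps om @[eps --> 0^'+] --> sigma om &
           C_Cm_norm T' m' O (fun t x => de eps t x - d0 t x)
             @[eps --> 0^'+] --> 0%E]}) ->
  exists2 delta0 : R, 0 < delta0 &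
  forall delta : R, 0 < delta < delta0 ->
  exists2 epsstar : Omega -> R, (forall om, 0 < epsstar om <= 1) &
  forall L : nat,
  exists (tau : Omega -> R) (C : R -> R -> R),
    [/\ stopping_time F tau,
        {ae P, forall om, 0 < tau om},
        (forall x y, 0 < C x y) &
        {ae P, forall om (eps0 : R), 0 < eps0 <= epsstar om ->
          let T := tau om in
          let V := forcings alpha we eps0 om in
          let CVT := C_VT D g0 delta M V T in
          (CVT < +oo)%E /\
          (forall v, V v -> exists2 X : R -> R -> R * R,
            is_unique_flow D g0 v T X /\ good_tubes D delta T X &
            let bound := ((C (fine CVT) T)%:E
                            * (1 + cknorm N T v) ^+ N)%E in
            (forall k m, (k <= K)%N -> (m <= M)%N ->
               (ereal_sup [set y : \bar R | exists (i : 'I_2) (th : R),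
                  (0 <= th < 2 * pi)%R /\
                  y = cknorm 0 T (dt_dth T k m i X ^~ th)] <=
                bound)%E) /\
            (forall k m1 m2, (k <= K)%N -> (m1 + m2 <= M)%N ->
               (ereal_sup [set y : \bar R | exists t x,
                  tubes D delta T X (t, x) /\
                  y = `|dt_pd_angle T k m1 m2 X t x|%:E] <= bound)%E))}].
Proof.
exists K => dd Omega P F w we alpha D g0 sigmae sigma Xe X0 O hF hw happ alpha0 hD hg gD _ _ _ _ _ _ _ _ _.
have [delta0 delta00 main] := deterministic_flows K M hD hg gD.
exists delta0; first exact: delta00.
move=> delta hdelta; have [T0 [eta [T00 eta0 flows]]] := main delta hdelta.
(* The constant is chosen as a function of a deterministic time, before the path om; outside (0, T0]
   it has the default value 1. *)
have /choice[Cst hCst] : forall T : R, exists C : R, 0 < C /\ (0 < T <= T0 ->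
    forall (w : R -> R) (vd : nat -> R -> R), forcing_ok T eta w vd ->
    exists X : R -> R -> R * R,
    let bound := (C%:E * (1 + cknorm K T (vd 0%N)) ^+ K)%E in
    [/\ is_unique_flow D g0 (vd 0%N) T X, good_tubes D delta T X,
    forall k m (c : 'I_2) t th, (k <= K)%N -> (m <= M)%N -> 0 <= t <= T ->
      (`|dt_dth T k m c X t th|%:E <= bound)%E,
    forall k m1 m2 t x, (k <= K)%N -> (m1 + m2 <= M)%N -> tubes D delta T X (t, x) ->
      (`|dt_pd_angle T k m1 m2 X t x|%:E <= bound)%E &
    forall t th, 0 <= t <= T -> 0 <= th < 2 * pi ->
    [/\ forall m1 m2, (m1 + m2 <= M)%N -> `|pd m1 m2 (sdist (X t)) (X t th)| <= C,
        forall m1 m2 r, (m1 + m2 <= M)%N -> `|r| < 3 * delta ->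
          `|pd_angle m1 m2 (X t) (curve_point (X t) r th)| <= C,
        forall m, (m <= M)%N -> enorm (dth m (X t) th) <= C,
        enorm (grad_angle (X t) (X t th)) ^- 2 <= C &
        (clen (X t))^-1 <= C]]).
  move=> T; have [TT|nT] := pselect (0 < T <= T0); last by exists 1; split.
  by have [C C0 hC] := flows T TT; exists C; split.
(* The primitive alpha (we t - we 0) consists of the approximation errors at t and at 0 and of alpha
   w t; each is allotted eta / 3. *)
pose e := eta / (3 * alpha).
have e0 : 0 < e by rewrite divr_gt0// mulr_gt0.
have e3 : alpha * (3 * e) = eta by rewrite /e; field; rewrite gt_eqF.
pose close om (ep : R) := 0 < ep <= 1 /\ forall eps, 0 < eps <= ep -> forall t, 0 <= t <= T0 ->
  `|we eps om t - w om t| < e.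
(* The threshold is selected path by path; it takes the default value 1 where no uniform
   approximation is available, which happens only on a null set. *)
have /choice[epsstar hepsstar] : forall om, exists ep : R, 0 < ep <= 1 /\ ((exists ep', close om ep') -> close om ep).
  move=> om; have [[ep h]|n] := pselect (exists ep, close om ep).
    by exists ep; split => //; have [] := h.
  by exists 1; split; rewrite ?ltr01 ?lexx.
exists epsstar; first by move=> om; have [] := hepsstar om.
move=> L; pose tau := exit_time w T0 e.
exists tau, (fun _ T => Cst T).
have [ad w00 cw _] := hw; have [_ sm [h [_ cv]]] := happ.
split.
- exact: (exit_time_stopping e T00 hF ad).
- by apply: filterS2 w00 cw => om z c; exact: exit_time_gt0.
- by move=> _ T; have [] := hCst T.
apply: filterS2 (filterI w00 cw) (filterI sm cv) => om [z c] [smo cvo] eps0 heps0.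
set T := tau om; set V := forcings alpha we eps0 om.
have Tpos : 0 < T by exact: exit_time_gt0.
have TT0 : T <= T0 by apply: (exit_time_le T00); left.
have TT : 0 < T <= T0 by rewrite Tpos.
have [_ hC] := hCst T; have {}hC := hC TT.
have cl : close om (epsstar om).
  apply: (hepsstar om).2.
  have [ep ep0 hep] := holder_cvg_uniform T00 e0 (cvo T0 T00).
  by exists ep; split.
have [ep01 hcl] := cl.
have fl v : V v -> exists vd w', forcing_ok T eta w' vd /\ v = vd 0%N.
  move=> [eps /= /andP[p0 p1] <-].
  have pe : 0 < eps <= epsstar om.
    by rewrite p0 (le_trans p1)//; case/andP: heps0.
  have pe1 : 0 < eps <= 1.
    by rewrite p0 (le_trans _ (proj2 (andP ep01)))//; case/andP: pe.
  exists (fun a t => alpha * derwn `[0, +oo[ a.+1 (we eps om) t), (fun t => alpha * (we eps om t - we eps om 0)).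
  split; last by [].
  apply: forcing_chain; first exact: smo.
  move=> t tT; rewrite normrM (gtr0_norm alpha0) -e3; apply: ler_wpM2l; first exact: ltW.
  have b1 : `|we eps om t - w om t| < e.
    by apply: hcl => //; case/andP: tT => -> tT; exact: le_trans tT TT0.
  have b2 : `|we eps om 0 - w om 0| < e by apply: hcl => //; rewrite lexx ltW.
  have b3 : `|w om t| <= e by exact: (exit_time_bound T00 e0 z c tT).
  have -> : we eps om t - we eps om 0 = (we eps om t - w om t) + w om t - (we eps om 0 - w om 0).
    by rewrite z; ring.
  apply: le_trans (ler_normB _ _) _; have := ler_normD (we eps om t - w om t) (w om t); clear - b1 b2 b3; lra.
split.
  apply: (C_VT_bounded (C := Cst T)) => // v /fl[vd [w' [ok ->]]].
  by have [X [uf _ _ _ gb]] := hC w' vd ok; exists X.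
move=> v /fl[vd [w' [ok ->]]].
have [X [uf gt b1 b2 _]] := hC w' vd ok; exists X => //; split.
- move=> k m kK mM; apply: ge_ereal_sup => y [i [th [hth ->]]].
  rewrite /cknorm big_ord1; apply: ge_ereal_sup => z' [t]; rewrite /= in_itv/= => tT <-.
  exact: b1.
- by move=> k m1 m2 kK mM; apply: ge_ereal_sup => y [t [x [tx ->]]]; exact: b2.
Qed.
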